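(* Let $n\ge 8$ be an integer and let $\delta_n=(2n-15)/10$. Let $$\vec P_0=(0,0,0),\quad \vec P_1=(1,0,1),\quad \vec P_2=(0,1,1),\quad \vec P_3=\Big(\frac{1+2\delta_n}{2+2\delta_n},\ \frac{1+2\delta_n}{2+2\delta_n},\ \frac{1+2\delta_n}{1+\delta_n}\Big).$$ Then for all indices $p_1,p_2,p$ with $\frac1p=\frac1{p_1}+\frac1{p_2}$ such that the point $(\frac1{p_1},\frac1{p_2},\frac1p)$ lies in the open rhombus with vertices $\vec P_0,\vec P_1,\vec P_2,\vec P_3$, the bilinear spherical maximal operator $\mathcal M$, restricted to Schwartz functions, is bounded from $L^{p_1}(\mathbb R^n)\times L^{p_2}(\mathbb R^n)$ to $L^p(\mathbb R^n)$; that is, there is a finite constant $C$ (depending on $n,p_1,p_2$) such that $$\|\mathcal M(f,g)\|_{L^p(\mathbb R^n)}\le C\,\|f\|_{L^{p_1}(\mathbb R^n)}\,\|g\|_{L^{p_2}(\mathbb R^n)}$$ for all Schwartz functions $f,g$ on $\mathbb R^n$.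
   Context: For Schwartz functions $f,g$ on $\mathbb R^n$, the bi(sub)linear spherical maximal function is $$\mathcal M(f,g)(x)=\sup_{t>0}\Big|\int_{\mathbb S^{2n-1}} f(x-ty)\,g(x-tz)\,d\sigma(y,z)\Big|,\qquad x\in\mathbb R^n,$$ where $\mathbb S^{2n-1}=\{(y,z)\in\mathbb R^n\times\mathbb R^n: |y|^2+|z|^2=1\}$ and $\sigma$ is surface measure on $\mathbb S^{2n-1}$. The four points $\vec P_0,\vec P_1,\vec P_2,\vec P_3$ all lie in the plane $\{(a,b,c): c=a+b\}$; the ''open rhombus'' with these vertices is the interior, relative to this plane, of their convex hull (the quadrilateral with vertices in cyclic order $\vec P_0,\vec P_1,\vec P_3,\vec P_2$). The exponent $p$ may be less than $1$, in which case $\|\cdot\|_{L^p}$ is the usual quasi-norm. *)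

(* Defs.v *)
From HB Require Import structures.
From mathcomp Require Import all_boot all_order all_algebra.
From mathcomp Require Import all_classical all_reals all_analysis.
From mathcomp Require Import measurable_realfun.
From mathcomp.real_closed Require Import complex.

Set Implicit Arguments.
Unset Strict Implicit.
Unset Printing Implicit Defensive.

Import Order.TTheory GRing.Theory Num.Theory.
Import numFieldNormedType.Exports.

Local Open Scope classical_set_scope.
Local Open Scope ring_scope.

Definition rV_display : measure_display. Proof. exact: default_measure_display. Qed.

(* The sigma-algebra on 'rV[R]_n is the n-fold product of the Borel
   sigma-algebra of R, i.e. the Borel sigma-algebra of R^n. *)
Section rV_measurable.
Context {R : realType} (n : nat).

Let coor : 'I_n -> 'rV[R]_n -> R := fun i x => x ord0 i.

Let rV_set0 : g_sigma_preimage coor set0.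
Proof. exact: sigma_algebra0. Qed.

Let rV_setC A : g_sigma_preimage coor A -> g_sigma_preimage coor (~` A).
Proof. exact: sigma_algebraC. Qed.

Let rV_bigcup (F : _^nat) : (forall i, g_sigma_preimage coor (F i)) ->
  g_sigma_preimage coor (\bigcup_i (F i)).
Proof. exact: sigma_algebra_bigcup. Qed.

HB.instance Definition _ := @isMeasurable.Build rV_display
  'rV[R]_n (g_sigma_preimage coor) rV_set0 rV_setC rV_bigcup.

Lemma measurable_coor (i : 'I_n) :
  measurable_fun [set: 'rV[R]_n] (fun x : 'rV[R]_n => x ord0 i).
Proof.
move=> _ Y mY; rewrite setTI; apply: sub_sigma_algebra => /=.
rewrite -bigcup_seq/=; exists i => /=; first by rewrite mem_index_enum.
by exists Y => //; rewrite setTI.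
Qed.

Lemma measurable_fun_coorP d (T : measurableType d) (f : T -> 'rV[R]_n) :
  (forall i, measurable_fun [set: T] (fun x => f x ord0 i)) ->
  measurable_fun [set: T] f.
Proof.
move=> mf; have sub : g_sigma_preimage coor `<=`
    [set A | measurable (f @^-1` A)].
  apply: smallest_sub.
    split.
    - by rewrite /= preimage_set0.
    - by move=> A /= mA; rewrite setTD preimage_setC; exact: measurableC.
    - by move=> F /= mF; rewrite preimage_bigcup; exact: bigcupT_measurable.
  move=> A; rewrite -bigcup_seq => -[i /= _ [B mB <-]].
  by rewrite setTI -comp_preimage -[X in measurable X]setTI; exact: mf.
by move=> _ A mA; rewrite setTI; exact: sub.
Qed.

End rV_measurable.

Section rV_lebesgue.
Context {R : realType}.
Local Open Scope ereal_scope.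

Section cons.
Context (n : nat) (mu : {sigma_finite_measure set 'rV[R]_n -> \bar R}).

Definition cons_rV (x : measurableTypeR R * 'rV[R]_n) : 'rV[R]_n.+1 :=
  row_mx (x.1 : R)%:M x.2.

Lemma measurable_cons_rV : measurable_fun [set: _] cons_rV.
Proof.
apply: measurable_fun_coorP => i.
rewrite (_ : (fun x => _) = (fun x : measurableTypeR R * 'rV[R]_n =>
    match fintype.split (i : 'I_(1 + n)) with
    | inl _ => x.1 | inr j => x.2 ord0 j end)).
  case: fintype.split => j; first exact: measurable_fst.
  apply: (measurableT_comp (measurable_coor j)); exact: measurable_snd.
apply/funext => x; rewrite /cons_rV mxE; case: fintype.split => // j.
by rewrite !mxE (ord1 j).
Qed.

Definition lebesgue_cons : set 'rV[R]_n.+1 -> \bar R :=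
  pushforward (lebesgue_measure \x mu) cons_rV.

Let m0 : lebesgue_cons set0 = 0.
Proof. by rewrite /lebesgue_cons /pushforward preimage_set0 measure0. Qed.

Let m_ge0 A : 0 <= lebesgue_cons A.
Proof. by rewrite /lebesgue_cons /pushforward; exact: measure_ge0. Qed.

Let m_sigma : semi_sigma_additive lebesgue_cons.
Proof.
rewrite /lebesgue_cons; apply: measure_semi_sigma_additive.
exact: measurable_cons_rV.
Qed.

HB.instance Definition _ := isMeasure.Build _ _ _ lebesgue_cons m0 m_ge0 m_sigma.

Let m_sigma_finite : sigma_finite [set: _] lebesgue_cons.
Proof.
have [F TF mF] : sigma_finite [set: _] (lebesgue_measure \x mu).
  have /sigma_finiteP[F [TF ndF Foo]] := sigma_finiteT (@lebesgue_measure R).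
  have /sigma_finiteP[G [TG ndG Goo]] := sigma_finiteT mu.
  exists (fun n => F n `*` G n).
    rewrite -setXTT TF TG predeqE => -[x y]; split.
      move=> [/= [k _ Fkx] [l _ Gly]]; exists (maxn k l) => //; split.
      - by move: x Fkx; exact/subsetPset/ndF/leq_maxl.
      - by move: y Gly; exact/subsetPset/ndG/leq_maxr.
    by move=> [k _ []/= ? ?]; split; exists k.
  move=> k; have [? ?] := Foo k; have [? ?] := Goo k.
  split; first exact: measurableX.
  by rewrite product_measure1E// lte_mul_pinfty// ge0_fin_numE.
pose uncons (x : 'rV[R]_n.+1) : measurableTypeR R * 'rV[R]_n :=
  (x ord0 ord0, \row_j x ord0 (lift ord0 j)).
have mu_ : measurable_fun [set: _] uncons.
  apply: measurable_fun_pair; first exact: measurable_coor.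
  apply: measurable_fun_coorP => i.
  rewrite (_ : (fun x => _) =
      (fun x : 'rV[R]_n.+1 => x ord0 (lift ord0 i))).
    exact: measurable_coor.
  by apply/funext => x; rewrite mxE.
have consK : cancel cons_rV uncons.
  move=> [a x]; rewrite /uncons /cons_rV; congr pair.
    by rewrite mxE; case: splitP => // j _; rewrite !mxE (ord1 j).
  apply/rowP => j; rewrite mxE -[RHS](row_mxEr (a : R)%:M x).
  by congr (row_mx _ _ _ _); exact/val_inj.
exists (fun i => uncons @^-1` F i).
  by rewrite -preimage_bigcup -TF preimage_setT.
move=> i; have [mFi Fi] := mF i; split.
  by rewrite -[X in measurable X]setTI; exact: mu_.
rewrite /lebesgue_cons /pushforward -comp_preimage.
by rewrite (_ : uncons \o cons_rV = id) //; apply/funext => x /=; rewrite consK.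
Qed.

HB.instance Definition _ :=
  Measure_isSigmaFinite.Build _ _ _ lebesgue_cons m_sigma_finite.

End cons.


Lemma sigma_finite_dirac_rV0 :
  sigma_finite [set: 'rV[R]_0] (@dirac _ 'rV[R]_0 0%R R).
Proof.
apply: fin_num_fun_sigma_finite; first by rewrite measure0.
by move=> A mA; rewrite /dirac.
Qed.

HB.instance Definition _ := Measure_isSigmaFinite.Build _ _ _
  (@dirac _ 'rV[R]_0 0%R R) sigma_finite_dirac_rV0.

(* n-fold product of the Lebesgue measure on R; R^0 carries the unit mass. *)
Fixpoint lebesgue_rV (n : nat) : {sigma_finite_measure set 'rV[R]_n -> \bar R} :=
  match n with
  | 0 => @dirac _ 'rV[R]_0 0%R R
  | m.+1 => lebesgue_cons (lebesgue_rV m)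
  end.

End rV_lebesgue.

(* Norms are Euclidean; the library norm `|x| on 'rV[R]_n is the sup norm. *)
Section sphere.
Context {R : realType} (n : nat).

Definition enorm (x : 'rV[R]_n) : R := Num.sqrt (\sum_(i < n) x ord0 i ^+ 2).

Definition enorm2 (x : 'rV[R]_n * 'rV[R]_n) : R :=
  Num.sqrt (enorm x.1 ^+ 2 + enorm x.2 ^+ 2).

Definition sphere : set ('rV[R]_n * 'rV[R]_n) :=
  [set x | enorm x.1 ^+ 2 + enorm x.2 ^+ 2 = 1].

Definition punctured_ball : set ('rV[R]_n * 'rV[R]_n) :=
  [set x | 0 < enorm2 x <= 1].

Definition sphere_proj (x : 'rV[R]_n * 'rV[R]_n) : 'rV[R]_n * 'rV[R]_n :=
  ((enorm2 x)^-1 *: x.1, (enorm2 x)^-1 *: x.2).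

Lemma measurable_enorm : measurable_fun [set: _] enorm.
Proof.
apply: (@measurableT_comp _ _ _ _ _ _ (@Num.sqrt R)).
  by apply: continuous_measurable_fun; exact: sqrt_continuous.
by apply: measurable_sum => i; apply: measurable_funX; exact: measurable_coor.
Qed.

Lemma measurable_enorm2 : measurable_fun [set: _] enorm2.
Proof.
apply: (@measurableT_comp _ _ _ _ _ _ (@Num.sqrt R)).
  by apply: continuous_measurable_fun; exact: sqrt_continuous.
apply: measurable_funD; apply: measurable_funX.
- exact: (measurableT_comp measurable_enorm).
- exact: (measurableT_comp measurable_enorm).
Qed.

Lemma measurable_sphere_proj : measurable_fun [set: _] sphere_proj.
Proof.
have mV : measurable_fun [set: _] (fun x => (enorm2 x)^-1).
  under eq_fun do rewrite -powR_inv1 ?sqrtr_ge0//.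
  exact: (measurableT_comp (measurable_powR _) measurable_enorm2).
apply: measurable_fun_pair => /=; apply: measurable_fun_coorP => i.
- under eq_fun do rewrite mxE.
  apply: measurable_funM => //.
  exact: (measurableT_comp (measurable_coor i)).
- under eq_fun do rewrite mxE.
  apply: measurable_funM => //.
  exact: (measurableT_comp (measurable_coor i)).
Qed.

Lemma measurable_punctured_ball : measurable punctured_ball.
Proof.
rewrite (_ : punctured_ball = enorm2 @^-1` `]0, 1]).
  by rewrite -[X in measurable X]setTI; exact: measurable_enorm2.
by apply/seteqP; split => x /=; rewrite in_itv.
Qed.

Local Open Scope ereal_scope.

(* Surface measure of the unit sphere of R^n x R^n = R^(2n): sigma(A) is 2n
   times the volume of the cone {r w : w in A, 0 < r <= 1} over A.  It is a
   measure on the ambient space, carried by the sphere. *)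
Definition surface_measure (A : set ('rV[R]_n * 'rV[R]_n)) : \bar R :=
  (2 * n)%:R%:E *
  (lebesgue_rV n \x lebesgue_rV n) (punctured_ball `&` sphere_proj @^-1` A).

Let s0 : surface_measure set0 = 0.
Proof. by rewrite /surface_measure preimage_set0 setI0 measure0 mule0. Qed.

Let s_ge0 A : 0 <= surface_measure A.
Proof. by rewrite /surface_measure mule_ge0// lee_fin. Qed.

Let s_sigma : semi_sigma_additive surface_measure.
Proof.
move=> F mF tF mUF.
have mb := measurable_punctured_ball.
have mG i : measurable (punctured_ball `&` sphere_proj @^-1` F i).
  apply: measurableI => //; rewrite -[X in measurable X]setTI.
  exact: measurable_sphere_proj.
rewrite /surface_measure preimage_bigcup setI_bigcupr.
rewrite [X in X @ \oo --> _](_ : _ = (fun k => (2 * n)%:R%:E *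
   \sum_(0 <= i < k) (lebesgue_rV n \x lebesgue_rV n)
     (punctured_ball `&` sphere_proj @^-1` F i))); last first.
  by apply/funext => k; rewrite ge0_sume_distrr.
apply: cvgeZl => //; apply: measure_semi_sigma_additive => //.
- move=> i j _ _ [x [[_ xi] [_ xj]]]; apply: tF => //.
  by exists (sphere_proj x).
- by apply: bigcupT_measurable.
Qed.

HB.instance Definition _ :=
  isMeasure.Build _ _ _ surface_measure s0 s_ge0 s_sigma.

End sphere.

(* Derivatives are indexed by sequences of directions, so that smoothness
   covers the mixed partial derivatives taken in every order. *)
Section schwartz.
Context {R : realType} (n : nat).

Definition iter_partial (s : seq 'I_n) (f : 'rV[R]_n -> R) : 'rV[R]_n -> R :=
  foldr (fun i g => 'D_(delta_mx ord0 i) g) f s.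

Definition smooth (f : 'rV[R]_n -> R) : Prop :=
  forall s : seq 'I_n, continuous (iter_partial s f) /\
    forall (i : 'I_n) (x : 'rV[R]_n), derivable (iter_partial s f) x (delta_mx ord0 i).

Definition schwartz_real (f : 'rV[R]_n -> R) : Prop :=
  smooth f /\
  forall (a : 'I_n -> nat) (s : seq 'I_n), exists C : R,
    forall x : 'rV[R]_n,
    `|(\prod_(i < n) x ord0 i ^+ a i) * iter_partial s f x| <= C.

(* R[i] is a normed module over itself but not over R, so differentiability
   is imposed on the real and imaginary parts. *)
Definition schwartz (f : 'rV[R]_n -> R[i]) : Prop :=
  schwartz_real (fun x => complex.Re (f x)) /\
  schwartz_real (fun x => complex.Im (f x)).

End schwartz.

Definition complex_integral d (T : measurableType d) (R : realType)
    (mu : {measure set T -> \bar R}) (D : set T) (f : T -> R[i]) : R[i] :=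
  Complex (\int[mu]_(x in D) complex.Re (f x))
          (\int[mu]_(x in D) complex.Im (f x)).

Definition spherical_average (R : realType) (n : nat)
    (f g : 'rV[R]_n -> R[i]) (t : R) (x : 'rV[R]_n) : R[i] :=
  complex_integral (@surface_measure R n) (@sphere R n)
    (fun yz => f (x - t *: yz.1) * g (x - t *: yz.2)).

Definition spherical_maximal (R : realType) (n : nat)
    (f g : 'rV[R]_n -> R[i]) (x : 'rV[R]_n) : \bar R :=
  ereal_sup [set (Normc.normc (spherical_average f g t x))%:E
            | t in [set t : R | 0 < t]].

(* For 0 < p this is (\int |F|^p)^(1/p), a quasi-norm when p < 1. *)
Definition Lp_norm (R : realType) (n : nat) (p : R) (F : 'rV[R]_n -> \bar R) :
  \bar R := Lnorm (lebesgue_rV n) p%:E F.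

Definition modulus (R : realType) (n : nat) (f : 'rV[R]_n -> R[i])
  (x : 'rV[R]_n) : \bar R := (Normc.normc (f x))%:E.

Section rhombus.
Context {R : realType}.

Definition vec3 (a b c : R) : 'rV[R]_3 := \row_(i < 3) [:: a; b; c]`_i.

Definition convex_hull (m : nat) (P : 'I_m -> 'rV[R]_3) : set 'rV[R]_3 :=
  [set x | exists w : 'I_m -> R,
    [/\ forall k, 0 <= w k, \sum_(k < m) w k = 1 &
        x = \sum_(k < m) w k *: P k]].

Definition exponent_plane : set 'rV[R]_3 :=
  [set x | exists a b : R, x = vec3 a b (a + b)].

Definition delta (n : nat) : R := (2 * n%:R - 15) / 10.

Definition rhombus_vertex (n : nat) (k : 'I_4) : 'rV[R]_3 :=
  let d := delta n in
  nth 0 [:: vec3 0 0 0; vec3 1 0 1; vec3 0 1 1;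
            vec3 ((1 + 2 * d) / (2 + 2 * d)) ((1 + 2 * d) / (2 + 2 * d))
                 ((1 + 2 * d) / (1 + d))] k.

(* All coordinates of a point of the open rhombus lie strictly between 0 and 2
   (the first two strictly between 0 and 1), so the exponents 1/a are finite and
   real exponents suffice.

   Interior relative to the plane: the points of the plane near which every
   point of the plane belongs to the hull. *)
Definition open_rhombus (n : nat) : set 'rV[R]_3 :=
  [set x | exponent_plane x /\
    \forall y \near x, exponent_plane y -> convex_hull (rhombus_vertex n) y].

End rhombus.

(* Main.v *)
Require Import Defs.
From HB Require Import structures.
From mathcomp Require Import all_boot all_order all_algebra.
From mathcomp Require Import all_classical all_reals all_analysis.
From mathcomp Require Import measurable_realfun.
From mathcomp.real_closed Require Import complex.
From mathcomp Require Import ring lra zify.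
Set Implicit Arguments.
Unset Strict Implicit.
Unset Printing Implicit Defensive.
Import Order.TTheory GRing.Theory Num.Theory.
Import numFieldNormedType.Exports.
Local Open Scope classical_set_scope.
Local Open Scope ring_scope.

(* A point of the open rhombus satisfies 1/p1 < 1, 1/p2 < 1 and, after exchanging
   f and g if necessary, 1/p2 < (2n-10)/(2n-5).  Substituting u = |v| h and then
   rescaling v in the integral over the unit ball of R^n x R^n decouples the two
   variables and gives the pointwise bound
     M(f,g)(x) <= C * HL|f|(x) * sup_t A_t|g|(x),
   where HL is the Hardy-Littlewood maximal function and A_t the average over the
   sphere of radius t in R^n, so Hoelder's inequality reduces everything to the
   L^p2 bound for the spherical maximal function in the range above.

   For that bound, A_t is the limit of averages smoothed at scale 2^(m-k) when t is
   in [2^m, 2^(m+1)].  The increment of level k is at most C 2^k HL|g|, hence of weak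
   type (1,1) with norm C 2^k.  It varies slowly in t, so the supremum may be
   restricted to a grid of 8^k values of t; on this grid a square function and the
   decay |J(xi)| <= C |xi|^(-2q), q = floor((n-2)/4), of the Fourier transform of
   the sphere give an L^2 bound that decays geometrically in k.  Marcinkiewicz
   interpolation makes the L^p norms summable when (4q-1) < p(4q-2), and the larger
   exponents follow by applying this to powers of |g|. *)

(** The numerology is one comparison. Level k uses 8^k radii per dyadic block, each gaining 16^(-q
    k) in the squared L^2 norm, against a loss 2^k in weak L^1. If the function is cut at 2^(kap k)
    times the height considered, both contributions decay when 1/(p - 1) < kap < (4 q - 3)/(2 - p),
    and such a kap exists when (4 q - 1)/(4 q - 2) < p. The threshold (2 n - 10)/(2 n - 5) of the
    rhombus is at most (4 q - 2)/(4 q - 1) exactly when n <= 10 q, which the chosen q satisfies. Two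
    obstacles shape the rest. The maximal function is a supremum over uncountably many radii, so it
    is controlled through measurable majorants. The square function calls for Plancherel: here the
    frequency integral is weighted by dilates of a kernel whose cosine transform is nonnegative and
    integrable. One and the same constant bounds the weighted integral and is its limit, so it
    cancels without being computed. Averages over a sphere are written throughout as integrals of
    functions of [dir w] over the unit ball, which are volume integrals. *)

(** * Measurability and norms of row vectors *)

Section vector_measurability.
Context {R : realType} d (X : measurableType d) (n : nat).
Implicit Types (f g : X -> 'rV[R]_n) (a : X -> R).

Lemma measurable_rVD f g : measurable_fun [set: X] f -> measurable_fun [set: X] g ->
  measurable_fun [set: X] (fun x => f x + g x).
Proof.
move=> mf mg; apply: measurable_fun_coorP => i; under eq_fun do rewrite mxE.
by apply: measurable_funD; apply: (measurableT_comp (measurable_coor i)).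
Qed.

Lemma measurable_rVZ a f : measurable_fun [set: X] a -> measurable_fun [set: X] f ->
  measurable_fun [set: X] (fun x => a x *: f x).
Proof.
move=> mf mg; apply: measurable_fun_coorP => i; under eq_fun do rewrite mxE.
by apply: measurable_funM => //; apply: (measurableT_comp (measurable_coor i)).
Qed.

Lemma measurable_rVN f : measurable_fun [set: X] f ->
  measurable_fun [set: X] (fun x => - f x).
Proof.
move=> mf; under eq_fun do rewrite -scaleN1r.
by apply: measurable_rVZ => //; exact: measurable_cst.
Qed.

Lemma measurable_rVB f g : measurable_fun [set: X] f -> measurable_fun [set: X] g ->
  measurable_fun [set: X] (fun x => f x - g x).
Proof. by move=> mf mg; apply: measurable_rVD => //; exact: measurable_rVN. Qed.

Lemma measurable_inv_ge0 a : (forall x, 0 <= a x) -> measurable_fun [set: X] a ->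
  measurable_fun [set: X] (fun x => (a x)^-1).
Proof.
move=> a0 ma; under eq_fun do rewrite -powR_inv1//.
exact: (measurableT_comp (measurable_powR _) ma).
Qed.

End vector_measurability.

Section norms.
Context {R : realType} (n : nat).
Implicit Types (x y w : 'rV[R]_n).

Lemma rVnorm_leP x (r : R) : 0 <= r ->
  (`|x| <= r) <-> (forall i, `|x ord0 i| <= r).
Proof.
move=> r0; split=> [xr i|xr].
  apply: le_trans xr; rewrite {2}/Num.norm/= mx_normrE.
  by rewrite (le_trans _ (le_bigmax _ _ (ord0, i)))//=.
rewrite /Num.norm/= mx_normrE; apply/bigmax_leP; split => //= -[i j] _ /=.
by rewrite (ord1 i).
Qed.

Lemma coor_le_rVnorm x i : `|x ord0 i| <= `|x|.
Proof. by have /(_ (lexx _)) := (rVnorm_leP x (normr_ge0 x)).1; apply. Qed.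

Lemma enorm_ge0 x : 0 <= enorm x. Proof. exact: sqrtr_ge0. Qed.

Lemma enorm_sqr x : enorm x ^+ 2 = \sum_(i < n) x ord0 i ^+ 2.
Proof. by rewrite sqr_sqrtr// sumr_ge0// => i _; exact: sqr_ge0. Qed.

Lemma enormZ (a : R) x : enorm (a *: x) = `|a| * enorm x.
Proof.
rewrite /enorm -sqrtr_sqr -sqrtrM ?sqr_ge0//; congr Num.sqrt.
by rewrite mulr_sumr; apply: eq_bigr => i _; rewrite mxE exprMn.
Qed.

Lemma enormN x : enorm (- x) = enorm x.
Proof. by rewrite -scaleN1r enormZ normrN1 mul1r. Qed.

Lemma rVnorm_le_enorm x : `|x| <= enorm x.
Proof.
apply/rVnorm_leP; first exact: enorm_ge0.
move=> i; rewrite -(ger0_norm (enorm_ge0 x)) -ler_sqr ?nnegrE//.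
rewrite !real_normK ?num_real// enorm_sqr (bigD1 i)//= lerDl.
by apply: sumr_ge0 => j _; exact: sqr_ge0.
Qed.

Lemma enorm_sqr_le_rVnorm x : enorm x ^+ 2 <= n%:R * `|x| ^+ 2.
Proof.
rewrite enorm_sqr mulr_natl -[X in _ *+ X]card_ord -sumr_const.
apply: ler_sum => i _; rewrite -real_normK ?num_real// lerXn2r ?nnegrE//.
exact: coor_le_rVnorm.
Qed.

Lemma enorm_eq0 x : (enorm x == 0) = (x == 0).
Proof.
apply/eqP/eqP => [x0|->].
  by apply/eqP; rewrite -normr_le0 (le_trans (rVnorm_le_enorm x))// x0.
by rewrite -(scale0r 0) enormZ normr0 mul0r.
Qed.

Lemma enorm0 : enorm (0 : 'rV[R]_n) = 0.
Proof. by apply/eqP; rewrite enorm_eq0. Qed.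

Lemma enorm_gt0 x : (0 < enorm x) = (x != 0).
Proof. by rewrite lt_def enorm_eq0 enorm_ge0 andbT. Qed.

(** Since 0^-1 = 0, the direction of the origin is 0; this keeps [dir] total, odd and of norm at
    most one. *)
Definition dir w := (enorm w)^-1 *: w.

Lemma enorm_dir w : w != 0 -> enorm (dir w) = 1.
Proof.
move=> w0; rewrite enormZ ger0_norm ?invr_ge0 ?enorm_ge0// mulVf//.
by rewrite enorm_eq0.
Qed.

Lemma enorm_dir_le1 w : enorm (dir w) <= 1.
Proof.
have [->|w0] := eqVneq w 0; last by rewrite enorm_dir.
by rewrite /dir scaler0 enorm0.
Qed.

Lemma dirN w : dir (- w) = - dir w.
Proof. by rewrite /dir enormN scalerN. Qed.

Lemma dirZ (a : R) w : 0 < a -> dir (a *: w) = dir w.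
Proof.
move=> a0; rewrite /dir enormZ gtr0_norm// invfM scalerA mulrAC mulVf ?gt_eqF//.
by rewrite mul1r.
Qed.

Lemma measurable_rVnorm : measurable_fun [set: 'rV[R]_n] (fun x : 'rV[R]_n => `|x|).
Proof.
rewrite (_ : (fun x => _) = fun x : 'rV[R]_n =>
    \big[Num.max/0]_(ij <- index_enum ('I_1 * 'I_n)%type) `|x ij.1 ij.2|); last first.
  by apply/funext => x; rewrite /Num.norm/= mx_normrE.
elim: (index_enum _) => [|[i j] s IH].
  by under eq_fun do rewrite big_nil; exact: measurable_cst.
under eq_fun do rewrite big_cons.
apply: measurable_maxr => //=; apply: measurableT_comp => //.
by rewrite (ord1 i); exact: measurable_coor.
Qed.

Lemma measurable_dir : measurable_fun [set: 'rV[R]_n] dir.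
Proof.
apply: measurable_rVZ => //; apply: measurable_inv_ge0.
  by move=> x; exact: enorm_ge0.
exact: measurable_enorm.
Qed.

End norms.

Section continuous_measurable.
Context {R : realType} (n : nat).

Definition grid_floor (k : nat) (x : 'rV[R]_n) : 'rV[R]_n :=
  \row_i ((Num.floor (k.+1%:R * x ord0 i))%:~R / k.+1%:R).

Lemma grid_floor_dist (k : nat) x : `|grid_floor k x - x| <= k.+1%:R^-1.
Proof.
apply/rVnorm_leP => [|i]; first by rewrite invr_ge0.
rewrite !mxE distrC; set y := x ord0 i.
have k0 : 0 < k.+1%:R :> R by [].
have -> : y - (Num.floor (k.+1%:R * y))%:~R / k.+1%:R =
    (k.+1%:R * y - (Num.floor (k.+1%:R * y))%:~R) / k.+1%:R.
  by rewrite mulrBl mulrAC mulfV ?mul1r// gt_eqF.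
rewrite normrM (ger0_norm (_ : 0 <= k.+1%:R^-1)) ?invr_ge0//.
rewrite ler_piMl ?invr_ge0//.
rewrite ger0_norm ?subr_ge0 ?floor_le_tmp// lerBlDr.
by have := lt_succ_floor (k.+1%:R * y); rewrite intrD addrC => /ltW.
Qed.

(** The sigma-algebra is generated by the coordinates, not by the open sets. So f is written as the
    pointwise limit of its compositions with rounding to the grid of mesh 1/(k+1); these take
    countably many values, each on a union of measurable boxes. *)
Lemma continuous_rV_measurable (f : 'rV[R]_n -> R) : continuous f ->
  measurable_fun [set: 'rV[R]_n] f.
Proof.
move=> cf; apply: (@measurable_fun_cvg _ _ _ _ (fun k => f \o grid_floor k)).
- move=> k _ Y mY; rewrite setTI.
  pose q (c : 'rV[int]_n) : 'rV[R]_n := \row_i ((c ord0 i)%:~R / k.+1%:R).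
  pose A (c : 'rV[int]_n) := \bigcap_(i in [set: 'I_n])
    [set x : 'rV[R]_n | Num.floor (k.+1%:R * x ord0 i) = c ord0 i].
  rewrite (_ : _ @^-1` Y = \bigcup_(c in [set c | Y (f (q c))]) A c); last first.
    apply/seteqP; split => [x /= Yx|x [c /= Yc Ac]].
      exists (\row_i Num.floor (k.+1%:R * x ord0 i)).
        rewrite /= (_ : q _ = grid_floor k x)//.
        by apply/rowP => i; rewrite !mxE.
      by move=> i _ /=; rewrite mxE.
    rewrite /= (_ : grid_floor k x = q c)//.
    by apply/rowP => i; rewrite !mxE (Ac i).
  rewrite bigcup_mkcond; apply: countable_bigcupT_measurable => // c.
  case: ifPn => // _; apply: fin_bigcap_measurable => // i _.
  rewrite (_ : [set x | _] = (fun x : 'rV[R]_n => k.+1%:R * x ord0 i) @^-1`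
    `[(c ord0 i)%:~R, (c ord0 i + 1)%:~R[).
    rewrite -[X in measurable X]setTI.
    have mc : measurable_fun [set: 'rV[R]_n] (fun x : 'rV[R]_n => k.+1%:R * x ord0 i).
      by apply: measurable_funM => //; exact: measurable_coor.
    exact: mc.
  apply/seteqP; split => x /=; rewrite in_itv/=.
    by move=> <-; rewrite floor_le_tmp lt_succ_floor.
  by move=> /floor_def.
- move=> x _; apply: (@cvg_comp _ _ _ (grid_floor^~ x) f _ (nbhs x)); last exact: cf.
  apply/cvgrPdist_le => e e0; near=> k; rewrite distrC.
  rewrite (le_trans (grid_floor_dist k x))// ltW//.
  by near: k; exact: near_infty_natSinv_lt (PosNum e0).
Unshelve. all: by end_near. Qed.

End continuous_measurable.

(** * Lebesgue measure under translations, dilations and isometries *)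

Section transport.
Local Open Scope ereal_scope.
Context d1 d2 (X : measurableType d1) (Y : measurableType d2) (R : realType).
Variables (mu : {measure set X -> \bar R}) (nu : {measure set Y -> \bar R}).
Variables (phi : X -> Y) (mphi : measurable_fun [set: X] phi).

(** Reduces a change of variables to an identity between measures of sets. It serves the dilations
    and isometries below and, at the end, the passage from the surface measure to the ball. *)
Lemma ge0_integral_transport (c : {nonneg R}) (F : Y -> \bar R) :
  (forall B, measurable B -> mu (phi @^-1` B) = c%:num%:E * nu B) ->
  measurable_fun [set: Y] F -> (forall y, 0 <= F y) ->
  \int[mu]_x F (phi x) = c%:num%:E * \int[nu]_y F y.
Proof.
move=> muphi mF F0.
pose phi' : {mfun X >-> Y} := HB.pack phi (isMeasurableFun.Build _ _ _ _ _ mphi).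
transitivity (\int[pushforward mu phi']_y F y).
  by rewrite ge0_integral_pushforward.
rewrite -ge0_integral_mscale//.
by apply: eq_measure_integral => A mA _; exact: muphi.
Qed.

End transport.

Section lebesgue_line.
Local Open Scope ereal_scope.
Context {R : realType}.
Notation mu := (@lebesgue_measure R).

Lemma lebesgue_measure_translation (c : R) (B : set (measurableTypeR R)) :
  measurable B -> mu ((fun x => x + c)%R @^-1` B) = mu B.
Proof.
move=> mB; have mphi : measurable_fun [set: measurableTypeR R]
    ((fun x => x + c)%R : _ -> measurableTypeR R).
  by apply: measurable_funD.
pose phi : {mfun measurableTypeR R >-> measurableTypeR R} :=
  HB.pack (fun x : measurableTypeR R => (x + c)%R : measurableTypeR R)
    (isMeasurableFun.Build _ _ _ _ _ mphi).
rewrite [RHS](@lebesgue_measure_unique _ (pushforward mu phi))//.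
move=> _ [[a b] _ <-] /=; rewrite /pushforward.
rewrite (_ : _ @^-1` _ = `](a - c)%R, (b - c)%R]%classic); last first.
  by apply/seteqP; split => x; rewrite /= !in_itv/= ltrBlDr lerBrDr.
rewrite !lebesgue_measure_itv/= !lte_fin ltrD2r.
by case: ifP => // _; rewrite -!EFinB; congr EFin; ring.
Qed.

Lemma lebesgue_measure_scale (s : R) (B : set (measurableTypeR R)) : (0 < s)%R ->
  measurable B -> mu ((fun x => s * x)%R @^-1` B) = s^-1%:E * mu B.
Proof.
move=> s0 mB; have mphi : measurable_fun [set: measurableTypeR R]
    ((fun x => s * x)%R : _ -> measurableTypeR R).
  by apply: measurable_funM.
pose phi : {mfun measurableTypeR R >-> measurableTypeR R} :=
  HB.pack (fun x : measurableTypeR R => (s * x)%R : measurableTypeR R)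
    (isMeasurableFun.Build _ _ _ _ _ mphi).
rewrite [in RHS](@lebesgue_measure_unique _
    (mscale (NngNum (ltW s0)) (pushforward mu phi)))//.
  rewrite /mscale/= muleA -EFinM mulVf ?gt_eqF//.
  by rewrite mul1e.
move=> _ [[a b] _ <-] /=; rewrite /mscale/= /pushforward.
rewrite (_ : _ @^-1` _ = `](s^-1 * a)%R, (s^-1 * b)%R]%classic); last first.
  apply/seteqP; split => x; rewrite /= !in_itv/=;
  by rewrite ltr_pdivrMl// ler_pdivlMl.
rewrite !lebesgue_measure_itv/= !lte_fin ltr_pM2l ?invr_gt0//.
case: ifP => // _; last by rewrite mule0.
by rewrite -!EFinB -EFinM; congr EFin; field; rewrite gt_eqF.
Qed.

Lemma ge0_integral_scale (s : R) (F : R -> \bar R) : (0 < s)%R ->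
  measurable_fun [set: R] F -> (forall y, 0 <= F y) ->
  \int[mu]_x F (s * x)%R = s^-1%:E * \int[mu]_y F y.
Proof.
move=> s0 mF F0; have si0 : (0 <= s^-1)%R by rewrite invr_ge0 ltW.
apply: (@ge0_integral_transport _ _ _ _ _ mu mu
  ((fun x => s * x)%R : measurableTypeR R -> measurableTypeR R) _ (NngNum si0)) => //.
  by apply: measurable_funM.
by move=> B mB; exact: lebesgue_measure_scale.
Qed.

Lemma ge0_integral_translation (c : R) (F : R -> \bar R) :
  measurable_fun [set: R] F -> (forall y, 0 <= F y) ->
  \int[mu]_x F (x + c)%R = \int[mu]_y F y.
Proof.
move=> mF F0; rewrite -[RHS]mul1e.
apply: (@ge0_integral_transport _ _ _ _ _ mu mu
  ((fun x => x + c)%R : measurableTypeR R -> measurableTypeR R) _ (NngNum (@ler01 R))) => //.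
  by apply: measurable_funD.
by move=> B mB; rewrite mul1e; exact: lebesgue_measure_translation.
Qed.

End lebesgue_line.

Section lebesgue_space.
Local Open Scope ereal_scope.
Context {R : realType}.
Notation lam := (@lebesgue_rV R _).

Lemma ge0_integral_rVS (n : nat) (F : 'rV[R]_n.+1 -> \bar R) :
  measurable_fun setT F -> (forall x, 0 <= F x) ->
  \int[lam]_x F x =
  \int[lebesgue_measure]_a \int[lam]_v F (cons_rV (a, v)).
Proof.
move=> mF F0.
transitivity (\int[lebesgue_measure \x lebesgue_rV n]_p F (cons_rV p)).
  rewrite -[RHS](@ge0_integral_pushforward _ _ _ _ _ _ (@measurable_cons_rV R n) _ setT)//.
rewrite (fubini_tonelli1 (F \o (@cons_rV R n)))//=.
  by apply: measurableT_comp => //; exact: measurable_cons_rV.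
Qed.

Lemma cons_rVD (n : nat) (p q : measurableTypeR R * 'rV[R]_n) :
  cons_rV (p.1 + q.1, p.2 + q.2)%R = (cons_rV p + cons_rV q)%R :> 'rV[R]_n.+1.
Proof.
apply/rowP => i; rewrite /cons_rV !mxE/=; case: splitP => j _; rewrite !mxE//.
by rewrite (ord1 j).
Qed.

Lemma cons_rV_surj (n : nat) (x : 'rV[R]_n.+1) : exists a v, x = cons_rV (a, v).
Proof.
exists (x ord0 ord0), (\row_j x ord0 (lift ord0 j)); apply/rowP => i.
rewrite /cons_rV mxE; case: splitP => j ij; rewrite !mxE.
  by rewrite (ord1 j) eqxx mulr1n; congr (x _ _); apply/val_inj; rewrite /= ij (ord1 j).
rewrite (_ : i = lift ord0 j)//; exact/val_inj.
Qed.

Lemma ge0_integral_rV_translation (n : nat) (c : 'rV[R]_n) (F : 'rV[R]_n -> \bar R) :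
  measurable_fun setT F -> (forall x, 0 <= F x) ->
  \int[lam]_x F (x + c)%R = \int[lam]_x F x.
Proof.
elim: n => [|n IH] in c F * => mF F0.
  by apply: eq_integral => x _; congr F; apply/rowP => -[].
have [a [v ->]] := cons_rV_surj c.
have mc : measurable_fun setT (fun x : 'rV[R]_n.+1 => x + cons_rV (a, v))%R.
  by apply: measurable_rVD.
rewrite [LHS](ge0_integral_rVS (measurableT_comp mF mc)); last by move=> x; exact: F0.
rewrite [RHS](ge0_integral_rVS mF F0).
pose G := fun b : R => \int[lam]_w F (cons_rV (b, w)).
rewrite -(@ge0_integral_translation R a G); last 2 first.
- apply: (measurable_fun_fubini_tonelli_F (F \o (@cons_rV R n))) => //=.
  by apply: measurableT_comp => //; exact: measurable_cons_rV.
- by move=> y; apply: integral_ge0.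
apply: eq_integral => b _; rewrite /G.
rewrite -(IH v (fun w => F (cons_rV (b + a, w)%R))).
- by apply: eq_integral => w _; rewrite /= -cons_rVD.
- apply: (measurableT_comp mF).
  apply: (measurableT_comp (@measurable_cons_rV R n)).
  by apply: measurable_fun_pair.
- by [].
Qed.

Lemma rVnorm_cons (n : nat) (a : R) (v : 'rV[R]_n) (r : R) : (0 <= r)%R ->
  (`|cons_rV (a, v)| <= r)%R <-> (`|a| <= r)%R /\ (`|v| <= r)%R.
Proof.
move=> r0; rewrite !rVnorm_leP//; split=> [H|[ar vr] i].
  split; first by have := H ord0; rewrite /cons_rV mxE; case: splitP => // j _; rewrite (ord1 j) mxE.
  move=> i; have := H (lift ord0 i); rewrite /cons_rV mxE.
  by case: splitP => j; [rewrite (ord1 j)|rewrite /= /bump/= add1n => -[/val_inj ->]].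
rewrite /cons_rV mxE; case: splitP => j _ /=; last exact: vr.
by rewrite (ord1 j) mxE.
Qed.

(** Balls of the sup norm have the explicit volume (2 r)^n, so averages over them avoid the volume
    of the Euclidean ball. *)
Definition cube (n : nat) (r : R) : set 'rV[R]_n := [set x | (`|x| <= r)%R].

Lemma measurable_cube (n : nat) (r : R) : measurable (@cube n r).
Proof.
rewrite (_ : cube _ = (fun x : 'rV[R]_n => `|x|%R) @^-1` `]-oo, r]).
  rewrite -[X in measurable X]setTI; exact: measurable_rVnorm.
by apply/seteqP; split => x /=; rewrite in_itv.
Qed.

Lemma lebesgue_rVS_set (n : nat) (A : set 'rV[R]_n.+1) : measurable A ->
  lam A = \int[lebesgue_measure]_a lebesgue_rV n ((fun v => cons_rV (a, v)) @^-1` A).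
Proof.
move=> mA; rewrite -(setIT A) -integral_indic//.
rewrite [LHS]ge0_integral_rVS; first last.
- by move=> x; rewrite lee_fin.
- by apply/measurable_EFinP; apply: measurable_indic.
apply: eq_integral => a _; rewrite setIT.
have ma : measurable ((fun v : 'rV[R]_n => cons_rV (a, v)) @^-1` A).
  rewrite -[X in measurable X]setTI.
  have mc : measurable_fun setT (fun v : 'rV[R]_n => cons_rV (a, v)).
    apply: (measurableT_comp (@measurable_cons_rV R n)).
    by apply: measurable_fun_pair.
  exact: mc.
by rewrite -[X in _ = _ X]setIT -integral_indic.
Qed.

Lemma lebesgue_cube (n : nat) (r : R) : (0 <= r)%R ->
  lam (@cube n r) = ((2 * r) ^+ n)%:E.
Proof.
move=> r0; elim: n => [|n IH].
  rewrite /= diracE mem_set//= /cube/=; apply/rVnorm_leP => // -[]//.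
rewrite lebesgue_rVS_set; last exact: measurable_cube.
transitivity (\int[lebesgue_measure]_a (((2 * r) ^+ n)%:E * (\1_(`[(- r)%R, r]) a)%:E)).
  apply: eq_integral => a _; rewrite indicE; have [ar|ar] := boolP (a \in _).
    rewrite mule1 -IH; congr (lebesgue_rV n _).
    apply/seteqP; split => v; rewrite /cube/= rVnorm_cons//; first by case.
    by move: ar; rewrite inE/= in_itv/= -ler_norml.
  rewrite mule0 (_ : _ @^-1` _ = set0) ?measure0//.
  apply/seteqP; split => v //=; rewrite /cube/= rVnorm_cons// => -[ar' _].
  by move/negP: ar; apply; rewrite inE/= in_itv/= -ler_norml.
rewrite ge0_integralZl; [|by []| |by []|]; last 2 first.
- by apply/measurable_EFinP; apply: measurable_indic.
- by rewrite lee_fin exprn_ge0// mulr_ge0.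
rewrite integral_indic; [|by []|by []].
rewrite setIT [X in _ * X](lebesgue_measure_itv `[(- r)%R, r])/= lte_fin.
have [r_gt0|] := ltP 0%R r.
  rewrite ifT; last lra.
  by rewrite -EFinB -EFinM; congr EFin; rewrite exprS; ring.
move=> r_le0; have -> : r = 0%R by lra.
by rewrite oppr0 ltxx mule0 mulr0 expr0n.
Qed.

End lebesgue_space.
Section lebesgue_linear.
Local Open Scope ereal_scope.
Context {R : realType} (n : nat).
Notation T := 'rV[R]_n.
Notation lam := (@lebesgue_rV R n).

Lemma measure_integral_indic (A : set T) : measurable A ->
  \int[lam]_x (\1_A x)%:E = lam A.
Proof. by move=> mA; rewrite integral_indic// setIT. Qed.

(* Uniqueness of translation-invariant measures: evaluate
   \int\int 1_A(x) 1_B(phi y + x) in both orders. *)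
Lemma lebesgue_rV_additive_preimage (phi : T -> T) (A : set T) (k : R) :
  measurable_fun setT phi -> (forall x y, phi (x + y) = phi x + phi y)%R ->
  (forall y, exists x, phi x = y) ->
  measurable A -> (forall x, A (- x)%R -> A x) -> (0 < lam A) -> (lam A < +oo) ->
  lam (phi @^-1` A) = k%:E * lam A ->
  forall B, measurable B -> lam (phi @^-1` B) = k%:E * lam B.
Proof.
move=> mphi phiD surj mA symA A_gt0 A_fin phiA B mB.
have mpre (C : set T) : measurable C -> measurable (phi @^-1` C).
  by move=> mC; rewrite -[X in measurable X]setTI; exact: mphi.
have shift (C : set T) (c : T) : measurable C ->
    \int[lam]_y (\1_C (phi y + c)%R)%:E = lam (phi @^-1` C).
  move=> mC; have [d dc] := surj c.
  rewrite -(measure_integral_indic (mpre _ mC)).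
  rewrite -[RHS](@ge0_integral_rV_translation _ _ d)//.
    by apply: eq_integral => y _; rewrite /= -dc -phiD.
  by apply/measurable_EFinP; apply: measurable_indic; exact: mpre.
have sym x : \1_A (- x)%R = \1_A x :> R.
  rewrite !indicE; congr (_ %:R); congr nat_of_bool.
  apply/idP/idP; rewrite !inE; first exact: symA.
  by move=> Ax; apply: symA; rewrite opprK.
have : lam A * lam (phi @^-1` B) = lam (phi @^-1` A) * lam B.
  transitivity (\int[lam]_x \int[lam]_y ((\1_A x)%:E * (\1_B (phi y + x)%R)%:E)).
    rewrite -(measure_integral_indic mA) -ge0_integralZr//; last first.
      by apply/measurable_EFinP; apply: measurable_indic.
    apply: eq_integral => x _; rewrite -(shift _ x mB) -ge0_integralZl//.
    apply/measurable_EFinP; apply: measurableT_comp; first exact: measurable_indic.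
    by apply: measurable_rVD.
  rewrite (fubini_tonelli (fun p : T * T =>
      (\1_A p.1)%:E * (\1_B (phi p.2 + p.1)%R)%:E)); first last.
  - by move=> p; rewrite mule_ge0.
  - apply: emeasurable_funM; apply/measurable_EFinP; apply: measurableT_comp => //.
    by apply: measurable_rVD => //; apply: measurableT_comp.
  transitivity (\int[lam]_y \int[lam]_x ((\1_A (x - phi y)%R)%:E * (\1_B x)%:E)).
    apply: eq_integral => y _ /=.
    rewrite -[RHS](@ge0_integral_rV_translation _ _ (phi y)).
    - by apply: eq_integral => x _; rewrite /= addrK addrC.
    - apply: emeasurable_funM; apply/measurable_EFinP; last exact: measurable_indic.
      apply: measurableT_comp => //.
      by apply: measurable_rVB => //; exact: measurable_cst.
    - by move=> x; rewrite mule_ge0.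
  rewrite -(fubini_tonelli (fun p : T * T =>
      (\1_A (p.1 - phi p.2)%R)%:E * (\1_B p.1)%:E)); first last.
  - by move=> p; rewrite mule_ge0.
  - apply: emeasurable_funM; apply/measurable_EFinP; apply: measurableT_comp => //.
    by apply: measurable_rVB => //; apply: measurableT_comp.
  rewrite muleC -(measure_integral_indic mB) -ge0_integralZr//; last first.
    by apply/measurable_EFinP; apply: measurable_indic.
  apply: eq_integral => x _; rewrite muleC -(shift _ (- x)%R mA) -ge0_integralZr//.
    by apply: eq_integral => y _; rewrite -sym opprB.
  apply/measurable_EFinP; apply: measurableT_comp; first exact: measurable_indic.
  by apply: measurable_rVB => //; exact: measurable_cst.
rewrite phiA [k%:E * _]muleC -muleA => /(congr1 (fun z => (fine (lam A))^-1%:E * z)).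
have finA : lam A \is a fin_num by rewrite ge0_fin_numE.
have c0 : fine (lam A) != 0%R by rewrite gt_eqF// fine_gt0// A_gt0.
have e1 : (fine (lam A))^-1%:E * lam A = 1 by rewrite -{2}(fineK finA) -EFinM mulVf.
by rewrite !(muleA _ (lam A)) e1 !mul1e.
Qed.

Lemma lebesgue_rV_scale (s : R) (B : set T) : (0 < s)%R -> measurable B ->
  lam ((fun x => s *: x)%R @^-1` B) = (s ^- n)%:E * lam B.
Proof.
move=> s0; apply: (@lebesgue_rV_additive_preimage _ (cube 1)).
- by apply: measurable_rVZ.
- by move=> x y; rewrite scalerDr.
- by move=> y; exists (s^-1 *: y); rewrite scalerA mulfV ?scale1r// gt_eqF.
- exact: measurable_cube.
- by move=> x; rewrite /cube/= normrN.
- by rewrite lebesgue_cube// lte_fin exprn_gt0.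
- by rewrite lebesgue_cube// ltry.
- rewrite (_ : _ @^-1` _ = cube s^-1).
    rewrite !lebesgue_cube ?invr_ge0 ?ltW// -EFinM; congr EFin.
    by rewrite mulr1 exprMn exprVn mulrC.
  apply/seteqP; split => x; rewrite /cube/= normrZ gtr0_norm//;
  by rewrite -ler_pdivlMl// mulr1.
Qed.

Lemma lebesgue_rVN (B : set T) : measurable B -> lam (-%R @^-1` B) = lam B.
Proof.
rewrite -[X in _ -> _ = X]mul1e; move: B; apply: (@lebesgue_rV_additive_preimage _ (cube 1)).
- by apply: measurable_rVN.
- by move=> x y; rewrite opprD.
- by move=> y; exists (- y)%R; rewrite opprK.
- exact: measurable_cube.
- by move=> x; rewrite /cube/= normrN.
- by rewrite lebesgue_cube// lte_fin exprn_gt0.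
- by rewrite lebesgue_cube// ltry.
- rewrite mul1e; congr (lam _).
  by apply/seteqP; split => x; rewrite /cube/= normrN.
Qed.

Definition eball (r : R) : set T := [set x | (enorm x <= r)%R].

Lemma measurable_eball (r : R) : measurable (eball r).
Proof.
rewrite (_ : eball _ = (@enorm R n) @^-1` `]-oo, r]).
  by rewrite -[X in measurable X]setTI; exact: measurable_enorm.
by apply/seteqP; split => x /=; rewrite in_itv.
Qed.

Lemma lebesgue_eball_lty (r : R) : (0 <= r)%R -> lam (eball r) < +oo.
Proof.
move=> r0; apply: (@le_lt_trans _ _ (lam (cube r))).
  apply: le_measure; rewrite ?inE; [exact: measurable_eball|exact: measurable_cube|].
  by move=> x /=; apply: le_trans; exact: rVnorm_le_enorm.
by rewrite lebesgue_cube// ltry.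
Qed.

Lemma lebesgue_eball_gt0 (r : R) : (0 < r)%R -> 0 < lam (eball r).
Proof.
(* A cube of half-side r/(n+1) fits in the ball because n/(n+1)^2 <= 1; the successor also keeps the
   quotient meaningful in dimension 0. *)
move=> r0; pose s := (r / n.+1%:R)%R.
have s0 : (0 < s)%R by rewrite divr_gt0.
apply: (@lt_le_trans _ _ (lam (cube s))).
  by rewrite lebesgue_cube ?ltW// lte_fin exprn_gt0// mulr_gt0.
apply: le_measure; rewrite ?inE; [exact: measurable_cube|exact: measurable_eball|].
move=> x; rewrite /eball /cube/= => xs.
rewrite -ler_sqr ?nnegrE ?enorm_ge0//; last exact: ltW.
rewrite (le_trans (enorm_sqr_le_rVnorm x))//.
rewrite (@le_trans _ _ (n%:R * s ^+ 2)%R)//.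
  by rewrite ler_wpM2l// lerXn2r ?nnegrE ?(ltW s0).
rewrite /s expr_div_n mulrCA ler_piMr ?sqr_ge0//.
rewrite ler_pdivrMr ?exprn_gt0// mul1r -natrX ler_nat.
by rewrite (leq_trans (leqnSn n))// leq_pmulr.
Qed.

(** The Euclidean unit ball is its own preimage, which forces the proportionality constant of
    [lebesgue_rV_additive_preimage] to be 1; no determinant is computed. *)
Lemma lebesgue_rV_isometry (phi : T -> T) (B : set T) :
  measurable_fun setT phi -> (forall x y, phi (x + y) = phi x + phi y)%R ->
  (forall y, exists x, phi x = y) -> (forall x, enorm (phi x) = enorm x) ->
  measurable B -> lam (phi @^-1` B) = lam B.
Proof.
move=> mphi phiD surj iso; rewrite -[X in _ -> _ = X]mul1e; move: B.
apply: (@lebesgue_rV_additive_preimage _ (eball 1)) => //.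
- exact: measurable_eball.
- by move=> x; rewrite /eball/= enormN.
- exact: lebesgue_eball_gt0.
- exact: lebesgue_eball_lty.
- by rewrite mul1e; congr (lam _); apply/seteqP; split => x; rewrite /eball/= iso.
Qed.

Lemma ge0_integral_rV_scale (s : R) (F : T -> \bar R) : (0 < s)%R ->
  measurable_fun setT F -> (forall x, 0 <= F x) ->
  \int[lam]_x F (s *: x)%R = (s ^- n)%:E * \int[lam]_x F x.
Proof.
move=> s0 mF F0; have c0 : (0 <= s ^- n)%R by rewrite invr_ge0 exprn_ge0// ltW.
apply: (@ge0_integral_transport _ _ _ _ _ lam lam (fun x => s *: x)%R _ (NngNum c0)) => //.
  by apply: measurable_rVZ.
by move=> B mB; exact: lebesgue_rV_scale.
Qed.

Lemma ge0_integral_rVN (F : T -> \bar R) :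
  measurable_fun setT F -> (forall x, 0 <= F x) ->
  \int[lam]_x F (- x)%R = \int[lam]_x F x.
Proof.
move=> mF F0; rewrite -[RHS]mul1e.
apply: (@ge0_integral_transport _ _ _ _ _ lam lam (fun x => - x)%R _ (NngNum (@ler01 R))) => //.
  by apply: measurable_rVN.
by move=> B mB; rewrite mul1e; exact: lebesgue_rVN.
Qed.

Lemma ge0_integral_rV_isometry (phi : T -> T) (F : T -> \bar R) :
  measurable_fun setT phi -> (forall x y, phi (x + y) = phi x + phi y)%R ->
  (forall y, exists x, phi x = y) -> (forall x, enorm (phi x) = enorm x) ->
  measurable_fun setT F -> (forall x, 0 <= F x) ->
  \int[lam]_x F (phi x) = \int[lam]_x F x.
Proof.
move=> mphi phiD surj iso mF F0; rewrite -[RHS]mul1e.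
apply: (@ge0_integral_transport _ _ _ _ _ lam lam phi _ (NngNum (@ler01 R))) => //.
by move=> B mB; rewrite mul1e; exact: lebesgue_rV_isometry.
Qed.

End lebesgue_linear.

(** * Measurability of composite expressions *)

Section measurability_tools.
Context {R : realType} d (X : measurableType d).
Implicit Types (a b : X -> R).

Lemma measurable_natr_bool (b : X -> bool) : measurable_fun [set: X] b ->
  measurable_fun [set: X] (fun x => (b x)%:R : R).
Proof.
move=> mb; rewrite (_ : (fun x => _) = fun x => if b x then 1 else 0).
  by apply: measurable_fun_ifT.
by apply/funext => x; case: (b x).
Qed.

Lemma measurable_fun_enorm n (f : X -> 'rV[R]_n) : measurable_fun [set: X] f ->
  measurable_fun [set: X] (fun x => enorm (f x)).
Proof. by move=> mf; apply: (measurableT_comp (@measurable_enorm R n)). Qed.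

Lemma measurable_fun_rVnorm n (f : X -> 'rV[R]_n) : measurable_fun [set: X] f ->
  measurable_fun [set: X] (fun x => `|f x|).
Proof. by move=> mf; apply: (measurableT_comp (@measurable_rVnorm R n)). Qed.

Lemma measurable_fun_dir n (f : X -> 'rV[R]_n) : measurable_fun [set: X] f ->
  measurable_fun [set: X] (fun x => dir (f x)).
Proof. by move=> mf; apply: (measurableT_comp (@measurable_dir R n)). Qed.

Lemma measurable_fun_coor n (f : X -> 'rV[R]_n) i : measurable_fun [set: X] f ->
  measurable_fun [set: X] (fun x => f x ord0 i).
Proof. by move=> mf; apply: (measurableT_comp (measurable_coor i)). Qed.

Lemma measurable_fun_cons n (f : X -> 'rV[R]_n) a : measurable_fun [set: X] a ->
  measurable_fun [set: X] f -> measurable_fun [set: X] (fun x => cons_rV (a x, f x)).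
Proof.
move=> ma mf; apply: (measurableT_comp (@measurable_cons_rV R n)).
exact: measurable_fun_pair.
Qed.

Lemma measurable_funVr a : measurable_fun [set: X] a ->
  measurable_fun [set: X] (fun x => (a x)^-1).
Proof.
move=> ma; rewrite (_ : (fun x => _) =
    fun x => (0 <= a x)%R%:R * `|a x|^-1 - (a x < 0)%R%:R * `|a x|^-1); last first.
  apply/funext => x; have [a0|a0] := leP 0 (a x).
    by rewrite ger0_norm// mul0r subr0 mul1r.
  by rewrite ltr0_norm// mul0r mul1r sub0r invrN opprK.
have mi : measurable_fun setT (fun x => `|a x|^-1).
  by apply: measurable_inv_ge0 => //; exact: measurableT_comp.
apply: measurable_funB; apply: measurable_funM => //; apply: measurable_natr_bool.
  exact: measurable_fun_ler.
exact: measurable_fun_ltr.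
Qed.

Lemma measurable_fun_sqrt a : measurable_fun [set: X] a ->
  measurable_fun [set: X] (fun x => Num.sqrt (a x)).
Proof.
move=> ma; apply: (@measurableT_comp _ _ _ _ _ _ (@Num.sqrt R)) => //.
by apply: continuous_measurable_fun; exact: sqrt_continuous.
Qed.

Lemma measurable_fun_rV_neq0 n (f : X -> 'rV[R]_n) : measurable_fun [set: X] f ->
  measurable_fun [set: X] (fun x => f x != 0).
Proof.
move=> mf; apply: measurable_neg.
have -> : (fun x => f x == 0) = (fun x => `|f x| <= 0).
  by apply/funext => x; rewrite normr_le0.
by apply: measurable_fun_ler => //; exact: measurable_fun_rVnorm.
Qed.

Lemma measurable_fun_powRc a (r : R) : measurable_fun [set: X] a ->
  measurable_fun [set: X] (fun x => a x `^ r).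
Proof. by move=> ma; apply: (measurableT_comp (@measurable_powR R r)). Qed.

Lemma measurable_fun_normr a : measurable_fun [set: X] a ->
  measurable_fun [set: X] (fun x => `|a x|).
Proof. by move=> ma; apply: measurableT_comp. Qed.

Lemma measurable_fun_fst d1 d2 (Y : measurableType d1) (Z : measurableType d2)
  (f : X -> Y * Z) : measurable_fun [set: X] f -> measurable_fun [set: X] (fun x => (f x).1).
Proof. by move=> mf; apply: (measurableT_comp measurable_fst). Qed.

Lemma measurable_fun_snd d1 d2 (Y : measurableType d1) (Z : measurableType d2)
  (f : X -> Y * Z) : measurable_fun [set: X] f -> measurable_fun [set: X] (fun x => (f x).2).
Proof. by move=> mf; apply: (measurableT_comp measurable_snd). Qed.

End measurability_tools.

(** Structural descent on the body of the function. The goal is first eta-expanded and beta-reduced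
    so that its outermost operation can be matched. *)
Ltac mfun_step :=
 lazymatch goal with |- measurable_fun ?D ?f =>
   change (measurable_fun D (fun x => f x)); cbv beta end;
 first
 [ assumption
 | match goal with
   | |- measurable_fun _ (fun _ => ?c) => exact: measurable_cst
   | |- measurable_fun _ (fun x => x) => exact: measurable_id
   | H : measurable_fun _ ?F |- measurable_fun _ (fun x => ?F (@?g x)) =>
       lazymatch g with (fun x => x) => exact: H | _ => apply: (measurableT_comp H) end
   | |- measurable_fun _ (fun x => (_ <= _)%R) => apply: measurable_fun_ler
   | |- measurable_fun _ (fun x => (_ < _)%R) => apply: measurable_fun_ltr
   | |- measurable_fun _ (fun x => (_ < _)%E) => apply: measurable_fun_lte
   | |- measurable_fun _ (fun x => (_ `^ _)%R) => apply: measurable_fun_powRc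
   | |- measurable_fun _ (fun x => (_ != 0%R)) => apply: measurable_fun_rV_neq0
   | |- measurable_fun _ (fun x => (_ && _)) => apply: measurable_and
   | |- measurable_fun _ (fun x => (_ %:E)%E) => apply/measurable_EFinP
   | |- measurable_fun _ (fun x => (_, _)) => apply: measurable_fun_pair
   | |- measurable_fun _ (fun x => ((nat_of_bool _)%:R)%R) => apply: measurable_natr_bool
   | |- measurable_fun _ (fun x => enorm _) => apply: measurable_fun_enorm
   | |- measurable_fun _ (fun x => dir _) => apply: measurable_fun_dir
   | |- measurable_fun _ (fun x => cons_rV _) => apply: measurable_fun_cons
   | |- measurable_fun _ (fun x => (_^-1)%R) => apply: measurable_funVr
   | |- measurable_fun _ (fun x => fst _) => apply: measurable_fun_fst
   | |- measurable_fun _ (fun x => snd _) => apply: measurable_fun_snd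
   | |- measurable_fun _ (fun x => Num.sqrt _) => apply: measurable_fun_sqrt
   | |- measurable_fun _ (fun x => (_ ^+ _)%R) => apply: measurable_funX
   | |- measurable_fun _ (fun x => (`|_|)%R) =>
       first [apply: measurable_fun_normr | apply: measurable_fun_rVnorm]
   | |- measurable_fun _ (fun x => (_ + _)%R) =>
       first [apply: measurable_funD | apply: measurable_rVD]
   | |- measurable_fun _ (fun x => (- _)%R) =>
       first [apply: measurable_funN | apply: measurable_rVN]
   | |- measurable_fun _ (fun x => (_ *: _)%R) => apply: measurable_rVZ
   | |- measurable_fun _ (fun x => (_ * _)%R) => apply: measurable_funM
   | |- measurable_fun _ (fun x => (_ * _)%E) => apply: emeasurable_funM
   | |- measurable_fun _ (fun x => (_ + _)%E) => apply: emeasurable_funD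
   | |- measurable_fun _ (fun x => fun_of_matrix _ _ _) => apply: measurable_fun_coor
   end ].
Ltac mfun := repeat mfun_step.

(** * Integrals of powers and polar coordinates *)

Section power_integrals.
Local Open Scope ereal_scope.
Context {R : realType}.
Notation mu := (@lebesgue_measure R).
Implicit Types (s x y a rho : R).

Lemma continuous_at_powR a x : (0 < x)%R -> {for x, continuous (fun r => r `^ a)%R}.
Proof.
move=> x0; apply: differentiable_continuous; apply/derivable1_diffP.
by have [] := is_derive1_powR a x0.
Qed.

Lemma cvgy_powRN s : (0 < s)%R -> (r `^ (- s))%R @[r --> +oo%R] --> (0 : R)%R.
Proof.
move=> s0; apply/cvgrPdist_le => e e0; near=> r.
have r0 : (0 < r)%R by near: r; exact: nbhs_pinfty_gt.
rewrite sub0r normrN ger0_norm ?powR_ge0// powRN.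
have er : (e `^ (- s^-1) <= r)%R by near: r; exact: nbhs_pinfty_ge.
rewrite invf_ple ?posrE ?powR_gt0//.
rewrite (@le_trans _ _ ((e `^ (- s^-1)) `^ s)%R)//.
  by rewrite -powRrM mulNr mulVf ?gt_eqF// powRN powRr1// ltW.
by rewrite ge0_ler_powR// ?nnegrE ?powR_ge0// ltW.
Unshelve. all: by end_near. Qed.

Lemma integral_powR_infty s rho : (0 < s)%R -> (0 < rho)%R ->
  \int[mu]_(r in `[rho, +oo[) (s * r `^ (- s - 1))%:E = (rho `^ (- s))%:E.
Proof.
move=> s0 rho0.
have dF (r : R) : (0 < r)%R ->
    is_derive r (1 : R)%R (fun r => - (r `^ (- s)))%R (s * r `^ (- s - 1))%R.
  move=> r0; have H := is_derive1_powR (- s)%R r0.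
  by apply: is_derive_eq; rewrite mulNr opprK.
rewrite (@ge0_continuous_FTC2y _ _ (fun r => - (r `^ (- s)))%R rho 0%R).
- by rewrite sub0e EFinN oppeK.
- by move=> x _; rewrite mulr_ge0// ?powR_ge0// ltW.
- apply: continuous_in_subspaceT => x; rewrite inE/= in_itv/= andbT => rx.
  by apply: cvgM; [exact: cvg_cst|apply: continuous_at_powR; exact: lt_le_trans rx].
- by rewrite -oppr0; apply: cvgN; exact: cvgy_powRN.
- by move=> x rx; have [] := dF x (lt_trans rho0 rx).
- by apply: cvg_at_right_filter; apply: cvgN; exact: continuous_at_powR.
- move=> x; rewrite in_itv/= andbT => rx.
  by have H := dF x (lt_trans rho0 rx); rewrite derive1E derive_val.
Qed.

Lemma integral_powR_zero s y : (0 < s)%R -> (0 < y)%R ->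
  \int[mu]_(r in `]0%R, y]) (s * r `^ (s - 1))%:E = (y `^ s)%:E.
Proof.
move=> s0 y0.
have dF (r : R) : (0 < r)%R ->
    is_derive r (1 : R)%R (fun r => r `^ s)%R (s * r `^ (s - 1))%R.
  by move=> r0; exact: is_derive1_powR.
(* The integrand may blow up at 0, so the fundamental theorem of calculus is applied away from 0 and
   a monotone limit is taken. The shift [k.+2] makes the left end smaller than y already for k =
   0. *)
pose F k := `[(y / k.+2%:R)%R, y]%classic : set R.
have Fk0 k : (0 < y / k.+2%:R)%R by rewrite divr_gt0.
have Fky k : (y / k.+2%:R < y)%R by rewrite ltr_pdivrMr// ltr_pMr// ltr1n.
have intF k : \int[mu]_(r in F k) (s * r `^ (s - 1))%:E =
    (y `^ s - (y / k.+2%:R) `^ s)%:E.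
  rewrite EFinB (@continuous_FTC2 _ _ (fun r => r `^ s)%R)//.
  - apply: continuous_in_subspaceT => x; rewrite inE/= in_itv/= => /andP[rx _].
    by apply: cvgM; [exact: cvg_cst|apply: continuous_at_powR; exact: lt_le_trans rx].
  - split => [x||].
    + by rewrite in_itv/= => /andP[rx _]; have [] := dF x (lt_trans (Fk0 k) rx).
    + by apply: cvg_at_right_filter; exact: continuous_at_powR.
    + by apply: cvg_at_left_filter; exact: continuous_at_powR.
  - move=> x; rewrite in_itv/= => /andP[rx _].
    by have H := dF x (lt_trans (Fk0 k) rx); rewrite derive1E derive_val.
have UF : `]0%R, y]%classic = \bigcup_k F k.
  apply/seteqP; split => [x|x [k _]]; rewrite /F/= !in_itv/=; last first.
    by move=> /andP[kx ->]; rewrite (lt_le_trans (Fk0 k) kx).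
  move=> /andP[x0 xy]; exists (Num.truncn (y / x)) => //; rewrite /F/= in_itv/= xy andbT.
  rewrite ler_pdivrMr// mulrC -ler_pdivrMr//.
  rewrite (le_trans (ltW (truncnS_gt _)))// ler_nat//.
have mf : measurable_fun [set: R] (fun r => (s * r `^ (s - 1))%:E).
  by apply/measurable_EFinP; apply: measurable_funM => //; exact: measurable_powR.
have : \int[mu]_(r in F k) (s * r `^ (s - 1))%:E @[k --> \oo] -->
    \int[mu]_(r in `]0%R, y]) (s * r `^ (s - 1))%:E.
  rewrite UF; apply: ge0_nondecreasing_set_cvg_integral => //.
  - apply/nondecreasing_seqP => k; rewrite subsetEset => x.
    rewrite /F/= !in_itv/= => /andP[kx ->]; rewrite andbT (le_trans _ kx)//.
    by rewrite ler_wpM2l ?(ltW y0)// lef_pV2 ?posrE// ler_nat.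
  - by move=> k; exact: measurable_itv.
  - by move=> k; exact: measurable_funTS.
  - by move=> k x _; rewrite lee_fin mulr_ge0 ?powR_ge0// ltW.
under eq_fun do rewrite intF.
move=> H; apply: (cvg_unique _ H) => //; apply: cvg_EFin; first exact: nearW.
rewrite -[X in _ --> X]subr0; apply: cvgB; first exact: cvg_cst.
apply: (cvg_at_rightP _ _ _).1 (powR_cvg0 s0) (fun k : nat => y / k.+2%:R)%R _; split=> //.
rewrite -(mulr0 y); apply: cvgM; first exact: cvg_cst.
have := @cvg_harmonic R; rewrite -cvg_shiftS; exact.
Qed.
End power_integrals.
Section polar.
Local Open Scope ereal_scope.
Context {R : realType} (n : nat) (n0 : (0 < n)%N).
Notation T := 'rV[R]_n.
Notation lam := (@lebesgue_rV R n).

Lemma ge0_integral_rV_neq0 (F : T -> \bar R) : measurable_fun setT F ->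
  (forall x, 0 <= F x) ->
  \int[lam]_x F x = \int[lam]_x (F x * (x != 0)%:R%:E).
Proof.
move=> mF F0.
have E0 : [set 0%R] = @cube R n 0.
  apply/seteqP; split => x; rewrite /cube/=; first by move=> ->; rewrite normr0.
  by rewrite normr_le0 => /eqP.
have m2 : measurable_fun setT (fun x : T => F x * (x != 0)%:R%:E) by mfun.
apply: ge0_ae_eq_integral => //; first by move=> x _; rewrite mule_ge0.
exists [set 0%R]; split.
- by rewrite E0; exact: measurable_cube.
- have -> : [set 0%R] = @cube R n 0 by [].
  transitivity ((2 * 0) ^+ n : R)%R%:E; first exact: lebesgue_cube.
  by rewrite mulr0 expr0n eqn0Ngt n0.
- move=> x /=; apply: contra_notP => /eqP x0 _; by rewrite x0 mule1.
Qed.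

(** Polar coordinates in which the ball, seen through [dir], stands for the sphere. Averaging over
    the length of w is harmless because the inner integral depends on w only through its
    direction. *)
Lemma ge0_integral_polar (H : T -> \bar R) : measurable_fun setT H -> (forall x, 0 <= H x) ->
  \int[lam]_x H x = \int[lam]_w ((enorm w <= 1)%R%:R%:E *
    \int[lebesgue_measure]_r ((n%:R * r ^+ n.-1 * (0 < r)%R%:R)%:E * H (r *: dir w)%R)).
Proof.
move=> mH H0; rewrite (ge0_integral_rV_neq0 mH H0).
(* A partition of unity in r: its integral over r >= |x| is 1. Inserting it and substituting x = r w
   produces the weight n |w|^n r^(n-1) on |w| <= 1, and replacing r by r/|w| turns r w into r
   [dir w] and absorbs |w|^n. *)
pose K (x : T) (r : R) := (n%:R * enorm x ^+ n * r^-1 ^+ n.+1 *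
  ((0 < r)%R && (enorm x <= r)%R)%:R)%R.
have K0 x r : (0 <= K x r)%R.
  rewrite /K; case: ltP => r0; rewrite ?mulr0//= mulr_ge0// mulr_ge0//.
    by rewrite mulr_ge0// exprn_ge0// enorm_ge0.
  by rewrite exprn_ge0// invr_ge0 ltW.
have mK : measurable_fun setT (fun p : T * measurableTypeR R => K p.1 p.2).
  by rewrite /K; mfun.
have intK x : x != 0%R -> \int[lebesgue_measure]_r (K x r)%:E = 1.
  move=> x0; have ex : (0 < enorm x)%R by rewrite enorm_gt0.
  transitivity ((enorm x ^+ n)%:E * \int[lebesgue_measure]_(r in `[enorm x, +oo[)
      (n%:R * r `^ (- n%:R - 1))%:E).
    rewrite -ge0_integralZl//; first last.
    - by rewrite lee_fin exprn_ge0// enorm_ge0.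
    - by move=> r _; rewrite lee_fin mulr_ge0// powR_ge0.
    - by apply/measurable_EFinP; apply: measurable_funTS; apply: measurable_funM => //; exact: measurable_powR.
    rewrite [RHS]integral_mkcond; apply: eq_integral => r _.
    rewrite patchE; case: ifPn => [|/negP]; rewrite inE/= in_itv/= andbT => xr.
      have r0 : (0 < r)%R := lt_le_trans ex xr.
      rewrite -EFinM /K xr r0/= mulr1; congr EFin.
      have -> : (1 *- n - 1 = - n.+1%:R :> R)%R by rewrite -natr1 opprD.
      by rewrite powRN powR_mulrn ?ltW// exprVn; ring.
    have /negbTE xr' : ~~ (enorm x <= r)%R by exact/negP.
    by rewrite /K xr' andbF mulr0.
  rewrite integral_powR_infty//; last by rewrite ltr0n.
  rewrite -EFinM powRN powR_mulrn ?enorm_ge0// mulfV//.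
  by rewrite expf_neq0// gt_eqF.
transitivity (\int[lam]_x \int[lebesgue_measure]_r ((x != 0)%:R%:E * (K x r)%:E * H x)).
  apply: eq_integral => x _; have [->|x0] := eqVneq x 0%R.
    by rewrite mule0 integral0_eq// => r _; rewrite !mul0e.
  under eq_integral do rewrite mul1e.
  rewrite ge0_integralZr//; first by rewrite intK// mul1e mule1.
  - by rewrite /K; mfun.
  - by move=> r _; rewrite lee_fin.
rewrite (fubini_tonelli (fun p : T * measurableTypeR R =>
  (p.1 != 0)%:R%:E * (K p.1 p.2)%:E * H p.1)); first last.
- by move=> p; rewrite !mule_ge0// lee_fin.
- by mfun.
transitivity (\int[lebesgue_measure]_r \int[lam]_w
   ((w != 0)%:R%:E * (enorm w <= 1)%R%:R%:E *
    ((n%:R * enorm w ^+ n * r ^+ n.-1 * (0 < r)%R%:R)%:E * H (r *: w)%R))).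
  apply: eq_integral => r _ /=; have [r0|r0] := ltP 0%R r; last first.
    rewrite !integral0_eq// => w _; first by rewrite mulr0 mul0e mule0.
    by rewrite /K ltNge r0/= mulr0 mule0 mul0e.
  have rn0 : (r ^+ n != 0)%R by rewrite expf_neq0// gt_eqF.
  have rn1 : (r^-1 ^+ n.+1 = r ^- n * r^-1)%R by rewrite exprSr exprVn.
  have := @ge0_integral_rV_scale R n r
    (fun x => (x != 0)%:R%:E * (K x r)%:E * H x) r0.
  move=> /(_ _ _)/(congr1 (fun z => (r ^+ n)%:E * z)).
  rewrite muleA -EFinM mulfV// mul1e => <-; last 2 first.
  - by rewrite /K; mfun.
  - by move=> x; rewrite !mule_ge0// lee_fin.
  rewrite -ge0_integralZl//; last 3 first.
  - by rewrite /K; mfun.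
  - by move=> x _; rewrite !mule_ge0// lee_fin.
  - by rewrite lee_fin exprn_ge0// ltW.
  apply: eq_integral => w _; rewrite /K r0/= enormZ gtr0_norm//.
  rewrite scaler_eq0 (gt_eqF r0)/= mulr1.
  have -> : (r * enorm w <= r)%R = (enorm w <= 1)%R by rewrite -[leRHS]mulr1 ler_pM2l.
  rewrite !muleA; congr (_ * H _); rewrite -!EFinM; congr EFin.
  have q0 : (r ^+ n.-1 != 0)%R by rewrite expf_neq0// gt_eqF.
  have rS : (r ^+ n = r * r ^+ n.-1)%R by rewrite -exprS prednK.
  rewrite rn1 exprMn rS; field.
  by rewrite q0 gt_eqF.
rewrite -(fubini_tonelli (fun p : T * measurableTypeR R =>
  (p.1 != 0)%:R%:E * (enorm p.1 <= 1)%R%:R%:E *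
    ((n%:R * enorm p.1 ^+ n * p.2 ^+ n.-1 * (0 < p.2)%R%:R)%:E * H (p.2 *: p.1)%R))); first last.
- move=> p; rewrite !mule_ge0// lee_fin; case: ltP => p0; rewrite ?mulr0//=.
  by rewrite !mulr_ge0// exprn_ge0// ?enorm_ge0// ltW.
- by mfun.
rewrite [RHS]ge0_integral_rV_neq0//; first last.
- move=> w; rewrite mule_ge0//; apply: integral_ge0 => r _; rewrite mule_ge0// lee_fin.
  by case: ltP => r0; rewrite ?mulr0// !mulr_ge0// exprn_ge0// ltW.
- apply: emeasurable_funM; first by mfun.
  apply: (measurable_fun_fubini_tonelli_F (fun p : T * measurableTypeR R =>
    (n%:R * p.2 ^+ n.-1 * (0 < p.2)%R%:R)%:E * H (p.2 *: dir p.1)%R)).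
  - by mfun.
  - move=> p; rewrite mule_ge0// lee_fin.
    by case: ltP => r0; rewrite ?mulr0// !mulr_ge0// exprn_ge0// ltW.
apply: eq_integral => w _ /=; have [->|w0] := eqVneq w 0%R.
  by rewrite mule0 integral0_eq// => r _; rewrite !mul0e.
have ew : (0 < enorm w)%R by rewrite enorm_gt0.
rewrite mule1; under eq_integral do rewrite mul1e.
rewrite ge0_integralZl//; last 2 first.
- by mfun.
- move=> r _; rewrite mule_ge0// lee_fin.
  by case: ltP => r0; rewrite ?mulr0// !mulr_ge0// exprn_ge0// ?enorm_ge0// ltW.
congr (_ * _).
have := @ge0_integral_scale R (enorm w)
  (fun r => (n%:R * r ^+ n.-1 * (0 < r)%R%:R)%:E * H (r *: dir w)%R) ew.
move=> /(_ _ _)/(congr1 (fun z => (enorm w)%:E * z)).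
rewrite muleA -EFinM mulfV ?gt_eqF// mul1e => <-; last 2 first.
- by mfun.
- move=> r; rewrite mule_ge0// lee_fin.
  by case: ltP => r0; rewrite ?mulr0// !mulr_ge0// exprn_ge0// ltW.
rewrite -ge0_integralZl//; last 3 first.
- by mfun.
- move=> r _; rewrite mule_ge0// lee_fin.
  case: ltP => r0; rewrite ?mulr0// !mulr_ge0// exprn_ge0//.
  by rewrite mulr_ge0 ?enorm_ge0//; rewrite pmulr_rgt0// in r0; rewrite ltW.
- by rewrite lee_fin enorm_ge0.
apply: eq_integral => r _.
have -> : ((enorm w * r) *: dir w = r *: w)%R.
  by rewrite /dir scalerA; congr (_ *: _)%R; field; rewrite gt_eqF.
rewrite muleA pmulr_rgt0//; congr (_ * H _).
have eS : (enorm w ^+ n = enorm w * enorm w ^+ n.-1)%R by rewrite -exprS prednK.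
by rewrite -EFinM; congr EFin; rewrite exprMn eS; ring.
Qed.
End polar.
(** The integral of a nonnegative function is a supremum over the simple functions below it, so
    monotonicity is an inclusion of index sets. This lets functions such as uncountable suprema be
    compared with measurable majorants. *)
Lemma ge0_le_integral_nomeas d (X : measurableType d) (R : realType)
    (mu : {measure set X -> \bar R}) (D : set X) (f g : X -> \bar R) :
  (forall x, D x -> 0 <= f x)%E -> (forall x, D x -> f x <= g x)%E ->
  (\int[mu]_(x in D) f x <= \int[mu]_(x in D) g x)%E.
Proof.
move=> f0 fg; rewrite integral_mkcond [leRHS]integral_mkcond.
have fg' x : ((f \_ D) x <= (g \_ D) x)%E.
  by rewrite !patchE; case: ifPn => //; rewrite inE; exact: fg.
have f0' x : (0 <= (f \_ D) x)%E by apply: erestrict_ge0.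
have g0' x : (0 <= (g \_ D) x)%E by apply: le_trans (fg' x).
rewrite !ge0_integralTE//; apply: le_ereal_sup => _ [h hf <-]; exists h => // x.
exact: le_trans (hf x) (fg' x).
Qed.

(** * Layer-cake formula and real interpolation *)

Section real_interpolation.
Local Open Scope ereal_scope.
Context {R : realType} d (X : measurableType d) (mu : {sigma_finite_measure set X -> \bar R}).
Notation leb := (@lebesgue_measure R).
Implicit Types (F : X -> \bar R) (f : X -> R) (q A B c : R).

Lemma integral_powR_below q y : (0 < q)%R -> (0 <= y)%R ->
  \int[leb]_a ((q * a `^ (q - 1) * ((0 < a)%R && (a <= y)%R)%:R)%:E) = (y `^ q)%:E.
Proof.
move=> q0; rewrite le_eqVlt => /predU1P[<-|y0].
  rewrite powR0 ?gt_eqF// integral0_eq// => a _.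
  by case: ltP => //= a0; rewrite ?mulr0//= leNgt a0 mulr0.
rewrite -integral_powR_zero// [RHS]integral_mkcond; apply: eq_integral => a _.
rewrite patchE; case: ifPn => [|/negP]; rewrite inE/= in_itv/= => ay.
  by rewrite ay mulr1.
by case: andP ay => // _ _; rewrite mulr0.
Qed.

Lemma integral_powR_below_lt q y : (0 < q)%R -> (0 <= y)%R ->
  \int[leb]_a ((q * a `^ (q - 1) * ((0 < a)%R && (a < y)%R)%:R)%:E) = (y `^ q)%:E.
Proof.
move=> q0 y0; rewrite -(integral_powR_below q0 y0).
apply: ge0_ae_eq_integral => //.
- by apply/measurable_EFinP; mfun.
- by apply/measurable_EFinP; mfun.
- by move=> a _; rewrite lee_fin mulr_ge0// mulr_ge0 ?powR_ge0// ltW.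
- by move=> a _; rewrite lee_fin mulr_ge0// mulr_ge0 ?powR_ge0// ltW.
- exists [set y]; split => //; first exact: lebesgue_measure_set1.
  move=> a /=; apply: contra_notP => /eqP ay _; congr EFin; congr (_ * _%:R)%R.
  by rewrite [(a <= y)%R]le_eqVlt; case: eqVneq => // E; case/eqP: ay.
Qed.

Lemma integral_powR_above q y : (0 < q)%R -> (0 < y)%R ->
  \int[leb]_a ((q * a `^ (- q - 1) * (y <= a)%R%:R)%:E) = (y `^ (- q))%:E.
Proof.
move=> q0 y0.
rewrite -integral_powR_infty// [RHS]integral_mkcond; apply: eq_integral => a _.
rewrite patchE; case: ifPn => [|/negP]; rewrite inE/= in_itv/= andbT => ay.
  by rewrite ay mulr1.
by have /negbTE -> : ~~ (y <= a)%R; [exact/negP|rewrite mulr0].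
Qed.

Lemma poweR_layer (y : \bar R) q : (0 < q)%R -> 0 <= y ->
  y `^ q = \int[leb]_a ((q * a `^ (q - 1) * (0 < a)%R%:R)%:E * (a%:E < y)%E%:R%:E).
Proof.
move=> q0; case: y => [y||//] y0.
  rewrite poweR_EFin -integral_powR_below_lt//; apply: eq_integral => a _.
  by rewrite lte_fin -EFinM -!mulrA -natrM mulnb.
(* At y = +oo the right-hand side must exceed every M: restricting the layers to heights below
   M^(1/q) already gives M. *)
rewrite poweRyr ?gt_eqF//; apply/esym/eqyP => M M0.
rewrite (_ : M = (M `^ q^-1) `^ q)%R; last first.
  by rewrite -powRrM mulVf ?gt_eqF// powRr1// ltW.
rewrite -integral_powR_below_lt ?powR_ge0//.
apply: ge0_le_integral_nomeas => a _.
  by rewrite lee_fin mulr_ge0// mulr_ge0 ?powR_ge0// ltW.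
rewrite ltry mule1 lee_fin ler_wpM2l ?mulr_ge0 ?powR_ge0//; first exact: ltW.
by case: (0 < a)%R => //=; case: (a < _)%R.
Qed.

Lemma layer_cake F q : (0 < q)%R -> measurable_fun setT F -> (forall x, 0 <= F x) ->
  \int[mu]_x (F x `^ q) =
  \int[leb]_a ((q * a `^ (q - 1) * (0 < a)%R%:R)%:E * mu [set x | a%:E < F x]).
Proof.
move=> q0 mF F0.
transitivity (\int[mu]_x \int[leb]_a
   ((q * a `^ (q - 1) * (0 < a)%R%:R)%:E * (a%:E < F x)%E%:R%:E)).
  by apply: eq_integral => x _; exact: poweR_layer.
have mlt : measurable_fun [set: X * measurableTypeR R]
    (fun p : X * measurableTypeR R => (p.2%:E < F p.1)).
  by apply: measurable_fun_lte; mfun.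
rewrite (fubini_tonelli (fun p : X * measurableTypeR R =>
   (q * p.2 `^ (q - 1) * (0 < p.2)%R%:R)%:E * (p.2%:E < F p.1)%E%:R%:E)); first last.
- by move=> p; rewrite mule_ge0// lee_fin mulr_ge0// mulr_ge0 ?powR_ge0// ltW.
- by mfun.
apply: eq_integral => a _ /=; rewrite ge0_integralZl//; first last.
- by rewrite lee_fin mulr_ge0// mulr_ge0 ?powR_ge0// ltW.
- by mfun.
congr (_ * _).
have mS : measurable [set x | a%:E < F x].
  by rewrite -[X in measurable X]setTI; exact: emeasurable_fun_o_infty.
rewrite -[X in _ = _ X]setIT -integral_indic//; apply: eq_integral => x _.
by rewrite indicE; congr (_%:R)%:E; congr nat_of_bool; apply/idP/idP; rewrite inE.
Qed.

(** After Tonelli the inner integral is that of a^(q-2) over 0 < a < f x / c, which converges at 0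
    because q > 1 and is a multiple of (f x)^(q-1). *)
Lemma weak_type_upper f q A c : (1 < q)%R -> (0 <= A)%R -> (0 < c)%R ->
  measurable_fun setT f -> (forall x, 0 <= f x)%R ->
  \int[leb]_a ((q * a `^ (q - 1) * (0 < a)%R%:R)%:E *
     ((A / a)%:E * \int[mu]_x (f x * (c * a < f x)%R%:R)%:E)) =
  (q * A * c `^ (1 - q) / (q - 1))%:E * \int[mu]_x (f x `^ q)%:E.
Proof.
move=> q1 A0 c0 mf f0; have q0 : (0 < q)%R by exact: lt_trans q1.
have mfq : measurable_fun setT (fun x => f x `^ q)%R.
  by apply: (measurableT_comp (@measurable_powR R q)).
have w0 a : (0 <= q * a `^ (q - 1) * (0 < a)%R%:R * (A / a))%R.
  case: ltP => a0; rewrite ?mulr0 ?mul0r//=.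
  by rewrite mulr1 mulr_ge0 ?divr_ge0 ?mulr_ge0 ?powR_ge0 ?(ltW a0)// ltW.
have k0 x a : (0 <= f x * (c * a < f x)%R%:R)%R by rewrite mulr_ge0.
transitivity (\int[leb]_a \int[mu]_x (q * a `^ (q - 1) * (0 < a)%R%:R * (A / a) *
    (f x * (c * a < f x)%R%:R))%:E).
  apply: eq_integral => a _; rewrite muleA -EFinM -ge0_integralZl//.
  - by apply/measurable_EFinP; mfun.
  - by move=> x _; rewrite lee_fin.
  - by rewrite lee_fin.
rewrite -(fubini_tonelli (fun p : X * measurableTypeR R =>
  (q * p.2 `^ (q - 1) * (0 < p.2)%R%:R * (A / p.2) * (f p.1 * (c * p.2 < f p.1)%R%:R))%:E));
  first last.
- by move=> p; rewrite lee_fin mulr_ge0.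
- by mfun.
rewrite -ge0_integralZl//; first last.
- by rewrite lee_fin divr_ge0// ?mulr_ge0 ?powR_ge0// ?(ltW q0)// subr_ge0 ltW.
- by move=> x _; rewrite lee_fin powR_ge0.
- exact/measurable_EFinP.
apply: eq_integral => x _ /=.
have [fx0|fx0] := ltP 0%R (f x); last first.
  have fxe : f x = 0%R by apply/eqP; rewrite eq_le fx0 f0.
  by rewrite fxe powR0 ?gt_eqF// mule0 integral0_eq// => a _; rewrite mul0r mulr0.
have q10 : (0 < q - 1)%R by rewrite subr_gt0.
transitivity ((q * A * f x / (q - 1))%:E * \int[leb]_a
   (((q - 1) * a `^ (q - 1 - 1) * ((0 < a)%R && (a < f x / c)%R)%:R)%:E)).
  rewrite -ge0_integralZl//; first last.
  - by rewrite lee_fin divr_ge0// ?mulr_ge0// ?(ltW q0)// ltW.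
  - by move=> a _; rewrite lee_fin mulr_ge0// mulr_ge0 ?powR_ge0// ltW.
  - by apply/measurable_EFinP; mfun.
  apply: eq_integral => a _; rewrite -EFinM; congr EFin.
  rewrite (ltr_pdivlMr _ _ c0) (mulrC a c).
  have [a0|a0] := ltP 0%R a; last by rewrite /= !(mulr0, mul0r).
  have -> : (a `^ (q - 1) = a `^ (q - 1 - 1) * a)%R.
    rewrite -[X in (_ * X)%R](powRr1 (ltW a0)) -powRD ?subrK//.
    by apply/implyP => _; rewrite gt_eqF.
  by rewrite /=; field; rewrite !gt_eqF.
rewrite integral_powR_below_lt//; last by rewrite divr_ge0// ltW.
rewrite -!EFinM; congr EFin.
have -> : (f x `^ q = f x `^ (q - 1) * f x)%R.
  rewrite -[X in (_ * X)%R](powRr1 (ltW fx0)) -powRD ?subrK//.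
  by apply/implyP => _; rewrite gt_eqF.
rewrite powRM ?invr_ge0 ?(ltW fx0) ?(ltW c0)//.
rewrite -[in (c^-1)%R](powR_inv1 (ltW c0)) -powRrM.
by rewrite mulN1r opprB; field; rewrite gt_eqF.
Qed.

(** The counterpart for the low part of f: the inner integral is that of a^(q-3) over a >= f x / c,
    which converges at infinity because q < 2. *)
Lemma weak_type_lower f q B c : (0 < q < 2)%R -> (0 <= B)%R -> (0 < c)%R ->
  measurable_fun setT f -> (forall x, 0 <= f x)%R ->
  \int[leb]_a ((q * a `^ (q - 1) * (0 < a)%R%:R)%:E *
     ((B / a ^+ 2)%:E * \int[mu]_x (f x ^+ 2 * (f x <= c * a)%R%:R)%:E)) =
  (q * B * c `^ (2 - q) / (2 - q))%:E * \int[mu]_x (f x `^ q)%:E.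
Proof.
move=> /andP[q0 q2] B0 c0 mf f0.
have mfq : measurable_fun setT (fun x => f x `^ q)%R.
  by apply: (measurableT_comp (@measurable_powR R q)).
have w0 a : (0 <= q * a `^ (q - 1) * (0 < a)%R%:R * (B / a ^+ 2))%R.
  by rewrite mulr_ge0 ?divr_ge0 ?sqr_ge0// mulr_ge0// mulr_ge0 ?powR_ge0// ltW.
have k0 x a : (0 <= f x ^+ 2 * (f x <= c * a)%R%:R)%R by rewrite mulr_ge0// sqr_ge0.
transitivity (\int[leb]_a \int[mu]_x (q * a `^ (q - 1) * (0 < a)%R%:R * (B / a ^+ 2) *
    (f x ^+ 2 * (f x <= c * a)%R%:R))%:E).
  apply: eq_integral => a _; rewrite muleA -EFinM -ge0_integralZl//.
  - by apply/measurable_EFinP; mfun.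
  - by move=> x _; rewrite lee_fin.
  - by rewrite lee_fin.
rewrite -(fubini_tonelli (fun p : X * measurableTypeR R =>
  (q * p.2 `^ (q - 1) * (0 < p.2)%R%:R * (B / p.2 ^+ 2) *
   (f p.1 ^+ 2 * (f p.1 <= c * p.2)%R%:R))%:E)); first last.
- by move=> p; rewrite lee_fin mulr_ge0.
- by mfun.
have q20 : (0 < 2 - q)%R by rewrite subr_gt0.
rewrite -ge0_integralZl//; first last.
- by rewrite lee_fin divr_ge0// ?mulr_ge0 ?powR_ge0// ?(ltW q0)// ltW.
- by move=> x _; rewrite lee_fin powR_ge0.
- exact/measurable_EFinP.
apply: eq_integral => x _ /=.
have [fx0|fx0] := ltP 0%R (f x); last first.
  have fxe : f x = 0%R by apply/eqP; rewrite eq_le fx0 f0.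
  by rewrite fxe powR0 ?gt_eqF// mule0 integral0_eq// => a _; rewrite expr0n mul0r mulr0.
have fc0 : (0 < f x / c)%R by rewrite divr_gt0.
transitivity ((q * B * f x ^+ 2 / (2 - q))%:E * \int[leb]_a
   (((2 - q) * a `^ (- (2 - q) - 1) * (f x / c <= a)%R%:R)%:E)).
  rewrite -ge0_integralZl//; first last.
  - by rewrite lee_fin divr_ge0// ?mulr_ge0 ?sqr_ge0// ?(ltW q0)// ltW.
  - by move=> a _; rewrite lee_fin mulr_ge0// mulr_ge0 ?powR_ge0// ltW.
  - by apply/measurable_EFinP; mfun.
  apply: eq_integral => a _; rewrite -EFinM; congr EFin.
  rewrite (ler_pdivrMr _ _ c0) (mulrC a c).
  have [a0|a0] := ltP 0%R a; last first.
    have /negbTE -> : ~~ (f x <= c * a)%R.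
      by rewrite -ltNge (le_lt_trans _ fx0)// pmulr_rle0.
    by rewrite /= !(mulr0, mul0r).
  have -> : (a `^ (q - 1) = a `^ (- (2 - q) - 1) * a ^+ 2)%R.
    rewrite -(powR_mulrn 2 (ltW a0)) -powRD; first by congr (_ `^ _)%R; ring.
    by apply/implyP => _; rewrite gt_eqF.
  by rewrite /=; field; rewrite !gt_eqF.
rewrite integral_powR_above// -!EFinM; congr EFin.
have -> : (f x `^ q = f x `^ (- (2 - q)) * f x ^+ 2)%R.
  rewrite -(powR_mulrn 2 (ltW fx0)) -powRD; first by congr (_ `^ _)%R; ring.
  by apply/implyP => _; rewrite gt_eqF.
rewrite powRM ?invr_ge0 ?(ltW fx0) ?(ltW c0)//.
rewrite -[in (c^-1)%R](powR_inv1 (ltW c0)) -powRrM.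
by rewrite mulrN mulN1r opprK; field; rewrite gt_eqF.
Qed.

(** Interpolation between weak type (1,1) and boundedness on L^oo: the latter is encoded in the fact
    that only the part of f above c a enters at height a. *)
Lemma strong_type_of_weak F f q A c : (1 < q)%R -> (0 <= A)%R -> (0 < c)%R ->
  measurable_fun setT F -> (forall x, 0 <= F x) ->
  measurable_fun setT f -> (forall x, 0 <= f x)%R ->
  (forall a, (0 < a)%R -> mu [set x | a%:E < F x] <=
     (A / a)%:E * \int[mu]_x (f x * (c * a < f x)%R%:R)%:E) ->
  \int[mu]_x (F x `^ q) <=
  (q * A * c `^ (1 - q) / (q - 1))%:E * \int[mu]_x (f x `^ q)%:E.
Proof.
move=> q1 A0 c0 mF F0 mf f0 H; have q0 : (0 < q)%R by exact: lt_trans q1.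
rewrite layer_cake// -weak_type_upper//.
have w0 a : (0 <= q * a `^ (q - 1) * (0 < a)%R%:R)%R.
  by rewrite mulr_ge0// mulr_ge0 ?powR_ge0// ltW.
apply: ge0_le_integral_nomeas => a _; first by rewrite mule_ge0// lee_fin.
have [a0|a0] := ltP 0%R a; last by rewrite mulr0 !mul0e.
by apply: lee_wpmul2l; [rewrite lee_fin mulr_ge0// mulr_ge0 ?powR_ge0// ltW|exact: H].
Qed.

(* Marcinkiewicz interpolation between weak type (1,1) and strong type (2,2):
   the two terms come from the parts of f above and below the height c a. *)
Lemma strong_type_interpolation F f q A B c : (1 < q < 2)%R -> (0 <= A)%R ->
  (0 <= B)%R -> (0 < c)%R ->
  measurable_fun setT F -> (forall x, 0 <= F x) ->
  measurable_fun setT f -> (forall x, 0 <= f x)%R ->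
  (forall a, (0 < a)%R -> mu [set x | a%:E < F x] <=
     (A / a)%:E * \int[mu]_x (f x * (c * a < f x)%R%:R)%:E +
     (B / a ^+ 2)%:E * \int[mu]_x (f x ^+ 2 * (f x <= c * a)%R%:R)%:E) ->
  \int[mu]_x (F x `^ q) <=
  (q * A * c `^ (1 - q) / (q - 1) + q * B * c `^ (2 - q) / (2 - q))%:E *
  \int[mu]_x (f x `^ q)%:E.
Proof.
move=> /andP[q1 q2] A0 B0 c0 mF F0 mf f0 H; have q0 : (0 < q)%R by exact: lt_trans q1.
have w0 a : (0 <= q * a `^ (q - 1) * (0 < a)%R%:R)%R.
  by rewrite mulr_ge0// mulr_ge0 ?powR_ge0// ltW.
have m2 : measurable_fun setT
    (fun a : R => \int[mu]_x (f x * (c * a < f x)%R%:R)%:E).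
  apply: (measurable_fun_fubini_tonelli_G (fun p : X * measurableTypeR R =>
    (f p.1 * (c * p.2 < f p.1)%R%:R)%:E)); first by mfun.
  by move=> p; rewrite lee_fin mulr_ge0.
have m3 : measurable_fun setT
    (fun a : R => \int[mu]_x (f x ^+ 2 * (f x <= c * a)%R%:R)%:E).
  apply: (measurable_fun_fubini_tonelli_G (fun p : X * measurableTypeR R =>
    (f p.1 ^+ 2 * (f p.1 <= c * p.2)%R%:R)%:E)); first by mfun.
  by move=> p; rewrite lee_fin mulr_ge0// sqr_ge0.
have i2 a : 0 <= \int[mu]_x (f x * (c * a < f x)%R%:R)%:E.
  by apply: integral_ge0 => x _; rewrite lee_fin mulr_ge0.
have i3 a : 0 <= \int[mu]_x (f x ^+ 2 * (f x <= c * a)%R%:R)%:E.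
  by apply: integral_ge0 => x _; rewrite lee_fin mulr_ge0// sqr_ge0.
rewrite EFinD ge0_muleDl; last 2 first.
- by rewrite lee_fin divr_ge0 ?mulr_ge0 ?powR_ge0 ?(ltW q0)// subr_ge0 ltW.
- by rewrite lee_fin divr_ge0 ?mulr_ge0 ?powR_ge0 ?(ltW q0)// subr_ge0 ltW.
rewrite layer_cake// -weak_type_upper// -weak_type_lower ?q0//.
rewrite -ge0_integralD//; first last.
- by mfun.
- move=> a _; have [a0|a0] := ltP 0%R a; last by rewrite mulr0 !mul0e.
  by rewrite !mule_ge0// lee_fin ?divr_ge0 ?sqr_ge0// !mulr_ge0 ?powR_ge0// ltW.
- by mfun.
- move=> a _; have [a0|a0] := ltP 0%R a; last by rewrite mulr0 !mul0e.
  by rewrite !mule_ge0// lee_fin ?divr_ge0 ?(ltW a0)// !mulr_ge0 ?powR_ge0// ltW.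
apply: ge0_le_integral_nomeas => a _; first by rewrite mule_ge0// lee_fin.
have [a0|a0] := ltP 0%R a; last by rewrite mulr0 !mul0e adde0.
rewrite -ge0_muleDr.
- by apply: lee_wpmul2l; [rewrite lee_fin !mulr_ge0 ?powR_ge0// ltW|exact: H].
- by rewrite mule_ge0// lee_fin divr_ge0// ltW.
- by rewrite mule_ge0// lee_fin divr_ge0 ?sqr_ge0.
Qed.

End real_interpolation.

(** * Hardy-Littlewood maximal function *)

Section countable_sup.
Local Open Scope ereal_scope.
Context {R : realType} d (X : measurableType d) (I : countType).

Lemma measurable_fun_countable_sup (i0 : I) (h : I -> X -> \bar R) :
  (forall i, measurable_fun setT (h i)) ->
  measurable_fun setT (fun x => ereal_sup (range (h ^~ x))).
Proof.
(* A code of no element falls back to [i0], which only repeats a member of the family. *)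
move=> mh; pose e k := odflt i0 (unpickle k : option I).
have mhe : forall k, measurable_fun setT (h (e k)) by move=> k; exact: mh.
rewrite (_ : (fun x => _) = fun x => esups (fun k => h (e k) x) 0%N).
  exact: (measurable_fun_esups mhe 0%N).
apply/funext => x; congr ereal_sup; apply/seteqP; split => y /=.
  by move=> [i _ <-]; exists (pickle i) => //=; rewrite /e pickleK.
by move=> [k _ <-]; exists (e k).
Qed.

End countable_sup.

Section vitali.
Context {R : realType} (n : nat) (I : eqType) (q : I -> 'rV[R]_n) (rho : I -> R).
Hypothesis rho_ge0 : forall i, 0 <= rho i.

(** Greedy selection: keep a largest cube, discard those that meet it, and recurse. Every discarded
    cube meets a kept one at least as large, hence lies in its threefold dilate. *)
Lemma vitali_cubes (s : seq I) : exists t : seq I,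
  [/\ {subset t <= s}, pairwise (fun i j => rho i + rho j < `|q i - q j|) t &
      forall i, i \in s -> exists j, [/\ j \in t, rho i <= rho j &
        `|q i - q j| <= rho i + rho j]].
Proof.
have [m] := ubnP (size s); elim: m => // m IH in s * => sm.
have [->|[i0 i0s]] : s = [::] \/ exists i, i \in s.
- by case: s {sm} => [|i s]; [left|right; exists i; rewrite mem_head].
- by exists [::].
have [i1 i1s i1max] : exists2 i1, i1 \in s & forall i, i \in s -> rho i <= rho i1.
  elim: s i0 i0s {sm} => // i s IHs _ _.
  case: s IHs => [_|j s IHs].
    by exists i; rewrite ?mem_head// => k; rewrite mem_seq1 => /eqP->.
  have [k ks kmax] := IHs _ (mem_head _ _).
  have [ik|ki] := leP (rho i) (rho k).
    exists k; first by rewrite inE ks orbT.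
    by move=> l; rewrite inE => /predU1P[->//|/kmax].
  exists i; first by rewrite mem_head.
  move=> l; rewrite inE => /predU1P[->//|/kmax] /le_trans; apply; exact: ltW.
pose s' := [seq i <- s | rho i1 + rho i < `|q i1 - q i|].
have [|t [ts pt tmax]] := IH s'.
  (* The list shrinks since [i1] itself is filtered out: its distance to itself is 0. *)
  rewrite -ltnS (leq_trans _ sm)// ltnS size_filter.
  rewrite -(count_predC (fun i => rho i1 + rho i < `|q i1 - q i|) s) -addn1 leq_add2l.
  rewrite -has_count; apply/hasP; exists i1 => //=.
  by rewrite subrr normr0 -leNgt addr_ge0.
exists (i1 :: t); split.
- by move=> i; rewrite inE => /predU1P[->//|/ts]; rewrite mem_filter => /andP[].
- rewrite /= pt andbT; apply/allP => i /ts; rewrite mem_filter => /andP[].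
  by [].
- move=> i iS; have [H|H] := ltP (rho i1 + rho i) `|q i1 - q i|.
    have [|j [jt ij qij]] := tmax i; first by rewrite mem_filter H.
    by exists j; split => //; rewrite inE jt orbT.
  by exists i1; split; [exact: mem_head|exact: i1max|rewrite distrC [leRHS]addrC].
Qed.

Lemma pairwise_cubes_le1 (t : seq I) (x : 'rV[R]_n) :
  pairwise (fun i j => rho i + rho j < `|q i - q j|) t ->
  (\sum_(i <- t) (`|q i - x| <= rho i)%R%:R <= 1 :> R).
Proof.
elim: t => [|i t IH] /=; first by rewrite big_nil.
move=> /andP[/allP it pt]; rewrite big_cons.
have [ix|ix] := leP `|q i - x| (rho i); last by rewrite add0r; exact: IH.
rewrite big_seq big1 ?addr0// => j jt; have := it _ jt.
have [jx|//] := leP `|q j - x| (rho j).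
rewrite ltNge (le_trans (ler_distD x _ _))// lerD//.
by rewrite distrC.
Qed.

End vitali.

Section hardy_littlewood.
Local Open Scope ereal_scope.
Context {R : realType} (n : nat).
Notation T := 'rV[R]_n.
Notation lam := (@lebesgue_rV R n).
Implicit Types (f : T -> R).

Definition cube_integral f (r : R) (x : T) : \bar R :=
  \int[lam]_y (f y * (`|x - y| <= r)%R%:R)%:E.

(** Only dyadic half-sides are used: the supremum is then countable, hence measurable, and an
    arbitrary radius is compared with a neighbouring power of 2 at the cost of a constant. *)
Definition HL f (x : T) : \bar R :=
  ereal_sup (range (fun j : int => ((2 * 2 ^ j) ^- n)%:E * cube_integral f (2 ^ j)%R x)).

Lemma expz2_gt0 (j : int) : (0 < 2 ^ j :> R)%R.
Proof. by rewrite exprz_gt0. Qed.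

Lemma cube_integral_ge0 f r x : (forall y, 0 <= f y)%R -> 0 <= cube_integral f r x.
Proof. by move=> f0; apply: integral_ge0 => y _; rewrite lee_fin mulr_ge0. Qed.

Lemma measurable_cube_integral f r : measurable_fun setT f -> (forall y, 0 <= f y)%R ->
  measurable_fun setT (cube_integral f r).
Proof.
move=> mf f0; apply: (measurable_fun_fubini_tonelli_F (fun p : T * T =>
  (f p.2 * (`|p.1 - p.2| <= r)%R%:R)%:E)).
  by mfun.
by move=> p; rewrite lee_fin mulr_ge0.
Qed.

Lemma measurable_HL f : measurable_fun setT f -> (forall y, 0 <= f y)%R ->
  measurable_fun setT (HL f).
Proof.
move=> mf f0; apply: (@measurable_fun_countable_sup _ _ _ _ 0%R
  (fun (j : int) x => ((2 * 2 ^ j) ^- n)%:E * cube_integral f (2 ^ j)%R x)) => j.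
have mc := measurable_cube_integral (2 ^ j)%R mf f0.
by mfun.
Qed.

Lemma cube_integral_le_HL f (j : int) x :
  cube_integral f (2 ^ j)%R x <= ((2 * 2 ^ j) ^+ n)%:E * HL f x.
Proof.
have c0 : (0 < (2 * 2 ^ j : R) ^+ n)%R by rewrite exprn_gt0// mulr_gt0// expz2_gt0.
rewrite muleC -lee_pdivrMr// muleC; apply: ereal_sup_ubound.
by exists j.
Qed.

Lemma HL_ge0 f x : (forall y, 0 <= f y)%R -> 0 <= HL f x.
Proof.
move=> f0; apply: le_trans (ereal_sup_ubound _); last by exists 0%R.
by rewrite mule_ge0 ?cube_integral_ge0// lee_fin invr_ge0 exprn_ge0// mulr_ge0.
Qed.

Lemma lebesgue_cube_center (c : T) (r : R) : (0 <= r)%R ->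
  lam [set x | (`|c - x| <= r)%R] = ((2 * r) ^+ n)%:E.
Proof.
move=> r0; have m1 : measurable [set x : T | (`|c - x| <= r)%R].
  rewrite (_ : [set x | _] = (fun x => (`|c - x|)%R) @^-1` `]-oo, r]).
    have mc : measurable_fun setT (fun x : T => `|c - x|)%R by mfun.
    by rewrite -[X in measurable X]setTI; exact: mc.
  by apply/seteqP; split => x /=; rewrite in_itv.
rewrite -measure_integral_indic// -(lebesgue_cube n r0).
rewrite -[RHS](measure_integral_indic (@measurable_cube R n r)).
rewrite -[LHS](@ge0_integral_rV_translation _ _ c)//.
  apply: eq_integral => x _; rewrite !indicE; congr (_%:R)%:E; congr nat_of_bool.
  by apply/idP/idP; rewrite !inE /cube/= opprD addrCA subrr addr0 normrN.
by apply/measurable_EFinP; apply: measurable_indic.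
Qed.

(** The level set is covered by countably many cubes with centres on dyadic grids. Finite
    subfamilies are thinned by [vitali_cubes]; tripling a half-side rho gives the volume (6 rho)^n,
    whence 6^n. The countable union is reached by continuity from below. *)
Lemma HL_weak_type f (a : R) : (0 < a)%R -> measurable_fun setT f ->
  (forall y, 0 <= f y)%R ->
  lam [set x | a%:E < HL f x] <= (6 ^+ n / a)%:E * \int[lam]_x (f x)%:E.
Proof.
move=> a0 mf f0.
pose I := (int * 'rV[int]_n)%type.
pose q (i : I) : T := (\row_k (2 ^ i.1 * (i.2 ord0 k)%:~R))%R.
pose rho (i : I) : R := (2 * 2 ^ i.1)%R.
have rho0 i : (0 < rho i)%R by rewrite mulr_gt0// expz2_gt0.
pose good (i : I) := (a * rho i ^+ n)%:E < cube_integral f (rho i) (q i).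
pose D (i : I) := [set x | (`|q i - x| <= rho i)%R].
have mD (i : I) r : measurable [set x : T | (`|q i - x| <= r)%R].
  rewrite (_ : [set x | _] = (fun x => (`|q i - x|)%R) @^-1` `]-oo, r]).
    have mc : measurable_fun setT (fun x : T => `|q i - x|)%R by mfun.
    by rewrite -[X in measurable X]setTI; exact: mc.
  by apply/seteqP; split => x /=; rewrite in_itv.
have fin (s : seq I) : all good s ->
    lam (\big[setU/set0]_(i <- s) D i) <= (6 ^+ n / a)%:E * \int[lam]_x (f x)%:E.
  move=> /allP gs; have [t [ts pt tmax]] := vitali_cubes q (fun i => ltW (rho0 i)) s.
  pose D3 (i : I) := [set x | (`|q i - x| <= 3 * rho i)%R].
  have mbig (u : seq I) (G : I -> set T) : (forall i, measurable (G i)) ->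
      measurable (\big[setU/set0]_(i <- u) G i).
    by move=> mG; apply: bigsetU_measurable.
  apply: (@le_trans _ _ (lam (\big[setU/set0]_(i <- t) D3 i))).
    apply: le_measure; rewrite ?inE; [by apply: mbig => i; exact: mD|by apply: mbig => i; exact: mD|].
    rewrite -!bigcup_seq => x [i /= iS Dix]; have [j [jt ij qij]] := tmax _ iS.
    exists j => //; rewrite /D3/= (le_trans (ler_distD (q i) _ _))//.
    rewrite distrC (le_trans (lerD qij Dix))//.
    by rewrite (_ : 3 = 1 + 1 + 1)%R ?mulrDl ?mul1r ?lerD//; ring.
  apply: (@le_trans _ _ (\sum_(i <- t) lam (D3 i))).
    elim: (t) => [|i u IH]; first by rewrite !big_nil measure0.
    rewrite !big_cons (le_trans (measureU2 _ _ _))//; [exact: mD|by apply: mbig => k; exact: mD|].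
    by rewrite leeD2l.
  apply: (@le_trans _ _ (\sum_(i <- t) (6 ^+ n / a)%:E * cube_integral f (rho i) (q i))).
    rewrite big_seq [leRHS]big_seq; apply: lee_sum => i /ts /gs gi.
    rewrite [leLHS]lebesgue_cube_center; last by rewrite mulr_ge0// ltW.
    apply: (@le_trans _ _ ((6 ^+ n / a)%:E * (a * rho i ^+ n)%:E)).
      have -> : (2 * (3 * rho i) = 6 * rho i)%R by ring.
      rewrite -EFinM lee_fin exprMn.
      have -> // : (6 ^+ n / a * (a * rho i ^+ n) = 6 ^+ n * rho i ^+ n)%R.
      by field; rewrite gt_eqF.
    by rewrite lee_wpmul2l ?(ltW gi)// lee_fin divr_ge0 ?exprn_ge0// ltW.
  rewrite -ge0_sume_distrr; last by move=> i _; exact: cube_integral_ge0.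
  rewrite lee_wpmul2l ?lee_fin ?divr_ge0 ?exprn_ge0 ?(ltW a0)//.
  rewrite /cube_integral -ge0_integral_sum//; first last.
  - by move=> i x _; rewrite lee_fin mulr_ge0.
  - by move=> i; mfun.
  apply: ge0_le_integral_nomeas => x _.
    by rewrite sume_ge0// => i _; rewrite lee_fin mulr_ge0.
  rewrite sumEFin lee_fin -mulr_sumr ler_piMr//.
  exact: (pairwise_cubes_le1 _ pt).
pose e (k : nat) : option I := unpickle k.
pose s k := pmap e (iota 0 k).
pose G k := \big[setU/set0]_(i <- [seq i <- s k | good i]) D i.
have mG k : measurable (G k).
  by apply: bigsetU_measurable => i _; exact: mD.
have sub : [set x | a%:E < HL f x] `<=` \bigcup_k G k.
  move=> x /= /ereal_sup_gt[_ [j _ <-]] Hj.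
  (* Rounding the centre moves it by at most 2^j, so doubling the half-side keeps the old cube
     inside the new one. The doubling costs nothing in [good], since the average was normalised by
     (2 * 2^j)^n = rho^n. *)
  pose c : 'rV[int]_n := \row_k Num.floor (x ord0 k / 2 ^ j).
  pose i : I := (j, c).
  have xq : (`|q i - x| <= 2 ^ j)%R.
    apply/rVnorm_leP => [|k]; first exact/ltW/expz2_gt0.
    rewrite !mxE/= distrC; have j0 := expz2_gt0 j; set y := x ord0 k.
    have -> : (y - 2 ^ j * (Num.floor (y / 2 ^ j))%:~R =
       2 ^ j * (y / 2 ^ j - (Num.floor (y / 2 ^ j))%:~R))%R.
      by field; rewrite gt_eqF.
    rewrite normrM gtr0_norm// ger_pMr// ger0_norm ?subr_ge0 ?floor_le_tmp// lerBlDr.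
    by have := lt_succ_floor (y / 2 ^ j); rewrite intrD addrC => /ltW.
  have gi : good i.
    rewrite /good.
    have : (a * rho i ^+ n)%:E < cube_integral f (2 ^ j)%R x.
      move: Hj; rewrite /rho/= [in X in X -> _]muleC lte_pdivlMr//.
      by rewrite exprn_gt0// mulr_gt0// expz2_gt0.
    move=> /lt_le_trans; apply; apply: ge0_le_integral_nomeas => y _.
      by rewrite lee_fin mulr_ge0.
    rewrite lee_fin ler_wpM2l//; have [xy|//] := leP `|x - y|%R (2 ^ j)%R.
    have -> // : (`|q i - y| <= rho i)%R.
    rewrite (le_trans (ler_distD x _ _))//.
    have -> : (rho i = 2 ^ j + 2 ^ j)%R by rewrite /rho/=; ring.
    by rewrite lerD.
  exists (pickle i).+1 => //; rewrite /G -bigcup_seq; exists i => /=.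
    rewrite mem_filter; apply/andP; split; first exact: gi.
    rewrite mem_pmap; apply/mapP; exists (pickle i); last by rewrite /e pickleK.
    by rewrite mem_iota add0n ltnS leqnn.
  rewrite /D/= (le_trans xq)// /rho/= ler_peMl ?ler1n//; exact/ltW/expz2_gt0.
have mE : measurable [set x | a%:E < HL f x].
  have mH := measurable_HL mf f0.
  by rewrite -[X in measurable X]setTI; exact: emeasurable_fun_o_infty.
have mUG : measurable (\bigcup_k G k) by exact: bigcupT_measurable.
apply: (@le_trans _ _ (lam (\bigcup_k G k))).
  by apply: le_measure; rewrite ?inE.
have ndG : nondecreasing_seq G.
  apply/nondecreasing_seqP => k; rewrite subsetEset /G -!bigcup_seq => x [i /= + Dix].
  rewrite mem_filter => /andP[gi ik]; exists i => //=.
  rewrite mem_filter gi/=; move: ik; rewrite /s !mem_pmap => /mapP[l].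
  rewrite mem_iota add0n leq0n => lk el; apply/mapP; exists l; last exact: el.
  by rewrite mem_iota add0n leq0n ltnS ltnW.
have cvg_lamG : lam (G k) @[k --> \oo] --> lam (\bigcup_k G k).
  exact: nondecreasing_cvg_mu.
rewrite -(cvg_lim _ cvg_lamG)//.
apply: lime_le; first by apply/cvg_ex; eexists; exact: cvg_lamG.
apply: nearW => k /=; apply: fin; apply/allP => i; rewrite mem_filter => /andP[].
by [].
Qed.

(** The values of f that are at most a/2 contribute at most a/2 to any average, so the part above
    a/2 must have an average exceeding a/2. *)
Lemma HL_weak_type_truncated f (a : R) : (0 < a)%R -> measurable_fun setT f ->
  (forall y, 0 <= f y)%R ->
  lam [set x | a%:E < HL f x] <=
  (2 * 6 ^+ n / a)%:E * \int[lam]_x (f x * (2^-1 * a < f x)%R%:R)%:E.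
Proof.
move=> a0 mf f0; pose f1 x := (f x * (2^-1 * a < f x)%R%:R)%R.
have mf1 : measurable_fun setT f1 by rewrite /f1; mfun.
have f10 y : (0 <= f1 y)%R by rewrite mulr_ge0.
have a20 : (0 < 2^-1 * a)%R by rewrite mulr_gt0.
have -> : (2 * 6 ^+ n / a = 6 ^+ n / (2^-1 * a) :> R)%R by field; rewrite gt_eqF.
apply: le_trans (HL_weak_type a20 mf1 f10).
have mE (g : T -> R) (b : R) : measurable_fun setT g -> (forall y, 0 <= g y)%R ->
    measurable [set x | b%:E < HL g x].
  move=> mg g0; have mH := measurable_HL mg g0.
  by rewrite -[X in measurable X]setTI; exact: emeasurable_fun_o_infty.
apply: le_measure; rewrite ?inE; [exact: mE|exact: mE|].
move=> x /= /ereal_sup_gt[_ [j _ <-]] Hj.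
apply: lt_le_trans (ereal_sup_ubound _); last by exists j.
have c0 : (0 < (2 * 2 ^ j : R) ^+ n)%R by rewrite exprn_gt0// mulr_gt0// expz2_gt0.
move: Hj; rewrite muleC lte_pdivlMr// [in X in _ -> X]muleC lte_pdivlMr// => Hj.
set c := ((2 * 2 ^ j) ^+ n)%R in c0 Hj *.
have H1 : cube_integral f (2 ^ j)%R x <=
    cube_integral f1 (2 ^ j)%R x + (2^-1 * a * c)%:E.
  rewrite /c EFinM -(lebesgue_cube_center x (ltW (expz2_gt0 j))).
  have -> : lam [set y | (`|x - y| <= 2 ^ j)%R] =
      \int[lam]_y ((`|x - y| <= 2 ^ j)%R%:R)%:E.
    rewrite -measure_integral_indic.
      apply: eq_integral => y _; rewrite indicE; congr (_%:R)%:E; congr nat_of_bool.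
      by apply/idP/idP; rewrite inE.
    have mc : measurable_fun setT (fun y : T => `|x - y|)%R by mfun.
    rewrite (_ : [set y | _] = (fun y => (`|x - y|)%R) @^-1` `]-oo, (2 ^ j)%R]).
      by rewrite -[X in measurable X]setTI; exact: mc.
    by apply/seteqP; split => y /=; rewrite in_itv.
  rewrite -ge0_integralZl//; first last.
  - by rewrite lee_fin ltW.
  - by mfun.
  rewrite /cube_integral -ge0_integralD//; first last.
  - by mfun.
  - by move=> y _; rewrite mule_ge0// lee_fin ltW.
  - by mfun.
  - by move=> y _; rewrite lee_fin mulr_ge0.
  apply: ge0_le_integral_nomeas => y _; first by rewrite lee_fin mulr_ge0.
  rewrite -EFinM -EFinD lee_fin -mulrDl ler_wpM2r// /f1.
  by have [h|h] := ltP (2^-1 * a)%R (f y); rewrite ?mulr1 ?mulr0 ?add0r// lerDl ltW.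
have := lt_le_trans Hj H1; rewrite -EFinM.
have -> : (a * c = 2^-1 * a * c + 2^-1 * a * c)%R by field.
by rewrite EFinD lteD2rE.
Qed.

Lemma HL_strong_type (p : R) : (1 < p)%R -> exists C : R, (0 <= C)%R /\
  forall f, measurable_fun setT f -> (forall y, 0 <= f y)%R ->
  \int[lam]_x (HL f x `^ p) <= C%:E * \int[lam]_x (f x `^ p)%:E.
Proof.
move=> p1; exists (p * (2 * 6 ^+ n) * 2^-1 `^ (1 - p) / (p - 1))%R; split.
  rewrite divr_ge0 ?mulr_ge0 ?powR_ge0 ?exprn_ge0//; last by rewrite subr_ge0 ltW.
  by rewrite (le_trans _ (ltW p1)).
move=> f mf f0; apply: strong_type_of_weak => //.
- exact: measurable_HL.
- by move=> x; exact: HL_ge0.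
- by move=> a a0; exact: HL_weak_type_truncated.
Qed.

End hardy_littlewood.

(** * Real-valued integrals, Fubini and convolutions *)

Section real_integrals.
Context {R : realType} d (X : measurableType d) (mu : {measure set X -> \bar R}).
Implicit Types (f g k : X -> R).

Lemma integrable_mul_bounded f k (M : R) : mu.-integrable setT (EFin \o f) ->
  measurable_fun setT k -> (forall x, `|k x| <= M) ->
  mu.-integrable setT (EFin \o (fun x => k x * f x)).
Proof.
move=> intf mk kM; have mf : measurable_fun setT f.
  by apply/measurable_EFinP; exact: measurable_int intf.
apply: (le_integrable measurableT _ _ (integrableZl measurableT M intf)).
  by apply/measurable_EFinP; exact: measurable_funM.
move=> x _ /=; rewrite lee_fin !normrM ler_wpM2r// (le_trans (kM x))//.
exact: ler_norm.
Qed.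

Lemma integrable_measurable f : mu.-integrable setT (EFin \o f) -> measurable_fun setT f.
Proof. by move=> intf; apply/measurable_EFinP; exact: measurable_int intf. Qed.

Lemma integral_EFin f : mu.-integrable setT (EFin \o f) ->
  (\int[mu]_x (f x)%:E)%E = (\int[mu]_x f x)%:E.
Proof. by move=> intf; rewrite /Rintegral fineK//; exact: integrable_fin_num. Qed.

Lemma normr_Rintegral_le f g : mu.-integrable setT (EFin \o g) ->
  measurable_fun setT f -> (forall x, `|f x| <= g x) ->
  `|\int[mu]_x f x| <= \int[mu]_x g x.
Proof.
move=> intg mf fg; have intf : mu.-integrable setT (EFin \o f).
  apply: (le_integrable measurableT _ _ intg); first exact/measurable_EFinP.
  by move=> x _; rewrite /= lee_fin (le_trans (fg x))// ler_norm.
apply: (le_trans (le_normr_Rintegral measurableT intf)).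
apply: le_Rintegral => //; exact: integrable_norm.
Qed.

Lemma Rintegral_dominated_cvg (f_ : nat -> X -> R) f g :
  (forall m, measurable_fun setT (f_ m)) -> measurable_fun setT f ->
  (forall x, f_ m x @[m --> \oo] --> f x) ->
  mu.-integrable setT (EFin \o g) -> (forall m x, `|f_ m x| <= g x) ->
  \int[mu]_x f_ m x @[m --> \oo] --> \int[mu]_x f x.
Proof.
move=> mf_ mf ff intg fg.
have [||||intf _ H] := @dominated_convergence _ X R mu setT measurableT
  (fun m x => (f_ m x)%:E) (EFin \o f) (EFin \o g) _ _ _ intg.
- by move=> m; exact/measurable_EFinP.
- exact/measurable_EFinP.
- by apply: aeW => x _; apply: cvg_EFin; [exact: nearW|exact: ff].
- by apply: aeW => x m _; rewrite /= lee_fin.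
rewrite /Rintegral; apply: fine_cvg; rewrite fineK//; exact: integrable_fin_num.
Qed.

End real_integrals.

Section real_fubini.
Context {R : realType} d1 d2 (X : measurableType d1) (Y : measurableType d2).
Variables (mu : {sigma_finite_measure set X -> \bar R})
          (nu : {sigma_finite_measure set Y -> \bar R}).
Variable F : X * Y -> R.
Hypotheses (iF : (mu \x nu)%E.-integrable setT (EFin \o F))
  (i1 : forall x, nu.-integrable setT (fun y => (F (x, y))%:E))
  (i2 : forall y, mu.-integrable setT (fun x => (F (x, y))%:E)).

Lemma Rfubini : \int[mu]_x \int[nu]_y F (x, y) = \int[nu]_y \int[mu]_x F (x, y).
Proof.
have := Fubini iF; rewrite /=.
under eq_integral do rewrite (integral_EFin (i1 _)).
under [X in _ = X -> _]eq_integral do rewrite (integral_EFin (i2 _)).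
by move=> H; rewrite /Rintegral H.
Qed.

Lemma Rfubini_integrable : mu.-integrable setT (EFin \o (fun x => \int[nu]_y F (x, y))).
Proof.
have := integrable_fubini_F iF; rewrite /fubini_F/=.
by under eq_fun do rewrite (integral_EFin (i1 _)).
Qed.

End real_fubini.

Section space_integrals.
Context {R : realType} (n : nat).
Notation T := 'rV[R]_n.
Notation lam := (@lebesgue_rV R n).
Implicit Types (f g : T -> R) (F : T -> \bar R).

Lemma integral_rV_translation F (c : T) : measurable_fun setT F ->
  (\int[lam]_x F (x + c)%R = \int[lam]_x F x)%E.
Proof.
move=> mF; rewrite integralE [RHS]integralE.
congr (_ - _)%E.
- by have <- := ge0_integral_rV_translation c (measurable_funepos mF) (funepos_ge0 F); apply: eq_integral => x _; rewrite unlock.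
- by have <- := ge0_integral_rV_translation c (measurable_funeneg mF) (funeneg_ge0 F); apply: eq_integral => x _; rewrite unlock.
Qed.

Lemma integral_rVN F : measurable_fun setT F ->
  (\int[lam]_x F (- x)%R = \int[lam]_x F x)%E.
Proof.
move=> mF; rewrite integralE [RHS]integralE.
congr (_ - _)%E.
- by have <- := ge0_integral_rVN (measurable_funepos mF) (funepos_ge0 F); apply: eq_integral => x _; rewrite unlock.
- by have <- := ge0_integral_rVN (measurable_funeneg mF) (funeneg_ge0 F); apply: eq_integral => x _; rewrite unlock.
Qed.

Lemma integral_rV_scale F (s : R) : 0 < s -> measurable_fun setT F ->
  (\int[lam]_x F (s *: x)%R = (s ^- n)%:E * \int[lam]_x F x)%E.
Proof.
move=> s0 mF; rewrite integralE [in RHS]integralE.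
have sn : (0 < s ^- n)%R by rewrite invr_gt0 exprn_gt0.
have -> (x y : \bar R) : ((s ^- n)%:E * (x - y) = (s ^- n)%:E * x - (s ^- n)%:E * y)%E.
  have s0E : (0%:E < (s ^- n)%:E)%E by rewrite lte_fin.
  by case: x => [x||]; case: y => [y||]; rewrite /= -?EFinB -?EFinM -?EFinB ?mulrBr//
    ?(gt0_muley s0E) ?(gt0_muleNy s0E).
congr (_ - _)%E.
- by have <- := ge0_integral_rV_scale s0 (measurable_funepos mF) (funepos_ge0 F); apply: eq_integral => x _; rewrite unlock.
- by have <- := ge0_integral_rV_scale s0 (measurable_funeneg mF) (funeneg_ge0 F); apply: eq_integral => x _; rewrite unlock.
Qed.

Lemma Rintegral_rV_translation f (c : T) : measurable_fun setT f ->
  \int[lam]_x f (x + c) = \int[lam]_x f x.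
Proof.
move=> mf; rewrite /Rintegral (@integral_rV_translation (EFin \o f))//.
exact/measurable_EFinP.
Qed.

Lemma Rintegral_rVN f : measurable_fun setT f ->
  \int[lam]_x f (- x) = \int[lam]_x f x.
Proof.
by move=> mf; rewrite /Rintegral (@integral_rVN (EFin \o f))//; exact/measurable_EFinP.
Qed.

Lemma Rintegral_rV_scale f (s : R) : 0 < s -> measurable_fun setT f ->
  \int[lam]_x f (s *: x) = s ^- n * \int[lam]_x f x.
Proof.
move=> s0 mf; rewrite /Rintegral (@integral_rV_scale (EFin \o f))//; last exact/measurable_EFinP.
have sn : (0 < s ^- n) by rewrite invr_gt0 exprn_gt0.
(* For an infinite integral both sides are 0, because [fine] sends both infinities to 0. *)
rewrite /=; case: (\int[lam]_x (f x)%:E)%E => [x||] //=.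
  by rewrite gt0_muley ?lte_fin//= mulr0.
by rewrite gt0_muleNy ?lte_fin//= mulr0.
Qed.

Lemma integrable_rV_translation f (c : T) : lam.-integrable setT (EFin \o f) ->
  lam.-integrable setT (EFin \o (fun x => f (x + c))).
Proof.
move=> intf; have mf := integrable_measurable intf.
apply/integrableP; split; first by apply/measurable_EFinP; mfun.
move/integrableP : intf => [_]; apply: le_lt_trans.
rewrite -[leRHS](@integral_rV_translation _ c)//.
by apply: measurableT_comp => //; exact/measurable_EFinP.
Qed.

Lemma integrable_rV_scale f (s : R) : 0 < s -> lam.-integrable setT (EFin \o f) ->
  lam.-integrable setT (EFin \o (fun x => f (s *: x))).
Proof.
move=> s0 intf; have mf := integrable_measurable intf.
apply/integrableP; split; first by apply/measurable_EFinP; mfun.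
have sn : (0 < s ^- n) by rewrite invr_gt0 exprn_gt0.
rewrite (@integral_rV_scale (fun x => `|(f x)%:E|)%E)//; last first.
  by apply: measurableT_comp => //; exact/measurable_EFinP.
move/integrableP : intf => [_ H]; rewrite lte_mul_pinfty// lee_fin ltW//.
Qed.

Lemma Rintegral_odd f : measurable_fun setT f -> (forall x, f (- x) = - f x) ->
  lam.-integrable setT (EFin \o f) -> \int[lam]_x f x = 0.
Proof.
move=> mf fN intf; have := Rintegral_rVN mf.
under eq_Rintegral do rewrite fN -mulN1r.
rewrite RintegralZl// mulN1r => /eqP.
by rewrite eq_sym -addr_eq0 -mulr2n mulrn_eq0/= => /eqP.
Qed.

End space_integrals.

(** A class inside L^1 and L^2 that is stable under the products, dilations and convolutions used
    below, so that every exchange of integrals is absolutely convergent. *)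
Definition bounded_integrable {R : realType} d (X : measurableType d)
    (mu : set X -> \bar R) (f : X -> R) :=
  [/\ measurable_fun setT f, exists M, forall x, `|f x| <= M
    & mu.-integrable setT (EFin \o f)].

Section bounded_fubini.
Context {R : realType} d1 d2 (X : measurableType d1) (Y : measurableType d2).
Variables (mu : {sigma_finite_measure set X -> \bar R})
          (nu : {sigma_finite_measure set Y -> \bar R}).
Variables (h : Y -> R) (G : X * Y -> R) (M N : R).
Hypotheses (ih : nu.-integrable setT (EFin \o h)) (mG : measurable_fun setT G)
  (GM : forall p, `|G p| <= M)
  (GN : forall y, (\int[mu]_x `|(G (x, y))%:E| <= N%:E)%E).

Let F p := h p.2 * G p.

Let mh : measurable_fun setT h := integrable_measurable ih.

Let mF : measurable_fun setT F.
Proof. by apply: measurable_funM => //; exact: (measurableT_comp mh measurable_snd). Qed.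

Let mGx x : measurable_fun setT (fun y => G (x, y)).
Proof. exact: (measurableT_comp mG (pair1_measurable x)). Qed.

Let mGy y : measurable_fun setT (fun x => G (x, y)).
Proof. exact: (measurableT_comp mG (pair2_measurable y)). Qed.

Lemma bounded_fubini_slice x : nu.-integrable setT (EFin \o (fun y => h y * G (x, y))).
Proof.
rewrite (_ : (fun y => _) = fun y => G (x, y) * h y); last by apply/funext => y; rewrite mulrC.
exact: (integrable_mul_bounded (M := M)).
Qed.

Lemma bounded_fubini_slice2 y : mu.-integrable setT (EFin \o (fun x => G (x, y))).
Proof.
apply/integrableP; split; first exact/measurable_EFinP.
by rewrite (le_lt_trans (GN y))// ltry.
Qed.

(** Integrating in x first costs at most N for each y, uniformly, and the remaining factor h is
    integrable. *)
Lemma bounded_fubini_integrable : (mu \x nu)%E.-integrable setT (EFin \o F).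
Proof.
have mE : measurable_fun setT (abse \o (EFin \o F)).
  by apply: measurableT_comp => //; exact/measurable_EFinP.
apply/integrableP; split; first exact/measurable_EFinP.
rewrite (@fubini_tonelli2 _ _ _ _ _ mu nu (abse \o (EFin \o F)))//; last first.
  by move=> p; exact: abse_ge0.
have [_ hoo] := integrableP _ _ _ (integrableZl measurableT N ih).
apply: le_lt_trans hoo; apply: ge0_le_integral_nomeas => y _; rewrite /fubini_G.
  by apply: integral_ge0 => x _; exact: abse_ge0.
rewrite /= normrM mulrC EFinM.
have -> : (\int[mu]_x `|(F (x, y))%:E| = `|h y|%:E * \int[mu]_x `|(G (x, y))%:E|)%E.
  under eq_integral do rewrite /F /= normrM EFinM.
  rewrite [LHS](@ge0_integralZl_EFin _ _ _ mu setT measurableT (fun x => `|G (x, y)|%:E))//.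
  by apply/measurable_EFinP; apply: measurableT_comp.
rewrite lee_pmul//; first exact: integral_ge0.
by rewrite (le_trans (GN y))// lee_fin ler_norm.
Qed.

Lemma bounded_fubini :
  \int[mu]_x \int[nu]_y (h y * G (x, y)) = \int[nu]_y (h y * \int[mu]_x G (x, y)).
Proof.
rewrite (Rfubini bounded_fubini_integrable).
- by apply: eq_Rintegral => y _; rewrite /F /= RintegralZl//; exact: bounded_fubini_slice2.
- exact: bounded_fubini_slice.
- by move=> y; exact: (integrableZl measurableT (h y) (bounded_fubini_slice2 y)).
Qed.

Lemma bounded_fubini_integral : bounded_integrable mu (fun x => \int[nu]_y (h y * G (x, y))).
Proof.
have ii : mu.-integrable setT (EFin \o (fun x => \int[nu]_y (h y * G (x, y)))).
  apply: (Rfubini_integrable bounded_fubini_integrable).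
  exact: bounded_fubini_slice.
split; [exact: (integrable_measurable ii)| |exact: ii].
exists (\int[nu]_y (`|h y| * M)) => x.
apply: normr_Rintegral_le.
- apply: (eq_integrable _ (EFin \o (fun y => M * `|h y|))) => //.
    by move=> y _; rewrite /= mulrC.
  have ih' : nu.-integrable setT (EFin \o (fun y => `|h y|)) by exact: integrable_norm.
  exact: (integrableZl measurableT M ih').
- exact: measurable_funM (mGx x).
- by move=> y; rewrite normrM ler_wpM2l.
Qed.

End bounded_fubini.

Section smear.
Context {R : realType} (n : nat) d (Y : measurableType d).
Variable nu : {sigma_finite_measure set Y -> \bar R}.
Notation T := 'rV[R]_n.
Notation lam := (@lebesgue_rV R n).

(** Convolution of H with the image under [phi] of the measure of density h. Taking [phi = id] gives
    ordinary convolution, and [phi w = t *: dir w] on the unit ball gives averages over the sphere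
    of radius t. *)
Definition smear (h : Y -> R) (phi : Y -> T) (H : T -> R) (x : T) :=
  \int[nu]_z (h z * H (x - phi z)).

Variables (h : Y -> R) (phi : Y -> T) (H : T -> R).
Hypotheses (ih : nu.-integrable setT (EFin \o h)) (mphi : measurable_fun setT phi)
  (bH : bounded_integrable lam H).

Let mH : measurable_fun setT H. Proof. by case: bH. Qed.

Let iH : lam.-integrable setT (EFin \o H). Proof. by case: bH. Qed.

Let mG : measurable_fun setT (fun p : T * Y => H (p.1 - phi p.2)).
Proof. by apply: (measurableT_comp mH); mfun. Qed.

Lemma smear_slice_integrable x : nu.-integrable setT (EFin \o (fun z => h z * H (x - phi z))).
Proof.
have [_ [M HM] _] := bH.
rewrite (_ : (fun z => _) = fun z => H (x - phi z) * h z); last by apply/funext => z; rewrite mulrC.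
by apply: (integrable_mul_bounded (M := M)) => //; mfun.
Qed.

(** Fubini moves the translation from H to the test function k. Cosines and sines for k give the
    transforms of a convolution, k = 1 its integrability, and k = H the autocorrelation of H. *)
Lemma integral_mul_smear (k : T -> R) (M : R) : measurable_fun setT k ->
  (forall x, `|k x| <= M) ->
  \int[lam]_x (k x * smear h phi H x) = \int[nu]_z (h z * \int[lam]_x (k (x + phi z) * H x))
  /\ bounded_integrable lam (fun x => k x * smear h phi H x).
Proof.
move=> mk kM; have [_ [B HB] _] := bH.
pose G (p : T * Y) := k p.1 * H (p.1 - phi p.2).
have mG' : measurable_fun setT G by apply: measurable_funM => //; mfun.
have GB p : `|G p| <= M * B by rewrite normrM ler_pM.
have M0 : 0 <= M by apply: le_trans (kM 0).
have GN z : (\int[lam]_x `|(G (x, z))%:E| <= (M * \int[lam]_x `|H x|)%:E)%E.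
  have iH' : lam.-integrable setT (EFin \o (fun x => `|H x|)) by exact: integrable_norm.
  apply: (@le_trans _ _ (\int[lam]_x (M * `|H (x - phi z)|)%:E)%E).
    by apply: ge0_le_integral_nomeas => x _ //; rewrite lee_fin normrM ler_wpM2r.
  under eq_integral do rewrite EFinM.
  rewrite ge0_integralZl_EFin//; last by apply/measurable_EFinP; mfun.
  rewrite (@ge0_integral_rV_translation _ _ (- phi z) (fun x => `|H x|%:E))//.
    by rewrite integral_EFin// EFinM.
  by apply/measurable_EFinP; mfun.
have E x : k x * smear h phi H x = \int[nu]_z (h z * G (x, z)).
  rewrite -RintegralZl//; last exact: smear_slice_integrable.
  by apply: eq_Rintegral => z _; rewrite /G/= mulrCA.
under eq_Rintegral do rewrite E.
under [X in _ /\ bounded_integrable _ X]eq_fun do rewrite E.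
split; last exact: (bounded_fubini_integral ih mG' GB GN).
rewrite (bounded_fubini ih mG' GB GN); apply: eq_Rintegral => z _; congr (_ * _).
rewrite -[LHS](@Rintegral_rV_translation _ _ _ (phi z))//; last by rewrite /G; mfun.
by apply: eq_Rintegral => x _; rewrite /G/= addrK.
Qed.

Lemma smear_bounded_integrable : bounded_integrable lam (smear h phi H).
Proof.
have le11 (x : T) : `|1 : R| <= 1 by rewrite normr1.
have [_] := integral_mul_smear (measurable_cst (1 : R)) le11.
by under [X in bounded_integrable _ X]eq_fun do rewrite mul1r.
Qed.

End smear.

(** * Cosine and sine transforms *)

Section fourier.
Context {R : realType} (n : nat).
Notation T := 'rV[R]_n.
Notation lam := (@lebesgue_rV R n).
Implicit Types (f H : T -> R) (x xi : T).

Definition dot xi x : R := \sum_(i < n) xi ord0 i * x ord0 i.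

Lemma dotDr xi x y : dot xi (x + y) = dot xi x + dot xi y.
Proof. by rewrite /dot -big_split; apply: eq_bigr => i _; rewrite mxE mulrDr. Qed.

Lemma dotZr xi (a : R) x : dot xi (a *: x) = a * dot xi x.
Proof. by rewrite /dot mulr_sumr; apply: eq_bigr => i _; rewrite mxE mulrCA. Qed.

Lemma dotNr xi x : dot xi (- x) = - dot xi x.
Proof. by rewrite -scaleN1r dotZr mulN1r. Qed.

Lemma dotC xi x : dot xi x = dot x xi.
Proof. by apply: eq_bigr => i _; rewrite mulrC. Qed.

Lemma dotxx x : dot x x = enorm x ^+ 2.
Proof. by rewrite enorm_sqr. Qed.

Lemma dot_le xi x : `|dot xi x| <= n%:R * enorm xi * `|x|.
Proof.
rewrite (le_trans (ler_norm_sum _ _ _))//.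
rewrite (@le_trans _ _ (\sum_(i < n) enorm xi * `|x|))//.
  apply: ler_sum => i _; rewrite normrM ler_pM//; last exact: coor_le_rVnorm.
  exact: le_trans (coor_le_rVnorm _ _) (rVnorm_le_enorm _).
by rewrite sumr_const card_ord -[leLHS]mulr_natl mulrA.
Qed.

Lemma measurable_dot xi : measurable_fun setT (dot xi).
Proof.
apply: measurable_sum => i; apply: measurable_funM => //; exact: measurable_coor.
Qed.

(** Up to sign, [cosT] and [sinT] are the real and imaginary parts of the Fourier transform. The
    convolution kernels below are even, so for them [cosT] is the whole transform. *)
Definition cosT f xi := \int[lam]_x (cos (dot xi x) * f x).
Definition sinT f xi := \int[lam]_x (sin (dot xi x) * f x).

Lemma measurable_cos_dot xi : measurable_fun setT (fun x => cos (dot xi x)).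
Proof.
apply: (measurableT_comp _ (measurable_dot xi)).
by apply: continuous_measurable_fun; exact: continuous_cos.
Qed.

Lemma measurable_sin_dot xi : measurable_fun setT (fun x => sin (dot xi x)).
Proof.
apply: (measurableT_comp _ (measurable_dot xi)).
by apply: continuous_measurable_fun; exact: continuous_sin.
Qed.

Lemma integrable_cos f xi : lam.-integrable setT (EFin \o f) ->
  lam.-integrable setT (EFin \o (fun x => cos (dot xi x) * f x)).
Proof.
move=> intf; apply: integrable_mul_bounded => //; first exact: measurable_cos_dot.
by move=> x; exact: cos_max.
Qed.

Lemma integrable_sin f xi : lam.-integrable setT (EFin \o f) ->
  lam.-integrable setT (EFin \o (fun x => sin (dot xi x) * f x)).
Proof.
move=> intf; apply: integrable_mul_bounded => //; first exact: measurable_sin_dot.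
by move=> x; exact: sin_max.
Qed.

Lemma sinT_even f xi : lam.-integrable setT (EFin \o f) -> (forall x, f (- x) = f x) ->
  sinT f xi = 0.
Proof.
move=> intf fN; apply: Rintegral_odd; last exact: integrable_sin.
  by apply: integrable_measurable; exact: integrable_sin.
by move=> x; rewrite dotNr sinN fN mulNr.
Qed.

Section transform_smear.
Context d (Y : measurableType d) (nu : {sigma_finite_measure set Y -> \bar R}).
Variables (h : Y -> R) (phi : Y -> T) (H : T -> R).
Hypotheses (ih : nu.-integrable setT (EFin \o h)) (mphi : measurable_fun setT phi)
  (bH : bounded_integrable lam H) (HN : forall x, H (- x) = H x).

Let iH : lam.-integrable setT (EFin \o H). Proof. by case: bH. Qed.

(** The addition formula yields a second term with [sinT H], which vanishes because H is even; this
    leaves a plain product, as for the complex transform. *)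
Lemma cosT_smear xi : cosT (smear nu h phi H) xi =
  \int[nu]_z (h z * cos (dot xi (phi z))) * cosT H xi.
Proof.
rewrite {1}/cosT; have [-> _] := integral_mul_smear ih mphi bH (measurable_cos_dot xi) (fun x => cos_max _).
rewrite -RintegralZr; [|exact: measurableT|]; last first.
  under eq_fun do rewrite mulrC.
  apply: integrable_mul_bounded => //; last by move=> z; exact: cos_max.
  exact: (measurableT_comp (measurable_cos_dot xi) mphi).
apply: eq_Rintegral => z _; rewrite -mulrA; congr (_ * _).
transitivity (\int[lam]_x (cos (dot xi (phi z)) * (cos (dot xi x) * H x)
   - sin (dot xi (phi z)) * (sin (dot xi x) * H x))).
  by apply: eq_Rintegral => x _; rewrite dotDr cosD; ring.
rewrite RintegralB//; last 2 first.
- exact: (integrableZl measurableT _ (integrable_cos xi iH)).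
- exact: (integrableZl measurableT _ (integrable_sin xi iH)).
rewrite RintegralZl//; last exact: integrable_cos.
rewrite RintegralZl//; last exact: integrable_sin.
by rewrite -/(sinT H xi) sinT_even// mulr0 subr0.
Qed.

Lemma sinT_smear xi : sinT (smear nu h phi H) xi =
  \int[nu]_z (h z * sin (dot xi (phi z))) * cosT H xi.
Proof.
rewrite {1}/sinT; have [-> _] := integral_mul_smear ih mphi bH (measurable_sin_dot xi) (fun x => sin_max _).
rewrite -RintegralZr; [|exact: measurableT|]; last first.
  under eq_fun do rewrite mulrC.
  apply: integrable_mul_bounded => //; last by move=> z; exact: sin_max.
  exact: (measurableT_comp (measurable_sin_dot xi) mphi).
apply: eq_Rintegral => z _; rewrite -mulrA; congr (_ * _).
transitivity (\int[lam]_x (sin (dot xi (phi z)) * (cos (dot xi x) * H x)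
   + cos (dot xi (phi z)) * (sin (dot xi x) * H x))).
  by apply: eq_Rintegral => x _; rewrite dotDr sinD; ring.
rewrite RintegralD//; last 2 first.
- exact: (integrableZl measurableT _ (integrable_cos xi iH)).
- exact: (integrableZl measurableT _ (integrable_sin xi iH)).
rewrite RintegralZl//; last exact: integrable_cos.
rewrite RintegralZl//; last exact: integrable_sin.
by rewrite -/(sinT H xi) sinT_even// mulr0 addr0.
Qed.

End transform_smear.
End fourier.

(** * A weighted substitute for the Plancherel identity *)

Lemma integrable_normr {R : realType} d (X : measurableType d) (mu : {measure set X -> \bar R})
    (f : X -> R) : mu.-integrable setT (EFin \o f) ->
  mu.-integrable setT (EFin \o (fun z => `|f z|)).
Proof. by move=> intf; exact: integrable_norm. Qed.

Section spectral_form.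
Context {R : realType} (n : nat).
Notation T := 'rV[R]_n.
Notation lam := (@lebesgue_rV R n).
Implicit Types (u gam : T -> R) (x xi : T).

Lemma measurable_dot2 : measurable_fun setT (fun p : T * T => dot p.1 p.2).
Proof.
apply: measurable_sum => i; apply: measurable_funM.
  exact: (measurableT_comp (measurable_coor i)).
exact: (measurableT_comp (measurable_coor i)).
Qed.

Lemma measurable_cos_dot2 : measurable_fun setT (fun p : T * T => cos (dot p.1 p.2)).
Proof.
apply: (measurableT_comp _ measurable_dot2).
by apply: continuous_measurable_fun; exact: continuous_cos.
Qed.

Lemma measurable_sin_dot2 : measurable_fun setT (fun p : T * T => sin (dot p.1 p.2)).
Proof.
apply: (measurableT_comp _ measurable_dot2).
by apply: continuous_measurable_fun; exact: continuous_sin.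
Qed.

Lemma bounded_integrable_mul u gam : bounded_integrable lam u -> bounded_integrable lam gam ->
  bounded_integrable lam (fun x => u x * gam x).
Proof.
move=> [mu [M uM] iu] [mg [N gN] ig]; split.
- exact: measurable_funM.
- by exists (M * N) => x; rewrite normrM ler_pM.
- exact: (integrable_mul_bounded ig mu uM).
Qed.

Lemma bounded_integrableD u gam : bounded_integrable lam u -> bounded_integrable lam gam ->
  bounded_integrable lam (fun x => u x + gam x).
Proof.
move=> [mu [M uM] iu] [mg [N gN] ig]; split.
- exact: measurable_funD.
- by exists (M + N) => x; rewrite (le_trans (ler_normD _ _))// lerD.
- exact: (integrableD measurableT iu ig).
Qed.

(** Expanding the squares and using the cosine of a difference gives a double integral in x and y.
    The weight [gam] makes the frequency integral absolutely convergent, so that all orders of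
    integration agree. *)
Lemma spectral_form gam u : bounded_integrable lam gam -> bounded_integrable lam u ->
  \int[lam]_xi (gam xi * (cosT u xi ^+ 2 + sinT u xi ^+ 2)) =
  \int[lam]_x (u x * \int[lam]_y (u y * cosT gam (x - y))).
Proof.
move=> bg bu; have [mg [M gM] ig] := bg; have [mu _ iu] := bu.
have ig' : lam.-integrable setT (EFin \o (fun x => `|gam x|)) by exact: integrable_norm.
have bgk (k : T * T -> R) : measurable_fun setT k -> (forall p, `|k p| <= 1) ->
    bounded_integrable lam (fun xi => \int[lam]_x (u x * (gam xi * k (xi, x)))).
  move=> mk k1.
  apply: (@bounded_fubini_integral _ _ _ _ _ lam lam u (fun p => gam p.1 * k p)
    M (\int[lam]_x `|gam x|) iu).
  - by apply: measurable_funM => //; mfun.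
  - by move=> p; rewrite normrM -[M]mulr1 ler_pM.
  - move=> y; rewrite -integral_EFin//.
    by apply: ge0_le_integral_nomeas => x _ //=; rewrite lee_fin normrM ler_piMr.
have gCE xi : gam xi * cosT u xi = \int[lam]_x (u x * (gam xi * cos (dot xi x))).
  rewrite /cosT -RintegralZl//; last exact: integrable_cos.
  by apply: eq_Rintegral => x _; rewrite [RHS]mulrC; ring.
have gSE xi : gam xi * sinT u xi = \int[lam]_x (u x * (gam xi * sin (dot xi x))).
  rewrite /sinT -RintegralZl//; last exact: integrable_sin.
  by apply: eq_Rintegral => x _; rewrite [RHS]mulrC; ring.
have bC : bounded_integrable lam (fun xi => gam xi * cosT u xi).
  under eq_fun do rewrite gCE.
  by apply: (bgk _ measurable_cos_dot2) => p; exact: cos_max.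
have bS : bounded_integrable lam (fun xi => gam xi * sinT u xi).
  under eq_fun do rewrite gSE.
  by apply: (bgk _ measurable_sin_dot2) => p; exact: sin_max.
have [mC [MC CM] iC] := bC; have [mS [MS SM] iS] := bS.
pose G (p : T * T) := cos (dot p.1 p.2) * (gam p.1 * cosT u p.1) +
  sin (dot p.1 p.2) * (gam p.1 * sinT u p.1).
transitivity (\int[lam]_xi \int[lam]_x (u x * G (xi, x))).
  apply: eq_Rintegral => xi _.
  transitivity (\int[lam]_x (gam xi * cosT u xi * (cos (dot xi x) * u x) +
      gam xi * sinT u xi * (sin (dot xi x) * u x))).
    rewrite RintegralD//; last 2 first.
    - exact: (integrableZl measurableT _ (integrable_cos xi iu)).
    - exact: (integrableZl measurableT _ (integrable_sin xi iu)).
    rewrite RintegralZl//; last exact: integrable_cos.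
    rewrite RintegralZl//; last exact: integrable_sin.
    by rewrite -/(cosT u xi) -/(sinT u xi); ring.
  by apply: eq_Rintegral => x _; rewrite /G/=; ring.
rewrite (@bounded_fubini _ _ _ _ _ lam lam u G (MC + MS)
  (\int[lam]_xi (`|gam xi * cosT u xi| + `|gam xi * sinT u xi|)) iu); last 3 first.
- apply: measurable_funD; apply: measurable_funM.
  + exact: measurable_cos_dot2.
  + exact: (measurableT_comp mC).
  + exact: measurable_sin_dot2.
  + exact: (measurableT_comp mS).
- move=> p; rewrite (le_trans (ler_normD _ _))// lerD// normrM -[leRHS]mul1r ler_pM//.
  + exact: cos_max.
  + exact: sin_max.
- move=> y; rewrite -integral_EFin; last first.
    exact: (integrableD measurableT (integrable_normr iC) (integrable_normr iS)).
  apply: ge0_le_integral_nomeas => x _ //; rewrite lee_fin (le_trans (ler_normD _ _))//.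
  by rewrite lerD// normrM ler_piMl// ?cos_max ?sin_max.
apply: eq_Rintegral => x _; congr (_ * _).
transitivity (\int[lam]_xi \int[lam]_y (u y * (gam xi * cos (dot xi (x - y))))).
  apply: eq_Rintegral => xi _; rewrite /G /= gCE gSE -RintegralZl//; last first.
    rewrite (_ : _ \o _ = EFin \o (fun y => gam xi * (cos (dot xi y) * u y))).
      exact: (integrableZl measurableT _ (integrable_cos xi iu)).
    by apply/funext => y /=; congr EFin; ring.
  rewrite -RintegralZl//; last first.
    rewrite (_ : _ \o _ = EFin \o (fun y => gam xi * (sin (dot xi y) * u y))).
      exact: (integrableZl measurableT _ (integrable_sin xi iu)).
    by apply/funext => y /=; congr EFin; ring.
  rewrite -RintegralD//; last 2 first.
  - rewrite (_ : _ \o _ = EFin \o (fun y => cos (dot xi x) * gam xi * (cos (dot xi y) * u y))).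
      exact: (integrableZl measurableT _ (integrable_cos xi iu)).
    by apply/funext => y /=; congr EFin; ring.
  - rewrite (_ : _ \o _ = EFin \o (fun y => sin (dot xi x) * gam xi * (sin (dot xi y) * u y))).
      exact: (integrableZl measurableT _ (integrable_sin xi iu)).
    by apply/funext => y /=; congr EFin; ring.
  by apply: eq_Rintegral => y _; rewrite dotDr dotNr cosD cosN sinN; ring.
rewrite (@bounded_fubini _ _ _ _ _ lam lam u (fun p => gam p.1 * cos (dot p.1 (x - p.2))) M
  (\int[lam]_x `|gam x|) iu).
- apply: eq_Rintegral => y _; congr (_ * _).
  by apply: eq_Rintegral => xi _; rewrite mulrC dotC.
- apply: measurable_funM; first exact: (measurableT_comp mg).
  have mm : measurable_fun setT (fun p : T * T => (p.1, x - p.2)).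
    by apply: measurable_fun_pair; mfun.
  exact: (measurableT_comp measurable_cos_dot2 mm).
- by move=> p; rewrite normrM -[M]mulr1 ler_pM// cos_max.
- move=> y; rewrite -integral_EFin//.
  by apply: ge0_le_integral_nomeas => xi _ //=; rewrite lee_fin normrM ler_piMr// cos_max.
Qed.

Lemma dotZl xi (a : R) x : dot (a *: xi) x = a * dot xi x.
Proof. by rewrite dotC dotZr dotC. Qed.

Lemma cosT_dilate gam (e : R) xi : 0 < e -> measurable_fun setT gam ->
  cosT (fun x => gam (e *: x)) xi = e ^- n * cosT gam (e^-1 *: xi).
Proof.
move=> e0 mg; rewrite /cosT -(@Rintegral_rV_scale _ _ (fun x => cos (dot (e^-1 *: xi) x) * gam x))//.
- by apply: eq_Rintegral => x _; rewrite dotZr dotZl mulrA divff ?gt_eqF// mul1r.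
- by apply: measurable_funM => //; exact: measurable_cos_dot.
Qed.

Lemma bounded_integrable_dilate gam (e : R) : 0 < e -> bounded_integrable lam gam ->
  bounded_integrable lam (fun x => gam (e *: x)).
Proof.
move=> e0 [mg [M gM] ig]; split; first by mfun.
- by exists M => x.
- exact: (integrable_rV_scale e0 ig).
Qed.

Lemma Rintegral_shift_mul_le u c : bounded_integrable lam u ->
  \int[lam]_x (u (x + c) * u x) <= \int[lam]_x u x ^+ 2.
Proof.
move=> bu; have bu2 : bounded_integrable lam (fun x => u x ^+ 2).
  by under eq_fun do rewrite expr2; exact: bounded_integrable_mul.
have [mu [M uM] iu] := bu; have [mu2 _ iu2] := bu2.
have iuc := integrable_rV_translation c iu.
have iuc2 := integrable_rV_translation c iu2.
apply: (@le_trans _ _ (\int[lam]_x (2^-1 * (u (x + c) ^+ 2 + u x ^+ 2)))).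
  apply: le_Rintegral => //.
  - by apply: (integrable_mul_bounded (M := M)) => //; mfun.
  - exact: (integrableZl measurableT _ (integrableD measurableT iuc2 iu2)).
  - by move=> x _; have := sqr_ge0 (u (x + c) - u x); nra.
rewrite RintegralZl//; last exact: (integrableD measurableT iuc2 iu2).
rewrite RintegralD// (@Rintegral_rV_translation _ _ (fun x => u x ^+ 2))//.
by set J := Rintegral _ _ _; lra.
Qed.

Section dilated.
Variables (gam u : T -> R).
Hypotheses (bg : bounded_integrable lam gam) (bG : bounded_integrable lam (cosT gam))
  (G0 : forall xi, 0 <= cosT gam xi) (bu : bounded_integrable lam u).

Let mu : measurable_fun setT u. Proof. by case: bu. Qed.
Let iu : lam.-integrable setT (EFin \o u). Proof. by case: bu. Qed.
Let mG : measurable_fun setT (cosT gam). Proof. by case: bG. Qed.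
Let iG : lam.-integrable setT (EFin \o cosT gam). Proof. by case: bG. Qed.

Let I (e : R) z := \int[lam]_x (u (x + e *: z) * u x).

(** The substitution y = x - e z separates the weight from the autocorrelation of u at e z; the
    width e then enters only through the latter. *)
Lemma spectral_form_dilate (e : R) : 0 < e ->
  \int[lam]_xi (gam (e *: xi) * (cosT u xi ^+ 2 + sinT u xi ^+ 2)) =
  \int[lam]_z (cosT gam z * I e z).
Proof.
move=> e0; rewrite (spectral_form (bounded_integrable_dilate e0 bg) bu).
have mphi : measurable_fun setT (fun z : T => e *: z) by mfun.
have [_ [M uM] _] := bu.
have [<- _] := integral_mul_smear iG mphi bu mu uM.
apply: eq_Rintegral => x _; congr (_ * _).
have mg : measurable_fun setT gam by case: bg.
pose F w := u (x - w) * (e ^- n * cosT gam (e^-1 *: w)).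
have mF : measurable_fun setT F by rewrite /F; mfun.
transitivity (\int[lam]_w F w).
  rewrite -[RHS](@Rintegral_rV_translation _ _ F x)//.
  rewrite -[RHS](@Rintegral_rVN _ _ (fun y => F (y + x))); last first.
    by apply: (measurableT_comp mF); mfun.
  apply: eq_Rintegral => y _; rewrite (cosT_dilate _ e0 mg) /F.
  by rewrite (addrC (- y)) subKr.
have en0 : e ^+ n != 0 by rewrite gt_eqF// exprn_gt0.
apply: (mulfI (invr_neq0 en0)); rewrite -(Rintegral_rV_scale e0 mF) /smear.
rewrite -RintegralZl//; last exact: smear_slice_integrable.
apply: eq_Rintegral => z _; rewrite /F scalerA mulVf ?gt_eqF// scale1r; ring.
Qed.

Let bGI (e : R) : bounded_integrable lam (fun z => cosT gam z * I e z).
Proof.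
have [_ [M uM] _] := bu; have [_ [N GN] _] := bG.
have E z : cosT gam z * I e z = \int[lam]_x (u x * (cosT gam z * u (x + e *: z))).
  rewrite /I -RintegralZl//.
    by apply: eq_Rintegral => x _; ring.
  by apply: integrable_mul_bounded => //; mfun.
under eq_fun do rewrite E.
apply: (@bounded_fubini_integral _ _ _ _ _ lam lam u
  (fun p => cosT gam p.1 * u (p.2 + e *: p.1)) (N * M) (M * \int[lam]_z cosT gam z) iu).
- by mfun.
- by move=> p; rewrite normrM ler_pM.
- move=> y; rewrite EFinM -integral_EFin// -ge0_integralZl_EFin//.
  + apply: ge0_le_integral_nomeas => z _ //=; rewrite -EFinM lee_fin normrM mulrC.
    by rewrite ler_pM// ger0_norm.
  + by move=> z _; rewrite lee_fin.
  + exact/measurable_EFinP.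
  + exact: le_trans (uM 0).
Qed.

(** The autocorrelation is largest at 0, and [cosT gam] is nonnegative, so the autocorrelation may
    be replaced by its value at 0 for every width e. *)
Lemma spectral_form_le (e : R) : 0 < e ->
  \int[lam]_xi (gam (e *: xi) * (cosT u xi ^+ 2 + sinT u xi ^+ 2)) <=
  (\int[lam]_z cosT gam z) * \int[lam]_x u x ^+ 2.
Proof.
move=> e0; rewrite spectral_form_dilate// -RintegralZr//.
have [_ _ iGI] := bGI e.
apply: le_Rintegral => //.
- under eq_fun do rewrite mulrC; exact: (integrableZl measurableT _ iG).
- by move=> z _; rewrite ler_wpM2l// Rintegral_shift_mul_le.
Qed.

(** As the width tends to 0 the bound of [spectral_form_le] is attained, with the same constant: the
    autocorrelation of a continuous u tends to its value at 0, by dominated convergence used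
    twice. *)
Lemma spectral_form_cvg : continuous u ->
  \int[lam]_xi (gam (k.+1%:R^-1 *: xi) * (cosT u xi ^+ 2 + sinT u xi ^+ 2)) @[k --> \oo] -->
  (\int[lam]_z cosT gam z) * \int[lam]_x u x ^+ 2.
Proof.
move=> cu; have [_ [M uM] _] := bu.
have iun := integrable_normr iu.
have iMu : lam.-integrable setT (EFin \o (fun x => M * `|u x|)).
  exact: (integrableZl measurableT M iun).
under eq_fun do rewrite spectral_form_dilate ?invr_gt0//.
rewrite -RintegralZr//.
apply: (@Rintegral_dominated_cvg _ _ _ _ _ _
  (fun z => cosT gam z * \int[lam]_x (M * `|u x|))).
- by move=> k; case: (bGI k.+1%:R^-1).
- by apply: measurable_funM.
- move=> z; apply: cvgMr; apply: (@Rintegral_dominated_cvg _ _ _ _ _ _ (fun x => M * `|u x|)) => //.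
  + by move=> k; mfun.
  + by mfun.
  + move=> x; rewrite expr2; apply: cvgMl.
    have xz : x + k.+1%:R^-1 *: z @[k --> \oo] --> x.
      rewrite -[X in _ --> X]addr0; apply: cvgD; first exact: cvg_cst.
      rewrite -[X in _ --> X](scale0r z); apply: cvgZl; exact: cvg_harmonic.
    exact: (cvg_comp _ _ xz (cu x)).
  + by move=> k x; rewrite normrM ler_pM.
- under eq_fun do rewrite mulrC; exact: (integrableZl measurableT _ iG).
- move=> k z; rewrite normrM ger0_norm// ler_wpM2l//.
  apply: normr_Rintegral_le => //; first by mfun.
  by move=> x; rewrite normrM ler_pM.
Qed.

End dilated.
End spectral_form.

Section square_sum.
Context {R : realType} (n : nat).
Notation T := 'rV[R]_n.
Notation lam := (@lebesgue_rV R n).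
Implicit Types (f u gam : T -> R) (x xi : T).

Lemma measurable_Rintegral d1 d2 (X : measurableType d1) (Y : measurableType d2)
    (nu : {sigma_finite_measure set Y -> \bar R}) (F : X * Y -> R) :
  measurable_fun setT F -> measurable_fun setT (fun a => \int[nu]_b F (a, b)).
Proof.
move=> mF; apply: (measurableT_comp (fine_measurable measurableT)).
have mE : measurable_fun setT (EFin \o F) by exact/measurable_EFinP.
rewrite (_ : (fun a => _) = (fun a => \int[nu]_b (EFin \o F)^\+ (a, b) -
    \int[nu]_b (EFin \o F)^\- (a, b))%E).
  by apply: emeasurable_funB; apply: measurable_fun_fubini_tonelli_F => // p;
    [exact: measurable_funepos|exact: measurable_funeneg].
apply/funext => a; rewrite integralE; congr (_ - _)%E; apply: eq_integral => b _.
  by rewrite !funeposE.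
by rewrite !funenegE.
Qed.

Lemma measurable_cosT u : measurable_fun setT u -> measurable_fun setT (cosT u).
Proof.
move=> mu; apply: (@measurable_Rintegral _ _ _ _ lam (fun p => cos (dot p.1 p.2) * u p.2)).
apply: measurable_funM; [exact: measurable_cos_dot2|mfun].
Qed.

Lemma measurable_sinT u : measurable_fun setT u -> measurable_fun setT (sinT u).
Proof.
move=> mu; apply: (@measurable_Rintegral _ _ _ _ lam (fun p => sin (dot p.1 p.2) * u p.2)).
apply: measurable_funM; [exact: measurable_sin_dot2|mfun].
Qed.

Lemma cosT_le u xi : lam.-integrable setT (EFin \o u) -> `|cosT u xi| <= \int[lam]_x `|u x|.
Proof.
move=> iu; apply: normr_Rintegral_le; first exact: integrable_normr.
  exact: (integrable_measurable (integrable_cos _ iu)).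
by move=> x; rewrite normrM ler_piMl// cos_max.
Qed.

Lemma sinT_le u xi : lam.-integrable setT (EFin \o u) -> `|sinT u xi| <= \int[lam]_x `|u x|.
Proof.
move=> iu; apply: normr_Rintegral_le; first exact: integrable_normr.
  exact: (integrable_measurable (integrable_sin _ iu)).
by move=> x; rewrite normrM ler_piMl// sin_max.
Qed.

Lemma integrable_spectral u gam : bounded_integrable lam gam ->
  lam.-integrable setT (EFin \o u) ->
  lam.-integrable setT (EFin \o (fun xi => gam xi * (cosT u xi ^+ 2 + sinT u xi ^+ 2))).
Proof.
move=> [mg _ ig] iu; have mu := integrable_measurable iu.
have mC := measurable_cosT mu; have mS := measurable_sinT mu.
under eq_fun do rewrite mulrC.
apply: (integrable_mul_bounded (M := (\int[lam]_x `|u x|) ^+ 2 + (\int[lam]_x `|u x|) ^+ 2)) => //.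
  by mfun.
move=> xi; rewrite (le_trans (ler_normD _ _))// !normrX lerD// lerXn2r ?nnegrE ?cosT_le ?sinT_le//.
  exact: le_trans (cosT_le 0 iu).
exact: le_trans (cosT_le 0 iu).
Qed.

Lemma Rintegral_sum (I : Type) (s : seq I) (F : I -> T -> R) :
  (forall i, lam.-integrable setT (EFin \o F i)) ->
  \int[lam]_x \sum_(i <- s) F i x = \sum_(i <- s) \int[lam]_x F i x /\
  lam.-integrable setT (EFin \o (fun x => \sum_(i <- s) F i x)).
Proof.
move=> iF; elim: s => [|i s [IH1 IH2]].
  under eq_Rintegral do rewrite big_nil.
  under [X in _ /\ integrable _ _ X]eq_fun do rewrite big_nil.
  by rewrite big_nil /Rintegral integral0; split => //; exact: integrable0.
under eq_Rintegral do rewrite big_cons.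
under [X in _ /\ integrable _ _ X]eq_fun do rewrite /= big_cons.
rewrite big_cons RintegralD// IH1; split => //.
exact: (integrableD measurableT (iF i) IH2).
Qed.

Lemma cvg_sum_seq (I : Type) (s : seq I) (F : I -> nat -> R) (l : I -> R) :
  (forall i, F i k @[k --> \oo] --> l i) ->
  \sum_(i <- s) F i k @[k --> \oo] --> \sum_(i <- s) l i.
Proof.
move=> Fl; elim: s => [|i s IH].
  by rewrite big_nil; under eq_fun do rewrite big_nil; exact: cvg_cst.
by rewrite big_cons; under eq_fun do rewrite big_cons; exact: cvgD.
Qed.

(** At a fixed width the transforms multiply and the bound on the symbols is applied pointwise in
    frequency; [spectral_form_le] then handles f. Letting the width tend to 0 recovers the L^2 norms
    of the convolutions, and the common factor, the integral of [cosT gam], is cancelled. *)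
Lemma square_sum_smear (I : Type) (s : seq I) (K : I -> T -> R) gam f (B : R) :
  bounded_integrable lam gam -> (forall xi, 0 <= gam xi) ->
  bounded_integrable lam (cosT gam) -> (forall xi, 0 <= cosT gam xi) ->
  0 < \int[lam]_xi cosT gam xi ->
  bounded_integrable lam f -> (forall i, bounded_integrable lam (K i)) ->
  (forall i x, K i (- x) = K i x) -> (forall i, continuous (smear lam f id (K i))) ->
  (forall xi, \sum_(i <- s) cosT (K i) xi ^+ 2 <= B) ->
  \sum_(i <- s) \int[lam]_x (smear lam f id (K i) x) ^+ 2 <= B * \int[lam]_x f x ^+ 2.
Proof.
move=> bg g0 bG G0 c0 bf bK KN cK KB; have [_ _ iff] := bf.
have mid : measurable_fun setT (@id T) by [].
have bu i := smear_bounded_integrable iff mid (bK i).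
set c := \int[lam]_xi cosT gam xi in c0.
rewrite -(ler_pM2l c0) mulr_sumr mulrCA.
have Qc := @cvg_sum_seq _ s _ _ (fun i => spectral_form_cvg bg bG G0 (bu i) (cK i)).
apply: (ler_cvg_to Qc (cvg_cst (B * (c * \int[lam]_x f x ^+ 2)))).
apply: nearW => k; have k0 : 0 < k.+1%:R^-1 :> R by [].
have bgk := bounded_integrable_dilate k0 bg.
have isp (u : T -> R) : bounded_integrable lam u -> lam.-integrable setT (EFin \o (fun xi =>
    gam (k.+1%:R^-1 *: xi) * (cosT u xi ^+ 2 + sinT u xi ^+ 2))).
  by move=> [_ _ iu]; exact: integrable_spectral.
have [<- isum] := Rintegral_sum s (fun i => isp _ (bu i)).
apply: (@le_trans _ _ (\int[lam]_xi (B * (gam (k.+1%:R^-1 *: xi) * (cosT f xi ^+ 2 + sinT f xi ^+ 2))))).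
  apply: le_Rintegral => //; first exact: (integrableZl measurableT _ (isp _ bf)).
  move=> xi _; rewrite -mulr_sumr mulrCA ler_wpM2l//.
  apply: (@le_trans _ _ (\sum_(i <- s) cosT (K i) xi ^+ 2 * (cosT f xi ^+ 2 + sinT f xi ^+ 2))).
    apply: ler_sum => i _; rewrite cosT_smear// sinT_smear//.
    have -> : \int[lam]_z (f z * cos (dot xi z)) = cosT f xi.
      by apply: eq_Rintegral => z _; rewrite mulrC.
    have -> : \int[lam]_z (f z * sin (dot xi z)) = sinT f xi.
      by apply: eq_Rintegral => z _; rewrite mulrC.
    by rewrite !exprMn -mulrDl mulrC.
  by rewrite -mulr_suml ler_wpM2r// addr_ge0// sqr_ge0.
rewrite RintegralZl//; last exact: isp.
have B0 : 0 <= B by apply: le_trans (KB 0); apply: sumr_ge0 => i _; exact: sqr_ge0.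
by rewrite ler_wpM2l//; exact: spectral_form_le.
Qed.

End square_sum.

(** * Kernels and a positive definite approximate identity *)

Section kernels.
Context {R : realType} (n : nat).
Notation T := 'rV[R]_n.
Notation lam := (@lebesgue_rV R n).
Implicit Types (f h H K : T -> R) (x y z xi : T).

(** A single constant serves as bound, Lipschitz constant and support radius, so that kernel
    operations have one number to track. *)
Definition kernel_bound H (C : R) := [/\ forall x, `|H x| <= C,
  forall x y, `|H x - H y| <= C * `|x - y| & forall x, C < `|x| -> H x = 0].

(** Neither positivity nor a normalisation is asked: the class is a vector space closed under
    convolution, and it contains the differences of kernels at two scales. *)
Definition mollifier H := (exists C, kernel_bound H C) /\ forall x, H (- x) = H x.

Lemma lipschitz_continuous_rV f (C : R) :
  (forall x y, `|f x - f y| <= C * `|x - y|) -> continuous f.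
Proof.
move=> fC x; apply/(@cvgrPdist_le _ _ _ (nbhs x) (nbhs_filter x)) => e e0.
have C0 : 0 < `|C| + 1 by rewrite ltr_wpDl.
have := @cvgr_dist_le _ _ _ (nbhs x) (nbhs_filter x) id x (@cvg_id _ (nbhs x)) _ (divr_gt0 e0 C0).
apply: filterS => y /= xy; rewrite (le_trans (fC x y))// (@le_trans _ _ ((`|C| + 1) * `|x - y|))//.
  by rewrite ler_wpM2r// (le_trans (ler_norm C))// lerDl.
by rewrite mulrC -ler_pdivlMr.
Qed.

Lemma kernel_bound_ge0 H C : kernel_bound H C -> 0 <= C.
Proof. by move=> [HC _ _]; apply: le_trans (HC 0). Qed.

Lemma kernel_boundS H C D : C <= D -> kernel_bound H C -> kernel_bound H D.
Proof.
move=> CD [HC HL HS]; split.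
- by move=> x; exact: le_trans (HC x) CD.
- by move=> x y; rewrite (le_trans (HL x y))// ler_wpM2r.
- by move=> x Dx; apply: HS; exact: le_lt_trans CD Dx.
Qed.

Lemma integrable_cube (C : R) : 0 <= C ->
  lam.-integrable setT (EFin \o (fun x => (`|x| <= C)%R%:R)).
Proof.
move=> C0; apply/integrableP; split; first by apply/measurable_EFinP; mfun.
have -> : (\int[lam]_x `|((fun x => (`|x| <= C)%R%:R) x)%:E| = lam (cube C))%E.
  rewrite -measure_integral_indic; last exact: measurable_cube.
  apply: eq_integral => x _; rewrite indicE /= ger0_norm//; congr (_%:R%:E); congr nat_of_bool.
  by apply/idP/idP; rewrite inE.
apply: (@le_lt_trans _ _ ((2 * C) ^+ n)%:E); last exact: ltry.
by rewrite le_eqVlt; apply/orP; left; apply/eqP; exact: lebesgue_cube.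
Qed.

Lemma integrable_bounded_support f (C D : R) : measurable_fun setT f ->
  (forall x, `|f x| <= C) -> (forall x, D < `|x| -> f x = 0) ->
  lam.-integrable setT (EFin \o f).
Proof.
move=> mf fC fD.
rewrite (_ : f = fun x => f x * (`|x| <= `|D|)%R%:R).
  by apply: (integrable_mul_bounded (M := C)) => //; exact: integrable_cube.
apply/funext => x; case: leP; rewrite ?mulr1// mulr0 => Dx.
by rewrite fD// (le_lt_trans (ler_norm D)).
Qed.

Lemma kernel_continuous H : mollifier H -> continuous H.
Proof. by move=> [[C [_ HL _]] _]; exact: lipschitz_continuous_rV HL. Qed.

Lemma kernel_bounded_integrable H : mollifier H -> bounded_integrable lam H.
Proof.
move=> kH; have mH : measurable_fun setT H.
  by apply: continuous_rV_measurable; exact: kernel_continuous.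
have [[C [HC HL HS]] _] := kH; split => //; first by exists C.
exact: integrable_bounded_support mH HC HS.
Qed.

Lemma smear_lipschitz H (C : R) d (Y : measurableType d)
    (nu : {sigma_finite_measure set Y -> \bar R}) (h : Y -> R) (phi : Y -> T) :
  nu.-integrable setT (EFin \o h) -> measurable_fun setT phi ->
  bounded_integrable lam H -> (forall x y, `|H x - H y| <= C * `|x - y|) ->
  forall x y, `|smear nu h phi H x - smear nu h phi H y| <=
    (C * \int[nu]_z `|h z|) * `|x - y|.
Proof.
move=> ih mphi bH HL x y; have mH : measurable_fun setT H by case: bH.
have mh := integrable_measurable ih.
rewrite /smear -RintegralB//; [|exact: smear_slice_integrable..].
rewrite mulrAC -RintegralZl//; last exact: integrable_normr.
apply: normr_Rintegral_le.
- exact: (integrableZl measurableT (C * `|x - y|) (integrable_normr ih)).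
- by mfun.
- move=> z; rewrite -mulrBr normrM mulrC ler_wpM2r// (le_trans (HL _ _))//.
  by rewrite opprB addrA subrK.
Qed.

Lemma smear_continuous f H : bounded_integrable lam f -> mollifier H ->
  continuous (smear lam f id H).
Proof.
move=> [_ _ iff] kH; have bH := kernel_bounded_integrable kH.
have [[C [_ HL _]] _] := kH.
have mid : measurable_fun setT (@id T) by [].
exact: (lipschitz_continuous_rV (smear_lipschitz iff mid bH HL)).
Qed.

Lemma kernel_smear h (phi : T -> T) H (D : R) : lam.-integrable setT (EFin \o h) ->
  measurable_fun setT phi -> (forall z, h (- z) = h z) ->
  (forall z, phi (- z) = - phi z) -> (forall z, D < `|phi z| -> h z = 0) ->
  mollifier H -> mollifier (smear lam h phi H).
Proof.
move=> ih mphi hN phiN hD kH; have bH := kernel_bounded_integrable kH.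
have mH : measurable_fun setT H by case: bH.
have mh := integrable_measurable ih.
have [[C [HC HL HS]] HN] := kH; have C0 : 0 <= C by apply: le_trans (HC 0).
set I := \int[lam]_z `|h z|; have I0 : 0 <= I by apply: Rintegral_ge0.
have CI0 : 0 <= C * I by rewrite mulr_ge0.
split.
- exists (C * I + (C + `|D|)); split.
  + move=> x; apply: (@le_trans _ _ (C * I)); last by rewrite lerDl addr_ge0.
    rewrite /I -RintegralZl//; last exact: integrable_normr.
    apply: normr_Rintegral_le.
    * exact: (integrableZl measurableT C (integrable_normr ih)).
    * by mfun.
    * by move=> z; rewrite normrM mulrC ler_wpM2r.
  + move=> x y; rewrite (le_trans (smear_lipschitz ih mphi bH HL x y))// -/I.
    by rewrite ler_wpM2r// lerDl addr_ge0.
  + move=> x Cx; rewrite /smear.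
    have CDx : C + `|D| < `|x| by rewrite (le_lt_trans _ Cx)// lerDr.
    under eq_Rintegral => z _.
      rewrite (_ : _ * _ = 0); first over.
      have [zD|Dz] := leP `|phi z| D; last by rewrite hD// mul0r.
      rewrite HS ?mulr0//; have := lerB_dist x (phi z).
      by apply: lt_le_trans; have := ler_norm D; lra.
    by rewrite /Rintegral integral0.
- move=> x; rewrite /smear -[LHS]Rintegral_rVN; last by mfun.
  by apply: eq_Rintegral => z _; rewrite hN phiN -(HN (x - phi z)) opprD.
Qed.

Lemma kernel0 : mollifier (fun=> 0).
Proof.
by split => //; exists 0; split => // x => [|y]; rewrite ?subrr normr0 ?mul0r.
Qed.

Lemma kernelD H K : mollifier H -> mollifier K -> mollifier (fun x => H x + K x).
Proof.
move=> [[C kH] HN] [[D kK] KN]; split; last by move=> x; rewrite HN KN.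
have C0 := kernel_bound_ge0 kH; have D0 := kernel_bound_ge0 kK.
move: kH kK => [HC HL HS] [KD KL KS]; exists (C + D); split.
- by move=> x; rewrite (le_trans (ler_normD _ _))// lerD.
- move=> x y; rewrite (_ : _ - _ = (H x - H y) + (K x - K y)); last by ring.
  by rewrite (le_trans (ler_normD _ _))// mulrDl lerD.
- by move=> x CDx; rewrite HS ?KS ?addr0// (le_lt_trans _ CDx)// ?lerDr ?lerDl.
Qed.

Lemma kernelZ (a : R) H : mollifier H -> mollifier (fun x => a * H x).
Proof.
move=> [[C kH] HN]; split; last by move=> x; rewrite HN.
have C0 := kernel_bound_ge0 kH; move: kH => [HC HL HS].
exists (`|a| * C + C); split.
- by move=> x; rewrite normrM (@le_trans _ _ (`|a| * C)) ?ler_wpM2l ?lerDl.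
- move=> x y; rewrite -mulrBr normrM mulrDl -mulrA.
  by rewrite (@le_trans _ _ (`|a| * (C * `|x - y|))) ?ler_wpM2l// lerDl mulr_ge0.
- by move=> x Cx; rewrite HS ?mulr0// (le_lt_trans _ Cx)// lerDr mulr_ge0.
Qed.

Lemma kernel_dilate (e : R) H : 0 < e -> mollifier H -> mollifier (fun x => H (e *: x)).
Proof.
move=> e0 [[C kH] HN]; split; last by move=> x; rewrite scalerN HN.
have C0 := kernel_bound_ge0 kH; move: kH => [HC HL HS].
have Ce0 : 0 <= C * e by rewrite mulr_ge0// ltW.
have Ce1 : 0 <= C / e by rewrite divr_ge0// ltW.
exists (C + C * e + C / e); split.
- by move=> x; rewrite (le_trans (HC _))// -addrA lerDl addr_ge0.
- move=> x y; rewrite (le_trans (HL _ _))// -scalerBr normrZ gtr0_norm// mulrA.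
  by rewrite ler_wpM2r//; lra.
- move=> x Cx; rewrite HS// normrZ gtr0_norm// -ltr_pdivrMl// mulrC.
  by apply: le_lt_trans Cx; lra.
Qed.

End kernels.

Section bump.
Context {R : realType} (n : nat).
Notation T := 'rV[R]_n.
Notation lam := (@lebesgue_rV R n).
Implicit Types (f g h H K : T -> R) (x y z xi : T).

Lemma Rintegral_cube (C : R) : 0 <= C ->
  \int[lam]_x ((`|x| <= C)%R%:R : R) = (2 * C) ^+ n.
Proof.
move=> C0; rewrite /Rintegral.
suff -> : (\int[lam]_x ((`|x| <= C)%R%:R : R)%:E = lam (cube C))%E.
  have -> : lam (cube C) = ((2 * C) ^+ n)%:E by exact: lebesgue_cube.
  by [].
rewrite -measure_integral_indic; last exact: measurable_cube.
apply: eq_integral => x _; rewrite indicE; congr (_%:R%:E); congr nat_of_bool.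
by apply/idP/idP; rewrite inE.
Qed.

Definition tent (x : T) : R := Num.max 0 (1 - `|x|).

Lemma tent_ge0 x : 0 <= tent x. Proof. by rewrite /tent le_max lexx. Qed.

Lemma kernel_tent : mollifier tent.
Proof.
split; last by move=> x; rewrite /tent normrN.
exists 1; split.
- by move=> x; have := normr_ge0 x; rewrite /tent maxEle; case: ifP => h; rewrite ler_norml; lra.
- move=> x y; rewrite mul1r.
  have : `| `|x| - `|y| | <= `|x - y| by exact: ler_dist_dist.
  rewrite /tent !maxEle; case: ifP => h1; case: ifP => h2; rewrite !ler_norml; lra.
- by move=> x x1; rewrite /tent; apply/max_idPl; lra.
Qed.

Lemma Rintegral_tent_gt0 : 0 < \int[lam]_x tent x.
Proof.
have ic : lam.-integrable setT (EFin \o (fun x => (`|x| <= 2^-1)%R%:R)) by exact: integrable_cube.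
have [_ _ it] := kernel_bounded_integrable kernel_tent.
apply: (@lt_le_trans _ _ (\int[lam]_x (2^-1 * (`|x| <= 2^-1)%R%:R))).
  by rewrite RintegralZl// Rintegral_cube// mulr_gt0// exprn_gt0// mulr_gt0.
apply: le_Rintegral => //; first exact: (integrableZl measurableT 2^-1 ic).
move=> x _; case: (leP `|x| 2^-1) => h; last by rewrite mulr0 tent_ge0.
by rewrite mulr1 /tent le_max; apply/orP; right; lra.
Qed.

Definition bump (x : T) : R := (\int[lam]_y tent y)^-1 * tent x.

Lemma bump_ge0 x : 0 <= bump x.
Proof. by rewrite mulr_ge0 ?tent_ge0// invr_ge0 ltW// Rintegral_tent_gt0. Qed.

Lemma kernel_bump : mollifier bump.
Proof. exact: kernelZ kernel_tent. Qed.

Let ibump : lam.-integrable setT (EFin \o bump).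
Proof. by case: (kernel_bounded_integrable kernel_bump). Qed.

Lemma Rintegral_bump : \int[lam]_x bump x = 1.
Proof.
rewrite RintegralZl//; last by case: (kernel_bounded_integrable kernel_tent).
by rewrite mulVf// gt_eqF// Rintegral_tent_gt0.
Qed.

Lemma bump_support x : 1 < `|x| -> bump x = 0.
Proof. by move=> x1; rewrite /bump /tent (max_idPl _) ?mulr0//; lra. Qed.

Lemma cosT_bump_le1 xi : `|cosT bump xi| <= 1.
Proof.
rewrite (le_trans (cosT_le xi ibump))// -Rintegral_bump.
by under eq_Rintegral do rewrite ger0_norm ?bump_ge0//.
Qed.

Lemma normr_sin_le (a : R) : `|sin a| <= `|a|.
Proof.
wlog a0 : a / 0 <= a => [hw|].
  have [/hw//|a0] := leP 0 a.
  by rewrite -[a]opprK sinN normrN [X in _ <= X]normrN hw// oppr_ge0 ltW.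
have [|c _] := @MVT_segment R sin cos 0 a a0.
  by apply: continuous_subspaceT => x; exact: continuous_sin.
rewrite sin0 !subr0 => ->.
by rewrite normrM ler_piMl// cos_max.
Qed.

Lemma one_sub_cos_le (a : R) : 1 - cos a <= a ^+ 2.
Proof.
have -> : a = (a / 2) *+ 2 by rewrite -mulr_natr divfK.
rewrite cos_mulr2n cos2sin2 -mulr_natr.
have : sin (a / 2) ^+ 2 <= (a / 2) ^+ 2.
  rewrite -(real_normK (num_real (sin _))) -(real_normK (num_real (a / 2))).
  by rewrite lerXn2r ?nnegrE// normr_sin_le.
set s := sin _ ^+ 2; rewrite -mulr_natr; nra.
Qed.

Lemma cosT_bump_low xi : 1 - cosT bump xi <= (n%:R * enorm xi) ^+ 2.
Proof.
rewrite -{1}Rintegral_bump -RintegralB//; last exact: integrable_cos.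
rewrite -[leRHS]mulr1 -[X in _ <= _ * X]Rintegral_bump -RintegralZl//.
apply: le_Rintegral => //.
- exact: (integrableB measurableT ibump (integrable_cos xi ibump)).
- exact: (integrableZl measurableT _ ibump).
move=> x _; rewrite -{1}[bump x]mul1r -mulrBl.
have [x1|x1] := leP `|x| 1; last by rewrite bump_support ?mulr0.
rewrite ler_wpM2r ?bump_ge0// (le_trans (one_sub_cos_le _))//.
rewrite -(real_normK (num_real (dot _ _))) lerXn2r ?nnegrE ?mulr_ge0 ?enorm_ge0//.
by rewrite (le_trans (dot_le _ _))// ler_piMr// mulr_ge0// enorm_ge0.
Qed.

(** Shifting by half a period changes the sign of the cosine. Twice the transform is therefore the
    transform of a difference bump x - bump (x + h), which is O(|h|) by the Lipschitz bound and
    lives on a fixed cube. *)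
Lemma cosT_bump_decay : exists2 C, 0 <= C & forall xi, `|cosT bump xi| * (1 + enorm xi) <= C.
Proof.
have [[L kL] _] := kernel_bump; have L0 := kernel_bound_ge0 kL; have [_ HL _] := kL.
pose V : R := (2 * (1 + pi)) ^+ n.
have pi0 : 0 <= pi :> R by exact: pi_ge0.
have V0 : 0 <= V by rewrite exprn_ge0// mulr_ge0// addr_ge0.
exists (2 + 2 * (L * pi * V)) => [|xi].
  by rewrite addr_ge0// mulr_ge0// mulr_ge0// mulr_ge0.
have c1 := cosT_bump_le1 xi; have e0 := enorm_ge0 xi.
have LpV : 0 <= L * pi * V by rewrite !mulr_ge0.
have [xi1|xi1] := ltP (enorm xi) 1.
  apply: (@le_trans _ _ (1 * 2)); last by rewrite mul1r lerDl mulr_ge0.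
  by rewrite ler_pM// ?addr_ge0//; lra.
suff : `|cosT bump xi| * enorm xi <= L * pi * V.
  move=> h; rewrite mulrDr mulr1; apply: (@le_trans _ _ (1 + L * pi * V)); first exact: lerD.
  by lra.
have e1 : 0 < enorm xi by rewrite (lt_le_trans _ xi1).
(* Chosen so that the inner product of xi and h is pi, while |h| <= pi/|xi|. *)
pose h : T := (pi / enorm xi ^+ 2) *: xi.
have hn : `|h| <= pi / enorm xi.
  rewrite (le_trans (rVnorm_le_enorm _))// enormZ ger0_norm ?divr_ge0 ?exprn_ge0//.
  by rewrite expr2 invfM mulrA divfK ?gt_eqF.
have hpi : pi / enorm xi <= pi by rewrite ler_pdivrMr// ler_peMr.
have ih := integrable_rV_translation h ibump.
have mb := integrable_measurable ibump.
have sh : cosT bump xi = - cosT (fun x => bump (x + h)) xi.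
  rewrite {1}/cosT -[LHS](@Rintegral_rV_translation _ _ _ h); last first.
    by apply: measurable_funM => //; exact: measurable_cos_dot.
  rewrite /cosT -mulN1r -RintegralZl//; last exact: (integrable_cos xi ih).
  apply: eq_Rintegral => x _; rewrite dotDr dotZr dotxx divfK ?gt_eqF ?exprn_gt0//.
  by rewrite cosDpi; ring.
have two : cosT bump xi *+ 2 = \int[lam]_x (cos (dot xi x) * (bump x - bump (x + h))).
  rewrite mulr2n {2}sh /cosT -RintegralB//; [|exact: integrable_cos..].
  by apply: eq_Rintegral => x _; rewrite mulrBr.
have ic : lam.-integrable setT (EFin \o (fun x => (`|x| <= 1 + pi)%R%:R)).
  by apply: integrable_cube; rewrite addr_ge0.
have : `|cosT bump xi *+ 2| <= \int[lam]_x (L * `|h| * (`|x| <= 1 + pi)%R%:R).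
  rewrite two; apply: normr_Rintegral_le.
  - exact: (integrableZl measurableT _ ic).
  - by apply: measurable_funM; [exact: measurable_cos_dot|mfun].
  - move=> x; rewrite normrM.
    apply: (@le_trans _ _ `|bump x - bump (x + h)|); first by rewrite ler_piMl// cos_max.
    case: (leP `|x| (1 + pi)) => xpi; rewrite ?mulr1 ?mulr0.
      by rewrite (le_trans (HL _ _))// opprD addrA subrr sub0r normrN.
    rewrite !bump_support ?subrr ?normr0//; last by lra.
    have := lerB_dist x (- h); rewrite opprK normrN.
    by apply: lt_le_trans; lra.
rewrite RintegralZl//.
rewrite Rintegral_cube; last by rewrite addr_ge0.
rewrite -/V => H2.
have H3 : `|cosT bump xi| <= `|cosT bump xi *+ 2|.
  by rewrite normrMn mulr2n lerDl.
apply: (@le_trans _ _ (L * `|h| * V * enorm xi)).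
  by rewrite ler_wpM2r// (le_trans H3).
have hne : `|h| * enorm xi <= pi by rewrite -ler_pdivlMr.
rewrite (_ : L * `|h| * V * enorm xi = L * V * (`|h| * enorm xi)); last by ring.
by rewrite (_ : L * pi * V = L * V * pi) ?ler_wpM2l ?mulr_ge0//; ring.
Qed.

Fixpoint conv_power (k : nat) : T -> R :=
  if k is k'.+1 then smear lam bump id (conv_power k') else bump.

Lemma kernel_conv h H : mollifier h -> mollifier H -> mollifier (smear lam h id H).
Proof.
move=> kh kH; have [_ _ ih] := kernel_bounded_integrable kh.
have [[C [_ _ hC]] hN] := kh; have mid : measurable_fun setT (@id T) by [].
exact: (kernel_smear (D := C) ih mid).
Qed.

Lemma cosT_conv h H xi : mollifier h -> mollifier H ->
  cosT (smear lam h id H) xi = cosT h xi * cosT H xi.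
Proof.
move=> kh kH; have [_ _ ih] := kernel_bounded_integrable kh.
have mid : measurable_fun setT (@id T) by [].
rewrite cosT_smear//; [|exact: kernel_bounded_integrable|by case: kH].
by congr (_ * _); apply: eq_Rintegral => z _; rewrite mulrC.
Qed.

Lemma kernel_conv_power k : mollifier (conv_power k).
Proof.
by elim: k => [|k IH] /=; [exact: kernel_bump|exact: kernel_conv kernel_bump IH].
Qed.

Lemma cosT_conv_power k xi : cosT (conv_power k) xi = cosT bump xi ^+ k.+1.
Proof.
elim: k => [|k IH] /=; first by rewrite expr1.
rewrite cosT_conv ?IH ?exprS//; [exact: kernel_bump|exact: kernel_conv_power].
Qed.

Lemma conv_power_ge0 k x : 0 <= conv_power k x.
Proof.
elim: k x => [|k IH] x /=; first exact: bump_ge0.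
by apply: Rintegral_ge0 => z _; rewrite mulr_ge0 ?bump_ge0.
Qed.

(** In polar coordinates the radial integrand n r^(n-1)/(1+r)^(n+1) is at most n for r <= 1 and at
    most n r^(-2) beyond, so its integral is at most 2 n. *)
Lemma integrable_inv_polynomial (hn : (0 < n)%N) :
  lam.-integrable setT (EFin \o (fun x => ((1 + enorm x) ^+ n.+1)^-1)).
Proof.
have m1 : measurable_fun setT (fun x : T => ((1 + enorm x) ^+ n.+1)^-1).
  apply: measurable_inv_ge0; last by mfun.
  by move=> x; rewrite exprn_ge0// addr_ge0// enorm_ge0.
have p0 (x : T) : 0 <= ((1 + enorm x) ^+ n.+1)^-1.
  by rewrite invr_ge0 exprn_ge0// addr_ge0// enorm_ge0.
apply/integrableP; split; first exact/measurable_EFinP.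
have mne : measurable_fun setT (fun x : T => ((1 + enorm x) ^+ n.+1)^-1 * (0 < enorm x)%R%:R).
  by apply: measurable_funM => //; mfun.
under eq_integral => x _ do rewrite /= ger0_norm//.
rewrite ge0_integral_rV_neq0//; last exact/measurable_EFinP.
under eq_integral => x _ do rewrite -enorm_gt0 -EFinM.
rewrite ge0_integral_polar//; last 2 first.
- exact/measurable_EFinP.
- by move=> x; rewrite lee_fin mulr_ge0.
have mB : measurable_fun setT (fun w : T => (enorm w <= 1)%R%:R : R) by mfun.
apply: (@le_lt_trans _ _ (\int[lam]_w ((n%:R * 2)%:E * (enorm w <= 1)%R%:R%:E))%E).
  apply: ge0_le_integral_nomeas => w _.
    rewrite mule_ge0 ?lee_fin//; apply: integral_ge0 => r _.
    by rewrite -EFinM lee_fin; case: (ltP 0 r) => r0; rewrite ?mulr0 ?mul0r// mulr1 !mulr_ge0// exprn_ge0// ltW.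
  rewrite [leRHS]muleC lee_wpmul2l ?lee_fin//.
  apply: (@le_trans _ _ (\int[lebesgue_measure]_r (n%:R%:E *
     ((1 * r `^ (1 - 1) * ((0 < r)%R && (r <= 1)%R)%:R)%:E + (1 * r `^ (- 1 - 1) * (1 <= r)%R%:R)%:E)))%E).
    apply: ge0_le_integral_nomeas => r _.
      by rewrite -EFinM lee_fin; case: (ltP 0 r) => r0; rewrite ?mulr0 ?mul0r// mulr1 !mulr_ge0// exprn_ge0// ltW.
    rewrite -EFinM -EFinD -EFinM lee_fin.
    have q0 : 0 <= 1 * r `^ (1 - 1) * ((0 < r)%R && (r <= 1)%R)%:R + 1 * r `^ (- 1 - 1) * (1 <= r)%R%:R.
      by rewrite addr_ge0// !mulr_ge0// powR_ge0.
    have [r0|r0] := ltP 0 r; last by rewrite mulr0 mul0r mulr_ge0// addr_ge0// !mulr_ge0// powR_ge0.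
    have [ew|ew] := ltP 0 (enorm (r *: dir w)); last by rewrite !mulr0 mulr_ge0// addr_ge0// !mulr_ge0// powR_ge0.
    have -> : enorm (r *: dir w) = r.
      rewrite enormZ gtr0_norm// enorm_dir ?mulr1//.
      by apply: contraTneq ew => ->; rewrite /dir scaler0 scaler0 enorm0 ltxx.
    rewrite !mulr1 subrr powRr0 !mul1r -(mulrA n%:R); apply: ler_wpM2l => //.
    have rp : 0 < (1 + r) ^+ n.+1 by rewrite exprn_gt0// addr_gt0.
    have [r1|r1] := leP r 1 => /=.
      apply: (@le_trans _ _ 1); last by rewrite lerDl mulr_ge0// powR_ge0.
      rewrite ler_pdivrMr// mul1r (@le_trans _ _ 1)//.
        by rewrite exprn_ile1// ltW.
      by rewrite exprn_ege1// lerDl ltW.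
    rewrite add0r (ltW r1) mulr1.
    rewrite (_ : - 1 - 1 = - 2%:R); last by lra.
    rewrite powRN powR_mulrn ?(ltW r0)// ler_pdivrMr// mulrC ler_pdivlMr ?exprn_gt0//.
    rewrite -exprD addn2 prednK// lerXn2r ?nnegrE ?addr_ge0 ?(ltW r0)//.
    by rewrite lerDr.
  have m2 : measurable_fun setT (fun r : R => (1 * r `^ (1 - 1) * ((0 < r)%R && (r <= 1)%R)%:R)%:E).
    by mfun.
  have m3 : measurable_fun setT (fun r : R => (1 * r `^ (- 1 - 1) * (1 <= r)%R%:R)%:E) by mfun.
  have g2 (r : R) : (0 <= (1 * r `^ (1 - 1) * ((0 < r)%R && (r <= 1)%R)%:R)%:E)%E.
    by rewrite lee_fin !mulr_ge0// powR_ge0.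
  have g3 (r : R) : (0 <= (1 * r `^ (- 1 - 1) * (1 <= r)%R%:R)%:E)%E.
    by rewrite lee_fin !mulr_ge0// powR_ge0.
  rewrite ge0_integralZl//; last 2 first.
  - exact: emeasurable_funD.
  - by move=> r _; rewrite adde_ge0.
  rewrite ge0_integralD// integral_powR_below// integral_powR_above//.
  by rewrite !powR1 -EFinD -EFinM lee_fin.
rewrite ge0_integralZl//; last exact/measurable_EFinP.
rewrite lte_mul_pinfty ?lee_fin//.
have -> : (\int[lam]_w (enorm w <= 1)%R%:R%:E = lam (@eball R n 1))%E.
  rewrite -measure_integral_indic; last exact: measurable_eball.
  apply: eq_integral => x _; rewrite indicE; congr (_%:R%:E); congr nat_of_bool.
  by apply/idP/idP; rewrite inE.
exact: lebesgue_eball_lty.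
Qed.

End bump.

Section approximate_identity.
Context {R : realType} (n : nat).
Notation T := 'rV[R]_n.
Notation lam := (@lebesgue_rV R n).
Implicit Types (f g h H K : T -> R) (x y z xi : T).

Lemma cosTD f g xi : lam.-integrable setT (EFin \o f) -> lam.-integrable setT (EFin \o g) ->
  cosT (fun x => f x + g x) xi = cosT f xi + cosT g xi.
Proof.
move=> intf intg; rewrite /cosT -RintegralD//; [|exact: integrable_cos..].
by apply: eq_Rintegral => x _; rewrite mulrDr.
Qed.

Lemma cosTZ (a : R) f xi : lam.-integrable setT (EFin \o f) ->
  cosT (fun x => a * f x) xi = a * cosT f xi.
Proof.
move=> intf; rewrite /cosT -RintegralZl//; last exact: integrable_cos.
by apply: eq_Rintegral => x _; rewrite mulrCA.
Qed.

Lemma one_sub_expr_le (a : R) k : 0 <= a -> a <= 1 -> 1 - a ^+ k <= k%:R * (1 - a).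
Proof.
move=> a0 a1; elim: k => [|k IH]; first by rewrite expr0 subrr mul0r.
have ak : 0 <= a ^+ k <= 1 by rewrite exprn_ge0// exprn_ile1.
by rewrite exprS -natr1; nra.
Qed.

(** An even convolution power of [bump] has a nonnegative transform, and the decay of order one of
    [cosT bump] becomes integrable once enough factors are taken. *)
Lemma kernel_positive_definite (hn : (0 < n)%N) : exists g : T -> R,
  [/\ mollifier g /\ (forall x, 0 <= g x), forall xi, 0 <= cosT g xi <= 1,
      exists2 A, 0 <= A & forall xi, 1 - cosT g xi <= A * enorm xi ^+ 2,
      bounded_integrable lam (cosT g) & 0 < \int[lam]_xi cosT g xi].
Proof.
(* There are 2 (n + 1) factors, since [conv_power k] has k + 1 of them. The transform is the
   (n+1)-st power of a square, at most a multiple of (1 + |xi|)^(-(n+1)). *)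
pose m := n.+1; pose g := @conv_power R n (m.*2).-1.
have gE xi : cosT g xi = (cosT (@bump R n) xi ^+ 2) ^+ m.
  by rewrite /g cosT_conv_power prednK// -mul2n exprM.
have b1 xi : 0 <= cosT (@bump R n) xi ^+ 2 <= 1.
  rewrite sqr_ge0 -(real_normK (num_real (cosT _ _))) exprn_ile1//.
  exact: cosT_bump_le1.
have g01 xi : 0 <= cosT g xi <= 1.
  by have /andP[h1 h2] := b1 xi; rewrite gE exprn_ge0// exprn_ile1.
(* With b the transform of [bump], 1 - b^(2m) <= m (1 - b^2) <= 2 m (1 - b), and 1 - b is at most (n
   |xi|)^2. *)
pose A : R := m%:R * (2 * n%:R ^+ 2).
have A0 : 0 <= A by rewrite !mulr_ge0// exprn_ge0.
have gA xi : 1 - cosT g xi <= A * enorm xi ^+ 2.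
  have /andP[h1 h2] := b1 xi; rewrite gE (le_trans (one_sub_expr_le m h1 h2))//.
  rewrite /A -[leRHS]mulrA ler_wpM2l//.
  have := cosT_bump_low xi; have := cosT_bump_le1 xi; rewrite exprMn ler_norml.
  by set c := cosT _ xi; set N := _ * _ => /andP[c1 c2] cN; rewrite -mulrA -/N; have := sqr_ge0 (1 - c); lra.
have kg : mollifier g by exact: kernel_conv_power.
have mg : measurable_fun setT (cosT g).
  by apply: measurable_cosT; case: (kernel_bounded_integrable kg).
have ig : lam.-integrable setT (EFin \o cosT g).
  have [C C0 hC] := @cosT_bump_decay R n.
  apply: (le_integrable measurableT _ _
    (integrableZl measurableT (C ^+ n.+1) (@integrable_inv_polynomial R n hn))).
    exact/measurable_EFinP.
  move=> xi _ /=; have e1 : 0 < 1 + enorm xi by rewrite ltr_pwDl// enorm_ge0.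
  rewrite lee_fin gE ger0_norm; last by rewrite exprn_ge0// sqr_ge0.
  apply: le_trans (ler_norm _).
  rewrite ler_pdivlMr ?exprn_gt0// -exprMn; apply: lerXn2r => //; rewrite ?nnegrE.
    by apply: mulr_ge0; [exact: sqr_ge0|exact: ltW].
  apply: le_trans (hC xi); apply: ler_wpM2r; first exact: ltW.
  rewrite -(real_normK (num_real (cosT _ _))) expr2 ler_piMr//.
  exact: cosT_bump_le1.
exists g; split => //.
- by split => // x; exact: conv_power_ge0.
- by exists A.
- split => //; exists 1 => xi; have /andP[h1 h2] := g01 xi.
  by rewrite ger0_norm.
(* Small enough that A |x|^2 <= A n d <= 1/2 on the cube of half-side d, where the transform is
   therefore at least 1/2. *)
pose d : R := (2 * (A * n%:R + 1))^-1.
have An0 : 0 <= A * n%:R by rewrite mulr_ge0.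
have d0 : 0 < d by rewrite invr_gt0 mulr_gt0// ltr_wpDl.
have dA : 2 * (A * n%:R + 1) * d = 1 by rewrite mulfV// gt_eqF// mulr_gt0// ltr_wpDl.
have d1 : d <= 1 by rewrite invf_le1 ?mulr_gt0 ?ltr_wpDl//; lra.
have ic : lam.-integrable setT (EFin \o (fun x => (`|x| <= d)%R%:R)).
  by apply: integrable_cube; exact: ltW.
apply: (@lt_le_trans _ _ (\int[lam]_x (2^-1 * (`|x| <= d)%R%:R))).
  by rewrite RintegralZl// Rintegral_cube ?(ltW d0)// mulr_gt0// exprn_gt0// mulr_gt0.
apply: le_Rintegral => //; first exact: (integrableZl measurableT 2^-1 ic).
move=> x _; have /andP[h1 h2] := g01 x.
case: (leP `|x| d) => xd; last by rewrite mulr0.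
rewrite mulr1; have := gA x; have := enorm_sqr_le_rVnorm x.
have xx : `|x| ^+ 2 <= d.
  by rewrite expr2 (le_trans (ler_pM _ _ xd xd))// ler_piMr// ltW.
move=> e1 e2; have : A * enorm x ^+ 2 <= A * (n%:R * d).
  by rewrite ler_wpM2l// (le_trans e1)// ler_wpM2l.
by move: e2; rewrite mulrA; lra.
Qed.

(** This is 1 - (1 - g)^N in the convolution algebra, expanded so that the missing unit never
    appears. It raises the order of vanishing of 1 - [cosT] at frequency 0 from 2 to 2 N. *)
Fixpoint residual_kernel g (N : nat) : T -> R :=
  if N is N'.+1 then
    fun x => g x + (residual_kernel g N' x + (-1) * smear lam g id (residual_kernel g N') x)
  else fun=> 0.

Lemma kernel_residual g N : mollifier g -> mollifier (residual_kernel g N).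
Proof.
move=> kg; elim: N => [|N IH] /=; first exact: kernel0.
by apply: kernelD => //; apply: kernelD => //; apply: kernelZ; exact: kernel_conv.
Qed.

Lemma kernel_integrable g : mollifier g -> lam.-integrable setT (EFin \o g).
Proof. by move=> /kernel_bounded_integrable[]. Qed.

Lemma cosT_residual g N xi : mollifier g ->
  1 - cosT (residual_kernel g N) xi = (1 - cosT g xi) ^+ N.
Proof.
move=> kg; elim: N => [|N IH] /=.
  rewrite expr0 /cosT; under eq_Rintegral do rewrite mulr0.
  by rewrite /Rintegral integral0 subr0.
have kN := kernel_residual N kg; have kc := kernel_conv kg kN.
rewrite cosTD; [|exact: kernel_integrable|]; last first.
  by apply: kernel_integrable; apply: kernelD => //; exact: kernelZ.
rewrite cosTD; [|exact: kernel_integrable|by apply: kernel_integrable; exact: kernelZ].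
rewrite cosTZ; last exact: kernel_integrable.
by rewrite cosT_conv// exprS -IH; ring.
Qed.

End approximate_identity.

(** * Decay of the Fourier transform of the sphere *)

Section bracket.
Context {R : realType}.
Notation leb := (@lebesgue_measure R).
Implicit Types (h r : R).

(* With [h = tan phi] these are the cosine and the sine of [phi]. *)
Definition bcos h : R := (Num.sqrt (1 + h ^+ 2))^-1.
Definition bsin h : R := h * bcos h.

Lemma oneD_sqr_gt0 h : 0 < 1 + h ^+ 2.
Proof. by rewrite ltr_pwDl// sqr_ge0. Qed.

Lemma bcos_gt0 h : 0 < bcos h.
Proof. by rewrite invr_gt0 sqrtr_gt0 oneD_sqr_gt0. Qed.

Lemma bcos_sqr h : bcos h ^+ 2 = (1 + h ^+ 2)^-1.
Proof. by rewrite exprVn sqr_sqrtr// ltW// oneD_sqr_gt0. Qed.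

Lemma bcos_sqr_mul h : (1 + h ^+ 2) * bcos h ^+ 2 = 1.
Proof. by rewrite bcos_sqr mulfV// gt_eqF// oneD_sqr_gt0. Qed.

Lemma bcos_le1 h : bcos h <= 1.
Proof.
have := bcos_sqr_mul h; have := bcos_gt0 h; have := sqr_ge0 (h * bcos h).
by rewrite exprMn => ? ? ?; rewrite -ler_sqr ?nnegrE//; [lra|exact: ltW].
Qed.

Lemma bsin_sqr h : bsin h ^+ 2 = 1 - bcos h ^+ 2.
Proof. by rewrite /bsin exprMn; have := bcos_sqr_mul h; lra. Qed.

Lemma bsin_le1 h : `|bsin h| <= 1.
Proof.
rewrite -ler_sqr ?nnegrE// real_normK ?num_real// bsin_sqr expr1n.
by have := sqr_ge0 (bcos h); lra.
Qed.

Lemma bcos_le h : bcos h * `|h| <= 1.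
Proof. by have := bsin_le1 h; rewrite /bsin normrM mulrC (gtr0_norm (bcos_gt0 h)). Qed.

Lemma is_derive_bcos h : is_derive h 1 bcos (- bsin h * bcos h ^+ 2).
Proof.
have s0 := oneD_sqr_gt0 h.
have d1 : is_derive h 1 (fun x => 1 + x ^+ 2) (2 * h).
  have := is_deriveD (is_derive_cst (1 : R) h 1) (is_deriveX 2 (is_derive_id h 1)) => /is_derive_eq.
  by apply; rewrite /GRing.scale/= expr1 mulr1 add0r.
have d2 : is_derive h 1 (Num.sqrt \o (fun x => 1 + x ^+ 2))
    ((2 * Num.sqrt (1 + h ^+ 2))^-1 * (2 * h)).
  by apply: is_derive1_comp; exact: is_derive1_sqrt.
have sn : (Num.sqrt \o (fun x => 1 + x ^+ 2)) h != 0 by rewrite /= gt_eqF// sqrtr_gt0.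
have := is_deriveV sn d2 => /is_derive_eq; apply.
rewrite /= /bsin /bcos /GRing.scale/=; field.
by rewrite gt_eqF// sqrtr_gt0.
Qed.

Lemma is_derive_bsin h : is_derive h 1 bsin (bcos h ^+ 3).
Proof.
have db := is_derive_bcos h.
have -> : bsin = (fun x : R => x) * bcos by apply/funext => x.
have := is_deriveM (is_derive_id h 1) db => /is_derive_eq; apply.
rewrite /GRing.scale/= mulr1 /bsin; have := bcos_sqr_mul h.
set c := bcos h => e.
transitivity (c * (1 - h ^+ 2 * c ^+ 2)); first by ring.
by rewrite (_ : 1 - _ = c ^+ 2); [ring|lra].
Qed.

Lemma is_derive_continuous (f : R -> R) (x a : R) : is_derive x 1 f a -> {for x, continuous f}.
Proof.
by move=> [df _]; apply: differentiable_continuous; exact/derivable1_diffP.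
Qed.

Lemma continuous_bcos : continuous bcos.
Proof. by move=> h; exact: is_derive_continuous (is_derive_bcos h). Qed.

Lemma continuous_bcosX j : continuous (fun h => bcos h ^+ j).
Proof.
move=> h; rewrite (_ : (fun h => _) = bcos ^+ j); last by apply/funext => x; rewrite !fctE.
exact: is_derive_continuous (is_deriveX j (is_derive_bcos h)).
Qed.

Lemma continuous_bsin : continuous bsin.
Proof. by move=> h; exact: is_derive_continuous (is_derive_bsin h). Qed.

Lemma measurable_bcos : measurable_fun setT bcos.
Proof. by apply: continuous_measurable_fun; exact: continuous_bcos. Qed.

Lemma measurable_bsin : measurable_fun setT bsin.
Proof. by apply: continuous_measurable_fun; exact: continuous_bsin. Qed.

Lemma integrable_bcos m : (2 <= m)%N -> leb.-integrable setT (EFin \o (fun h => bcos h ^+ m)).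
Proof.
have mb k : measurable_fun setT (EFin \o (fun h => bcos h ^+ k)).
  by apply/measurable_EFinP; apply: measurable_funX; exact: measurable_bcos.
have i2 : leb.-integrable setT (EFin \o (fun h => bcos h ^+ 2)).
  apply/integrableP; split; first exact: mb.
  under eq_integral => x _ do rewrite /= ger0_norm ?sqr_ge0//.
  rewrite ge0_symfun_integralT.
  - rewrite (_ : [set x | _] = `[0%R, +oo[%classic); last first.
      by apply/seteqP; split => x /=; rewrite in_itv/= andbT.
    have -> : (\int[leb]_(x in `[0%R, +oo[) (bcos x ^+ 2)%:E = (pi / 2)%:E)%E.
      by rewrite -integral0y_oneDsqr; apply: eq_integral => x _; rewrite bcos_sqr.
    by rewrite -EFinM ltry.
  - by move=> x; rewrite sqr_ge0.
  - exact: continuous_bcosX.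
  - by move=> x; rewrite /= !bcos_sqr sqrrN.
move=> m2; apply: (le_integrable measurableT _ _ i2); first exact: mb.
move=> x _ /=.
rewrite lee_fin !ger0_norm ?exprn_ge0 ?(ltW (bcos_gt0 x))//.
by rewrite ler_wiXn2l// ?bcos_le1// ltW// bcos_gt0.
Qed.

(** The fundamental theorem is applied on [-(k+1), k+1], and dominated convergence lets k grow; the
    boundary values of E disappear in the limit. *)
Lemma Rintegral_derive0 (E F : R -> R) : (forall x : R, is_derive x 1 E (F x)) ->
  continuous F -> leb.-integrable setT (EFin \o F) ->
  E k%:R @[k --> \oo] --> 0 -> E (- k%:R) @[k --> \oo] --> 0 ->
  \int[leb]_x F x = 0.
Proof.
move=> dE cF iF Ep Em; have mF := integrable_measurable iF.
pose G (k : nat) x := F x * (`|x| <= k.+1%:R)%R%:R.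
have mG k : measurable_fun setT (G k).
  rewrite /G; apply: measurable_funM => //.
  have mn : measurable_fun setT (fun x : R => `|x|) by exact: measurableT_comp.
  by mfun.
have GE k : \int[leb]_x G k x = E k.+1%:R - E (- k.+1%:R).
  have ab : - k.+1%:R < k.+1%:R :> R by rewrite gtrN.
  have H : (\int[leb]_(x in `[(- k.+1%:R)%R, k.+1%:R]) (F x)%:E =
      (E k.+1%:R)%:E - (E (- k.+1%:R))%:E)%E.
    apply: (continuous_FTC2 ab).
  - by apply: continuous_subspaceT => x; exact: cF.
  - split.
    + by move=> x _; case: (dE x).
    + by apply: cvg_at_right_filter; exact: is_derive_continuous (dE _).
    + by apply: cvg_at_left_filter; exact: is_derive_continuous (dE _).
  - by move=> x _; rewrite derive1E; case: (dE x).
  rewrite /Rintegral; transitivity (fine (\int[leb]_(x in `[(- k.+1%:R)%R, k.+1%:R]) (F x)%:E)%E).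
    rewrite [in RHS]integral_mkcond; congr fine; apply: eq_integral => x _.
    rewrite /patch /G mem_setE/= in_itv/= -ler_norml.
    by case: (`|x| <= _); rewrite ?mulr1 ?mulr0.
  by rewrite H.
have lim1 : \int[leb]_x G k x @[k --> \oo] --> \int[leb]_x F x.
  apply: (@Rintegral_dominated_cvg R _ _ leb G F (fun x => `|F x|) mG mF); last 2 first.
  - exact: integrable_normr.
  - by move=> k x; rewrite /G normrM ler_piMr//; case: (`|x| <= k.+1%:R); rewrite ?normr1 ?normr0.
  - move=> x; apply: cvg_near_cst; near=> k; rewrite /G.
    suff -> : `|x| <= k.+1%:R by rewrite mulr1.
    rewrite (@le_trans _ _ k%:R) ?ler_nat//; near: k; exact: nbhs_infty_ger.
have lim2 : \int[leb]_x G k x @[k --> \oo] --> 0 - 0.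
  under eq_fun do rewrite GE.
  have Ep' : E k.+1%:R @[k --> \oo] --> 0.
    by have := Ep; rewrite -(cvg_shiftS (fun k : nat => E k%:R)).
  have Em' : E (- k.+1%:R) @[k --> \oo] --> 0.
    by have := Em; rewrite -(cvg_shiftS (fun k : nat => E (- k%:R))).
  exact: cvgB Ep' Em'.
have lim12 : \int[leb]_x F x = 0 - 0 by exact: cvg_unique lim1 lim2.
by rewrite lim12 subr0.
Unshelve. all: by end_near. Qed.

(** With h = tan phi this is the integral of cos(phi)^(m-2) cos(r sin phi) over a half-turn:
    Poisson's formula for the Bessel function of order m/2 - 1, up to a constant and a power of
    r. *)
Definition oscillatory m r : R := \int[leb]_h (bcos h ^+ m * cos (r * bsin h)).

Lemma measurable_cos_bsin r : measurable_fun setT (fun h => cos (r * bsin h)).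
Proof.
apply: (measurableT_comp (continuous_measurable_fun (@continuous_cos R))).
by apply: measurable_funM => //; exact: measurable_bsin.
Qed.

Lemma integrable_oscillatory m r : (2 <= m)%N ->
  leb.-integrable setT (EFin \o (fun h => bcos h ^+ m * cos (r * bsin h))).
Proof.
move=> m2; under eq_fun do rewrite mulrC.
apply: (integrable_mul_bounded (M := 1)); first exact: integrable_bcos.
- exact: measurable_cos_bsin.
- by move=> x; exact: cos_max.
Qed.

(** Two integrations by parts done at once: F, the difference of the two sides before integration,
    is the derivative of E, and E h = O(1/|h|). *)
Lemma oscillatory_rec i r : r ^+ 2 * oscillatory i.+2.+4 r =
  i.+3%:R * (i.+2%:R * oscillatory i.+4 r - i.+1%:R * oscillatory i.+2 r).
Proof.
pose k : R := i.+3%:R.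
pose E h := r * (sin (r * bsin h) * bcos h ^+ i.+3) - k * (cos (r * bsin h) * bsin h * bcos h ^+ i.+1).
pose F h := r ^+ 2 * (bcos h ^+ i.+2.+4 * cos (r * bsin h)) -
  (k * i.+2%:R * (bcos h ^+ i.+4 * cos (r * bsin h)) -
   k * i.+1%:R * (bcos h ^+ i.+2 * cos (r * bsin h))).
have iF1 := integrableZl measurableT (r ^+ 2) (integrable_oscillatory r (isT : (2 <= i.+2.+4)%N)).
have iF2 := integrableZl measurableT (k * i.+2%:R) (integrable_oscillatory r (isT : (2 <= i.+4)%N)).
have iF3 := integrableZl measurableT (k * i.+1%:R) (integrable_oscillatory r (isT : (2 <= i.+2)%N)).
have iF23 := integrableB measurableT iF2 iF3.
have iF : leb.-integrable setT (EFin \o F) by exact: (integrableB measurableT iF1 iF23).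
suff : \int[leb]_h F h = 0.
  rewrite /F RintegralB// RintegralB//.
  rewrite !RintegralZl//; [|exact: integrable_oscillatory..].
  by rewrite -!/(oscillatory _ _) -/k => /eqP; rewrite subr_eq0 => /eqP ->; ring.
have Ebound h : `|E h| * `|h| <= `|r| + k.
  have c1 := bcos_le1 h; have c0 := ltW (bcos_gt0 h).
  have cX j : bcos h ^+ j.+1 * `|h| <= 1.
    rewrite exprSr -mulrA (le_trans _ (bcos_le h))// ler_piMl ?exprn_ile1//.
    by rewrite mulr_ge0.
  have cX0 j : 0 <= bcos h ^+ j by rewrite exprn_ge0.
  rewrite (@le_trans _ _ ((`|r| * (bcos h ^+ i.+3) + k * bcos h ^+ i.+1) * `|h|))//.
    rewrite ler_wpM2r// (le_trans (ler_normB _ _))// lerD//.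
      by rewrite normrM ler_wpM2l// normrM (ger0_norm (cX0 _)) ler_piMl// sin_max.
    rewrite normrM ger0_norm ?ler0n// ler_wpM2l// normrM (ger0_norm (cX0 _)) ler_piMl//.
    by rewrite normrM mulr_ile1// ?cos_max ?bsin_le1.
  have k0 : 0 <= k by rewrite ler0n.
  by rewrite mulrDl; apply: lerD; rewrite -mulrA; apply: ler_piMr.
have Ecvg (u : nat -> R) : (forall j, `|u j| = j%:R) -> E (u j) @[j --> \oo] --> 0.
  move=> uj; apply/cvgrPdist_le => e e0; near=> j.
  have j0 : 0 < j%:R :> R by rewrite ltr0n; near: j; exact: nbhs_infty_gt.
  rewrite sub0r normrN -(ler_pM2r j0) -{1}uj (le_trans (Ebound _))//.
  rewrite mulrC -ler_pdivrMr//; near: j; exact: nbhs_infty_ger.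
apply: (@Rintegral_derive0 E F) => //.
- move=> h; have dc := is_derive_bcos h; have ds := is_derive_bsin h.
  have drs : is_derive h 1 (fun x => r * bsin x) (r * bcos h ^+ 3).
    exact: (is_deriveZ r ds).
  have dsin : is_derive h 1 (fun x => sin (r * bsin x)) (cos (r * bsin h) * (r * bcos h ^+ 3)).
    exact: (is_derive1_comp (is_derive_sin _) drs).
  have dcos : is_derive h 1 (fun x => cos (r * bsin x)) (- sin (r * bsin h) * (r * bcos h ^+ 3)).
    exact: (is_derive1_comp (is_derive_cos _) drs).
  have dX j := is_deriveX j dc.
  have d1 := is_deriveZ r (is_deriveM dsin (dX i.+3)).
  have d2 := is_deriveZ k (is_deriveM (is_deriveM dcos ds) (dX i.+1)).
  have -> : E = (r \*: ((fun x => sin (r * bsin x)) * bcos ^+ i.+3)) -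
      (k \*: ((fun x => cos (r * bsin x)) * bsin * bcos ^+ i.+1)).
    by apply/funext => x; rewrite /E !fctE.
  apply: (is_derive_eq (is_deriveB d1 d2)).
  rewrite /F !fctE /GRing.scale/=.
  set S := sin _; set C := cos _; have := bsin_sqr h; set c := bcos h; set s := bsin h => s2.
  have -> : i.+3%:R = k by [].
  have -> : i.+2%:R = k - 1 by rewrite /k -[in RHS]natr1 addrK.
  have -> : i.+1%:R = k - 2 :> R by rewrite /k -[in RHS]natr1 -[in RHS]natr1; ring.
  rewrite !exprS expr0 in s2 *.
  set ci := c ^+ i; rewrite ?mulr1 in s2 *.
  (* The two expressions agree modulo the relation between sine and cosine; subtracting the right
     multiple of d leaves a polynomial identity. *)
  pose d := s * s - (1 - c * c); have d0 : d = 0 by rewrite /d s2 subrr.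
  rewrite -[LHS]subr0 -[X in _ - X](mulr0 (k * (k - 2) * c * c * ci * C)) -d0 /d; ring.
- move=> h; have cb := @continuous_bcos h; have cs := @continuous_bsin h.
  have cX j := @continuous_bcosX j h.
  have cc : {for h, continuous (fun x => cos (r * bsin x))}.
    by apply: continuous_comp; [apply: cvgMr|exact: continuous_cos].
  have ct j : {for h, continuous (fun x => bcos x ^+ j * cos (r * bsin x))}.
    by apply: cvgM; [exact: cX|exact: cc].
  by apply: cvgB; [apply: cvgMr; exact: ct|apply: cvgB; apply: cvgMr; exact: ct].
- by apply: Ecvg => j; rewrite normr_nat.
- by apply: Ecvg => j; rewrite normrN normr_nat.
Unshelve. all: by end_near. Qed.

(** Each use of the recurrence gains r^(-2) and lowers m by 2 or 4, and integrability requires m >=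
    2 at the end; hence the condition 4 q + 2 <= m. *)
Lemma oscillatory_decay q m : (4 * q + 2 <= m)%N -> exists2 C, 0 <= C &
  forall r, 1 <= r -> `|oscillatory m r| * r ^+ (2 * q) <= C.
Proof.
elim: q m => [|q IH] m qm.
  have m2 : (2 <= m)%N by [].
  exists (\int[leb]_h bcos h ^+ m).
    by apply: Rintegral_ge0 => h _; rewrite exprn_ge0// ltW// bcos_gt0.
  move=> r r1; rewrite muln0 expr0 mulr1; apply: normr_Rintegral_le.
  - exact: integrable_bcos.
  - exact: (integrable_measurable (integrable_oscillatory r m2)).
  - move=> h; rewrite normrM ger0_norm ?exprn_ge0 ?(ltW (bcos_gt0 h))// ler_piMr ?cos_max//.
    by rewrite exprn_ge0// ltW// bcos_gt0.
have [i mi] : exists i, m = i.+2.+4 by exists (m - 6)%N; lia.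
subst m.
have [A A0 hA] := IH i.+4 ltac:(lia); have [B B0 hB] := IH i.+2 ltac:(lia).
exists (i.+3%:R * (i.+2%:R * A + i.+1%:R * B)).
  by rewrite mulr_ge0// addr_ge0// mulr_ge0.
move=> r r1; have r0 : 0 <= r by lra.
have -> : `|oscillatory i.+2.+4 r| * r ^+ (2 * q.+1) =
    `|r ^+ 2 * oscillatory i.+2.+4 r| * r ^+ (2 * q).
  rewrite normrM (ger0_norm (sqr_ge0 r)) (_ : (2 * q.+1 = 2 * q + 2)%N); last by lia.
  by rewrite exprD; ring.
rewrite oscillatory_rec normrM ger0_norm ?ler0n// -mulrA ler_wpM2l//.
rewrite (@le_trans _ _ ((i.+2%:R * `|oscillatory i.+4 r| + i.+1%:R * `|oscillatory i.+2 r|) * r ^+ (2 * q)))//.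
  by rewrite ler_wpM2r ?exprn_ge0// (le_trans (ler_normB _ _))// !normrM !normr_nat.
by rewrite mulrDl -!mulrA lerD// ler_wpM2l// ?hA ?hB.
Qed.

End bracket.

Section sphere_transform.
Context {R : realType} (n : nat).
Notation leb := (@lebesgue_measure R).
Implicit Types (a b h r : R).

Lemma enorm_cons a (v : 'rV[R]_n) : enorm (cons_rV (a, v)) = Num.sqrt (a ^+ 2 + enorm v ^+ 2).
Proof.
rewrite {1}/enorm big_ord_recl enorm_sqr; congr (Num.sqrt (_ + _)).
  by rewrite /cons_rV mxE; case: splitP => // j _; rewrite !mxE (ord1 j).
apply: eq_bigr => i _; congr (_ ^+ 2).
rewrite /cons_rV mxE; case: splitP => j ij; first by move: (ltn_ord j); rewrite -ij.
by congr (v _ _); apply/val_inj; move: ij => /= [].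
Qed.

Lemma cons_rV0 a (v : 'rV[R]_n) : cons_rV (a, v) ord0 ord0 = a.
Proof. by rewrite /cons_rV mxE; case: splitP => // j _; rewrite !mxE (ord1 j). Qed.

Lemma enorm_cons_scale h (v : 'rV[R]_n) : 
  enorm (cons_rV (enorm v * h, v)) = enorm v * (bcos h)^-1.
Proof.
rewrite enorm_cons /bcos invrK exprMn -{2}[enorm v ^+ 2]mulr1 -mulrDr addrC.
by rewrite sqrtrM ?sqr_ge0// sqrtr_sqr ger0_norm ?enorm_ge0.
Qed.

Definition slice_mass : \bar R :=
  (\int[@lebesgue_rV R n]_v (enorm v * (enorm v <= 1)%R%:R)%:E)%E.

(** Write w = (a, v) and substitute a = |v| h: the first coordinate of [dir w] becomes [bsin h] and
    |w| becomes |v| / [bcos h]. Rescaling v by [bcos h] produces n factors from the volume and one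
    from the Jacobian |v|. *)
Lemma ball_integral_direction (G : R -> R) : (0 < n)%N -> measurable_fun setT G ->
  (forall s, 0 <= G s) ->
  (\int[@lebesgue_rV R n.+1]_w ((enorm w <= 1)%R%:R * G (dir w ord0 ord0))%:E =
   slice_mass * \int[leb]_h (G (bsin h) * bcos h ^+ n.+1)%:E)%E.
Proof.
move=> n0 mG G0; have mb := @measurable_bcos R; have ms := @measurable_bsin R.
have md : measurable_fun setT (fun w : 'rV[R]_n.+1 => G (dir w ord0 ord0)).
  have md0 : measurable_fun setT (fun w : 'rV[R]_n.+1 => dir w ord0 ord0).
    exact: (measurableT_comp (measurable_coor ord0) (@measurable_dir R n.+1)).
  exact: (measurableT_comp mG md0).
have mF : measurable_fun setT (fun w : 'rV[R]_n.+1 => ((enorm w <= 1)%R%:R * G (dir w ord0 ord0))%:E).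
  by apply/measurable_EFinP; apply: measurable_funM => //; mfun.
have F0 (w : 'rV[R]_n.+1) : (0 <= ((enorm w <= 1)%R%:R * G (dir w ord0 ord0))%:E)%E.
  by rewrite lee_fin mulr_ge0.
rewrite ge0_integral_rVS//.
rewrite (fubini_tonelli (fun p : measurableTypeR R * 'rV[R]_n =>
  ((enorm (cons_rV p) <= 1)%R%:R * G (dir (cons_rV p) ord0 ord0))%:E)); first last.
- by move=> p; exact: F0.
- exact: (measurableT_comp mF (@measurable_cons_rV R n)).
rewrite [LHS]ge0_integral_rV_neq0//; first last.
- by move=> v; apply: integral_ge0 => a _; exact: F0.
- apply: (measurable_fun_fubini_tonelli_G (fun p : measurableTypeR R * 'rV[R]_n =>
    ((enorm (cons_rV p) <= 1)%R%:R * G (dir (cons_rV p) ord0 ord0))%:E)).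
    exact: (measurableT_comp mF (@measurable_cons_rV R n)).
  by move=> p; exact: F0.
transitivity (\int[@lebesgue_rV R n]_v \int[leb]_h ((enorm v * (enorm v <= bcos h)%R%:R)%:E * (G (bsin h))%:E))%E.
  apply: eq_integral => v _.
  have [->|v0] := eqVneq v 0.
    rewrite mule0 integral0_eq// => h _.
    by rewrite enorm0 mul0r mul0e.
  rewrite mule1; have e0 : 0 < enorm v by rewrite enorm_gt0.
  have mFv : measurable_fun setT (fun a : R => ((enorm (cons_rV (a, v)) <= 1)%R%:R * G (dir (cons_rV (a, v)) ord0 ord0))%:E).
    exact: (measurableT_comp (measurableT_comp mF (@measurable_cons_rV R n)) (pair2_measurable v)).
  have E1 : 1%E = ((enorm v)%:E * (enorm v)^-1%:E)%E by rewrite -EFinM mulfV ?gt_eqF.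
  rewrite -[LHS]mul1e {1}E1 -muleA.
  rewrite -(ge0_integral_scale e0 mFv)//.
  rewrite -ge0_integralZl//; last 2 first.
  - by apply: (measurableT_comp mFv); mfun.
  - by rewrite lee_fin ltW.
  apply: eq_integral => h _; rewrite -EFinM -EFinM; congr EFin.
  rewrite mulrA enorm_cons_scale ler_pdivrMr ?bcos_gt0// mul1r; congr (_ * G _).
  rewrite /dir mxE cons_rV0 enorm_cons_scale /bsin invfM invrK.
  by field; rewrite gt_eqF.
have mK : measurable_fun setT (fun p : 'rV[R]_n * measurableTypeR R =>
    ((enorm p.1 * (enorm p.1 <= bcos p.2)%R%:R)%:E * (G (bsin p.2))%:E)%E).
  by mfun.
rewrite (fubini_tonelli (fun p : 'rV[R]_n * measurableTypeR R =>
    ((enorm p.1 * (enorm p.1 <= bcos p.2)%R%:R)%:E * (G (bsin p.2))%:E)%E)) //; last first.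
  by move=> p; rewrite mule_ge0 ?lee_fin ?G0// mulr_ge0 ?enorm_ge0.
rewrite -ge0_integralZl//; first last.
- by apply: integral_ge0 => v _; rewrite lee_fin mulr_ge0 ?enorm_ge0.
- by move=> h _; rewrite lee_fin mulr_ge0// exprn_ge0// ltW// bcos_gt0.
- by apply/measurable_EFinP; mfun.
apply: eq_integral => h _; have c0 := bcos_gt0 h.
rewrite /= ge0_integralZr ?lee_fin//; last 2 first.
- by mfun.
- by move=> v _; rewrite lee_fin mulr_ge0 ?enorm_ge0.
suff -> : (\int[@lebesgue_rV R n]_v (enorm v * (enorm v <= bcos h)%R%:R)%:E =
    (bcos h ^+ n.+1)%:E * slice_mass)%E.
  by rewrite EFinM (muleC (bcos h ^+ n.+1)%:E) -muleA; congr (_ * _)%E; rewrite muleC.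
move: (bcos h) c0 => c c0.
pose F (v : 'rV[R]_n) := (c * (enorm v * (enorm v <= 1)%R%:R))%:E.
have mS : measurable_fun setT F by rewrite /F; mfun.
transitivity (\int[@lebesgue_rV R n]_v F (c^-1 *: v))%E.
  apply: eq_integral => v _; rewrite /F enormZ (@gtr0_norm _ c^-1) ?invr_gt0//.
  rewrite (ler_pdivrMl _ _ c0) mulr1.
  by rewrite !mulrA mulfV ?gt_eqF// mul1r.
rewrite ge0_integral_rV_scale ?invr_gt0//; last first.
  by move=> v; rewrite lee_fin !mulr_ge0 ?enorm_ge0// ltW.
rewrite exprVn invrK /F; under eq_integral do rewrite EFinM.
rewrite ge0_integralZl_EFin ?(ltW c0)//; last 2 first.
- by move=> v _; rewrite lee_fin mulr_ge0 ?enorm_ge0.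
- by mfun.
by rewrite muleA -EFinM -exprSr.
Qed.

Lemma slice_mass_fin_num : slice_mass \is a fin_num.
Proof.
rewrite ge0_fin_numE; last by apply: integral_ge0 => v _; rewrite lee_fin mulr_ge0 ?enorm_ge0.
apply: (@le_lt_trans _ _ (lebesgue_rV n (@eball R n 1))); last exact: lebesgue_eball_lty.
rewrite -measure_integral_indic; last exact: measurable_eball.
apply: ge0_le_integral_nomeas => v _; first by rewrite lee_fin mulr_ge0 ?enorm_ge0.
rewrite lee_fin indicE; case: (leP (enorm v) 1) => v1; last by rewrite mulr0.
by rewrite mulr1 mem_set.
Qed.

End sphere_transform.

Section sphere_decay.
Context {R : realType} (n : nat).
Notation T := 'rV[R]_n.
Notation lam := (@lebesgue_rV R n).
Implicit Types (x y v xi : T).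

Lemma dotDl xi eta x : dot (xi + eta : T) x = dot xi x + dot eta x.
Proof. by rewrite dotC dotDr !(dotC x). Qed.

Lemma dotNl xi x : dot (- xi) x = - dot xi x.
Proof. by rewrite dotC dotNr dotC. Qed.

Definition reflection v x : T := x - (2 * dot v x / dot v v) *: v.

Lemma reflectionD v x y : reflection v (x + y) = reflection v x + reflection v y.
Proof. by rewrite /reflection dotDr mulrDr mulrDl scalerDl opprD addrACA. Qed.

Lemma reflectionZ v (a : R) x : reflection v (a *: x) = a *: reflection v x.
Proof. by rewrite /reflection dotZr scalerBr scalerA; congr (_ - _ *: _); ring. Qed.

Lemma dot_reflection v x y : v != 0 -> dot x (reflection v y) = dot (reflection v x) y.
Proof.
by move=> v0; rewrite /reflection dotDr dotDl dotNr dotNl dotZr dotZl (dotC x v); ring.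
Qed.

Lemma dot_gt0 v : v != 0 -> 0 < dot v v.
Proof. by move=> v0; rewrite dotxx exprn_gt0// enorm_gt0. Qed.

Lemma reflectionK v x : v != 0 -> reflection v (reflection v x) = x.
Proof.
move=> v0; have vv := dot_gt0 v0; rewrite {1}/reflection {2}/reflection dotDr dotNr dotZr.
rewrite divfK ?gt_eqF// {1}/reflection -addrA -opprD -scalerDl.
rewrite (_ : 2 * dot v x / dot v v + _ = 0) ?scale0r ?subr0//; field.
by rewrite gt_eqF.
Qed.

Lemma enorm_reflection v x : v != 0 -> enorm (reflection v x) = enorm x.
Proof.
move=> v0; apply/eqP; rewrite -(@eqrXn2 _ 2)// ?enorm_ge0//; apply/eqP.
by rewrite -!dotxx dot_reflection// reflectionK.
Qed.

Lemma measurable_reflection v : measurable_fun setT (reflection v).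
Proof.
have md := measurable_dot v.
apply: measurable_rVB => //; apply: measurable_rVZ => //.
by apply: measurable_funM => //; apply: measurable_funM.
Qed.

Lemma ball_integral_reflection (G : R -> R) v xi : v != 0 -> measurable_fun setT G ->
  (forall s, 0 <= G s) ->
  (\int[lam]_w ((enorm w <= 1)%R%:R * G (dot xi (dir w)))%:E =
   \int[lam]_w ((enorm w <= 1)%R%:R * G (dot (reflection v xi) (dir w)))%:E)%E.
Proof.
move=> v0 mG G0; have mdir := @measurable_dir R n.
have md := measurable_dot xi.
have mF : measurable_fun setT (fun w : T => ((enorm w <= 1)%R%:R * G (dot xi (dir w)))%:E).
  have m1 : measurable_fun setT (fun w : T => G (dot xi (dir w))).
    exact: (measurableT_comp mG (measurableT_comp md mdir)).
  by apply/measurable_EFinP; apply: measurable_funM => //; mfun.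
rewrite -[LHS](@ge0_integral_rV_isometry _ _ (reflection v)).
- apply: eq_integral => w _; rewrite enorm_reflection//; congr ((_ * G _)%:E).
  by rewrite -dot_reflection// /dir enorm_reflection// reflectionZ.
- exact: measurable_reflection.
- exact: reflectionD.
- by move=> y; exists (reflection v y); rewrite reflectionK.
- by move=> x; exact: enorm_reflection.
- exact: mF.
- by move=> w; rewrite lee_fin mulr_ge0.
Qed.

(** Up to the factor n, the Fourier transform of surface measure on the unit sphere of R^n, which is
    even and so has no sine part. *)
Definition sphere_transform xi : R :=
  \int[lam]_w ((enorm w <= 1)%R%:R * cos (dot xi (dir w))).

End sphere_decay.

Section sphere_decay1.
Context {R : realType} (n' : nat).
Notation n := n'.+1.
Notation T := 'rV[R]_n.
Notation lam := (@lebesgue_rV R n).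
Notation leb := (@lebesgue_measure R).
Implicit Types (x y v xi : T).

(** The reflection in the hyperplane orthogonal to xi - |xi| e exchanges xi and |xi| e, where e is
    the first basis vector; if this difference vanishes, the integrands already agree. *)
Lemma ball_integral_rotation (G : R -> R) xi : measurable_fun setT G ->
  (forall s, 0 <= G s) ->
  (\int[lam]_w ((enorm w <= 1)%R%:R * G (dot xi (dir w)))%:E =
   \int[lam]_w ((enorm w <= 1)%R%:R * G (enorm xi * dir w ord0 ord0))%:E)%E.
Proof.
move=> mG G0; pose e : T := \row_i (i == ord0)%:R.
have dote x : dot e x = x ord0 ord0.
  rewrite /dot big_ord_recl mxE eqxx mul1r big1 ?addr0// => i _.
  by rewrite mxE mul0r.
have dE x : dot (enorm xi *: e) x = enorm xi * x ord0 ord0 by rewrite dotZl dote.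
have [xie|v0] := eqVneq (xi - enorm xi *: e) 0.
  apply: eq_integral => w _; congr ((_ * G _)%:E).
  by rewrite -dE; congr (dot _ _); apply/eqP; rewrite -subr_eq0 xie.
rewrite (ball_integral_reflection xi v0 mG G0).
apply: eq_integral => w _; congr ((_ * G _)%:E); rewrite -dE; congr (dot _ _).
have vv := dot_gt0 v0; rewrite /reflection.
set v := xi - _ in v0 vv *.
have ee : dot e e = 1 by rewrite dote mxE eqxx.
suff -> : 2 * dot v xi / dot v v = 1 by rewrite scale1r /v opprB addrC subrK.
apply: (mulIf (lt0r_neq0 vv)); rewrite divfK ?gt_eqF// mul1r.
rewrite /v dotDr !dotDl !dotNl !dotNr !dotZl !dotZr ee (dotC xi e) dotxx; ring.
Qed.

Lemma one_add_cos_bound (s : R) : 0 <= 1 + cos s <= 2.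
Proof. by have := cos_geN1 s; have := cos_le1 s => ? ?; apply/andP; split; lra. Qed.

Lemma sphere_transformE xi : (0 < n')%N ->
  sphere_transform xi = fine (@slice_mass R n') * oscillatory n (enorm xi).
Proof.
move=> n0; have sm := @slice_mass_fin_num R n'.
have n2 : (2 <= n)%N by [].
(* The slicing identity is proved for nonnegative functions, so the cosine is handled as (1 + cos) -
   1. *)
have key (G : R -> R) : continuous G -> (forall s, 0 <= G s <= 2) ->
    \int[lam]_w ((enorm w <= 1)%R%:R * G (dot xi (dir w))) =
    fine (@slice_mass R n') * \int[leb]_h (bcos h ^+ n * G (enorm xi * bsin h)).
  move=> cG G02; have mG : measurable_fun setT G by exact: continuous_measurable_fun.
  have G0 s : 0 <= G s by case/andP: (G02 s).
  pose G' s := G (enorm xi * s).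
  have mG' : measurable_fun setT G' by rewrite /G'; mfun.
  rewrite {1}/Rintegral ball_integral_rotation//.
  rewrite (@ball_integral_direction _ _ G')//; last by move=> s; exact: G0.
  rewrite -[X in (X * _)%E](fineK sm).
  have iG : leb.-integrable setT (EFin \o (fun h => G' (bsin h) * bcos h ^+ n)).
    apply: (integrable_mul_bounded (M := 2)); first exact: integrable_bcos.
    - exact: (measurableT_comp mG' (@measurable_bsin R)).
    - by move=> h; rewrite ger0_norm ?G0//; case/andP: (G02 (enorm xi * bsin h)).
  rewrite integral_EFin// -EFinM /=; congr (_ * _).
  by apply: eq_Rintegral => h _; rewrite mulrC.
have md : measurable_fun setT (fun w : T => cos (dot xi (dir w))).
  exact: (measurableT_comp (measurable_cos_dot xi) (@measurable_dir R n)).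
have iB : lam.-integrable setT (EFin \o (fun w : T => (enorm w <= 1)%R%:R : R)).
  apply: (le_integrable measurableT _ _ (@integrable_cube R n 1 ler01)).
    by apply/measurable_EFinP; mfun.
  move=> w _ /=; rewrite lee_fin !ger0_norm//; case: (leP (enorm w) 1) => // w1.
  by rewrite (le_trans (rVnorm_le_enorm w)).
have iBc : lam.-integrable setT (EFin \o (fun w : T => (enorm w <= 1)%R%:R * cos (dot xi (dir w)))).
  under eq_fun do rewrite mulrC.
  by apply: (integrable_mul_bounded (M := 1)) => // x; exact: cos_max.
have b1 (s : R) : 0 <= (1 : R) <= 2 by apply/andP; split; lra.
have k1 := key (fun=> 1) (fun=> cvg_cst _) b1.
have cc : continuous (fun s : R => 1 + cos s).
  by move=> s; apply: cvgD; [exact: cvg_cst|exact: continuous_cos].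
have k2 := key (fun s => 1 + cos s) cc one_add_cos_bound.
have E : sphere_transform xi = \int[lam]_w ((enorm w <= 1)%R%:R * (1 + cos (dot xi (dir w)))) -
    \int[lam]_w ((enorm w <= 1)%R%:R * 1).
  rewrite -RintegralB//.
  - by apply: eq_Rintegral => w _; ring.
  - under eq_fun do rewrite mulrDr mulr1; exact: (integrableD measurableT iB iBc).
  - by under eq_fun do rewrite mulr1.
rewrite E k1 k2 -mulrBr -RintegralB//.
- by congr (_ * _); apply: eq_Rintegral => h _; ring.
- under eq_fun do rewrite mulrDr mulr1.
  exact: (integrableD measurableT (integrable_bcos n2) (integrable_oscillatory _ n2)).
- by under eq_fun do rewrite mulr1; exact: integrable_bcos.
Qed.

Lemma sphere_transform_decay q : (0 < n')%N -> (4 * q + 2 <= n)%N -> exists2 C : R, 0 <= C &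
  forall xi, `|sphere_transform xi| <= C /\ `|sphere_transform xi| * enorm xi ^+ (2 * q) <= C.
Proof.
move=> n0 qn; have [C C0 hC] := @oscillatory_decay R q n qn.
have n2 : (2 <= n)%N by [].
pose D := \int[leb]_h bcos h ^+ n; pose s := fine (@slice_mass R n').
have s0 : 0 <= s by apply: fine_ge0; apply: integral_ge0 => v _; rewrite lee_fin mulr_ge0 ?enorm_ge0.
have D0 : 0 <= D by apply: Rintegral_ge0 => h _; rewrite exprn_ge0// ltW// bcos_gt0.
have oD r : `|oscillatory n r| <= D.
  apply: normr_Rintegral_le.
  - exact: integrable_bcos.
  - exact: (integrable_measurable (integrable_oscillatory r n2)).
  - move=> h; rewrite normrM ger0_norm ?exprn_ge0 ?(ltW (bcos_gt0 h))// ler_piMr ?cos_max//.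
    by rewrite exprn_ge0// ltW// bcos_gt0.
exists (s * (C + D)); first by rewrite mulr_ge0// addr_ge0.
move=> xi; rewrite sphere_transformE// -/s normrM (ger0_norm s0) -mulrA !ler_wpM2l//.
  have [xi1|xi1] := leP 1 (enorm xi); first by rewrite (le_trans (hC _ xi1))// lerDl.
  rewrite (@le_trans _ _ (D * 1))//; last by rewrite mulr1 lerDr.
  by rewrite ler_pM// ?exprn_ge0 ?enorm_ge0// exprn_ile1 ?enorm_ge0// ltW.
by rewrite (le_trans (oD _))// lerDr.
Qed.

End sphere_decay1.

(** * Smoothed spheres and their pointwise size *)

Section shells.
Context {R : realType} (n' : nat).
Notation n := n'.+1.
Notation T := 'rV[R]_n.
Notation lam := (@lebesgue_rV R n).
Notation leb := (@lebesgue_measure R).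
Implicit Types (x y z w xi : T) (a t s rho : R) (D f : T -> R).

Definition ball_indic w : R := (enorm w <= 1)%R%:R.

Lemma measurable_ball_indic : measurable_fun setT ball_indic.
Proof. by rewrite /ball_indic; mfun. Qed.

Lemma integrable_ball_indic : lam.-integrable setT (EFin \o ball_indic).
Proof.
apply: (le_integrable measurableT _ _ (@integrable_cube R n 1 ler01)).
  by apply/measurable_EFinP; exact: measurable_ball_indic.
move=> w _ /=; rewrite lee_fin !ger0_norm// /ball_indic; case: (leP (enorm w) 1) => // w1.
by rewrite (le_trans (rVnorm_le_enorm w)).
Qed.

Lemma dir_le1 w : `|dir w| <= 1.
Proof. exact: le_trans (rVnorm_le_enorm _) (enorm_dir_le1 _). Qed.

Definition dil a D x := a ^- n * D (a^-1 *: x).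

Lemma kernel_dil a D : 0 < a -> mollifier D -> mollifier (dil a D).
Proof. by move=> a0 kD; apply: kernelZ; apply: kernel_dilate => //; rewrite invr_gt0. Qed.

Lemma cosT_dil a D xi : 0 < a -> mollifier D -> cosT (dil a D) xi = cosT D (a *: xi).
Proof.
move=> a0 kD; have a0' : 0 < a^-1 by rewrite invr_gt0.
have kd := kernel_dilate a0' kD; have [mD _ _] := kernel_bounded_integrable kD.
rewrite /dil cosTZ; last exact: kernel_integrable.
by rewrite (cosT_dilate _ a0' mD) exprVn invrK mulrA mulVf ?mul1r ?invrK// gt_eqF// exprn_gt0.
Qed.

(** The sphere of radius t convolved with the kernel D at width a; convolution with [shell t a D] is
    the spherical average smoothed at scale a. *)
Definition shell t a D := smear lam ball_indic (fun w => t *: dir w) (dil a D).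

Lemma measurable_shell_phi t : measurable_fun setT (fun w : T => t *: dir w).
Proof. by mfun. Qed.

Lemma kernel_shell t a D : 0 < a -> mollifier D -> mollifier (shell t a D).
Proof.
move=> a0 kD; apply: (kernel_smear (D := `|t|)).
- exact: integrable_ball_indic.
- exact: measurable_shell_phi.
- by move=> w; rewrite /ball_indic enormN.
- by move=> w; rewrite dirN scalerN.
- move=> w; rewrite normrZ ltNge ler_piMr//; exact: dir_le1.
- exact: kernel_dil.
Qed.

Lemma cosT_shell t a D xi : 0 < a -> mollifier D ->
  cosT (shell t a D) xi = sphere_transform (t *: xi) * cosT D (a *: xi).
Proof.
move=> a0 kD; have kd := kernel_dil a0 kD.
rewrite cosT_smear//; [|exact: integrable_ball_indic|exact: measurable_shell_phi
  |exact: kernel_bounded_integrable|by case: kd].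
rewrite cosT_dil//; congr (_ * _); apply: eq_Rintegral => w _.
by rewrite dotZr dotZl.
Qed.

(* A neighbourhood of a cap of the sphere of radius [t] contains the radial
   thickening of that cap, whose volume is the area times the width. *)
Lemma cap_le z t rho : 0 < rho -> 0 < t ->
  t ^+ n' * rho * \int[lam]_w (ball_indic w * (`|z - t *: dir w| <= rho)%R%:R) <=
  (4 * rho) ^+ n.
Proof.
move=> rho0 t0; have mb := measurable_ball_indic.
have t'0 : 0 <= t ^+ n' * rho by rewrite mulr_ge0 ?exprn_ge0// ltW.
have mW : measurable_fun setT (fun w : T => ball_indic w * (`|z - t *: dir w| <= rho)%R%:R) by mfun.
have iW : lam.-integrable setT (EFin \o (fun w : T => ball_indic w * (`|z - t *: dir w| <= rho)%R%:R)).
  under eq_fun do rewrite mulrC.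
  apply: (integrable_mul_bounded (M := 1)); [exact: integrable_ball_indic|by mfun|].
  by move=> w; rewrite normr_nat; case: (_ <= rho).
rewrite -lee_fin EFinM -integral_EFin// -ge0_integralZl_EFin//; last 2 first.
- by move=> w _; rewrite lee_fin mulr_ge0.
- exact/measurable_EFinP.
have <- : (\int[lam]_x ((`|z - x| <= 2 * rho)%R%:R)%:E = ((4 * rho) ^+ n)%:E)%E.
  have r20 : 0 <= 2 * rho by rewrite mulr_ge0// ltW.
  have m1 : measurable [set x : T | (`|z - x| <= 2 * rho)%R].
    rewrite (_ : [set x | _] = (fun x => (`|z - x|)%R) @^-1` `]-oo, (2 * rho)]).
      have mc : measurable_fun setT (fun x : T => `|z - x|)%R by mfun.
      by rewrite -[X in measurable X]setTI; exact: mc.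
    by apply/seteqP; split => x /=; rewrite in_itv.
  rewrite (_ : 4 * rho = 2 * (2 * rho)); last by ring.
  rewrite -(lebesgue_cube_center z r20) -(measure_integral_indic m1).
  apply: eq_integral => x _; rewrite indicE; congr (_%:R%:E); congr nat_of_bool.
  by apply/idP/idP; rewrite inE.
rewrite ge0_integral_polar//; last first.
  by apply/measurable_EFinP; mfun.
apply: ge0_le_integral_nomeas => w _.
  by rewrite -EFinM lee_fin; apply: mulr_ge0 => //; apply: mulr_ge0.
rewrite -EFinM mulrCA EFinM; apply: lee_wpmul2l; first by rewrite lee_fin.
case: (leP `|z - t *: dir w| rho) => zw; last first.
  rewrite mulr0; apply: integral_ge0 => r _; rewrite -EFinM lee_fin.
  by case: (ltP 0 r) => r0; rewrite ?mulr0 ?mul0r// !mulr_ge0// exprn_ge0// ltW.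
rewrite mulr1.
have -> : ((t ^+ n' * rho)%:E = \int[leb]_(r in `[t, (t + rho)%R]) (t ^+ n')%:E)%E.
  rewrite integral_cst//= lebesgue_measure_itv/= lte_fin ltrDl rho0 -EFinD addrAC subrr add0r.
  by rewrite EFinM.
rewrite integral_mkcond; apply: ge0_le_integral_nomeas => r _.
  by rewrite /patch; case: ifP => // _; rewrite lee_fin exprn_ge0// ltW.
rewrite /patch mem_setE/= in_itv/=; case: ifP => [/andP[tr rt]|_]; last first.
  rewrite -EFinM lee_fin.
  by case: (ltP 0 r) => r0; rewrite ?mulr0 ?mul0r// !mulr_ge0// exprn_ge0// ltW.
have r0 : 0 < r by rewrite (lt_le_trans t0).
have -> : `|z - r *: dir w| <= 2 * rho.
  rewrite (_ : z - r *: dir w = (z - t *: dir w) + (t - r) *: dir w); last first.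
    by rewrite scalerBl addrA subrK.
  rewrite (le_trans (ler_normD _ _))// mulr_natl mulr2n lerD// normrZ.
  rewrite (@le_trans _ _ (`|t - r|))//; first by rewrite ler_piMr// dir_le1.
  by rewrite ler0_norm ?subr_le0// opprB lerBlDl.
rewrite r0 !mulr1 -EFinM mulr1 lee_fin /= (@le_trans _ _ (r ^+ n'))//.
  by rewrite lerXn2r ?nnegrE ?(ltW t0)// ltW.
by rewrite ler_peMl ?exprn_ge0 ?(ltW r0)// ler1n.
Qed.

Lemma cap_integral_le (G : T -> R) z t rho (B : R) : 0 < rho -> 0 < t -> 0 <= B ->
  measurable_fun setT G -> (forall w, `|G w| <= B * (`|z - t *: dir w| <= rho)%R%:R) ->
  `|\int[lam]_w (ball_indic w * G w)| <=
  B * (4 ^+ n * rho ^+ n' / t ^+ n') * (`|z| <= t + rho)%R%:R.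
Proof.
move=> rho0 t0 B0 mG GB; have mb := measurable_ball_indic.
have [zt|zt] := leP `|z| (t + rho); last first.
  rewrite mulr0 (_ : (fun w => _) = fun=> 0); first by rewrite /Rintegral integral0 normr0.
  apply/funext => w; suff -> : G w = 0 by rewrite mulr0.
  apply/eqP; rewrite -normr_le0 (le_trans (GB w))// (_ : (_ <= rho)%R = false) ?mulr0//.
  apply/negbTE; rewrite -ltNge; have := lerB_dist z (t *: dir w).
  apply: lt_le_trans; rewrite ltrBrDr (le_lt_trans _ zt)// addrC lerD2r.
  by rewrite normrZ gtr0_norm// ler_piMr ?dir_le1// ltW.
have iW : lam.-integrable setT (EFin \o (fun w : T => ball_indic w * (`|z - t *: dir w| <= rho)%R%:R)).
  under eq_fun do rewrite mulrC.
  apply: (integrable_mul_bounded (M := 1)); [exact: integrable_ball_indic|by mfun|].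
  by move=> w; rewrite normr_nat; case: (_ <= rho).
rewrite mulr1 (@le_trans _ _ (\int[lam]_w (B * (ball_indic w * (`|z - t *: dir w| <= rho)%R%:R))))//.
  apply: normr_Rintegral_le.
  - exact: (integrableZl measurableT B iW).
  - exact: measurable_funM.
  - by move=> w; rewrite normrM mulrCA ger0_norm// ler_wpM2l.
rewrite RintegralZl// ler_wpM2l// ler_pdivlMr ?exprn_gt0//.
rewrite -(ler_pM2r rho0) -mulrA mulrC (le_trans (cap_le z rho0 t0))//.
by rewrite exprMn -mulrA -exprSr.
Qed.

Lemma smear_le_HL f K (B : R) (j : int) x : bounded_integrable lam f ->
  (forall y, 0 <= f y) -> bounded_integrable lam K ->
  (forall z, `|K z| <= B * (`|z| <= 2 ^ j)%R%:R) -> 0 <= B ->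
  (`|smear lam f id K x|%:E <= (B * (2 * 2 ^ j) ^+ n)%:E * HL f x)%E.
Proof.
move=> [mf [M fM] iff] f0 bK KB B0; have [mK _ _] := bK.
rewrite EFinM -muleA; apply: (@le_trans _ _ (B%:E * cube_integral f (2 ^ j) x)%E); last first.
  by apply: lee_wpmul2l; [rewrite lee_fin|exact: cube_integral_le_HL].
have iL : lam.-integrable setT (EFin \o (fun y => f y * (`|x - y| <= 2 ^ j)%R%:R)).
  under eq_fun do rewrite mulrC.
  apply: (integrable_mul_bounded (M := 1)) => //; first by mfun.
  by move=> w; rewrite normr_nat; case: (`|x - w| <= _).
rewrite /cube_integral integral_EFin// -EFinM lee_fin -RintegralZl//.
apply: normr_Rintegral_le.
- exact: (integrableZl measurableT B iL).
- by mfun.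
- by move=> y; rewrite normrM ger0_norm// mulrCA ler_wpM2l.
Qed.

(** The kernel has height C/a^n and sees a cap of radius C a, whose normalised area is of order
    (a/t)^(n-1); the product is of order 1/(a t^(n-1)), as expected of a unit mass spread over a
    shell. *)
Lemma shell_le D (C : R) t a z : mollifier D -> kernel_bound D C -> 1 <= C -> 0 < a -> a <= t ->
  `|shell t a D z| <= (4 * C) ^+ n / (a * t ^+ n') * (`|z| <= 2 * C * t)%R%:R.
Proof.
move=> kD [DC _ DS] C1 a0 ta; have t0 : 0 < t by exact: lt_le_trans ta.
have C0 : 0 < C by lra.
have [mD _ _] := kernel_bounded_integrable kD.
have an : 0 < a ^+ n by rewrite exprn_gt0.
have Ca : 0 < C * a by rewrite mulr_gt0.
have mG : measurable_fun setT (fun w : T => dil a D (z - t *: dir w)) by rewrite /dil; mfun.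
have Can : 0 <= C / a ^+ n by rewrite divr_ge0// ltW.
have H := @cap_integral_le _ z t (C * a) (C / a ^+ n) Ca t0 Can mG.
rewrite /shell /smear (le_trans (H _))//.
  move=> w; case: (leP `|z - t *: dir w| (C * a)) => zw.
    by rewrite mulr1 /dil normrM gtr0_norm ?invr_gt0// mulrC ler_wpM2r// invr_ge0 ltW.
  rewrite /dil DS ?mulr0 ?normr0// normrZ gtr0_norm ?invr_gt0//.
  by rewrite mulrC ltr_pdivlMr.
have -> : C / a ^+ n * (4 ^+ n * (C * a) ^+ n' / t ^+ n') = (4 * C) ^+ n / (a * t ^+ n').
  rewrite !exprMn !exprS; field.
  by rewrite !expf_eq0 !gt_eqF// !andbF.
case: (leP `|z| (t + C * a)) => zt; last by rewrite mulr0 mulr_ge0// divr_ge0// ?exprn_ge0 ?mulr_ge0 ?exprn_ge0 ?(ltW t0) ?(ltW a0) ?(ltW C0).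
by rewrite (_ : (`|z| <= 2 * C * t) = true)//; nra.
Qed.

(** As in [shell_le], with the height of the kernel replaced by its Lipschitz variation; this gains
    the factor |t - s|/a. *)
Lemma shell_diff_le D (C : R) t s a z : mollifier D -> kernel_bound D C -> 1 <= C -> 0 < a ->
  a <= t -> `|t - s| <= a ->
  `|shell t a D z - shell s a D z| <=
  (8 * C) ^+ n * `|t - s| / (a ^+ 2 * t ^+ n') * (`|z| <= 3 * C * t)%R%:R.
Proof.
move=> kD kC C1 a0 ta tsa; have t0 : 0 < t by exact: lt_le_trans ta.
have [DC DL DS] := kC.
have C0 : 0 < C by lra.
have [mD _ _] := kernel_bounded_integrable kD.
have bd := kernel_bounded_integrable (kernel_dil a0 kD).
have an : 0 < a ^+ n by rewrite exprn_gt0.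
(* Since |t - s| <= a and C >= 1, the radius 2 C a around the first sphere point takes in the
   supports of both terms. *)
have Ca : 0 < 2 * C * a by rewrite mulr_gt0// mulr_gt0.
pose B := C * `|t - s| / (a * a ^+ n).
have B0 : 0 <= B by rewrite divr_ge0// mulr_ge0// ltW.
have mG : measurable_fun setT (fun w : T => dil a D (z - t *: dir w) - dil a D (z - s *: dir w)).
  by rewrite /dil; mfun.
have H := @cap_integral_le _ z t (2 * C * a) B Ca t0 B0 mG.
rewrite /shell /smear -RintegralB//; [|exact: (smear_slice_integrable integrable_ball_indic (measurable_shell_phi _) bd)..].
under eq_Rintegral do rewrite -mulrBr.
have far r w : C * a < `|z - r *: dir w| -> dil a D (z - r *: dir w) = 0.
  move=> zw; rewrite /dil DS ?mulr0// normrZ gtr0_norm ?invr_gt0//.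
  by rewrite mulrC ltr_pdivlMr.
rewrite (le_trans (H _))//.
  move=> w; case: (leP `|z - t *: dir w| (2 * C * a)) => zw.
    rewrite mulr1 /dil -mulrBr normrM gtr0_norm ?invr_gt0// mulrC ler_pdivrMr//.
    rewrite (le_trans (DL _ _))// -scalerBr normrZ gtr0_norm ?invr_gt0//.
    rewrite (_ : _ - _ - _ = (s - t) *: dir w); last first.
      by rewrite opprB addrC addrA subrK scalerBl.
    rewrite normrZ distrC /B (_ : _ / _ * _ = C * (a^-1 * `|t - s|)); last first.
      by field; rewrite !gt_eqF.
    apply: ler_wpM2l; first exact: ltW.
    apply: ler_wpM2l; first by rewrite invr_ge0 ltW.
    by rewrite ler_piMr// dir_le1.
  rewrite !far ?subrr ?normr0 ?mulr0//; last first.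
    by rewrite (le_lt_trans _ zw)// ler_wpM2r ?(ltW a0)//; lra.
  have := lerB_dist (z - t *: dir w) ((s - t) *: dir w).
  rewrite (_ : z - t *: dir w - (s - t) *: dir w = z - s *: dir w); last first.
    by rewrite scalerBl opprB addrA subrK.
  apply: lt_le_trans; have : `|(s - t) *: dir w| <= a.
    by rewrite normrZ distrC (le_trans _ tsa)// ler_piMr// dir_le1.
  by move: zw; nra.
have -> : B * (4 ^+ n * (2 * C * a) ^+ n' / t ^+ n') =
    4 ^+ n * 2 ^+ n' * C ^+ n * `|t - s| / (a ^+ 2 * t ^+ n').
  rewrite /B !exprMn !exprS; field.
  by rewrite !expf_eq0 !gt_eqF// !andbF.
have X0 : 0 <= `|t - s| / (a ^+ 2 * t ^+ n').
  by rewrite divr_ge0// mulr_ge0// exprn_ge0// ltW.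
have E8 : 4 ^+ n * 2 ^+ n' * C ^+ n <= (8 * C) ^+ n.
  rewrite (_ : 8 * C = 4 * 2 * C); last by ring.
  rewrite !exprMn ler_wpM2r ?exprn_ge0 ?(ltW C0)// ler_wpM2l ?exprn_ge0//.
  by rewrite ler_weXn2l ?ler1n.
case: (leP `|z| (t + 2 * C * a)) => zt.
  rewrite (_ : (`|z| <= 3 * C * t) = true); last by nra.
  by rewrite !mulr1 -!(mulrA _ `|t - s|) ler_wpM2r.
by rewrite mulr0 mulr_ge0// -mulrA; apply: mulr_ge0 => //; apply: exprn_ge0; lra.
Qed.

End shells.

(** * Square function over dyadic radii *)

Section square_function.
Context {R : realType} (n' : nat).
Notation n := n'.+1.
Notation T := 'rV[R]_n.
Notation lam := (@lebesgue_rV R n).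
Implicit Types (x y z w xi : T) (a t s : R) (f : T -> R).

Variables (g : T -> R) (A : R) (q : nat).
Hypotheses (kg : mollifier g) (g0 : forall x, 0 <= g x)
  (g01 : forall xi, 0 <= cosT g xi <= 1) (A0 : 0 <= A)
  (gA : forall xi, 1 - cosT g xi <= A * enorm xi ^+ 2)
  (bG : bounded_integrable lam (cosT g)) (G0 : 0 < \int[lam]_xi cosT g xi)
  (q0 : (0 < q)%N) (qn : (4 * q + 2 <= n)%N).

(** With 2 q factors, 1 - [cosT lowpass] vanishes to order 4 q at frequency 0. This compensates the
    factor |xi|^(-2q) from the sphere and leaves a positive power for summing over scales. *)
Definition lowpass : T -> R := residual_kernel g (2 * q).
Definition bandpass x : R := dil 2^-1 lowpass x + (-1) * lowpass x.

Lemma mollifier_lowpass : mollifier lowpass.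
Proof. exact: kernel_residual. Qed.

Let half0 : 0 < 2^-1 :> R. Proof. by rewrite invr_gt0. Qed.

Lemma mollifier_bandpass : mollifier bandpass.
Proof.
apply: kernelD; first exact: kernel_dil half0 mollifier_lowpass.
exact: kernelZ mollifier_lowpass.
Qed.

Lemma Rintegral_lowpass : \int[lam]_x lowpass x = 1.
Proof.
have g1 : cosT g 0 = 1.
  have := gA 0; have /andP[_] := g01 0; rewrite enorm0 expr0n mulr0 => g1 g2.
  by apply/eqP; rewrite eq_le g1 -subr_le0.
have := cosT_residual (2 * q) 0 kg; rewrite g1 subrr expr0n muln_eq0/= (gtn_eqF q0) => /eqP.
rewrite subr_eq0 => /eqP ->; apply: eq_Rintegral => x _.
by rewrite (_ : dot 0 x = 0) ?cos0 ?mul1r// /dot big1// => i _; rewrite mxE mul0r.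
Qed.

Lemma shell_bandpass t a z : 0 < a ->
  shell t a bandpass z = shell t (a / 2) lowpass z - shell t a lowpass z.
Proof.
move=> a0; have a2 : 0 < a / 2 by rewrite divr_gt0.
have kl := mollifier_lowpass.
rewrite /shell /smear -RintegralB//; last 2 first.
- by apply: smear_slice_integrable; [exact: integrable_ball_indic|exact: measurable_shell_phi|
    exact: kernel_bounded_integrable (kernel_dil a2 kl)].
- by apply: smear_slice_integrable; [exact: integrable_ball_indic|exact: measurable_shell_phi|
    exact: kernel_bounded_integrable (kernel_dil a0 kl)].
apply: eq_Rintegral => w _; rewrite -mulrBr; congr (_ * _).
rewrite /dil /bandpass /dil scalerA invrK invfM invrK.
by rewrite (mulrC a^-1 2) (_ : (a / 2) ^- n = a ^- n * 2^-1 ^- n); [ring|rewrite -invfM -exprMn].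
Qed.

Lemma cosT_bandpass_le xi : `|cosT bandpass xi| <= 1 /\
  `|cosT bandpass xi| <= (A * enorm xi ^+ 2) ^+ (2 * q).
Proof.
have kl := mollifier_lowpass; have kd := kernel_dil half0 kl.
rewrite /bandpass cosTD; [|exact: kernel_integrable|by apply: kernel_integrable; exact: kernelZ].
rewrite (cosTZ _ _ (kernel_integrable kl)) (cosT_dil _ half0 kl).
have e1 := cosT_residual (2 * q) xi kg; have e2 := cosT_residual (2 * q) (2^-1 *: xi) kg.
rewrite -/lowpass in e1 e2.
set u := (1 - cosT g xi) ^+ (2 * q) in e1; set v := (_) ^+ (2 * q) in e2.
have -> : cosT lowpass (2^-1 *: xi) + -1 * cosT lowpass xi = u - v by rewrite -e1 -e2; ring.
have b (eta : T) : 0 <= 1 - cosT g eta <= 1 by have /andP[? ?] := g01 eta; apply/andP; split; lra.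
have /andP[u0 u1] : 0 <= u <= 1.
  by have /andP[? ?] := b xi; rewrite exprn_ge0// exprn_ile1.
have /andP[v0 v1] : 0 <= v <= 1.
  by have /andP[? ?] := b (2^-1 *: xi); rewrite exprn_ge0// exprn_ile1.
have e0 : 0 <= A * enorm xi ^+ 2 by rewrite mulr_ge0// sqr_ge0.
have uA : u <= (A * enorm xi ^+ 2) ^+ (2 * q).
  by apply: lerXn2r; rewrite ?nnegrE//; have /andP[] := b xi.
have vA : v <= (A * enorm xi ^+ 2) ^+ (2 * q).
  apply: lerXn2r; rewrite ?nnegrE//; first by have /andP[] := b (2^-1 *: xi).
  rewrite (le_trans (gA _))// enormZ exprMn ler_wpM2l// ler_piMl ?sqr_ge0//.
  by rewrite ger0_norm// exprn_ile1//; lra.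
by split; rewrite ler_norml; apply/andP; split; lra.
Qed.

(** A profile of size y at 0 and 1/y at infinity, chosen because it is dominated by the increments
    of y/(1 + y) under y -> 4 y: its sums over dyadic scales telescope. *)
Definition bell (y : R) : R := y / (1 + y) ^+ 2.

Lemma bell_le (y : R) : 0 <= y ->
  bell y <= 4 / 3 * (4 * y / (1 + 4 * y) - y / (1 + y)) /\
  bell (4 * y) <= 4 / 3 * (4 * y / (1 + 4 * y) - y / (1 + y)).
Proof.
move=> y0; have p1 : 0 < 1 + y by lra.
have p4 : 0 < 1 + 4 * y by lra.
have -> : 4 / 3 * (4 * y / (1 + 4 * y) - y / (1 + y)) = 4 * y / ((1 + 4 * y) * (1 + y)).
  by field; rewrite !gt_eqF.
rewrite /bell; split; rewrite -subr_ge0.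
  rewrite (_ : _ - _ = 3 * y / ((1 + 4 * y) * (1 + y) ^+ 2)); last by field; rewrite !gt_eqF.
  by rewrite divr_ge0 ?mulr_ge0 ?exprn_ge0 ?(ltW p1) ?(ltW p4).
rewrite (_ : _ - _ = 12 * y ^+ 2 / ((1 + y) * (1 + 4 * y) ^+ 2)); last by field; rewrite !gt_eqF.
by rewrite divr_ge0 ?mulr_ge0 ?exprn_ge0 ?(ltW p1) ?(ltW p4).
Qed.

(** The ratio is 4 because y stands for the square of a scale with ratio 2. The bound depends
    neither on the starting scale nor on the number of terms. *)
Lemma sum_bell_le (y : nat -> R) L : (forall j, 0 <= y j) ->
  (forall j, y j.+1 = 4 * y j) \/ (forall j, y j = 4 * y j.+1) ->
  \sum_(0 <= j < L) bell (y j) <= 4 / 3.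
Proof.
move=> y0; pose h (y : R) := y / (1 + y).
have h0 j : 0 <= h (y j) by rewrite divr_ge0// addr_ge0.
have h1 j : h (y j) <= 1 by rewrite ler_pdivrMr ?mul1r ?lerDr// ltr_pwDl.
case=> yj.
  apply: (@le_trans _ _ (\sum_(0 <= j < L) 4 / 3 * (h (y j.+1) - h (y j)))).
    by apply: ler_sum => j _; rewrite /h yj; exact: (bell_le (y0 j)).1.
  by rewrite -mulr_sumr telescope_sumr//; have := h0 0%N; have := h1 L; lra.
apply: (@le_trans _ _ (\sum_(0 <= j < L) - (4 / 3 * (h (y j.+1) - h (y j))))).
  apply: ler_sum => j _; rewrite -mulrN opprB /h {1}yj [in X in _ <= X]yj.
  exact: (bell_le (y0 j.+1)).2.
by rewrite sumrN -mulr_sumr telescope_sumr//; have := h0 L; have := h1 0%N; lra.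
Qed.

(** Here X = a |xi|, Z = t |xi|, and J, W are the moduli of the transforms of the sphere and of
    [bandpass]. As Z >= 2^k X / 2, J is of order (2^k X)^(-2q), whose square gives 16^(-q k). For X
    >= 1 this decay suffices with W <= 1; for X <= 1 the blow-up X^(-2q) is repaid by W, of order
    X^(4q). *)
Lemma multiplier_algebra (X Z J W C B : R) k : 0 <= X -> 0 <= J -> 0 <= W ->
  0 <= C -> 2 ^+ k * X <= 2 * Z -> J * Z ^+ (2 * q) <= C -> W <= 1 ->
  W <= (B * X ^+ 2) ^+ (2 * q) ->
  (J * W) ^+ 2 <= 4 * (16 ^+ q * C ^+ 2 * (1 + (B ^+ (2 * q)) ^+ 2)) / (16 ^+ q) ^+ k * bell (X ^+ 2).
Proof.
move=> X0 J0 W0 C0 XZ JZ W1 WB; set y := X ^+ 2.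
pose p := X ^+ (2 * q); pose m : R := (2 ^+ k) ^+ (2 * q); pose b := B ^+ (2 * q).
have y0 : 0 <= y by exact: sqr_ge0.
have p0 : 0 <= p by exact: exprn_ge0.
have m0 : 0 < m by rewrite !exprn_gt0.
have yp : y ^+ (2 * q) = p ^+ 2 by rewrite /y /p -!exprM mulnC.
have b20 : 0 <= b ^+ 2 by exact: sqr_ge0.
have Mm : (16 ^+ q) ^+ k = m ^+ 2.
  rewrite /m (_ : 16 = 2 ^+ 4 :> R); last by ring.
  have e4 : (4 * (q * k) = k * (2 * q * 2))%N.
    by rewrite mulnA [RHS]mulnC (mulnAC 2 q 2)%N.
  by rewrite -!exprM e4.
pose C2 := 16 ^+ q * C ^+ 2.
have key : (m * p * J) ^+ 2 <= C2.
  have -> : C2 = (4 ^+ q * C) ^+ 2.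
    rewrite /C2 exprMn; congr (_ * _); rewrite (_ : 16 = 4 ^+ 2 :> R); last by ring.
    by rewrite -!exprM mulnC.
  have h1 : m * p <= 4 ^+ q * Z ^+ (2 * q).
    rewrite (_ : m * p = (2 ^+ k * X) ^+ (2 * q)); last by rewrite exprMn.
    rewrite (_ : 4 = 2 ^+ 2 :> R); last by ring.
    rewrite -exprM -exprMn; apply: lerXn2r => //; rewrite nnegrE.
      by rewrite mulr_ge0// exprn_ge0.
    by apply: le_trans XZ; rewrite mulr_ge0// exprn_ge0.
  apply: lerXn2r; rewrite ?nnegrE.
  - by apply: mulr_ge0 => //; apply: mulr_ge0 => //; exact: ltW.
  - by apply: mulr_ge0 => //; exact: exprn_ge0.
  - apply: (le_trans (ler_wpM2r J0 h1)); rewrite -mulrA.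
    by apply: ler_wpM2l; [exact: exprn_ge0|rewrite mulrC].
have C20 : 0 <= C2 by apply: le_trans key; exact: sqr_ge0.
have q2 : (2 * q = (2 * q).-2.+2)%N by rewrite -(prednK q0) mulnS.
rewrite Mm /bell mulrA ler_pdivlMr ?exprn_gt0 ?ltr_pwDl//.
rewrite [leRHS]mulrAC ler_pdivlMr ?exprn_gt0// -/C2 -/b.
have J20 : 0 <= (m * J) ^+ 2 by exact: sqr_ge0.
have s0 : 0 <= (1 + y) ^+ 2 by exact: sqr_ge0.
have [y1|/ltW y1] := leP y 1.
  have y14 : (1 + y) ^+ 2 <= 4.
    by rewrite (_ : 4 = 2 ^+ 2); [apply: lerXn2r; rewrite ?nnegrE; lra|ring].
  have py : p ^+ 2 <= y.
    by rewrite -yp q2 exprS ler_piMr// exprn_ile1.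
  have W2 : W ^+ 2 <= b ^+ 2 * p ^+ 2 * p ^+ 2.
    apply: (@le_trans _ _ (((B * y) ^+ (2 * q)) ^+ 2)).
      by apply: lerXn2r; rewrite ?nnegrE// (le_trans W0).
    by rewrite exprMn -/b yp exprMn expr2 [X in _ * X]expr2 mulrA.
  have h1 : (J * W) ^+ 2 * m ^+ 2 <= C2 * b ^+ 2 * y.
    rewrite (_ : (J * W) ^+ 2 * m ^+ 2 = (m * J) ^+ 2 * W ^+ 2); last by ring.
    apply: (le_trans (ler_wpM2l J20 W2)).
    rewrite [leLHS](_ : _ = (m * p * J) ^+ 2 * b ^+ 2 * p ^+ 2); last by ring.
    by apply: ler_pM => //; [apply: mulr_ge0 => //; exact: sqr_ge0|exact: sqr_ge0|exact: ler_wpM2r].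
  rewrite mulrAC; apply: (le_trans (ler_wpM2r s0 h1)).
  apply: (@le_trans _ _ (C2 * b ^+ 2 * y * 4)).
    by apply: ler_wpM2l => //; apply: mulr_ge0 => //; exact: mulr_ge0.
  rewrite (_ : C2 * b ^+ 2 * y * 4 = 4 * (C2 * b ^+ 2) * y); last by ring.
  apply: ler_wpM2r => //; apply: ler_wpM2l => //; apply: ler_wpM2l => //.
  by rewrite lerDr.
have y14 : (1 + y) ^+ 2 <= 4 * p ^+ 2.
  apply: (@le_trans _ _ ((2 * y) ^+ 2)); first by apply: lerXn2r; rewrite ?nnegrE; lra.
  by rewrite exprMn (_ : 2 ^+ 2 = 4) -?yp; [apply: ler_wpM2l => //; apply: ler_weXn2l => //; rewrite -{1}[2%N]muln1 leq_mul2l|ring].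
have h1 : (J * W) ^+ 2 * m ^+ 2 <= (m * J) ^+ 2.
  rewrite (_ : (J * W) ^+ 2 * m ^+ 2 = (m * J) ^+ 2 * W ^+ 2); last by ring.
  by rewrite ler_piMr// exprn_ile1.
rewrite mulrAC; apply: (le_trans (ler_wpM2r s0 h1)).
apply: (le_trans (ler_wpM2l J20 y14)).
rewrite [leLHS](_ : _ = 4 * (m * p * J) ^+ 2); last by ring.
rewrite -[leRHS]mulrA; apply: ler_wpM2l => //; apply: (le_trans key).
by rewrite -mulrA ler_peMr// -[leLHS]mulr1; apply: ler_pM => //; rewrite lerDl.
Qed.

Lemma multiplier_le : exists2 C : R, 0 <= C & forall k t a xi, 0 < a -> 2 ^+ k * a <= 2 * t ->
  (sphere_transform (t *: xi) * cosT bandpass (a *: xi)) ^+ 2 <=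
  C / (16 ^+ q) ^+ k * bell ((a * enorm xi) ^+ 2).
Proof.
have n'0 : (0 < n')%N by lia.
have [C C0 hC] := @sphere_transform_decay R n' q n'0 qn.
exists (4 * (16 ^+ q * C ^+ 2 * (1 + (A ^+ (2 * q)) ^+ 2))).
  apply: mulr_ge0 => //; apply: mulr_ge0; first by apply: mulr_ge0; exact: exprn_ge0.
  by apply: addr_ge0 => //; exact: sqr_ge0.
move=> k t a xi a0 kat; have e0 := enorm_ge0 xi.
have t0 : 0 < t.
  have h : 0 < 2 ^+ k * a by rewrite mulr_gt0// exprn_gt0.
  by have := lt_le_trans h kat; rewrite pmulr_rgt0.
have [_ hJ] := hC (t *: xi); have [hW1 hW2] := cosT_bandpass_le (a *: xi).
have ea : enorm (a *: xi) = a * enorm xi by rewrite enormZ gtr0_norm.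
have et : enorm (t *: xi) = t * enorm xi by rewrite enormZ gtr0_norm.
rewrite -(real_normK (num_real (_ * _))) normrM.
apply: (@multiplier_algebra _ (t * enorm xi)) => //.
- by rewrite mulr_ge0// ltW.
- by rewrite !mulrA ler_wpM2r.
- by rewrite -et.
- by rewrite -ea.
Qed.

(** The sequence [sg] runs through dyadic scales upwards or downwards, so that two instances cover
    all integers. The constant is uniform in L, which permits the passage to infinite series. *)
Lemma square_sum_shells : exists2 C : R, 0 <= C & forall k (sg : nat -> R) tau L f,
  (forall j, 0 < sg j) ->
  (forall j, sg j.+1 = 2 * sg j) \/ (forall j, sg j = 2 * sg j.+1) -> 1 <= tau ->
  bounded_integrable lam f ->
  \sum_(0 <= j < L) \int[lam]_x
     (smear lam f id (shell (sg j * tau) (sg j * (2 / 2 ^+ k)) bandpass) x) ^+ 2 <=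
  C / (16 ^+ q) ^+ k * \int[lam]_x f x ^+ 2.
Proof.
have [C C0 hC] := multiplier_le; exists (C * (4 / 3)); first by rewrite mulr_ge0.
move=> k sg tau L f s0 sg2 tau1 bf; pose d : R := 2 / 2 ^+ k.
have d0 : 0 < d by rewrite divr_gt0// exprn_gt0.
have sd0 j : 0 < sg j * d by rewrite mulr_gt0.
have kb := mollifier_bandpass.
have ks j := kernel_shell (sg j * tau) (sd0 j) kb.
have M0 : 0 < (16 ^+ q) ^+ k :> R by rewrite !exprn_gt0.
apply: (@square_sum_smear _ _ _ _ (fun j => shell (sg j * tau) (sg j * d) bandpass) g) => //.
- exact: kernel_bounded_integrable.
- by move=> xi; have /andP[] := g01 xi.
- by move=> j; exact: kernel_bounded_integrable (ks j).
- by move=> j x; have [_ ->] := ks j.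
- by move=> j; exact: smear_continuous.
move=> xi; pose y j := (sg j * d * enorm xi) ^+ 2.
have y0 j : 0 <= y j by rewrite sqr_ge0.
apply: (@le_trans _ _ (\sum_(0 <= j < L) C / (16 ^+ q) ^+ k * bell (y j))).
  apply: ler_sum => j _; rewrite cosT_shell//; apply: hC => //.
  rewrite (_ : 2 ^+ k * (sg j * d) = 2 * sg j); last first.
    by rewrite /d; field; rewrite gt_eqF// exprn_gt0.
  by rewrite ler_wpM2l// ler_peMr// ltW.
rewrite -mulr_sumr [leRHS]mulrAC; apply: ler_wpM2l; first by rewrite divr_ge0// ltW.
apply: sum_bell_le => //; case: sg2 => sg2; [left|right] => j; rewrite /y sg2; ring.
Qed.

End square_function.

(** * Maximal bounds for the increments of level k *)

Section shell_HL.
Context {R : realType} (n' : nat).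
Notation n := n'.+1.
Notation T := 'rV[R]_n.
Notation lam := (@lebesgue_rV R n).
Implicit Types (x y z w xi : T) (a t s d : R) (f D : T -> R).

Lemma pow2_bound (x : R) : exists c : nat, x <= 2 ^+ c.
Proof.
by exists (Num.bound x); apply: ltW; exact: upper_nthrootP.
Qed.

Lemma smearB f K1 K2 x : lam.-integrable setT (EFin \o f) -> bounded_integrable lam K1 ->
  bounded_integrable lam K2 ->
  smear lam f id K1 x - smear lam f id K2 x = smear lam f id (fun z => K1 z - K2 z) x.
Proof.
move=> iff b1 b2; have mid : measurable_fun setT (@id T) by [].
rewrite /smear -RintegralB//; [|exact: smear_slice_integrable..].
by apply: eq_Rintegral => z _; rewrite mulrBr.
Qed.

Lemma expzD2 (m : int) (c : nat) : 2 ^ (m + c%:Z) = 2 ^ m * 2 ^+ c :> R.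
Proof. by rewrite expfzDr. Qed.

Lemma mollifier_bound1 D : mollifier D -> exists2 C, 1 <= C & kernel_bound D C.
Proof.
move=> [[C kC] _]; exists (C + 1); first by rewrite lerDr (kernel_bound_ge0 kC).
by apply: kernel_boundS kC; rewrite lerDl.
Qed.

(** The kernel has height of order 1/(a t^(n-1)) on a cube of size t, so comparing it with an
    average over the cube loses t/a, of order 1/d. *)
Lemma shell_HL D : mollifier D -> exists2 C : R, 0 <= C & forall f x (m : int) t d,
  bounded_integrable lam f -> (forall y, 0 <= f y) -> 0 < d -> d <= 1 ->
  2 ^ m <= t -> t <= 2 ^ m * 2 ->
  (`|smear lam f id (shell t (2 ^ m * d) D) x|%:E <= (C / d)%:E * HL f x)%E.
Proof.
move=> kD; have [C C1 kC] := mollifier_bound1 kD; have C0 : 0 < C by lra.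
have [c hc] := pow2_bound (4 * C).
exists ((4 * C) ^+ n * (2 * 2 ^+ c) ^+ n).
  by rewrite mulr_ge0 ?exprn_ge0 ?mulr_ge0 ?exprn_ge0// ltW.
move=> f x m t d bf f0 d0 d1 mt tm; pose s : R := 2 ^ m; have s0 : 0 < s by exact: expz2_gt0.
have a0 : 0 < s * d by rewrite mulr_gt0.
have ast : s * d <= t by rewrite (le_trans _ mt)// ler_piMr// ltW.
have t0 : 0 < t by exact: lt_le_trans mt.
pose B := (4 * C) ^+ n / (d * s ^+ n).
have C4 : 0 < (4 * C) ^+ n by rewrite exprn_gt0// mulr_gt0.
have sn0 : 0 < s ^+ n by rewrite exprn_gt0.
have B0 : 0 <= B by rewrite divr_ge0 ?mulr_ge0 ?(ltW C4) ?(ltW d0) ?(ltW sn0).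
have -> : (4 * C) ^+ n * (2 * 2 ^+ c) ^+ n / d = B * (2 * 2 ^ (m + c%:Z)) ^+ n.
  rewrite expzD2 -/s (_ : 2 * (s * 2 ^+ c) = s * (2 * 2 ^+ c)); last by ring.
  rewrite (exprMn _ s) /B; move: (s ^+ n) sn0 => S S0; set Y := (2 * _) ^+ n.
  by set Z := (4 * C) ^+ n; field; rewrite !gt_eqF.
apply: smear_le_HL => //.
  exact: kernel_bounded_integrable (kernel_shell t a0 kD).
move=> z; rewrite (le_trans (shell_le z kD kC C1 a0 ast))//.
have X0 : 0 <= (4 * C) ^+ n / (s * d * t ^+ n').
  by rewrite divr_ge0 ?mulr_ge0 ?exprn_ge0 ?(ltW s0) ?(ltW d0) ?(ltW t0)//; rewrite mulr_ge0// ltW.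
have XB : (4 * C) ^+ n / (s * d * t ^+ n') <= B.
  rewrite /B ler_wpM2l ?(ltW C4)// lef_pV2 ?posrE ?mulr_gt0 ?exprn_gt0//.
  rewrite exprS mulrCA mulrA ler_wpM2l ?mulr_ge0 ?(ltW s0) ?(ltW d0)//.
  by apply: lerXn2r; rewrite ?nnegrE ?(ltW s0) ?(ltW t0).
apply: ler_pM => //; case: (leP `|z| (2 * C * t)) => // zt.
rewrite (_ : (`|z| <= _) = true)// (le_trans zt)// expzD2 -/s.
apply: (@le_trans _ _ (4 * C * s)); last by rewrite mulrC ler_wpM2l ?(ltW s0).
rewrite (_ : 4 * C * s = 2 * C * (s * 2)); last by ring.
by rewrite ler_wpM2l// mulr_ge0// ltW.
Qed.

Lemma shell_diff_HL D : mollifier D -> exists2 C : R, 0 <= C & forall f x (m : int) t t' d,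
  bounded_integrable lam f -> (forall y, 0 <= f y) -> 0 < d -> d <= 1 ->
  2 ^ m <= t -> t <= 2 ^ m * 2 -> `|t - t'| <= 2 ^ m * d ->
  (`|smear lam f id (shell t (2 ^ m * d) D) x -
     smear lam f id (shell t' (2 ^ m * d) D) x|%:E <=
     (C * (`|t - t'| / (2 ^ m * d ^+ 2)))%:E * HL f x)%E.
Proof.
move=> kD; have [C C1 kC] := mollifier_bound1 kD; have C0 : 0 < C by lra.
have [c hc] := pow2_bound (6 * C).
exists ((8 * C) ^+ n * (2 * 2 ^+ c) ^+ n).
  by rewrite mulr_ge0 ?exprn_ge0 ?mulr_ge0 ?exprn_ge0// ltW.
move=> f x m t t' d bf f0 d0 d1 mt tm tt; pose s : R := 2 ^ m.
have s0 : 0 < s by exact: expz2_gt0.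
have a0 : 0 < s * d by rewrite mulr_gt0.
have ast : s * d <= t by rewrite (le_trans _ mt)// ler_piMr// ltW.
have t0 : 0 < t by exact: lt_le_trans mt.
pose B := (8 * C) ^+ n * `|t - t'| / ((s * d) ^+ 2 * s ^+ n').
have C4 : 0 < (8 * C) ^+ n by rewrite exprn_gt0// mulr_gt0.
have sn0 : 0 < s ^+ n' by rewrite exprn_gt0.
have B0 : 0 <= B.
  by apply: divr_ge0; apply: mulr_ge0; rewrite ?sqr_ge0 ?(ltW C4) ?(ltW sn0).
have -> : (8 * C) ^+ n * (2 * 2 ^+ c) ^+ n * (`|t - t'| / (2 ^ m * d ^+ 2)) =
    B * (2 * 2 ^ (m + c%:Z)) ^+ n.
  rewrite expzD2 -/s (_ : 2 * (s * 2 ^+ c) = s * (2 * 2 ^+ c)); last by ring.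
  rewrite (exprMn _ s) /B [s ^+ n]exprS; move: (s ^+ n') sn0 => S S0; set Y := (2 * _) ^+ n.
  by set Z := (8 * C) ^+ n; field; rewrite !gt_eqF.
have bs r := kernel_bounded_integrable (kernel_shell r a0 kD).
have [mf _ iff] := bf; rewrite smearB//.
apply: smear_le_HL => //.
  have := bounded_integrableD (bs t) (kernel_bounded_integrable (kernelZ (-1) (kernel_shell t' a0 kD))).
  by under eq_fun do rewrite mulN1r.
move=> z; rewrite (le_trans (shell_diff_le z kD kC C1 a0 ast tt))//.
have XB : (8 * C) ^+ n * `|t - t'| / ((s * d) ^+ 2 * t ^+ n') <= B.
  rewrite /B ler_wpM2l ?mulr_ge0 ?(ltW C4)// lef_pV2 ?posrE ?mulr_gt0 ?exprn_gt0//.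
  rewrite ler_wpM2l ?sqr_ge0//.
  by apply: lerXn2r; rewrite ?nnegrE ?(ltW s0) ?(ltW t0).
apply: ler_pM => //.
  by apply: divr_ge0; apply: mulr_ge0; rewrite ?sqr_ge0 ?(exprn_ge0 _ (ltW t0)) ?(ltW C4).
case: (leP `|z| (3 * C * t)) => // zt.
rewrite (_ : (`|z| <= _) = true)// (le_trans zt)// expzD2 -/s.
apply: (@le_trans _ _ (6 * C * s)); last by rewrite mulrC ler_wpM2l ?(ltW s0).
rewrite (_ : 6 * C * s = 3 * C * (s * 2)); last by ring.
by rewrite ler_wpM2l// mulr_ge0// ltW.
Qed.

End shell_HL.

Section dyadic_maximal.
Context {R : realType} (n' : nat).
Notation n := n'.+1.
Notation T := 'rV[R]_n.
Notation lam := (@lebesgue_rV R n).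
Implicit Types (x y z w xi : T) (a t s d : R) (f : T -> R) (m : int).

Variables (g : T -> R) (A : R) (q : nat).
Hypotheses (kg : mollifier g) (g0 : forall x, 0 <= g x)
  (g01 : forall xi, 0 <= cosT g xi <= 1) (A0 : 0 <= A)
  (gA : forall xi, 1 - cosT g xi <= A * enorm xi ^+ 2)
  (bG : bounded_integrable lam (cosT g)) (G0 : 0 < \int[lam]_xi cosT g xi)
  (q0 : (0 < q)%N) (qn : (4 * q + 2 <= n)%N).

(* Two radii at distance at most [2 ^ m / 8 ^ k] give increments of level [k] that
   differ by [O(2 ^- k)], so radii in [2 ^ m, 2 ^ m * 2] are sampled at [2 ^ m * grid i]
   and smoothed at width [2 ^ m * grain k]. *)
Definition grid k (i : 'I_(8 ^ k)) : R := 1 + i%:R / 8 ^+ k.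
Definition grain k : R := 2 / 2 ^+ k.

Definition piece k f m (i : 'I_(8 ^ k)) x : R :=
  smear lam f id (shell (2 ^ m * grid i) (2 ^ m * grain k) (bandpass g q)) x.

Definition piece_sup k f x : \bar R :=
  ereal_sup (range (fun p : int * 'I_(8 ^ k) => `|piece f p.1 p.2 x|%:E)).

Let kb : mollifier (bandpass g q). Proof. exact: mollifier_bandpass. Qed.

Lemma grain_gt0 k : 0 < grain k. Proof. by rewrite divr_gt0// exprn_gt0. Qed.

Lemma grain_le1 k : (0 < k)%N -> grain k <= 1.
Proof.
by case: k => // k _; rewrite /grain ler_pdivrMr ?exprn_gt0// mul1r exprS ler_peMr// exprn_ege1// ler1n.
Qed.

Lemma grid_bounds k (i : 'I_(8 ^ k)) : 1 <= grid i <= 2.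
Proof.
have p8 : 0 < 8 ^+ k :> R by rewrite exprn_gt0.
rewrite /grid lerDl divr_ge0 ?(ltW p8)//= (_ : 2 = 1 + 1)// lerD2l ler_pdivrMr// mul1r.
by rewrite -natrX ler_nat ltnW.
Qed.

Let scale0 k m : 0 < 2 ^ m * grain k.
Proof. by rewrite mulr_gt0 ?expz2_gt0 ?grain_gt0. Qed.

Lemma piece_bounded_integrable k f m (i : 'I_(8 ^ k)) : bounded_integrable lam f ->
  bounded_integrable lam (piece f m i).
Proof.
move=> [_ _ iff]; have mid : measurable_fun setT (@id T) by [].
apply: (smear_bounded_integrable iff mid).
exact: kernel_bounded_integrable (kernel_shell _ (scale0 k m) kb).
Qed.

Lemma pieceD k f1 f2 m (i : 'I_(8 ^ k)) x : bounded_integrable lam f1 ->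
  bounded_integrable lam f2 ->
  piece (fun y => f1 y + f2 y) m i x = piece f1 m i x + piece f2 m i x.
Proof.
move=> [_ _ i1] [_ _ i2]; have mid : measurable_fun setT (@id T) by [].
have bs := kernel_bounded_integrable (kernel_shell (2 ^ m * grid i) (scale0 k m) kb).
rewrite /piece /smear -RintegralD//; [|exact: smear_slice_integrable..].
by apply: eq_Rintegral => z _; rewrite mulrDl.
Qed.

Lemma measurable_piece_sup k f : bounded_integrable lam f -> measurable_fun setT (piece_sup k f).
Proof.
move=> bf; have i0 : 'I_(8 ^ k) by exists 0%N; rewrite expn_gt0.
apply: (@measurable_fun_countable_sup _ _ _ _ (0%R : int, i0)
  (fun (p : int * 'I_(8 ^ k)) x => `|piece f p.1 p.2 x|%:E)) => p.
have [mp _ _] := piece_bounded_integrable p.1 p.2 bf.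
by apply/measurable_EFinP; exact: measurableT_comp.
Qed.

Lemma piece_sup_ge0 k f x : (0 <= piece_sup k f x)%E.
Proof.
have i0 : 'I_(8 ^ k) by exists 0%N; rewrite expn_gt0.
apply: (@le_trans _ _ (`|piece f 0 i0 x|%:E)); first by rewrite lee_fin.
by apply: ereal_sup_ubound; exists (0%R, i0).
Qed.

(** The integers m are enumerated by the two sequences j and -j; counting m = 0 twice only enlarges
    the sum, which serves as an upper bound. *)
Definition piece_square k f x : \bar R :=
  (\sum_(i < 8 ^ k) (\sum_(0 <= j <oo) ((piece f (j%:Z) i x) ^+ 2)%:E +
                     \sum_(0 <= j <oo) ((piece f (- j%:Z) i x) ^+ 2)%:E))%E.

Let sq0 k f (sg : nat -> int) (i : 'I_(8 ^ k)) x (j : nat) :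
  (0 <= ((piece f (sg j) i x) ^+ 2)%:E)%E.
Proof. by rewrite lee_fin sqr_ge0. Qed.

Lemma piece_le_square k f m (i : 'I_(8 ^ k)) x :
  (((piece f m i x) ^+ 2)%:E <= piece_square k f x)%E.
Proof.
have ser0 (sg : nat -> int) (i' : 'I_(8 ^ k)) :
    (0 <= \sum_(0 <= j <oo) ((piece f (sg j) i' x) ^+ 2)%:E)%E.
  by apply: nneseries_ge0 => j _ _; exact: sq0.
have one (sg : nat -> int) (j : nat) :
    (((piece f (sg j) i x) ^+ 2)%:E <= \sum_(0 <= j <oo) ((piece f (sg j) i x) ^+ 2)%:E)%E.
  apply: le_trans (nneseries_lim_ge j.+1 _); last by move=> *; exact: sq0.
  by rewrite big_nat_recr//= leeDr// sume_ge0// => l _; exact: sq0.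
rewrite /piece_square (bigD1 i)//=.
apply: (@le_trans _ _ (\sum_(0 <= j <oo) ((piece f (j%:Z) i x) ^+ 2)%:E +
                     \sum_(0 <= j <oo) ((piece f (- j%:Z) i x) ^+ 2)%:E)%E); last first.
  rewrite leeDl// sume_ge0// => l _; apply: adde_ge0; first exact: (ser0 (fun j => j%:Z)).
  exact: (ser0 (fun j => - j%:Z)).
case: m => j.
  apply: le_trans (one (fun j => j%:Z) j) _.
  by rewrite leeDl//; exact: (ser0 (fun j => - j%:Z)).
rewrite NegzE; apply: le_trans (one (fun j => - j%:Z) j.+1) _.
by rewrite leeDr//; exact: (ser0 (fun j => j%:Z)).
Qed.

Let msq k f (bf : bounded_integrable lam f) (sg : nat -> int) (i : 'I_(8 ^ k)) (j : nat) :
  measurable_fun setT (fun x => ((piece f (sg j) i x) ^+ 2)%:E).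
Proof.
have [mp _ _] := piece_bounded_integrable (sg j) i bf.
by apply/measurable_EFinP; mfun.
Qed.

Let mser k f (bf : bounded_integrable lam f) (sg : nat -> int) (i : 'I_(8 ^ k)) :
  measurable_fun setT (fun x => \sum_(0 <= j <oo) ((piece f (sg j) i x) ^+ 2)%:E)%E.
Proof.
by apply: ge0_emeasurable_sum; [move=> j y _ _; exact: sq0|move=> j _; exact: msq].
Qed.

Lemma measurable_piece_square k f : bounded_integrable lam f ->
  measurable_fun setT (piece_square k f).
Proof.
move=> bf; apply: emeasurable_sum => i; apply: emeasurable_funD.
  exact: (mser bf (fun j => j%:Z)).
exact: (mser bf (fun j => - j%:Z)).
Qed.

(** The supremum over the grid is bounded by a sum, at the price of its 8^k points; the 2 counts the
    two half-lines of integers. *)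
Lemma integral_piece_square : exists2 C : R, 0 <= C & forall k f, bounded_integrable lam f ->
  (\int[lam]_x piece_square k f x <=
   (2 * 8 ^+ k * (C / (16 ^+ q) ^+ k))%:E * \int[lam]_x ((f x) ^+ 2)%:E)%E.
Proof.
have [C C0 hC] := square_sum_shells kg g0 g01 A0 gA bG G0 q0 qn.
exists C => // k f bf.
have bf2 : bounded_integrable lam (fun x => f x ^+ 2).
  by under eq_fun do rewrite expr2; exact: bounded_integrable_mul.
have [_ _ if2] := bf2.
have D0 : 0 <= C / (16 ^+ q) ^+ k by rewrite divr_ge0// !exprn_ge0.
have ser (sg : nat -> int) (i : 'I_(8 ^ k)) :
    (forall j, 2 ^ sg j.+1 = 2 * 2 ^ sg j :> R) \/ (forall j, 2 ^ sg j = 2 * 2 ^ sg j.+1 :> R) ->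
    (\int[lam]_x \sum_(0 <= j <oo) ((piece f (sg j) i x) ^+ 2)%:E <=
     (C / (16 ^+ q) ^+ k)%:E * \int[lam]_x ((f x) ^+ 2)%:E)%E.
  move=> hsg; rewrite integral_nneseries//; last by move=> j; exact: msq.
  apply: lime_le.
    by apply: is_cvg_nneseries => j _ _; apply: integral_ge0 => x _; exact: sq0.
  apply: nearW => L; rewrite integral_EFin// -EFinM.
  under eq_bigr => j _.
    rewrite integral_EFin; last first.
      have [mp [M pM] ip] := piece_bounded_integrable (sg j) i bf.
      by under eq_fun do rewrite expr2; exact: (integrable_mul_bounded ip mp pM).
    over.
  rewrite sumEFin lee_fin; have /andP[i1 _] := grid_bounds i.
  exact: (hC k (fun j => 2 ^ sg j) (grid i) L f (fun j => expz2_gt0 _) hsg i1 bf).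
have ser0 (sg : nat -> int) (i : 'I_(8 ^ k)) x :
    (0 <= \sum_(0 <= j <oo) ((piece f (sg j) i x) ^+ 2)%:E)%E.
  by apply: nneseries_ge0 => j _ _; exact: sq0.
rewrite /piece_square ge0_integral_sum//; last 2 first.
- move=> i; apply: emeasurable_funD; first exact: (mser bf (fun j => j%:Z)).
  exact: (mser bf (fun j => - j%:Z)).
- move=> i x _; apply: adde_ge0; first exact: (ser0 (fun j => j%:Z)).
  exact: (ser0 (fun j => - j%:Z)).
rewrite integral_EFin// in ser *.
apply: (@le_trans _ _ (\sum_(i < 8 ^ k) ((C / (16 ^+ q) ^+ k)%:E * (\int[lam]_x f x ^+ 2)%:E +
   (C / (16 ^+ q) ^+ k)%:E * (\int[lam]_x f x ^+ 2)%:E))%E).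
  apply: lee_sum => i _.
  rewrite (ge0_integralD lam measurableT (fun x _ => ser0 (fun j => j%:Z) i x)
    (mser bf (fun j => j%:Z) i) (fun x _ => ser0 (fun j => - j%:Z) i x)
    (mser bf (fun j => - j%:Z) i)).
  apply: leeD.
    by apply: (ser (fun j => j%:Z)); left => j; rewrite -exprnP exprS.
  apply: (ser (fun j => - j%:Z)); right => j.
  by rewrite -!exprnN exprS invfM mulrA mulfV ?mul1r.
under eq_bigr do rewrite -EFinM -EFinD.
rewrite sumEFin lee_fin sumr_const card_ord -[leLHS]mulr_natr natrX.
by rewrite le_eqVlt; apply/orP; left; apply/eqP; ring.
Qed.

Lemma markov_measure (V : T -> \bar R) (v : R) : 0 < v -> measurable_fun setT V ->
  (forall x, 0 <= V x)%E ->
  (lam [set x | v%:E < V x] <= (v^-1)%:E * \int[lam]_x V x)%E.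
Proof.
move=> v0 mV V0; have mS : measurable [set x | (v%:E < V x)%E].
  by rewrite -[X in measurable X]setTI; exact: emeasurable_fun_o_infty.
rewrite -(measure_integral_indic mS) -ge0_integralZl//; last by rewrite lee_fin invr_ge0 ltW.
apply: ge0_le_integral_nomeas => x _; first by rewrite lee_fin.
rewrite indicE; case: (boolP (x \in _)) => [|_]; last first.
  by rewrite mule_ge0// lee_fin invr_ge0 ltW.
rewrite inE/= => /ltW vV; apply: (@le_trans _ _ ((v^-1)%:E * v%:E)%E).
  by rewrite -EFinM mulVf ?gt_eqF.
by apply: lee_wpmul2l => //; rewrite lee_fin invr_ge0 ltW.
Qed.

(** The function is cut at height c a. The upper part is bounded pointwise by C 2^k times its
    Hardy-Littlewood function, the lower part by Chebyshev and the square function. The cut c stays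
    free, to be balanced against k later. *)
Lemma piece_sup_weak_type : exists A1 B1 : R, [/\ 0 <= A1, 0 <= B1 & forall k f a c,
  (0 < k)%N -> bounded_integrable lam f -> (forall y, 0 <= f y) -> 0 < a -> 0 < c ->
  (lam [set x | a%:E < piece_sup k f x] <=
   (A1 * 2 ^+ k / a)%:E * \int[lam]_x (f x * (c * a < f x)%R%:R)%:E +
   (B1 * (8 / 16 ^+ q) ^+ k / a ^+ 2)%:E *
     \int[lam]_x (f x ^+ 2 * (f x <= c * a)%R%:R)%:E)%E].
Proof.
have [C C0 hC] := shell_HL kb; have [C2 C20 hC2] := integral_piece_square.
have C1 : 0 < C + 1 by rewrite ltr_wpDl.
exists (6 ^+ n * (C + 1)), (8 * C2); split.
- by rewrite mulr_ge0 ?exprn_ge0// ltW.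
- by rewrite mulr_ge0.
move=> k f a c k0 bf f0 a0 c0; have [mf [M fM] iff] := bf.
pose f1 y := f y * (c * a < f y)%R%:R; pose f2 y := f y * (f y <= c * a)%R%:R.
have bmul (b : T -> bool) : measurable_fun setT (fun y => (b y)%:R : R) ->
    bounded_integrable lam (fun y => f y * (b y)%:R).
  move=> mb; split; first exact: measurable_funM.
    exists M => y; rewrite normrM (le_trans _ (fM y))// ler_piMr// normr_nat.
    by case: (b y).
  under eq_fun do rewrite mulrC.
  apply: (integrable_mul_bounded (M := 1)) => // y.
  by rewrite normr_nat; case: (b y).
have bf1 : bounded_integrable lam f1 by apply: bmul; mfun.
have bf2 : bounded_integrable lam f2 by apply: bmul; mfun.
have f10 y : 0 <= f1 y by rewrite mulr_ge0.
have f20 y : 0 <= f2 y by rewrite mulr_ge0.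
have fE : f = fun y => f1 y + f2 y.
  by apply/funext => y; rewrite /f1 /f2 ltNge; case: (f y <= c * a); rewrite /= ?mulr1 ?mulr0 ?addr0 ?add0r.
have p2 : 0 < 2 ^+ k :> R by rewrite exprn_gt0.
(* A piece of the upper part above a/2 forces its Hardy-Littlewood function above b, because C /
   [grain k] = C 2^k / 2. Using C + 1 avoids a division by 0. *)
pose b := a / ((C + 1) * 2 ^+ k); have b0 : 0 < b by rewrite divr_gt0// mulr_gt0.
pose v := (a / 2) ^+ 2; have v0 : 0 < v by rewrite exprn_gt0// divr_gt0.
pose S1 := [set x | (b%:E < HL f1 x)%E].
pose S2 := [set x | (v%:E < piece_square k f2 x)%E].
have mf1 : measurable_fun setT f1 by case: bf1.
have mHL := measurable_HL mf1 f10.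
have mps := measurable_piece_square k bf2.
have mpp := measurable_piece_sup k bf.
have mS1 : measurable S1.
  by rewrite -[X in measurable X]setTI; exact: emeasurable_fun_o_infty.
have mS2 : measurable S2.
  by rewrite -[X in measurable X]setTI; exact: emeasurable_fun_o_infty.
have mS : measurable [set x | (a%:E < piece_sup k f x)%E].
  by rewrite -[X in measurable X]setTI; exact: emeasurable_fun_o_infty.
have ps0 x : (0 <= piece_square k f2 x)%E.
  have i0 : 'I_(8 ^ k) by exists 0%N; rewrite expn_gt0.
  by apply: le_trans (piece_le_square f2 0 i0 x); rewrite lee_fin sqr_ge0.
have sub : [set x | (a%:E < piece_sup k f x)%E] `<=` S1 `|` S2.
  move=> x /= /ereal_sup_gt[_ [[m i] _ <-]] /=; rewrite lte_fin fE pieceD// => apx.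
  have [h1|h1] := ltP (a / 2) `|piece f1 m i x|; last first.
    right; rewrite /S2/=; apply: lt_le_trans (piece_le_square f2 m i x).
    rewrite lte_fin -(real_normK (num_real (piece f2 m i x))) /v.
    rewrite ltrXn2r ?nnegrE ?divr_ge0 ?(ltW a0)//.
    by have := ler_normD (piece f1 m i x) (piece f2 m i x); lra.
  left; rewrite /S1/=; have /andP[i1 i2] := grid_bounds i.
  have s0 : 0 < 2 ^ m :> R by exact: expz2_gt0.
  have := hC f1 x m (2 ^ m * grid i) (grain k) bf1 f10 (grain_gt0 k) (grain_le1 k0).
  rewrite ler_peMr ?(ltW s0)// ler_wpM2l ?(ltW s0)// => /(_ isT isT) H.
  have H1 : ((a / 2)%:E < (C / grain k)%:E * HL f1 x)%E by apply: lt_le_trans H; rewrite lte_fin.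
  have HL0 : (0 <= HL f1 x)%E by exact: HL_ge0.
  have H2 : ((a / 2)%:E < ((C + 1) * 2 ^+ k / 2)%:E * HL f1 x)%E.
    apply: (lt_le_trans H1); apply: lee_wpmul2r => //; rewrite lee_fin.
    rewrite /grain invfM invrK mulrA mulrAC ler_wpM2r//.
    by rewrite ler_wpM2r ?(ltW p2)// lerDl.
  rewrite /b -(@lte_pmul2l _ ((C + 1) * 2 ^+ k / 2)%:E) ?lte_fin ?divr_gt0 ?mulr_gt0//.
  rewrite -EFinM (_ : (C + 1) * 2 ^+ k / 2 * (a / ((C + 1) * 2 ^+ k)) = a / 2)//; field.
  by rewrite !gt_eqF.
apply: (@le_trans _ _ (lam S1 + lam S2)%E).
  apply: (le_trans _ (measureU2 _ mS1 mS2)).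
  by apply: le_measure; rewrite ?inE//; exact: measurableU.
apply: leeD.
  apply: (le_trans (HL_weak_type b0 mf1 f10)).
  rewrite /b invf_div (_ : 6 ^+ n * ((C + 1) * 2 ^+ k / a) = 6 ^+ n * (C + 1) * 2 ^+ k / a)//.
  by rewrite !mulrA.
apply: (le_trans (markov_measure v0 mps ps0)).
apply: (@le_trans _ _ ((v^-1)%:E * ((2 * 8 ^+ k * (C2 / (16 ^+ q) ^+ k))%:E * \int[lam]_x ((f2 x) ^+ 2)%:E))%E).
  by apply: lee_wpmul2l; [rewrite lee_fin invr_ge0 ltW|exact: hC2].
rewrite muleA -EFinM (_ : v^-1 * _ = 8 * C2 * (8 / 16 ^+ q) ^+ k / a ^+ 2); last first.
  rewrite /v !expr_div_n; have : (16 ^+ q) ^+ k != 0 :> R by rewrite !expf_neq0.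
  move: ((16 ^+ q) ^+ k) => P P0; field.
  by rewrite P0 gt_eqF.
rewrite (_ : (\int[lam]_x ((f2 x) ^+ 2)%:E = \int[lam]_x (f x ^+ 2 * (f x <= c * a)%R%:R)%:E)%E)//.
apply: eq_integral => x _; rewrite /f2 exprMn; congr ((_ * _)%:E).
by case: (f x <= _); rewrite ?expr1n ?expr0n.
Qed.

Lemma powRX (u r : R) k : 0 <= u -> (u ^+ k) `^ r = (u `^ r) ^+ k.
Proof.
move=> u0; elim: k => [|k IH]; first by rewrite !expr0 powR1.
by rewrite !exprS powRM ?exprn_ge0// IH.
Qed.

Lemma powR2_lt1 (r : R) : r < 0 -> 2 `^ r < 1 :> R.
Proof.
move=> r0; rewrite /powR gt_eqF//= expR_lt1 nmulr_rlt0// ln_gt0// ltr1n.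
by [].
Qed.

Lemma piece_sup_strong_type (p : R) : 1 < p -> p < 2 -> (4 * q)%:R - 1 < p * ((4 * q)%:R - 2) ->
  exists C rho : R, [/\ 0 <= C, 0 < rho, rho < 1 & forall k f,
  (0 < k)%N -> bounded_integrable lam f -> (forall y, 0 <= f y) ->
  (\int[lam]_x (piece_sup k f x `^ p) <= (C * rho ^+ k)%:E * \int[lam]_x (f x `^ p)%:E)%E].
Proof.
move=> p1 p2 hp; have [A1 [B1 [A10 B10 hAB]]] := piece_sup_weak_type.
(* Cutting at c = u^k with u = 2^kap makes the two terms of the interpolation geometric, of ratios
   [rho1] and [rho2]. They are below 1 exactly when kap > [r1] and kap < [r2], and [r1 < r2] is the
   hypothesis on p. *)
pose r1 := (p - 1)^-1; pose r2 := ((4 * q)%:R - 3) / (2 - p).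
have p10 : 0 < p - 1 by lra.
have p20 : 0 < 2 - p by lra.
have r12 : r1 < r2.
  by rewrite /r1 /r2 ltr_pdivlMr// mulrC ltr_pdivrMr//; move: hp; set Q := (4 * q)%:R; lra.
have [kap r1k kr2] : exists2 kap : R, r1 < kap & kap < r2.
  by exists ((r1 + r2) / 2); [rewrite midf_lt|rewrite midf_lt].
have k1 : 1 < kap * (p - 1) by rewrite -ltr_pdivrMr// mul1r.
have k2 : kap * (2 - p) < (4 * q)%:R - 3 by rewrite -ltr_pdivlMr.
pose u : R := 2 `^ kap; have u0 : 0 < u by rewrite powR_gt0.
pose rho1 := 2 `^ (1 + kap * (1 - p)) : R; pose rho2 := 2 `^ (3 - (4 * q)%:R + kap * (2 - p)) : R.
have rho11 : rho1 < 1 by apply: powR2_lt1; lra.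
have rho21 : rho2 < 1 by apply: powR2_lt1; lra.
have rho10 : 0 < rho1 by rewrite powR_gt0.
have rho20 : 0 < rho2 by rewrite powR_gt0.
pose rho := Num.max rho1 rho2.
have E1 k : 2 ^+ k * (u ^+ k) `^ (1 - p) = rho1 ^+ k.
  rewrite powRX ?(ltW u0)// -exprMn /rho1 [2 `^ (1 + _)]powRD ?pnatr_eq0 ?implybT//.
  by rewrite powRr1// /u -powRrM.
have E2 k : (8 / 16 ^+ q) ^+ k * (u ^+ k) `^ (2 - p) = rho2 ^+ k.
  rewrite powRX ?(ltW u0)// -exprMn /rho2 [2 `^ (3 - _ + _)]powRD ?pnatr_eq0 ?implybT//.
  rewrite powRrM -/u; congr ((_ * _) ^+ k).
  rewrite powRD ?pnatr_eq0 ?implybT// powRN !powR_mulrn// exprM.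
  by congr (_ / _ ^+ q); ring.
exists (p * A1 / (p - 1) + p * B1 / (2 - p)), rho; split.
- by rewrite addr_ge0// divr_ge0// ?mulr_ge0//; lra.
- by rewrite lt_max rho10.
- by rewrite gt_max rho11.
move=> k f k0 bf f0; have c0 : 0 < u ^+ k by rewrite exprn_gt0.
have [mf _ _] := bf.
have A0' : 0 <= A1 * 2 ^+ k by rewrite mulr_ge0 ?exprn_ge0.
have B0' : 0 <= B1 * (8 / 16 ^+ q) ^+ k by rewrite mulr_ge0 ?exprn_ge0 ?divr_ge0 ?exprn_ge0.
have p12 : 1 < p < 2 by rewrite p1.
have := @strong_type_interpolation _ _ _ lam (piece_sup k f) f p _ _ _ p12 A0' B0' c0
  (measurable_piece_sup k bf) (piece_sup_ge0 k f) mf f0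
  (fun a ha => hAB k f a (u ^+ k) k0 bf f0 ha c0).
move=> H; apply: (le_trans H); apply: lee_wpmul2r.
  by apply: integral_ge0 => x _; rewrite lee_fin powR_ge0.
rewrite lee_fin.
have -> : p * (A1 * 2 ^+ k) * (u ^+ k) `^ (1 - p) / (p - 1) = p * A1 / (p - 1) * rho1 ^+ k.
  by rewrite -E1; ring.
have -> : p * (B1 * (8 / 16 ^+ q) ^+ k) * (u ^+ k) `^ (2 - p) / (2 - p) = p * B1 / (2 - p) * rho2 ^+ k.
  by rewrite -E2; ring.
rewrite mulrDl; apply: lerD; apply: ler_wpM2l.
- by rewrite divr_ge0// ?mulr_ge0//; lra.
- by apply: lerXn2r; rewrite ?nnegrE ?(ltW rho10) ?le_max ?lexx// (ltW rho10).
- by rewrite divr_ge0// ?mulr_ge0//; lra.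
- by apply: lerXn2r; rewrite ?nnegrE ?(ltW rho20) ?le_max ?lexx ?orbT// (ltW rho20) orbT.
Qed.

End dyadic_maximal.

(** * Spherical averages as sums of increments *)

Lemma geometric_sum_le {R : realType} K (r : R) : 0 <= r < 1 ->
  \sum_(0 <= k < K) r ^+ k <= (1 - r)^-1.
Proof.
move=> /andP[r0 r1]; have r10 : 0 < 1 - r by rewrite subr_gt0.
have : (\sum_(0 <= k < K) r ^+ k) * (1 - r) = 1 - r ^+ K.
  elim: K => [|K IH]; first by rewrite big_geq// mul0r expr0 subrr.
  by rewrite big_nat_recr//= mulrDl IH exprS; ring.
move=> H; rewrite -[leRHS]mul1r ler_pdivlMr// H.
by rewrite lerBlDr lerDl exprn_ge0.
Qed.

Section spherical_averages.
Context {R : realType} (n' : nat).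
Notation n := n'.+1.
Notation T := 'rV[R]_n.
Notation lam := (@lebesgue_rV R n).
Notation bind := (@ball_indic R n').
Implicit Types (x y z w xi : T) (a t s d : R) (f D : T -> R).

(** The average is not normalised: its total mass is the volume of the unit ball. *)
Definition sphere_average f t x : R := smear lam bind (fun w => t *: dir w) f x.

Lemma Rintegral_mul_dil f D a x (M : R) : 0 < a -> measurable_fun setT f ->
  (forall y, `|f y| <= M) -> lam.-integrable setT (EFin \o D) ->
  \int[lam]_y (f y * dil a D (x - y)) = \int[lam]_z (D z * f (x - a *: z)).
Proof.
move=> a0 mf fM iD; have a0' : 0 < a^-1 by rewrite invr_gt0.
have mD := integrable_measurable iD.
rewrite -(@Rintegral_rV_translation _ _ _ x); last by rewrite /dil; mfun.
rewrite -Rintegral_rVN; last by rewrite /dil; mfun.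
pose F u := D u * f (x - a *: u); have mF : measurable_fun setT F by rewrite /F; mfun.
have iF : lam.-integrable setT (EFin \o F).
  have mf' : measurable_fun setT (fun u : T => f (x - a *: u)) by mfun.
  have := integrable_mul_bounded iD mf' (fun u => fM (x - a *: u)).
  by apply: eq_integrable => // u _; rewrite /F/= mulrC.
have H := Rintegral_rV_scale a0' mF; rewrite exprVn invrK in H.
have an : a ^+ n != 0 by rewrite expf_neq0// gt_eqF.
have -> : \int[lam]_z (D z * f (x - a *: z)) = a ^- n * \int[lam]_u F (a^-1 *: u).
  by rewrite H mulrA mulVf// mul1r.
rewrite -RintegralZl//; last exact: integrable_rV_scale a0' iF.
apply: eq_Rintegral => z _; rewrite /dil /F scalerA mulfV ?gt_eqF// scale1r.
by rewrite opprD opprK addrCA subrr addr0 addrC mulrC mulrA.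
Qed.

Lemma smear_shell f D t a x : 0 < a -> bounded_integrable lam f -> mollifier D ->
  smear lam f id (shell t a D) x =
  \int[lam]_w (bind w * \int[lam]_z (D z * f (x - t *: dir w - a *: z))).
Proof.
move=> a0 bf kD; have [mf [M fM] iff] := bf.
have bd := kernel_bounded_integrable (kernel_dil a0 kD); have [mD [N DN] iD] := bd.
have [mD0 _ _] := kernel_bounded_integrable kD.
pose G (p : T * T) := f p.1 * dil a D (x - p.1 - t *: dir p.2).
have mG : measurable_fun setT G by rewrite /G; mfun.
have M0 : 0 <= M by apply: le_trans (fM 0); exact: normr_ge0.
have N0 : 0 <= N by apply: le_trans (DN 0); exact: normr_ge0.
have GM p : `|G p| <= M * N by rewrite normrM ler_pM.
have GN w : (\int[lam]_y `|(G (y, w))%:E| <= (N * \int[lam]_y `|f y|)%:E)%E.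
  have inf := integrable_normr iff.
  rewrite -RintegralZl// -integral_EFin; last exact: (integrableZl measurableT N inf).
  apply: ge0_le_integral_nomeas => y _; first by rewrite lee_fin.
  by rewrite lee_fin normrM mulrC ler_wpM2r.
have := bounded_fubini (integrable_ball_indic n') mG GM GN.
rewrite /smear /shell.
under eq_Rintegral => y _.
  rewrite (_ : \int[lam]_w (bind w * G (y, w)) = f y * smear lam bind (fun w => t *: dir w) (dil a D) (x - y)).
  over.
  rewrite /smear -RintegralZl//; last first.
    exact: (smear_slice_integrable (integrable_ball_indic n') (measurable_shell_phi t) bd).
  by apply: eq_Rintegral => w _; rewrite /G mulrCA.
move=> ->; apply: eq_Rintegral => w _; congr (_ * _).
rewrite -(Rintegral_mul_dil _ a0 mf fM (kernel_integrable kD)); apply: eq_Rintegral => y _.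
by rewrite /G/= addrAC.
Qed.

(** Rewritten by [smear_shell], the smoothing acts on f at each point of the sphere separately;
    there it is an approximate identity, since D has integral 1 and f is continuous. *)
Lemma smear_shell_cvg f D t x (a : nat -> R) : (forall k, 0 < a k) -> a k @[k --> \oo] --> 0 ->
  bounded_integrable lam f -> continuous f -> mollifier D -> \int[lam]_z D z = 1 ->
  smear lam f id (shell t (a k) D) x @[k --> \oo] --> sphere_average f t x.
Proof.
move=> a0 acvg bf cf kD D1; have [mf [M fM] iff] := bf.
have [mD _ iD] := kernel_bounded_integrable kD.
have M0 : 0 <= M by apply: le_trans (fM 0); exact: normr_ge0.
have inD := integrable_normr iD.
have inDM : lam.-integrable setT (EFin \o (fun z => M * `|D z|)) by exact: (integrableZl measurableT M inD).
have inner x' : \int[lam]_z (D z * f (x' - a k *: z)) @[k --> \oo] --> f x'.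
  rewrite -[X in _ --> X]mul1r -D1 -RintegralZr//.
  apply: (@Rintegral_dominated_cvg _ _ _ _ _ _ (fun z => M * `|D z|)) => //.
  - by move=> k; mfun.
  - by mfun.
  - move=> z; apply: cvgMr.
    have H : x' - a k *: z @[k --> \oo] --> x'.
      rewrite -[X in _ --> X]subr0; apply: cvgB; first exact: cvg_cst.
      by rewrite -(scale0r z); apply: cvgZr_tmp.
    exact: (cvg_comp _ _ H (cf x')).
  - by move=> k z; rewrite normrM mulrC ler_wpM2r.
under eq_fun do rewrite smear_shell//.
rewrite /sphere_average /smear.
have mb := @measurable_ball_indic R n'.
apply: (@Rintegral_dominated_cvg _ _ _ _ _ _ (fun w => (\int[lam]_z (M * `|D z|)) * ball_indic w)) => //.
- move=> k; apply: measurable_funM => //.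
  apply: (@measurable_Rintegral _ _ _ _ _ lam (fun p : T * T => D p.2 * f (x - t *: dir p.1 - a k *: p.2))).
  by mfun.
- by mfun.
- by move=> w; apply: cvgMr; exact: inner.
- exact: (integrableZl measurableT _ (integrable_ball_indic n')).
- move=> k w; rewrite normrM mulrC (@ger0_norm _ (bind w))//.
  rewrite ler_wpM2r//; apply: (normr_Rintegral_le inDM); first by mfun.
  by move=> z; rewrite normrM mulrC ler_wpM2r.
Qed.

End spherical_averages.

Lemma exists_grid {R : realType} k (u : R) : 1 <= u -> u < 2 ->
  exists i : 'I_(8 ^ k), `|u - (grid i : R)| <= 8 ^- k.
Proof.
move=> u1 u2; have p8 : 0 < 8 ^+ k :> R by rewrite exprn_gt0.
have v0 : 0 <= (u - 1) * 8 ^+ k by rewrite mulr_ge0 ?subr_ge0// ltW.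
have /andP[l1 l2] := truncn_itv v0.
have lt8 : (Num.truncn ((u - 1) * 8 ^+ k) < 8 ^ k)%N.
  rewrite -(ltr_nat R) natrX (le_lt_trans l1)// -[ltRHS]mul1r ltr_pM2r//; lra.
exists (Ordinal lt8); rewrite /grid /=.
have -> : u - (1 + (Num.truncn ((u - 1) * 8 ^+ k))%:R / 8 ^+ k) =
  ((u - 1) * 8 ^+ k - (Num.truncn ((u - 1) * 8 ^+ k))%:R) / 8 ^+ k.
  by field; rewrite gt_eqF.
rewrite normrM (@ger0_norm _ (8 ^- k)) ?invr_ge0 ?(ltW p8)//.
rewrite -[leRHS]mul1r ler_wpM2r ?invr_ge0 ?(ltW p8)// ger0_norm ?subr_ge0//.
by move: l2; rewrite -natr1; lra.
Qed.

Lemma exists_dyadic {R : realType} (t : R) : 0 < t -> exists m : int, 2 ^ m <= t < 2 ^ m * 2.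
Proof.
move=> t0; have [c hc] := pow2_bound t; have [c' hc'] := pow2_bound t^-1.
(* A least natural number is sought, so the exponents are shifted by c', for which 2^(-c') <= t. *)
have : exists j, t < 2 ^ (j%:Z - c'%:Z) * 2.
  exists (c' + c)%N; rewrite PoszD addrAC subrr add0r -exprnP (le_lt_trans hc)//.
  by rewrite ltr_pMr ?exprn_gt0// ltr1n.
move=> ex; case: (ex_minnP ex) => j hj jmin; exists (j%:Z - c'%:Z); rewrite hj andbT.
case: j hj jmin => [|j] hj jmin.
  rewrite sub0r -exprnN -[t]invrK lef_pV2 ?posrE ?exprn_gt0 ?invr_gt0//.
rewrite leNgt; apply/negP => h; suff /jmin : t < 2 ^ (j%:Z - c'%:Z) * 2 by rewrite ltnn.
by have := h; rewrite (_ : j.+1%:Z - c'%:Z = j%:Z - c'%:Z + 1%:Z) ?expzD2//; lia.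
Qed.

Section dyadic_decomposition.
Context {R : realType} (n' : nat).
Notation n := n'.+1.
Notation T := 'rV[R]_n.
Notation lam := (@lebesgue_rV R n).
Notation gr := (@grain R).
Implicit Types (x y z w xi : T) (a t s d : R) (f : T -> R) (m : int).

Variables (g : T -> R) (q : nat).
Hypotheses (kg : mollifier g) (G1 : \int[lam]_x lowpass g q x = 1).

Let kl : mollifier (lowpass g q). Proof. exact: mollifier_lowpass. Qed.
Let kb : mollifier (bandpass g q). Proof. exact: mollifier_bandpass. Qed.

(** The smoothed averages P k telescope to the spherical average. The first has width comparable to
    t and is bounded by [HL f]; each increment is moved to the nearest grid radius, where it is a
    [piece], with an error of order 2^(-k) [HL f]. *)
Lemma sphere_average_le : exists2 C : R, 0 <= C & forall (theta V : R) f x t,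
  bounded_integrable lam f -> continuous f -> (forall y, 0 <= f y) ->
  0 <= theta < 1 -> 0 <= V -> (HL f x <= V%:E)%E ->
  (forall k, piece_sup g q k.+1 f x <= (theta ^+ k * V)%:E)%E -> 0 < t ->
  sphere_average f t x <= (C + (1 - theta)^-1) * V.
Proof.
have [C1 C10 h1] := shell_HL kl; have [C2 C20 h2] := shell_diff_HL kb.
exists (C1 + C2); first exact: addr_ge0.
move=> theta V f x t bf cf f0 /andP[th0 th1] V0 HV pV t0.
have [m /andP[mt tm]] := exists_dyadic t0; have s0 : 0 < 2 ^ m :> R by exact: expz2_gt0.
pose P k := smear lam f id (shell t (2 ^ m * gr k.+1) (lowpass g q)) x.
have grS k : gr k.+1 = gr k / 2.
  by rewrite /grain exprS; field; rewrite expf_neq0.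
have gr0 k : 0 < gr k by exact: grain_gt0.
have cP : P k @[k --> \oo] --> sphere_average f t x.
  apply: (@smear_shell_cvg _ _ f (lowpass g q) t x (fun k => 2 ^ m * gr k.+1)) => //.
    by move=> k; rewrite mulr_gt0.
  rewrite -[X in _ --> X](mulr0 (2 ^ m)); apply: cvgMr.
  have -> : (fun k => gr k.+1) = (fun k => 2^-1 ^+ k).
    by apply/funext => k; rewrite /grain exprS exprVn; field; rewrite expf_neq0.
  by apply: cvg_expr; rewrite ger0_norm ?invr_ge0// invf_lt1// ltr1n.
have hP0 : P 0%N <= C1 * V.
  have g1 : gr 1 = 1 by rewrite /grain expr1 divff.
  have := h1 f x m t 1 bf f0 ltr01 (lexx 1) mt (ltW tm).
  rewrite divr1 mulr1 /P g1 mulr1 => H.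
  rewrite (le_trans (ler_norm _))// -lee_fin (le_trans H)// EFinM.
  by apply: lee_wpmul2l; rewrite ?lee_fin.
have hS k : P k.+1 - P k <= C2 * 2^-1 ^+ k.+1 * V + theta ^+ k * V.
  have a0 : 0 < 2 ^ m * gr k.+1 by rewrite mulr_gt0.
  have bl r : 0 < r -> bounded_integrable lam (shell t r (lowpass g q)).
    by move=> r0; exact: kernel_bounded_integrable (kernel_shell t r0 kl).
  have -> : P k.+1 - P k = smear lam f id (shell t (2 ^ m * gr k.+1) (bandpass g q)) x.
    have [mf _ iff] := bf; rewrite /P grS mulrA smearB//; last 2 first.
    - by apply: bl; rewrite divr_gt0.
    - exact: bl.
    by congr (smear _ _ _ _ _); apply/funext => z; rewrite shell_bandpass.
  have u1 : 1 <= t / 2 ^ m by rewrite ler_pdivlMr// mul1r.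
  have u2 : t / 2 ^ m < 2 by rewrite ltr_pdivrMr// mulrC.
  have [i hi] := exists_grid k.+1 u1 u2.
  have hi' : `|t - 2 ^ m * grid i| <= 2 ^ m * 8 ^- k.+1.
    rewrite (_ : t - 2 ^ m * grid i = 2 ^ m * (t / 2 ^ m - grid i)); last first.
      by field; rewrite gt_eqF.
    by rewrite normrM gtr0_norm// ler_wpM2l// ltW.
  (* The distance to the grid stays below the smoothing width, as [shell_diff_HL] requires. *)
  have g8 : 8 ^- k.+1 <= gr k.+1.
    rewrite /grain -[leLHS]mul1r ler_pM// ?ler1n//.
    by rewrite lef_pV2 ?posrE ?exprn_gt0// lerXn2r// ?nnegrE ?ler_nat.
  have := h2 f x m t (2 ^ m * grid i) (gr k.+1) bf f0 (gr0 _) (grain_le1 (ltn0Sn k)) mt (ltW tm).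
  rewrite (le_trans hi') ?ler_wpM2l ?(ltW s0)// => /(_ isT) H2.
  have pi : (`|piece g q f m i x|%:E <= (theta ^+ k * V)%:E)%E.
    by apply: le_trans (pV k); apply: ereal_sup_ubound; exists (m, i).
  rewrite lee_fin in pi.
  set Q := smear _ _ _ _ _ in H2 *; set Q' := smear _ _ _ _ _ in H2.
  have -> : Q = (Q - Q') + Q' by rewrite subrK.
  apply: lerD; last exact: le_trans (ler_norm _) pi.
  rewrite (le_trans (ler_norm _))// -lee_fin (le_trans H2)//.
  have c0 : 0 <= C2 * (`|t - 2 ^ m * grid i| / (2 ^ m * gr k.+1 ^+ 2)).
    by rewrite mulr_ge0// divr_ge0// mulr_ge0// ?sqr_ge0// ltW.
  apply: (le_trans (lee_wpmul2l _ HV)); first by rewrite lee_fin.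
  rewrite -EFinM lee_fin ler_wpM2r// ler_wpM2l// ler_pdivrMr ?mulr_gt0 ?exprn_gt0//.
  rewrite (le_trans hi')// mulrCA ler_wpM2l ?(ltW s0)//.
  (* This is where the mesh 8^(-k) comes from: the variation in t costs the inverse square of
     [grain], of order 4^k, and a summable factor 2^(-k) has to remain. *)
  have -> : 2^-1 ^+ k.+1 * gr k.+1 ^+ 2 = 4 * 8 ^- k.+1.
    have -> : 8 ^+ k.+1 = (2 ^+ k.+1) ^+ 3 :> R.
      by rewrite -exprM mulnC exprM; congr (_ ^+ _); ring.
    rewrite /grain exprVn; have : 2 ^+ k.+1 != 0 :> R by rewrite expf_neq0.
    by move: (2 ^+ k.+1) => u u0; field.
  by rewrite -[leLHS]mul1r ler_wpM2r ?invr_ge0 ?exprn_ge0// ler1n.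
have hK K : P K <= C1 * V + \sum_(0 <= k < K) (C2 * 2^-1 ^+ k.+1 * V + theta ^+ k * V).
  elim: K => [|K IH]; first by rewrite big_geq// addr0.
  rewrite big_nat_recr//= addrA (_ : P K.+1 = P K + (P K.+1 - P K)); last by rewrite addrC subrK.
  exact: lerD.
have hB K : P K <= (C1 + C2 + (1 - theta)^-1) * V.
  have th : 0 <= theta < 1 by rewrite th0.
  have g1 := @geometric_sum_le R K theta th.
  have hh : 0 <= (2^-1 : R) < 1 by rewrite invr_ge0 ler0n/= invf_lt1// ltr1n.
  have g2 := @geometric_sum_le R K 2^-1 hh.
  rewrite (le_trans (hK K))//.
  have -> : \sum_(0 <= k < K) (C2 * 2^-1 ^+ k.+1 * V + theta ^+ k * V) =
      C2 * ((\sum_(0 <= k < K) 2^-1 ^+ k) / 2) * V + (\sum_(0 <= k < K) theta ^+ k) * V.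
    rewrite big_split/=; congr (_ + _); last by rewrite mulr_suml.
    rewrite -mulrA [_ * V]mulrC mulrA !mulr_suml mulr_sumr; apply: eq_bigr => k _.
    by rewrite exprSr; ring.
  move: g1 g2; set S1 := \sum_(0 <= k < K) theta ^+ k; set S2 := \sum_(0 <= k < K) _ => g1 g2.
  have g2' : S2 <= 2 by rewrite (le_trans g2)// (_ : 1 - 2^-1 = 2^-1) ?invrK//; field.
  rewrite !mulrDl -addrA lerD2l lerD//; last by rewrite ler_wpM2r.
  by rewrite ler_wpM2r// ler_piMr// ler_pdivrMr// mul1r.
rewrite -(cvg_lim _ cP)//; apply: limr_le; first by apply/cvg_ex; exists (sphere_average f t x).
by apply: nearW.
Qed.

End dyadic_decomposition.

(** * L^p bounds for the spherical maximal function *)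

Section averages_Lp.
Context {R : realType} (n' : nat).
Notation n := n'.+1.
Notation T := 'rV[R]_n.
Notation lam := (@lebesgue_rV R n).
Notation bind := (@ball_indic R n').
Implicit Types (x y z w : T) (t : R) (f g : T -> R).

Lemma le_poweR_inv (y : \bar R) (v p : R) : 0 < p -> 0 <= v -> (0 <= y)%E ->
  (y `^ p <= (v `^ p)%:E)%E -> (y <= v%:E)%E.
Proof.
move=> p0 v0; case: y => [r| |]//; last by rewrite poweRyr ?gt_eqF.
rewrite lee_fin => r0; rewrite poweR_EFin !lee_fin; apply: contraTT.
by rewrite -!ltNge => vr; apply: gt0_ltr_powR.
Qed.

(** The majorant W is the p-th power of [HL f] plus a weighted sum of the p-th powers of the
    [piece_sup] at all levels. It is measurable, and W x <= v^p controls every level at once, which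
    is the form needed to bound all radii simultaneously. *)
Lemma sphere_average_dyadic (q : nat) (p : R) : (0 < q)%N -> (4 * q + 2 <= n)%N ->
  1 < p -> p < 2 -> (4 * q)%:R - 1 < p * ((4 * q)%:R - 2) ->
  exists2 C : R, 0 <= C & forall f, bounded_integrable lam f -> continuous f ->
  (forall y, 0 <= f y) -> exists W : T -> \bar R,
  [/\ measurable_fun setT W, forall x, (0 <= W x)%E,
      (\int[lam]_x W x <= C%:E * \int[lam]_x (f x `^ p)%:E)%E &
      forall t x v, 0 < t -> 0 <= v -> (W x <= (v `^ p)%:E)%E ->
        sphere_average f t x <= C * v].
Proof.
move=> q0 qn p1 p2 hp.
have [g [[kg g0] g01 [A A0 gA] bG G0]] := @kernel_positive_definite R n (ltn0Sn n').
have G1 := Rintegral_lowpass kg g01 gA q0.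
have [C [rho [C0 rho0 rho1 hC]]] := piece_sup_strong_type kg g0 g01 A0 gA bG G0 q0 qn p1 p2 hp.
have [C1 [C10 hC1]] := @HL_strong_type R n p p1.
have [K K0 hK] := sphere_average_le kg G1.
have p0 : 0 < p by exact: lt_trans p1.
(* The square root divides the decay rho^k in two: weighting level k by c^(-k) leaves summable
   integrals of order c^k, and W x <= v^p still forces level k below theta^k v. *)
pose c := Num.sqrt rho; have c0 : 0 < c by rewrite sqrtr_gt0.
have cc : rho = c * c by rewrite -expr2 sqr_sqrtr// ltW.
have c1 : c < 1 by rewrite -sqrtr1 ltr_sqrt.
pose theta := c `^ p^-1; have th0 : 0 <= theta by exact: powR_ge0.
have thp : theta `^ p = c by rewrite /theta -powRrM mulVf ?gt_eqF// powRr1// ltW.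
have th1 : theta < 1.
  have : c `^ p^-1 < 1 `^ p^-1 by apply: gt0_ltr_powR; rewrite ?invr_gt0// nnegrE ?ltW.
  by rewrite powR1.
have th01 : 0 <= theta < 1 by rewrite th0.
have i1 : 0 <= (1 - theta)^-1 by rewrite invr_ge0 subr_ge0 ltW.
have i2 : 0 <= (1 - c)^-1 by rewrite invr_ge0 subr_ge0 ltW.
exists ((C1 + C * (1 - c)^-1) + (K + (1 - theta)^-1)).
  by rewrite !addr_ge0// mulr_ge0.
move=> f bf cf f0; have [mf _ _] := bf.
pose S k x := ((c ^- k)%:E * piece_sup g q k.+1 f x `^ p)%E.
have cV k : 0 <= c ^- k by rewrite invr_ge0 exprn_ge0// ltW.
have S0 k x : (0 <= S k x)%E by rewrite mule_ge0 ?lee_fin ?poweR_ge0.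
have mps k : measurable_fun setT (piece_sup g q k.+1 f) by exact: measurable_piece_sup.
have mS k : measurable_fun setT (S k).
  apply: emeasurable_funM => //.
  exact: (measurableT_comp (measurable_poweR _)).
have mHL := measurable_HL mf f0.
have mHp : measurable_fun setT (fun x => HL f x `^ p)%E.
  exact: (measurableT_comp (measurable_poweR _)).
have mSS : measurable_fun setT (fun x => \sum_(0 <= k <oo) S k x)%E.
  by apply: ge0_emeasurable_sum => // k y _ _; exact: S0.
have SS0 x : (0 <= \sum_(0 <= k <oo) S k x)%E by apply: nneseries_ge0 => k _ _; exact: S0.
have HL0 x : (0 <= HL f x `^ p)%E by exact: poweR_ge0.
pose I := (\int[lam]_x (f x `^ p)%:E)%E.
have I0 : (0 <= I)%E by apply: integral_ge0 => x _; rewrite lee_fin powR_ge0.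
exists (fun x => HL f x `^ p + \sum_(0 <= k <oo) S k x)%E; split.
- exact: emeasurable_funD.
- by move=> x; rewrite adde_ge0.
- rewrite (ge0_integralD lam measurableT (fun x _ => HL0 x) mHp (fun x _ => SS0 x) mSS).
  have C20 : 0 <= C1 + C * (1 - c)^-1 by rewrite addr_ge0// mulr_ge0.
  have K20 : 0 <= K + (1 - theta)^-1 by rewrite addr_ge0.
  rewrite EFinD ge0_muleDl ?lee_fin// -[leLHS]adde0; apply: leeD; last by rewrite mule_ge0// lee_fin.
  rewrite EFinD ge0_muleDl ?lee_fin ?mulr_ge0//; apply: leeD; first exact: hC1.
  rewrite integral_nneseries//.
  apply: lime_le.
    by apply: is_cvg_nneseries => k _ _; apply: integral_ge0 => x _; exact: S0.
  apply: nearW => L.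
  apply: (@le_trans _ _ (\sum_(0 <= k < L) (C * c ^+ k)%:E * I)%E).
    apply: lee_sum => k _; rewrite /S ge0_integralZl//; last 3 first.
    - exact: (measurableT_comp (measurable_poweR _)).
    - by move=> x _; exact: poweR_ge0.
    - by rewrite lee_fin.
    apply: (@le_trans _ _ ((c ^- k)%:E * ((C * rho ^+ k.+1)%:E * I))%E).
      by apply: lee_wpmul2l; [rewrite lee_fin|exact: hC].
    rewrite muleA -EFinM; apply: lee_wpmul2r => //; rewrite lee_fin.
    rewrite mulrCA ler_wpM2l// cc exprMn [c ^+ k.+1]exprS.
    have u0 : 0 < c ^+ k by rewrite exprn_gt0.
    move: (c ^+ k) u0 => u u0; have -> : u^-1 * (c * u * (c * u)) = c * c * u.
      by field; rewrite gt_eqF.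
    by rewrite -cc ler_piMl ?ltW.
  rewrite -ge0_sume_distrl; last first.
    by move=> k _; rewrite lee_fin mulr_ge0// exprn_ge0// ltW.
  apply: lee_wpmul2r => //; rewrite sumEFin lee_fin -mulr_sumr ler_wpM2l//.
  by apply: geometric_sum_le; rewrite c1 ltW.
move=> t x v t0 v0 Wv.
have h1 : (HL f x <= v%:E)%E.
  apply: (@le_poweR_inv _ _ p) => //; first exact: HL_ge0.
  by apply: le_trans Wv; rewrite leeDl.
have h2 k : (piece_sup g q k.+1 f x <= (theta ^+ k * v)%:E)%E.
  apply: (@le_poweR_inv _ _ p) => //; first by rewrite mulr_ge0// exprn_ge0.
    exact: piece_sup_ge0.
  rewrite powRM ?exprn_ge0// powRX// thp EFinM -lee_pdivrMl ?exprn_gt0//.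
  apply: (le_trans _ Wv); apply: (@le_trans _ _ (\sum_(0 <= k <oo) S k x)%E); last by rewrite leeDr.
  apply: le_trans (nneseries_lim_ge k.+1 _); last by move=> *; exact: S0.
  by rewrite big_nat_recr//= leeDr// sume_ge0// => l _; exact: S0.
apply: (le_trans (hK theta v f x t bf cf f0 th01 v0 h1 h2 t0)).
by rewrite ler_wpM2r// lerDr addr_ge0// mulr_ge0.
Qed.

Lemma le_powR_split (y c r : R) : 0 <= y -> 0 < c -> 1 <= r ->
  y <= c `^ (1 - r) * y `^ r + c.
Proof.
move=> y0 c0 r1; have [yc|cy] := leP y c.
  by rewrite (le_trans yc)// lerDr mulr_ge0// powR_ge0.
have yp : 0 < y by exact: lt_trans cy.
apply: (@le_trans _ _ (c `^ (1 - r) * y `^ r)); last by rewrite lerDl ltW.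
have -> : r = 1 + (r - 1) by rewrite addrC subrK.
rewrite opprD addrA subrr add0r powRD ?(gt_eqF yp) ?implybT// powRr1 ?(ltW yp)//.
rewrite mulrCA ler_peMr ?(ltW yp)// powRN mulrC ler_pdivlMr ?powR_gt0// mul1r.
by apply: ge0_ler_powR; rewrite ?nnegrE ?subr_ge0 ?(ltW c0) ?(ltW yp) ?(ltW cy).
Qed.

Lemma powR_le_linear (y M r : R) : 0 <= y -> y <= M -> 1 <= r -> y `^ r <= M `^ (r - 1) * y.
Proof.
move=> y0 yM r1; have r0 : 0 < r by exact: lt_le_trans r1.
move: y0; rewrite le_eqVlt => /orP[/eqP <-|yp].
  by rewrite mulr0 powR0// gt_eqF.
have -> : y `^ r = y `^ (r - 1) * y.
  by rewrite -[X in _ = _ * X](powRr1 (ltW yp)) -powRD ?subrK// (gt_eqF yp) implybT.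
rewrite ler_wpM2r ?(ltW yp)//.
by apply: ge0_ler_powR; rewrite ?nnegrE ?subr_ge0// ?(ltW yp)// (le_trans (ltW yp)).
Qed.

(** For r >= 1 and g <= M, g^r is at most M^(r-1) g. This gives integrability, and also continuity
    at the zeros of g, where the power function has to be treated apart. *)
Lemma powR_bounded_integrable g (r : R) : bounded_integrable lam g -> continuous g ->
  (forall y, 0 <= g y) -> 1 <= r ->
  bounded_integrable lam (fun y => g y `^ r) /\ continuous (fun y => g y `^ r).
Proof.
move=> [mg [M gM] ig] cg g0 r1; have r0 : 0 < r by exact: lt_le_trans r1.
have gM' y : g y <= M by rewrite (le_trans (ler_norm _)).
have M0 : 0 <= M by apply: le_trans (g0 0) (gM' 0).
have mgr : measurable_fun setT (fun y => g y `^ r) by mfun.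
have lin y : g y `^ r <= M `^ (r - 1) * g y by exact: powR_le_linear.
split; [split => //|].
- exists (M `^ (r - 1) * M) => y; rewrite ger0_norm ?powR_ge0// (le_trans (lin y))//.
  by rewrite ler_wpM2l ?powR_ge0.
- apply: (le_integrable measurableT _ _ (integrableZl measurableT (M `^ (r - 1)) ig)).
    exact/measurable_EFinP.
  move=> y _ /=; rewrite lee_fin !ger0_norm ?mulr_ge0 ?powR_ge0//.
- move=> z; have := g0 z; rewrite le_eqVlt => /orP[/eqP gz|gz]; last first.
    apply: (@continuous_comp _ _ _ g (fun u => u `^ r)); first exact: cg.
    exact: continuous_at_powR.
  rewrite /continuous_at -gz powR0 ?gt_eqF//.
  apply/(@cvgrPdist_le _ _ _ (nbhs z) (nbhs_filter z)) => e e0.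
  have N0 : 0 < M `^ (r - 1) + 1 by rewrite ltr_wpDl ?powR_ge0.
  have := @cvgr_dist_le _ _ _ (nbhs z) (nbhs_filter z) g (g z) (cg z) _ (divr_gt0 e0 N0).
  apply: filterS => y /=; rewrite -gz !sub0r !normrN ger0_norm// ger0_norm ?powR_ge0// => gy.
  rewrite (le_trans (lin y))// (@le_trans _ _ ((M `^ (r - 1) + 1) * g y))//.
    by rewrite ler_wpM2r// lerDl.
  by rewrite mulrC -ler_pdivlMr.
Qed.

(* With [r = P / p], integrating [g <= c ^ (1 - r) * g ^ r + c] and choosing [c ^ r] to
   be the value at [x] of the maximal function of [g ^ r] transfers the bound for the
   exponent [p] to [P]. *)
Lemma sphere_average_strong (q : nat) (p P : R) : (0 < q)%N -> (4 * q + 2 <= n)%N ->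
  1 < p -> p < 2 -> (4 * q)%:R - 1 < p * ((4 * q)%:R - 2) -> p <= P ->
  exists2 C : R, 0 <= C & forall g, bounded_integrable lam g -> continuous g ->
  (forall y, 0 <= g y) -> exists L : T -> \bar R,
  [/\ measurable_fun setT L, forall x, (0 <= L x)%E,
      (\int[lam]_x (L x `^ P) <= C%:E * \int[lam]_x (g x `^ P)%:E)%E &
      forall t x, 0 < t -> ((sphere_average g t x)%:E <= L x)%E].
Proof.
move=> q0 qn p1 p2 hp pP; have [C C0 hC] := sphere_average_dyadic q0 qn p1 p2 hp.
have p0 : 0 < p by exact: lt_trans p1.
have P0 : 0 < P by exact: lt_le_trans pP.
pose r := P / p; have r1 : 1 <= r by rewrite ler_pdivlMr// mul1r.
have rp : r * p = P by rewrite /r divfK// gt_eqF.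
pose B := \int[lam]_w bind w; have B0 : 0 <= B by apply: Rintegral_ge0.
pose K := C + B + 1; have K0 : 0 < K by rewrite ltr_wpDl// addr_ge0.
exists (K `^ P * C); first by rewrite mulr_ge0 ?powR_ge0.
move=> g bg cg g0; have [bgr cgr] := powR_bounded_integrable bg cg g0 r1.
have [W [mW W0 iW hW]] := hC _ bgr cgr (fun y => powR_ge0 _ _).
have mWp : measurable_fun setT (fun x => W x `^ P^-1)%E.
  exact: (measurableT_comp (measurable_poweR _)).
exists (fun x => K%:E * W x `^ P^-1)%E; split.
- exact: emeasurable_funM.
- by move=> x; rewrite mule_ge0 ?lee_fin ?(ltW K0)// poweR_ge0.
- under eq_integral => x _.
    rewrite poweRM ?lee_fin ?(ltW K0) ?poweR_ge0// -poweRrM mulVf ?gt_eqF// poweRe1//.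
    over.
  rewrite poweR_EFin ge0_integralZl ?lee_fin ?powR_ge0//.
  rewrite EFinM -muleA; apply: lee_wpmul2l; first by rewrite lee_fin powR_ge0.
  apply: (le_trans iW); rewrite le_eqVlt; apply/orP; left; apply/eqP; congr (_ * _)%E.
  by apply: eq_integral => x _; rewrite -powRrM rp.
move=> t x t0; have := W0 x; case EW : (W x) => [u| |]//; last first.
  by move=> _; rewrite poweRyr ?invr_eq0 ?gt_eqF// gt0_muley ?lte_fin// leey.
rewrite lee_fin => u0; rewrite poweR_EFin -EFinM lee_fin.
have key c : u `^ P^-1 < c -> sphere_average g t x <= (C + B) * c.
  move=> uc; have c0 : 0 < c by rewrite (le_lt_trans _ uc)// powR_ge0.
  have cr0 : 0 <= c `^ r by exact: powR_ge0.
  have Wc : (W x <= ((c `^ r) `^ p)%:E)%E.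
    rewrite EW lee_fin -powRrM rp -[leLHS](@powRr1 _ u)// -(mulVf (lt0r_neq0 P0)) powRrM.
    by apply: ge0_ler_powR; rewrite ?nnegrE ?powR_ge0 ?(ltW P0) ?(ltW c0) ?(ltW uc).
  have h := hW t x _ t0 cr0 Wc.
  have mph := @measurable_shell_phi R n' t.
  have ib := integrable_ball_indic n' : (@lebesgue_rV R n).-integrable setT (EFin \o bind).
  have i1 := smear_slice_integrable ib mph bg x.
  have i2 := smear_slice_integrable ib mph bgr x.
  have i3 := integrableD measurableT (integrableZl measurableT (c `^ (1 - r)) i2) (integrableZl measurableT c ib).
  apply: (@le_trans _ _ (\int[lam]_w (c `^ (1 - r) * (bind w * g (x - t *: dir w) `^ r) + c * bind w))).
    apply: le_Rintegral => // w _.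
    rewrite mulrCA [c * _]mulrC -mulrDr ler_wpM2l//.
    exact: le_powR_split.
  rewrite RintegralD//; last 2 first.
  - exact: (integrableZl measurableT _ i2).
  - exact: (integrableZl measurableT _ ib).
  rewrite !RintegralZl// mulrDl [B * c]mulrC lerD//.
  apply: (@le_trans _ _ (c `^ (1 - r) * (C * c `^ r))); first by rewrite ler_wpM2l ?powR_ge0.
  by rewrite mulrCA -powRD ?(gt_eqF c0) ?implybT// subrK powRr1// ltW.
rewrite leNgt; apply/negP => lt_avg.
set a := sphere_average g t x in key lt_avg.
have a0 : 0 < a by rewrite (le_lt_trans _ lt_avg)// mulr_ge0 ?powR_ge0 ?(ltW K0).
have := key (a / K); rewrite ltr_pdivlMr// mulrC => /(_ lt_avg).
apply/negP; by rewrite -ltNge mulrCA gtr_pMr// ltr_pdivrMr// mul1r /K ltrDl.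
Qed.

End averages_Lp.

(** * Slicing the bilinear average *)

Section slicing.
Context {R : realType} (n' : nat) (n'0 : (0 < n')%N).
Notation n := n'.+1.
Notation T := 'rV[R]_n.
Notation lam := (@lebesgue_rV R n).
Notation leb := (@lebesgue_measure R).
Notation bind := (@ball_indic R n').
Implicit Types (x y w h u v : T) (t r s : R) (a b : T -> R).

(** The substitution s = [bsin r], with ds = [bcos r]^3 dr, maps the half-line into [0, 1]; it is
    made on [0, k] and k tends to infinity by monotone convergence. *)
Lemma integral_bsin_le (G : R -> R) : continuous G -> (forall s, 0 <= s -> 0 <= G s) ->
  (\int[leb]_r ((0 < r)%R%:R * (G (bsin r) * bcos r ^+ 3))%:E <=
   \int[leb]_s ((0 <= s <= 1)%R%:R * G s)%:E)%E.
Proof.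
move=> cG G0; pose f r := (G (bsin r) * bcos r ^+ 3)%:E.
have mG : measurable_fun setT G by apply: continuous_measurable_fun.
have mbc := @measurable_bcos R; have mbs := @measurable_bsin R.
have mf : measurable_fun setT f by apply/measurable_EFinP; mfun.
pose F (k : nat) := `[0, k%:R]%classic : set R.
have bs0 r : 0 <= r -> 0 <= bsin r by move=> r0; rewrite mulr_ge0// ltW// bcos_gt0.
have f0 r : 0 <= r -> (0 <= f r)%E.
  by move=> r0; rewrite lee_fin mulr_ge0 ?G0 ?bs0// exprn_ge0// ltW// bcos_gt0.
have cv : (\int[leb]_(r in F k) f r @[k --> \oo] --> \int[leb]_(r in \bigcup_k F k) f r)%E.
  apply: ge0_nondecreasing_set_cvg_integral => //.
  - apply/nondecreasing_seqP => k; rewrite subsetEset => r; rewrite /F /= !in_itv/= => /andP[-> rk].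
    by rewrite (le_trans rk)// ler_nat.
  - by move=> k; exact: measurable_itv.
  - by move=> k; exact: measurable_funTS.
  - by move=> k r; rewrite /F /= in_itv/= => /andP[r0 _]; exact: f0.
apply: (@le_trans _ _ (\int[leb]_(r in \bigcup_k F k) f r)%E).
  rewrite [leRHS]integral_mkcond; apply: ge0_le_integral_nomeas => r _.
    case: (ltP 0 r) => r0; rewrite ?mul0r// mul1r; apply: f0; exact: ltW.
  rewrite /patch; case: (ltP 0 r) => r0; rewrite ?mul0r ?mul1r.
    rewrite mem_set//; exists (Num.truncn r).+1 => //; rewrite /F/= in_itv/= (ltW r0)/=.
    by have /andP[_ /ltW] := truncn_itv (ltW r0).
  case: ifPn => [/set_mem[k _]|_]; last exact: lexx.
  by rewrite /F/= in_itv/= => /andP[? _]; exact: f0.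
rewrite -(cvg_lim _ cv)//; apply: lime_le; first by apply/cvg_ex; eexists; exact: cv.
apply: nearW => k.
have bsin0 : bsin (0 : R) = 0 by rewrite /bsin mul0r.
have dF : derive1 (@bsin R) = fun r => bcos r ^+ 3.
  by apply/funext => r; rewrite derive1E; case: (is_derive_bsin r).
have bmono : {in `[0, k%:R] &, {homo (@bsin R) : r s / r < s}}.
  move=> r s; rewrite !in_itv/= => /andP[r0 _] /andP[s0 _] rs.
  rewrite -ltr_sqr ?nnegrE ?bs0// !bsin_sqr ltrD2l ltrN2 !bcos_sqr.
  by rewrite ltf_pV2 ?posrE ?oneD_sqr_gt0// ltrD2l ltr_sqr ?nnegrE.
have H := @integration_by_substitution_increasing R (@bsin R) G 0 k%:R (ler0n _ k) bmono.
rewrite dF bsin0 in H.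
have cb3 : continuous (fun r : R => bcos r ^+ 3) by exact: continuous_bcosX.
rewrite [leLHS](_ : _ = \int[leb]_(s in `[0%R, bsin (k%:R : R)]) (G s)%:E)%E; last first.
  rewrite H.
  - by [].
  - by move=> r _; exact: cb3.
  - by apply/cvg_ex; eexists; apply: cvg_at_right_filter; exact: cb3.
  - by apply/cvg_ex; eexists; apply: cvg_at_left_filter; exact: cb3.
  - split.
    + by move=> r _; case: (is_derive_bsin r).
    + by apply: cvg_at_right_filter; exact: continuous_bsin.
    + by apply: cvg_at_left_filter; exact: continuous_bsin.
  - by apply: continuous_subspaceT => r; exact: cG.
rewrite [leLHS]integral_mkcond; apply: ge0_le_integral_nomeas => s _; rewrite /patch.
  by case: ifPn => // /set_mem/=; rewrite in_itv/= => /andP[s0 _]; rewrite lee_fin G0.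
case: ifPn => [/set_mem/=|_]; rewrite ?in_itv/=.
  move=> /andP[s0 s1]; rewrite s0 (le_trans s1) ?mul1r//.
  exact: le_trans (ler_norm _) (bsin_le1 _).
by rewrite lee_fin; case: (leP 0 s) => s0; rewrite ?mul0r// mulr_ge0// G0.
Qed.

(* In polar coordinates [s = r / sqrt (1 + r ^ 2)] turns the weight into
   [s ^ n' * (1 - s ^ 2) ^ ((n - 2) / 2)], which is at most [s ^ n']. *)
Lemma integral_bracket_le a t x : continuous a -> (forall y, 0 <= a y) ->
  (\int[lam]_h (a (x - t *: (bcos (enorm h) *: h)) * bcos (enorm h) ^+ (2 * n))%:E <=
   \int[lam]_y (bind y * a (x - t *: y))%:E)%E.
Proof.
move=> ca a0; have ma := continuous_rV_measurable ca; have n0 : (0 < n)%N by [].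
have mbc := @measurable_bcos R; have mb := @measurable_ball_indic R n'.
pose H h := (a (x - t *: (bcos (enorm h) *: h)) * bcos (enorm h) ^+ (2 * n))%:E.
have H0 h : (0 <= H h)%E by rewrite lee_fin mulr_ge0// exprn_ge0// ltW// bcos_gt0.
have mH : measurable_fun setT H by apply/measurable_EFinP; mfun.
rewrite (ge0_integral_rV_neq0 n0 mH H0).
have m1 : measurable_fun setT (fun h => H h * (h != 0)%R%:R%:E)%E.
  apply: emeasurable_funM => //; apply/measurable_EFinP; mfun.
rewrite (ge0_integral_polar n0 m1); last by move=> h; rewrite mule_ge0.
rewrite (@ge0_integral_polar _ _ n0 (fun y => (bind y * a (x - t *: y))%:E)); last 2 first.
- by apply/measurable_EFinP; mfun.
- by move=> y; rewrite lee_fin mulr_ge0.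
have k0 r : (0 <= (n%:R * r ^+ n' * (0 < r)%R%:R)%:E)%E.
  by rewrite lee_fin; case: ltP => r0; rewrite ?mulr0// mulr1 mulr_ge0// exprn_ge0// ltW.
apply: ge0_le_integral_nomeas => w _.
  rewrite mule_ge0//; apply: integral_ge0 => r _; rewrite mule_ge0 ?k0//.
  by rewrite mule_ge0.
apply: lee_wpmul2l => //.
have [->|w0] := eqVneq w 0.
  apply: ge0_le_integral_nomeas => r _; first by rewrite mule_ge0 ?k0// mule_ge0.
  by rewrite /dir !scaler0 eqxx mule0 mule0 mule_ge0 ?k0// lee_fin mulr_ge0.
have ew := enorm_dir w0.
pose G s := n%:R * s ^+ n' * a (x - t *: (s *: dir w)).
have cG : continuous G.
  move=> s; apply: cvgM.
    by apply: cvgMr; exact: exprn_continuous.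
  have L : x - t *: (u *: dir w) @[u --> s] --> x - t *: (s *: dir w).
    apply: cvgB; first exact: cvg_cst.
    by apply: cvgZl_tmp; apply: cvgZr_tmp; exact: cvg_id.
  exact: (cvg_comp _ _ L (ca _)).
have G0 s : 0 <= s -> 0 <= G s by move=> s0; rewrite !mulr_ge0// exprn_ge0.
apply: (@le_trans _ _ (\int[leb]_r ((0 < r)%R%:R * (G (bsin r) * bcos r ^+ 3))%:E)%E).
  apply: ge0_le_integral_nomeas => r _; first by rewrite mule_ge0 ?k0// mule_ge0.
  case: (ltP 0 r) => r0; rewrite ?mulr0 ?mul0r ?mul0e// mulr1 mul1r.
  rewrite /H enormZ ew mulr1 gtr0_norm//.
  have -> : r *: dir w != 0 by rewrite scaler_eq0 negb_or gt_eqF//= -enorm_gt0 ew.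
  rewrite mule1 -EFinM lee_fin /G /bsin [bcos r *: (r *: _)]scalerA (mulrC (bcos r) r).
  set A := a _; have A0 : 0 <= A by exact: a0.
  have c0 := bcos_gt0 r; have c1 := bcos_le1 r.
  rewrite exprMn (_ : (2 * n = n' + (n' + 2))%N); last by lia.
  rewrite exprD.
  have le3 : bcos r ^+ (n' + 2) <= bcos r ^+ 3.
    by rewrite ler_wiXn2l ?(ltW c0)//; lia.
  rewrite [leLHS](_ : _ = n%:R * (r ^+ n' * bcos r ^+ n') * A * bcos r ^+ (n' + 2)); last by ring.
  by rewrite ler_wpM2l// !mulr_ge0// exprn_ge0// ltW.
apply: (le_trans (integral_bsin_le cG G0)).
apply: ge0_le_integral_nomeas => s _.
  by rewrite lee_fin; case: (leP 0 s) => s0; rewrite ?mul0r// mulr_ge0// G0.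
rewrite /G; have [s0|s0|<-] := ltrgtP 0 s.
- rewrite /= mulr1 /ball_indic enormZ ew mulr1 gtr0_norm// -EFinM lee_fin.
  by rewrite mulrCA.
- by rewrite /= mul0r mulr0 mul0e.
- by rewrite expr0n gtn_eqF//= mulr0 !mul0r mulr0 mul0e.
Qed.

(** With 2^m <= t < 2^(m+1), the ball of radius t lies in the cube of half-side 2^(m+1), and the
    ratio (2 * 2^(m+1) / t)^n is at most 4^n. *)
Lemma integral_ball_le_HL a t x : 0 < t -> measurable_fun setT a -> (forall y, 0 <= a y) ->
  (\int[lam]_y (bind y * a (x - t *: y))%:E <= (4 ^+ n)%:E * HL a x)%E.
Proof.
move=> t0 ma a0; have [m /andP[mt tm]] : exists m : int, 2 ^ m <= t < 2 ^ m * 2 by exact: exists_dyadic.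
have s0 : 0 < 2 ^ m :> R by exact: expz2_gt0.
pose j := m + 1%:Z; have jE : 2 ^ j = 2 ^ m * 2 :> R by rewrite /j expzD2.
pose Q y := (a y * (`|x - y| <= 2 ^ j)%R%:R)%:E.
have mQ : measurable_fun setT Q by apply/measurable_EFinP; mfun.
have Q0 y : (0 <= Q y)%E by rewrite lee_fin mulr_ge0.
have mQ1 : measurable_fun setT (fun z : T => Q (z + x)) by apply: (measurableT_comp mQ); mfun.
have mQ2 : measurable_fun setT (fun z : T => Q (- z + x)).
  by apply: (measurableT_comp mQ1); apply: measurable_rVN; exact: measurable_id.
apply: (@le_trans _ _ (\int[lam]_y Q (- (t *: y) + x)%R)%E).
  apply: ge0_le_integral_nomeas => y _; first by rewrite lee_fin mulr_ge0.
  rewrite lee_fin /ball_indic [- _ + x]addrC opprB addrCA subrr addr0 mulrC ler_wpM2l//.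
  rewrite ler_nat; case: (leP (enorm y) 1) => // y1.
  rewrite normrZ gtr0_norm// jE (le_trans _ (ltW tm))//.
  by rewrite ler_piMr ?(ltW t0)// (le_trans (rVnorm_le_enorm _)).
rewrite (@ge0_integral_rV_scale R n t (fun z => Q (- z + x)) t0 mQ2)//.
rewrite (@ge0_integral_rVN R n (fun z => Q (z + x)) mQ1)//.
rewrite ge0_integral_rV_translation//.
apply: (@le_trans _ _ ((t ^- n)%:E * (((2 * 2 ^ j) ^+ n)%:E * HL a x))%E).
  apply: lee_wpmul2l; first by rewrite lee_fin invr_ge0 exprn_ge0// ltW.
  exact: cube_integral_le_HL.
rewrite muleA -EFinM; apply: lee_wpmul2r; first exact: HL_ge0.
rewrite lee_fin mulrC ler_pdivrMr ?exprn_gt0// -exprMn lerXn2r ?nnegrE ?mulr_ge0 ?(ltW t0)//.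
  by rewrite jE mulr_ge0// ltW.
by rewrite jE (_ : 2 * (2 ^ m * 2) = 4 * 2 ^ m) ?ler_wpM2l//; ring.
Qed.

(** After u = |v| h the point (u, v) normalises to (c h, c [dir v]) with c = [bcos |h|]: the
    argument of a no longer depends on v. For fixed h the integral in v is an average of b over a
    sphere, of radius t c, and L bounds all of these at once. *)
Lemma punctured_ball_integral_le a b t x (L : \bar R) : 0 < t -> continuous a -> continuous b ->
  (forall y, 0 <= a y) -> (forall y, 0 <= b y) ->
  (forall s, 0 < s -> (\int[lam]_w (bind w * b (x - s *: dir w))%:E <= L)%E) ->
  (\int[(lam \x lam)%E]_z ((0 < enorm2 z <= 1)%R%:R *
      (a (x - t *: ((enorm2 z)^-1 *: z.1)) * b (x - t *: ((enorm2 z)^-1 *: z.2))))%:E <=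
   (4 ^+ n)%:E * HL a x * L)%E.
Proof.
move=> t0 ca cb a0 b0 bL; have n0 : (0 < n)%N by [].
have ma := continuous_rV_measurable ca; have mb := continuous_rV_measurable cb.
have mbc := @measurable_bcos R; have me2 := @measurable_enorm2 R n.
have mbi := @measurable_ball_indic R n'.
pose F (z : T * T) := (0 < enorm2 z <= 1)%R%:R *
  (a (x - t *: ((enorm2 z)^-1 *: z.1)) * b (x - t *: ((enorm2 z)^-1 *: z.2))).
have mV : measurable_fun setT (fun z : T * T => (enorm2 z)^-1).
  by apply: measurable_inv_ge0 => // z; exact: sqrtr_ge0.
have mF : measurable_fun setT F by rewrite /F; mfun.
have F0 z : 0 <= F z by rewrite mulr_ge0// mulr_ge0.
pose c h := bcos (enorm h); have c0 h : 0 < c h by exact: bcos_gt0.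
have mc : measurable_fun setT c by rewrite /c; mfun.
have mFE : measurable_fun setT (EFin \o F) by apply/measurable_EFinP.
rewrite (@fubini_tonelli2 _ _ _ _ _ lam lam (EFin \o F))//.
pose I v := (\int[lam]_u (F (u, v))%:E)%E.
have mI : measurable_fun setT I.
  exact: (@measurable_fun_fubini_tonelli_G _ _ _ _ _ lam (EFin \o F) mFE (fun z => F0 z)).
have I0 v : (0 <= I v)%E by apply: integral_ge0 => u _; rewrite lee_fin.
rewrite (_ : (\int[lam]_v _ = \int[lam]_v I v)%E)// (ge0_integral_rV_neq0 n0 mI I0).
(* The integrand in (h, v): |v|^n is the Jacobian of u = |v| h, and |v| <= c h expresses that (u, v)
   lies in the unit ball. *)
pose K (p : T * T) := a (x - t *: (c p.1 *: p.1)) *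
  ((p.2 != 0)%R%:R * enorm p.2 ^+ n * (enorm p.2 <= c p.1)%R%:R * b (x - (t * c p.1) *: dir p.2)).
have mK : measurable_fun setT K by rewrite /K; mfun.
have K0 p : 0 <= K p by rewrite mulr_ge0// !mulr_ge0// exprn_ge0// enorm_ge0.
apply: (@le_trans _ _ (\int[lam]_v \int[lam]_h (K (h, v))%:E)%E).
  apply: ge0_le_integral_nomeas => v _; first by rewrite mule_ge0.
  have [->|v0] := eqVneq v 0.
    by rewrite mule0; apply: integral_ge0 => h _; rewrite lee_fin.
  rewrite mule1; have r0 : 0 < enorm v by rewrite enorm_gt0.
  have mFv : measurable_fun setT (fun u : T => (F (u, v))%:E).
    by apply/measurable_EFinP; apply: (measurableT_comp mF); mfun.
  have := @ge0_integral_rV_scale R n (enorm v) (fun u => (F (u, v))%:E) r0 mFv.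
  move=> /(_ (fun u => _)) H; rewrite /I.
  have -> : (\int[lam]_u (F (u, v))%:E = (enorm v ^+ n)%:E * \int[lam]_h (F (enorm v *: h, v))%:E)%E.
    rewrite H => [|u]; last by rewrite lee_fin.
    by rewrite muleA -EFinM mulfV ?mul1e// expf_neq0// gt_eqF.
  rewrite -ge0_integralZl//; last 3 first.
  - by apply: (measurableT_comp mFv); mfun.
  - by move=> h _; rewrite lee_fin.
  - by rewrite lee_fin exprn_ge0// ltW.
  apply: ge0_le_integral_nomeas => h _; first by rewrite mule_ge0// lee_fin ?exprn_ge0 ?(ltW r0).
  have E2 : enorm2 (enorm v *: h, v) = enorm v / c h.
    rewrite /enorm2/= enormZ gtr0_norm// exprMn -[X in _ + X]mulr1 -mulrDr addrC sqrtrM ?sqr_ge0//.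
    by rewrite sqrtr_sqr gtr0_norm// /c /bcos invrK.
  have A1 : t *: ((enorm v / c h)^-1 *: (enorm v *: h)) = t *: (c h *: h).
    by congr (_ *: _); rewrite scalerA invf_div divfK// gt_eqF.
  have A2 : t *: ((enorm v / c h)^-1 *: v) = (t * c h) *: dir v.
    by rewrite /dir !scalerA invf_div mulrA.
  rewrite -EFinM lee_fin /F /K E2/= A1 A2 divr_gt0//= ler_pdivrMr// mul1r v0 mul1r.
  by rewrite le_eqVlt; apply/orP; left; apply/eqP; ring.
rewrite -(@fubini_tonelli _ _ _ _ _ lam lam (EFin \o K))//; last by apply/measurable_EFinP.
have L0 : (0 <= L)%E.
  by apply: le_trans (bL 1 ltr01); apply: integral_ge0 => w _; rewrite lee_fin mulr_ge0.
apply: (@le_trans _ _ (\int[lam]_h ((a (x - t *: (c h *: h)) * c h ^+ (2 * n))%:E * L))%E).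
  apply: ge0_le_integral_nomeas => h _; first by apply: integral_ge0 => v _; rewrite lee_fin.
  pose k v := (v != 0)%R%:R * enorm v ^+ n * (enorm v <= c h)%R%:R * b (x - (t * c h) *: dir v).
  have mk : measurable_fun setT (EFin \o k) by apply/measurable_EFinP; rewrite /k; mfun.
  have kk0 v : 0 <= k v by rewrite !mulr_ge0// exprn_ge0// enorm_ge0.
  rewrite (_ : (\int[lam]_v (K (h, v))%:E = (a (x - t *: (c h *: h)))%:E * \int[lam]_v (k v)%:E)%E); last first.
    rewrite -ge0_integralZl; [by apply: eq_integral|exact: measurableT|exact: mk| |by rewrite lee_fin].
    by move=> v _; rewrite lee_fin.
  rewrite EFinM -muleA; apply: lee_wpmul2l; first by rewrite lee_fin.
  have := @ge0_integral_rV_scale R n (c h) (EFin \o k) (c0 h) mk.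
  move=> /(_ (fun u => _)) H.
  have -> : (\int[lam]_v (k v)%:E = (c h ^+ n)%:E * \int[lam]_v (k (c h *: v))%:E)%E.
    rewrite H => [|u]; last by rewrite lee_fin.
    by rewrite muleA -EFinM mulfV ?mul1e// expf_neq0// gt_eqF.
  have tc0 : 0 < t * c h by rewrite mulr_gt0.
  (* Rescaling v by c h gives one factor (c h)^n from the volume and one from |v|^n; the |v|^n that
     remains on the unit ball is bounded by 1. *)
  apply: (@le_trans _ _ ((c h ^+ n)%:E * ((c h ^+ n)%:E * \int[lam]_w (bind w * b (x - (t * c h) *: dir w))%:E))%E).
    apply: lee_wpmul2l; first by rewrite lee_fin exprn_ge0// ltW.
    rewrite -ge0_integralZl//; last 3 first.
    - by apply/measurable_EFinP; mfun.
    - by move=> w _; rewrite lee_fin mulr_ge0.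
    - by rewrite lee_fin exprn_ge0// ltW.
    apply: ge0_le_integral_nomeas => v _; first by rewrite lee_fin.
    rewrite -EFinM lee_fin /k dirZ// enormZ gtr0_norm// mulrA ler_wpM2r//.
    have -> : (c h * enorm v <= c h) = (enorm v <= 1) by rewrite -{2}(mulr1 (c h)) ler_pM2l.
    rewrite exprMn /ball_indic.
    case: (leP (enorm v) 1) => v1; last by rewrite !mulr0.
    rewrite !mulr1; case: (_ != 0); rewrite ?mul0r ?mul1r ?exprn_ge0 ?(ltW (c0 h))//.
    by rewrite ler_piMr ?exprn_ge0 ?(ltW (c0 h))// exprn_ile1// enorm_ge0.
  rewrite muleA -EFinM -exprD addnn -mul2n; apply: lee_wpmul2l; last exact: bL.
  by rewrite lee_fin exprn_ge0// ltW.
rewrite ge0_integralZr//; last 2 first.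
- by apply/measurable_EFinP; mfun.
- by move=> h _; rewrite lee_fin mulr_ge0// exprn_ge0// ltW.
apply: lee_wpmul2r => //.
exact: le_trans (integral_bracket_le t x ca a0) (integral_ball_le_HL x t0 ma a0).
Qed.

(** By its definition through cones, the surface measure is 2 n times the image under [sphere_proj]
    of Lebesgue measure restricted to the punctured ball, so [ge0_integral_transport] applies. *)
Lemma integral_surface_measure_le (H : T * T -> \bar R) : measurable_fun setT H ->
  (forall z, 0 <= H z)%E ->
  (\int[@surface_measure R n]_(z in @sphere R n) H z <=
   (2 * n)%:R%:E * \int[(lam \x lam)%E]_z ((0 < enorm2 z <= 1)%R%:R%:E * H (sphere_proj z)))%E.
Proof.
move=> mH H0; have mp := @measurable_punctured_ball R n.
have mproj := @measurable_sphere_proj R n.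
apply: (@le_trans _ _ (\int[@surface_measure R n]_z H z)%E).
  rewrite [leLHS]integral_mkcond; apply: ge0_le_integral_nomeas => z _; rewrite /patch; case: ifP => //.
have n0 : 0 < (2 * n)%:R :> R by rewrite ltr0n.
have ninv : 0 <= (2 * n)%:R^-1 :> R by rewrite invr_ge0 ltW.
have [mu [tr nul mE]] : exists mu : {measure set (T * T) -> \bar R},
  [/\ forall B, measurable B ->
        mu (@sphere_proj R n @^-1` B) = ((NngNum ninv)%:num%:E * surface_measure B)%E,
      mu (~` @punctured_ball R n) = 0 &
      forall B, measurable B -> B `<=` @punctured_ball R n -> mu B = (lam \x lam)%E B].
  exists (mrestr (lam \x lam)%E mp); split => [B mB||B mB Bp].
  - by rewrite /= /mrestr /surface_measure muleA -EFinM mulVf ?gt_eqF// mul1e setIC.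
  - by rewrite /= /mrestr setICl measure0.
  - by rewrite /= /mrestr setIidl.
have := ge0_integral_transport mproj tr mH H0.
move=> /= E; have -> : (\int[@surface_measure R n]_z H z =
    (2 * n)%:R%:E * \int[mu]_z H (sphere_proj z))%E.
  by rewrite E muleA -EFinM mulfV ?gt_eqF// mul1e.
apply: lee_wpmul2l; first by rewrite lee_fin ltW.
have mHp : measurable_fun setT (fun z => H (@sphere_proj R n z)) by exact: measurableT_comp.
have mpc : measurable (~` @punctured_ball R n) by exact: measurableC.
rewrite (ge0_negligible_integral mpc measurableT mHp (fun z _ => H0 _) nul) setTD setCK.
rewrite (eq_measure_integral _ mE).
rewrite [leLHS]integral_mkcond; apply: ge0_le_integral_nomeas => z _; rewrite /patch.
  by case: ifP.
case: ifPn => [/set_mem zp|_]; last by rewrite mule_ge0.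
by rewrite (_ : (0 < enorm2 z <= 1) = true) ?mul1e.
Qed.

End slicing.

(** * Moduli of Schwartz functions *)

Section schwartz_modulus.
Context {R : realType} (n' : nat).
Notation n := n'.+1.
Notation T := 'rV[R]_n.
Notation lam := (@lebesgue_rV R n).
Implicit Types (x y : T) (h : T -> R) (f : T -> R[i]).

Lemma exists_large_coor x : exists i, enorm x <= n%:R * `|x ord0 i|.
Proof.
have [i _ hi] := @arg_maxP _ _ _ ord0 (fun=> true) (fun i => `|x ord0 i|) isT.
exists i; rewrite -ler_sqr ?nnegrE ?enorm_ge0 ?mulr_ge0// enorm_sqr exprMn.
apply: (@le_trans _ _ (\sum_(j < n) `|x ord0 i| ^+ 2)).
  apply: ler_sum => j _; rewrite -[leLHS](real_normK (num_real _)).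
  by rewrite ler_sqr ?nnegrE//; exact: hi.
rewrite sumr_const card_ord -[leLHS]mulr_natl ler_wpM2r ?sqr_ge0//.
by rewrite -natrX ler_nat expnS expn1 leq_pmulr.
Qed.

Lemma oneD_expr_le (u : R) k : 0 <= u -> (1 + u) ^+ k <= 2 ^+ k * (1 + u ^+ k).
Proof.
move=> u0; have [u1|u1] := leP u 1.
  apply: (@le_trans _ _ (2 ^+ k)).
    by apply: lerXn2r; rewrite ?nnegrE ?addr_ge0//; lra.
  by rewrite ler_peMr ?exprn_ge0// lerDl exprn_ge0.
apply: (@le_trans _ _ ((2 * u) ^+ k)).
  by apply: lerXn2r; rewrite ?nnegrE ?addr_ge0 ?mulr_ge0//; lra.
by rewrite exprMn ler_wpM2l ?exprn_ge0// lerDr.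
Qed.

(** The seminorms are used without derivatives, for the monomials 1 and x_i^(n+1): the largest
    coordinate of x controls its norm up to the factor n, and summing the constants over i covers
    every choice of that coordinate. *)
Lemma schwartz_real_decay h : schwartz_real h -> continuous h /\
  exists2 B, 0 <= B & forall x, `|h x| * (1 + enorm x) ^+ n.+1 <= B.
Proof.
move=> [sm dec]; split; first exact: (sm [::]).1.
have coor i : exists C, forall x, `|x ord0 i| ^+ n.+1 * `|h x| <= C.
  have [C hC] := dec (fun j => if j == i then n.+1 else 0%N) [::].
  exists C => x; have := hC x; rewrite (bigD1 i)//= eqxx big1 => [|j /negbTE ->//].
  by rewrite mulr1 normrM normrX.
have [C hC] := fin_all_exists coor.
have [C0 h0] := dec (fun=> 0%N) [::].
have C0h x : `|h x| <= C0 by have := h0 x; rewrite big1 ?mul1r.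
have Ci0 i : 0 <= C i.
  by apply: le_trans (hC i 0); rewrite mulr_ge0// exprn_ge0.
have C00 : 0 <= C0 by apply: le_trans (C0h 0).
have S0 : 0 <= \sum_i C i by exact: sumr_ge0.
exists (2 ^+ n.+1 * (C0 + n%:R ^+ n.+1 * \sum_i C i)).
  by rewrite mulr_ge0 ?exprn_ge0// addr_ge0// mulr_ge0// exprn_ge0.
move=> x; have [i hi] := exists_large_coor x; set u := n%:R * _ in hi.
have u0 : 0 <= u by rewrite mulr_ge0.
apply: (@le_trans _ _ (`|h x| * (2 ^+ n.+1 * (1 + u ^+ n.+1)))).
  rewrite ler_wpM2l// (le_trans _ (oneD_expr_le _ u0))//.
  by apply: lerXn2r; rewrite ?nnegrE ?addr_ge0 ?enorm_ge0// lerD2l.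
rewrite mulrCA ler_wpM2l ?exprn_ge0// mulrDr mulr1 lerD//.
rewrite /u exprMn mulrCA ler_wpM2l ?exprn_ge0// mulrC (le_trans (hC i x))//.
by rewrite (bigD1 i)//= lerDl sumr_ge0.
Qed.

Definition norm_of f x : R := Normc.normc (f x).

Lemma normc_ge0 (z : R[i]) : 0 <= Normc.normc z.
Proof. by case: z => a b; exact: sqrtr_ge0. Qed.

Lemma normc_le_add (z : R[i]) : Normc.normc z <= `|complex.Re z| + `|complex.Im z|.
Proof.
case: z => a b /=; rewrite -ler_sqr ?nnegrE ?sqrtr_ge0 ?addr_ge0//.
rewrite sqr_sqrtr ?addr_ge0 ?sqr_ge0// sqrrD !real_normK ?num_real//.
by rewrite addrAC lerDl mulrn_wge0// mulr_ge0.
Qed.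

Lemma normr_Re_le (z : R[i]) : `|complex.Re z| <= Normc.normc z.
Proof. by case: z => a b /=; rewrite -sqrtr_sqr ler_wsqrtr// lerDl sqr_ge0. Qed.

Lemma normr_Im_le (z : R[i]) : `|complex.Im z| <= Normc.normc z.
Proof. by case: z => a b /=; rewrite -sqrtr_sqr ler_wsqrtr// lerDr sqr_ge0. Qed.

Lemma schwartz_norm f : schwartz f -> [/\ bounded_integrable lam (norm_of f),
  continuous (norm_of f) & forall x, 0 <= norm_of f x].
Proof.
move=> [/schwartz_real_decay[c1 [B1 B10 h1]] /schwartz_real_decay[c2 [B2 B20 h2]]].
have cn : continuous (norm_of f).
  have cs : continuous (fun x => complex.Re (f x) ^+ 2 + complex.Im (f x) ^+ 2).
    move=> x; apply: (@cvgD _ _ _ (nbhs x) (nbhs_filter x)).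
      apply: (@cvg_comp _ _ _ (fun y => complex.Re (f y)) (fun u => u ^+ 2) _ _ _ (c1 x)).
      exact: exprn_continuous.
    apply: (@cvg_comp _ _ _ (fun y => complex.Im (f y)) (fun u => u ^+ 2) _ _ _ (c2 x)).
    exact: exprn_continuous.
  have -> : norm_of f = fun x => Num.sqrt (complex.Re (f x) ^+ 2 + complex.Im (f x) ^+ 2).
    by apply/funext => x; rewrite /norm_of; case: (f x).
  move=> x; apply: (@cvg_comp _ _ _ (fun y => complex.Re (f y) ^+ 2 + complex.Im (f y) ^+ 2)
    (@Num.sqrt R) _ _ _ (cs x)).
  exact: sqrt_continuous.
have n0 x : 0 <= norm_of f x by exact: normc_ge0.
have mn := continuous_rV_measurable cn.
have p0 x : 0 < (1 + enorm x) ^+ n.+1 by rewrite exprn_gt0// ltr_wpDr ?enorm_ge0.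
have hB x : norm_of f x <= (B1 + B2) * ((1 + enorm x) ^+ n.+1)^-1.
  rewrite ler_pdivlMr// (@le_trans _ _ ((`|complex.Re (f x)| + `|complex.Im (f x)|) * (1 + enorm x) ^+ n.+1))//.
    by rewrite ler_wpM2r ?(ltW (p0 x))//; exact: normc_le_add.
  by rewrite mulrDl lerD.
have B0 : 0 <= B1 + B2 by exact: addr_ge0.
split => //; split => //.
  exists (B1 + B2) => x; rewrite ger0_norm// (le_trans (hB x))// ler_piMr//.
  by rewrite invf_le1// exprn_ege1// lerDl enorm_ge0.
have ip : lam.-integrable setT (EFin \o (fun x => ((1 + enorm x) ^+ n.+1)^-1)).
  exact: integrable_inv_polynomial.
apply: (le_integrable measurableT _ _ (integrableZl measurableT (B1 + B2) ip)).
  exact/measurable_EFinP.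
move=> x _ /=; rewrite lee_fin !ger0_norm// mulr_ge0// invr_ge0; exact: ltW.
Qed.

End schwartz_modulus.

(** * Pointwise domination of the bilinear maximal function *)

Section pointwise_domination.
Context {R : realType} (n' : nat) (n'0 : (0 < n')%N).
Notation n := n'.+1.
Notation T := 'rV[R]_n.
Notation lam := (@lebesgue_rV R n).
Implicit Types (x y : T) (t : R) (f g : T -> R[i]) (a b : T -> R).

(** An infinite or undefined integral has real value 0, so the bound does not depend on
    integrability. *)
Lemma normr_fine_integral_le d (X : measurableType d) (mu : {measure set X -> \bar R})
    (D : set X) (h : X -> R) : measurable D -> measurable_fun setT h ->
  (`|\int[mu]_(z in D) h z|%:E <= \int[mu]_(z in D) `|h z|%:E)%E.
Proof.
move=> mD mh; apply: le_trans (@le_abse_integral _ _ _ mu D (EFin \o h) mD _).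
  by rewrite /Rintegral; case: (integral _ _ _) => [r| |] //=; rewrite normr0 leey.
by apply/measurable_EFinP; exact: measurable_funTS.
Qed.

Lemma measurable_sphere : measurable (@sphere R n).
Proof.
have m1 : measurable_fun setT (fun z : T * T => enorm z.1 ^+ 2 + enorm z.2 ^+ 2) by mfun.
have -> : @sphere R n = (fun z : T * T => enorm z.1 ^+ 2 + enorm z.2 ^+ 2) @^-1` [set 1] by [].
by rewrite -[X in measurable X]setTI; exact: m1.
Qed.

Definition ball_form a b t x : \bar R :=
  (\int[(lam \x lam)%E]_z ((0 < enorm2 z <= 1)%R%:R *
      (a (x - t *: ((enorm2 z)^-1 *: z.1)) * b (x - t *: ((enorm2 z)^-1 *: z.2))))%:E)%E.

(** Tonelli is applied in the two orders, the norm on the product being symmetric. This allows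
    either function to receive the spherical maximal operator. *)
Lemma ball_form_swap a b t x : continuous a -> continuous b -> (forall y, 0 <= a y) ->
  (forall y, 0 <= b y) -> ball_form a b t x = ball_form b a t x.
Proof.
move=> ca cb a0 b0.
have ma := continuous_rV_measurable ca; have mb := continuous_rV_measurable cb.
have me2 := @measurable_enorm2 R n.
pose F a b (z : T * T) : R := (0 < enorm2 z <= 1)%R%:R *
  (a (x - t *: ((enorm2 z)^-1 *: z.1)) * b (x - t *: ((enorm2 z)^-1 *: z.2))).
have mV : measurable_fun setT (fun z : T * T => (enorm2 z)^-1).
  by apply: measurable_inv_ge0 => // z; exact: sqrtr_ge0.
have mF1 : measurable_fun setT (EFin \o F a b) by apply/measurable_EFinP; rewrite /F; mfun.
have mF2 : measurable_fun setT (EFin \o F b a) by apply/measurable_EFinP; rewrite /F; mfun.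
have F10 z : (0 <= (EFin \o F a b) z)%E by rewrite lee_fin !mulr_ge0.
have F20 z : (0 <= (EFin \o F b a) z)%E by rewrite lee_fin !mulr_ge0.
rewrite /ball_form (@fubini_tonelli1 _ _ _ _ _ lam lam (EFin \o F a b) mF1 F10).
rewrite (@fubini_tonelli2 _ _ _ _ _ lam lam (EFin \o F b a) mF2 F20).
apply: eq_integral => u _; apply: eq_integral => v _.
rewrite /F /= (_ : enorm2 (u, v) = enorm2 (v, u)); last by rewrite /enorm2 addrC.
by rewrite [X in _ * X]mulrC.
Qed.

(** The complex integral is taken by real and imaginary parts, each dominated by the integral of |f|
    |g|: hence the factor 2. The factor 2 n normalises the surface measure. *)
Lemma spherical_maximal_le_ball_form f g x : schwartz f -> schwartz g ->
  forall L : \bar R, (forall t, 0 < t -> (ball_form (norm_of f) (norm_of g) t x <= L)%E) ->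
  (spherical_maximal f g x <= (2 * (2 * n)%:R)%:E * L)%E.
Proof.
move=> sf sg L hL; have [_ ca a0] := schwartz_norm sf; have [_ cb b0] := schwartz_norm sg.
have [[/schwartz_real_decay[rf _] /schwartz_real_decay[mf _]]
      [/schwartz_real_decay[rg _] /schwartz_real_decay[mg _]]] := conj sf sg.
have mrf := continuous_rV_measurable rf; have mif := continuous_rV_measurable mf.
have mrg := continuous_rV_measurable rg; have mig := continuous_rV_measurable mg.
have ma := continuous_rV_measurable ca; have mb := continuous_rV_measurable cb.
apply: ge_ereal_sup => _ [t /= t0 <-].
pose h (z : T * T) := norm_of f (x - t *: z.1) * norm_of g (x - t *: z.2).
have mh : measurable_fun setT h by rewrite /h; mfun.
have h0 z : 0 <= h z by rewrite mulr_ge0.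
have key : (\int[@surface_measure R n]_(z in @sphere R n) (h z)%:E <= (2 * n)%:R%:E * L)%E.
  apply: le_trans (@integral_surface_measure_le R n' (EFin \o h) _ _) _.
  - exact/measurable_EFinP.
  - by move=> z; rewrite lee_fin.
  apply: lee_wpmul2l => //; apply: le_trans (hL t t0); apply: ge0_le_integral_nomeas => z _.
    by rewrite mule_ge0// lee_fin.
  by rewrite -EFinM.
pose F (z : T * T) := f (x - t *: z.1) * g (x - t *: z.2).
have bound (P : R[i] -> R) : (forall z, `|P z| <= Normc.normc z) ->
    measurable_fun setT (fun z => P (F z)) ->
    (`|\int[@surface_measure R n]_(z in @sphere R n) P (F z)|%:E <= (2 * n)%:R%:E * L)%E.
  move=> hP mP; apply: (le_trans (normr_fine_integral_le _ measurable_sphere mP)).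
  apply: le_trans key; apply: ge0_le_integral_nomeas => z _; first by rewrite lee_fin.
  by rewrite lee_fin (le_trans (hP _))// /F Normc.normcM.
have pr (r1 r2 : T -> R) : measurable_fun setT r1 -> measurable_fun setT r2 ->
    measurable_fun setT (fun z : T * T => r1 (x - t *: z.1) * r2 (x - t *: z.2)).
  by move=> m1 m2; mfun.
have mRe : measurable_fun setT (fun z => complex.Re (F z)).
  have -> : (fun z => complex.Re (F z)) = (fun z : T * T =>
     (fun y => complex.Re (f y)) (x - t *: z.1) * (fun y => complex.Re (g y)) (x - t *: z.2) -
     (fun y => complex.Im (f y)) (x - t *: z.1) * (fun y => complex.Im (g y)) (x - t *: z.2)).
    by apply/funext => z; rewrite /F; case: (f _) => ? ?; case: (g _).
  exact: measurable_funB (pr _ _ mrf mrg) (pr _ _ mif mig).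
have mIm : measurable_fun setT (fun z => complex.Im (F z)).
  have -> : (fun z => complex.Im (F z)) = (fun z : T * T =>
     (fun y => complex.Re (f y)) (x - t *: z.1) * (fun y => complex.Im (g y)) (x - t *: z.2) +
     (fun y => complex.Im (f y)) (x - t *: z.1) * (fun y => complex.Re (g y)) (x - t *: z.2)).
    by apply/funext => z; rewrite /F; case: (f _) => ? ?; case: (g _).
  exact: measurable_funD (pr _ _ mrf mig) (pr _ _ mif mrg).
have L0 : (0 <= L)%E.
  by apply: le_trans (hL t t0); apply: integral_ge0 => z _; rewrite lee_fin !mulr_ge0.
apply: (@le_trans _ _ ((2 * n)%:R%:E * L + (2 * n)%:R%:E * L)%E); last first.
  by rewrite -ge0_muleDl ?lee_fin// -EFinD (_ : 2 * (2 * n)%:R = (2 * n)%:R + (2 * n)%:R)//; ring.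
rewrite /spherical_average /complex_integral.
apply: (@le_trans _ _ (`|\int[@surface_measure R n]_(z in @sphere R n) complex.Re (F z)|%:E +
   `|\int[@surface_measure R n]_(z in @sphere R n) complex.Im (F z)|%:E)%E).
  rewrite -EFinD lee_fin.
  exact: (normc_le_add (complex_integral (@surface_measure R n) (@sphere R n) F)).
apply: leeD; first by apply: bound mRe => z; exact: normr_Re_le.
by apply: bound mIm => z; exact: normr_Im_le.
Qed.

Lemma sphere_average_EFin b t x : bounded_integrable lam b ->
  (\int[lam]_w (ball_indic w * b (x - t *: dir w))%:E = (sphere_average b t x)%:E)%E.
Proof.
move=> bb; rewrite integral_EFin//.
exact: (smear_slice_integrable (integrable_ball_indic n') (measurable_shell_phi t) bb).
Qed.

Lemma spherical_maximal_le f g x (L : \bar R) : schwartz f -> schwartz g ->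
  (forall t, 0 < t -> ((sphere_average (norm_of g) t x)%:E <= L)%E) ->
  (spherical_maximal f g x <= (2 * (2 * n)%:R * 4 ^+ n)%:E * (HL (norm_of f) x * L))%E.
Proof.
move=> sf sg hL; have [_ ca a0] := schwartz_norm sf; have [bb cb b0] := schwartz_norm sg.
rewrite EFinM -muleA; apply: spherical_maximal_le_ball_form => // t t0.
rewrite muleA; apply: punctured_ball_integral_le => // s s0.
by rewrite sphere_average_EFin//; exact: hL.
Qed.

Lemma spherical_maximal_le_swap f g x (L : \bar R) : schwartz f -> schwartz g ->
  (forall t, 0 < t -> ((sphere_average (norm_of f) t x)%:E <= L)%E) ->
  (spherical_maximal f g x <= (2 * (2 * n)%:R * 4 ^+ n)%:E * (HL (norm_of g) x * L))%E.
Proof.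
move=> sf sg hL; have [bb ca a0] := schwartz_norm sf; have [_ cb b0] := schwartz_norm sg.
rewrite EFinM -muleA; apply: spherical_maximal_le_ball_form => // t t0.
rewrite ball_form_swap// muleA; apply: punctured_ball_integral_le => // s s0.
by rewrite sphere_average_EFin//; exact: hL.
Qed.

Lemma spherical_maximal_ge0 f g x : (0 <= spherical_maximal f g x)%E.
Proof.
apply: (@le_trans _ _ (Normc.normc (spherical_average f g 1 x))%:E).
  by rewrite lee_fin normc_ge0.
by apply: ereal_sup_ubound; exists 1 => /=.
Qed.

End pointwise_domination.

(** * Hoelder's inequality for quasi-norms *)

Section hoelder_product.
Context {R : realType} d (X : measurableType d) (mu : {measure set X -> \bar R}).
Variables (p1 p2 p : R).
Hypotheses (p10 : 0 < p1) (p20 : 0 < p2) (p0 : 0 < p) (p12 : p^-1 = p1^-1 + p2^-1).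

Let frac : p / p1 + p / p2 = 1.
Proof. by rewrite -mulrDr -p12 mulfV// gt_eqF. Qed.

(** Young's inequality for u^p and v^p with the conjugate exponents p1/p and p2/p, which exceed 1
    even when p < 1. If a factor is infinite, so is the right-hand side. *)
Lemma young_poweR (u v : \bar R) : (0 <= u)%E -> (0 <= v)%E ->
  ((u * v) `^ p <= (p / p1)%:E * u `^ p1 + (p / p2)%:E * v `^ p2)%E.
Proof.
have c1 : 0 < p / p1 by rewrite divr_gt0.
have c2 : 0 < p / p2 by rewrite divr_gt0.
have t1 (w : \bar R) : (0 <= (p / p1)%:E * w `^ p1)%E.
  by apply: mule_ge0; [rewrite lee_fin ltW|exact: poweR_ge0].
have t2 (w : \bar R) : (0 <= (p / p2)%:E * w `^ p2)%E.
  by apply: mule_ge0; [rewrite lee_fin ltW|exact: poweR_ge0].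
have big1 w : ((p / p1)%:E * +oo `^ p1 + (p / p2)%:E * w `^ p2 = +oo)%E.
  rewrite poweRyr ?gt_eqF// gt0_muley ?lte_fin// addye//.
  by apply/negP => /eqP H; have := t2 w; rewrite H.
have big2 w : ((p / p1)%:E * w `^ p1 + (p / p2)%:E * +oo `^ p2 = +oo)%E.
  rewrite poweRyr ?gt_eqF// gt0_muley ?lte_fin// addey//.
  by apply/negP => /eqP H; have := t1 w; rewrite H.
case: u => [u| |]// u0; last by move=> _; rewrite big1 leey.
case: v => [v| |]// v0; last by rewrite big2 leey.
rewrite !lee_fin in u0 v0; rewrite -EFinM !poweR_EFin -!EFinM -EFinD lee_fin powRM//.
have := @conjugate_powR R (u `^ p) (v `^ p) (p1 / p) (p2 / p) (powR_ge0 _ _) (powR_ge0 _ _)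
  (divr_gt0 p10 p0) (divr_gt0 p20 p0).
rewrite !invf_div frac => /(_ erefl); rewrite -!powRrM.
rewrite [p * (p1 / p)]mulrC divfK ?gt_eqF// [p * (p2 / p)]mulrC divfK ?gt_eqF//.
by rewrite [u `^ p1 * _]mulrC [v `^ p2 * _]mulrC.
Qed.

Lemma poweR_invM (N : R) (u : \bar R) (r : R) : 0 < N -> (0 <= u)%E -> 0 < r ->
  (((N^-1)%:E * u) `^ r = ((N `^ r)^-1)%:E * u `^ r)%E.
Proof.
move=> N0 u0 r0; have iN : (0 <= (N^-1)%:E)%E by rewrite lee_fin invr_ge0 ltW.
rewrite (poweRM r iN u0) poweR_EFin; congr (_%:E * _)%E.
by rewrite -[RHS]powR_inv1 ?powR_ge0// -[N^-1]powR_inv1 ?(ltW N0)// -!powRrM mulrC.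
Qed.

(* Stated for the [p]-th powers because [p] may be smaller than [1]. *)
Lemma hoelder_product (U V : X -> \bar R) (N1 N2 : R) :
  measurable_fun setT U -> measurable_fun setT V ->
  (forall x, 0 <= U x)%E -> (forall x, 0 <= V x)%E -> 0 < N1 -> 0 < N2 ->
  (\int[mu]_x (U x `^ p1) <= (N1 `^ p1)%:E)%E -> (\int[mu]_x (V x `^ p2) <= (N2 `^ p2)%:E)%E ->
  (\int[mu]_x ((U x * V x) `^ p) <= ((N1 * N2) `^ p)%:E)%E.
Proof.
move=> mU mV U0 V0 N10 N20 iU iV.
pose U' x := ((N1^-1)%:E * U x)%E; pose V' x := ((N2^-1)%:E * V x)%E.
have iN1 : 0 <= N1^-1 by rewrite invr_ge0 ltW.
have iN2 : 0 <= N2^-1 by rewrite invr_ge0 ltW.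
have U'0 x : (0 <= U' x)%E by rewrite mule_ge0.
have V'0 x : (0 <= V' x)%E by rewrite mule_ge0.
have c1 : 0 <= p / p1 by rewrite divr_ge0// ltW.
have c2 : 0 <= p / p2 by rewrite divr_ge0// ltW.
have mUp : measurable_fun setT (fun x => U x `^ p1)%E.
  exact: (measurableT_comp (measurable_poweR _)).
have mVp : measurable_fun setT (fun x => V x `^ p2)%E.
  exact: (measurableT_comp (measurable_poweR _)).
have q1 : 0 < N1 `^ p1 by rewrite powR_gt0.
have q2 : 0 < N2 `^ p2 by rewrite powR_gt0.
pose A x := ((p / p1 / N1 `^ p1)%:E * U x `^ p1)%E.
pose B x := ((p / p2 / N2 `^ p2)%:E * V x `^ p2)%E.
have k1 : 0 <= p / p1 / N1 `^ p1 by rewrite divr_ge0// ltW.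
have k2 : 0 <= p / p2 / N2 `^ p2 by rewrite divr_ge0// ltW.
have A0 x : (0 <= A x)%E by rewrite mule_ge0 ?lee_fin ?poweR_ge0.
have B0 x : (0 <= B x)%E by rewrite mule_ge0 ?lee_fin ?poweR_ge0.
have mA : measurable_fun setT A by exact: emeasurable_funM.
have mB : measurable_fun setT B by exact: emeasurable_funM.
have iA : (\int[mu]_x A x <= (p / p1)%:E)%E.
  rewrite /A ge0_integralZl ?lee_fin//; last by move=> x _; exact: poweR_ge0.
  apply: (@le_trans _ _ ((p / p1 / N1 `^ p1)%:E * (N1 `^ p1)%:E)%E).
    by apply: lee_wpmul2l; rewrite ?lee_fin.
  by rewrite -EFinM divfK// gt_eqF.
have iB : (\int[mu]_x B x <= (p / p2)%:E)%E.
  rewrite /B ge0_integralZl ?lee_fin//; last by move=> x _; exact: poweR_ge0.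
  apply: (@le_trans _ _ ((p / p2 / N2 `^ p2)%:E * (N2 `^ p2)%:E)%E).
    by apply: lee_wpmul2l; rewrite ?lee_fin.
  by rewrite -EFinM divfK// gt_eqF.
have NN0 : 0 <= (N1 * N2) `^ p by exact: powR_ge0.
apply: (@le_trans _ _ (\int[mu]_x (((N1 * N2) `^ p)%:E * (A x + B x)))%E).
  apply: ge0_le_integral_nomeas => x _; first exact: poweR_ge0.
  have -> : (U x * V x = (N1 * N2)%:E * (U' x * V' x))%E.
    have -> : (U' x * V' x = (N1^-1 * N2^-1)%:E * (U x * V x))%E by rewrite /U' /V' muleACA EFinM.
    rewrite [RHS]muleA -EFinM.
    rewrite (_ : N1 * N2 * (N1^-1 * N2^-1) = 1) ?mul1e//; field.
    by rewrite !gt_eqF.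
  have NN : (0 <= (N1 * N2)%:E)%E by rewrite lee_fin mulr_ge0// ltW.
  rewrite (poweRM p NN (mule_ge0 (U'0 x) (V'0 x))) poweR_EFin.
  apply: lee_wpmul2l; first by rewrite lee_fin.
  apply: (le_trans (young_poweR (U'0 x) (V'0 x))).
  by rewrite /U' /V' !poweR_invM// !muleA -!EFinM.
rewrite ge0_integralZl ?lee_fin//; last 2 first.
- exact: emeasurable_funD.
- by move=> x _; rewrite adde_ge0.
rewrite (ge0_integralD mu measurableT (fun x _ => A0 x) mA (fun x _ => B0 x) mB).
rewrite -[leRHS]mule1; apply: lee_wpmul2l; first by rewrite lee_fin.
by rewrite -frac EFinD; exact: leeD.
Qed.

End hoelder_product.

(** * Arithmetic of the exponents *)

Section rhombus_exponents.
Context {R : realType}.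
Implicit Types u v : R.

(** Linear inequalities need checking at the four vertices only. The coordinates of the last vertex
    are s = (2n - 10)/(2n - 5), and at the second and third the sum bound reads 1 <= 2 s, which is
    where n >= 8 enters. *)
Lemma convex_hull_rhombus_bounds (n : nat) u v w : (8 <= n)%N ->
  convex_hull (@rhombus_vertex R n) (vec3 u v w) ->
  [/\ u <= 1, v <= 1 & (u + v) * (2 * n%:R - 5) <= 2 * (2 * n%:R - 10)].
Proof.
move=> n8 [c [c0 c1 E]].
have n8R : 8 <= n%:R :> R by rewrite ler_nat.
pose s : R := (2 * n%:R - 10) / (2 * n%:R - 5).
have n5 : 0 < 2 * n%:R - 5 :> R by lra.
have sE : (1 + 2 * delta n) / (2 + 2 * delta n) = s.
  by rewrite /s /delta; field; rewrite !gt_eqF//; lra.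
have s1 : s <= 1 by rewrite /s ler_pdivrMr//; lra.
have sM : s * (2 * n%:R - 5) = 2 * n%:R - 10 by rewrite /s divfK// gt_eqF.
have Eu := congr1 (fun M : 'rV_3 => M ord0 ord0) E.
have Ev := congr1 (fun M : 'rV_3 => M ord0 (lift ord0 ord0)) E.
rewrite summxE !big_ord_recl big_ord0 /rhombus_vertex !mxE /= sE in Eu.
rewrite summxE !big_ord_recl big_ord0 /rhombus_vertex !mxE /= sE in Ev.
rewrite !big_ord_recl big_ord0 in c1.
move: (c0 ord0) (c0 (lift ord0 ord0)) (c0 (lift ord0 (lift ord0 ord0)))
  (c0 (lift ord0 (lift ord0 (lift ord0 ord0)))) c1 Eu Ev.
move: (c ord0) (c (lift ord0 ord0)) (c (lift ord0 (lift ord0 ord0)))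
  (c (lift ord0 (lift ord0 (lift ord0 ord0)))) => a0 a1 a2 a3 a00 a10 a20 a30 c1 Eu Ev.
have a3s : a3 * s <= a3 by rewrite ler_piMr.
clear -s1 sM a00 a10 a20 a30 c1 Eu Ev a3s n8R.
split; [lra|lra|].
have -> : (u + v) * (2 * n%:R - 5) = (a1 + a2) * (2 * n%:R - 5) + 2 * a3 * (s * (2 * n%:R - 5)).
  by rewrite Eu Ev; ring.
rewrite sM; apply: (@le_trans _ _ ((a1 + a2) * (2 * (2 * n%:R - 10)) + 2 * a3 * (2 * n%:R - 10))).
  by rewrite lerD2r ler_wpM2l//; lra.
rewrite (_ : _ + _ = (a1 + a2 + a3) * (2 * (2 * n%:R - 10))); last by ring.
by rewrite ler_piMl//; lra.
Qed.

Lemma open_rhombus_bounds (n : nat) u v : (8 <= n)%N -> open_rhombus n (vec3 u v (u + v)) ->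
  [/\ u < 1, v < 1 & (u + v) * (2 * n%:R - 5) < 2 * (2 * n%:R - 10)].
Proof.
move=> n8 [_ /nbhs_ballP[e /= e0 eH]].
have n8R : 8 <= n%:R :> R by rewrite ler_nat.
(* Strictness comes from moving to (u + d, v + d), which moves the third coordinate by 2 d < e and
   so stays both in the plane and in the neighbourhood. *)
pose d := e / 4; have d0 : 0 < d by rewrite divr_gt0.
have de : d + d < e by rewrite /d; lra.
have yP : exponent_plane (vec3 (u + d) (v + d) (u + d + (v + d))) by exists (u + d), (v + d).
have : convex_hull (rhombus_vertex n) (vec3 (u + d) (v + d) (u + d + (v + d))).
  apply: eH yP; split => // i j; rewrite !mxE.
  have n1 w : ball w e (w + d).
    by rewrite /ball/= opprD addrA subrr sub0r normrN gtr0_norm//; lra.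
  case: j => [[|[|[|//]]] ?] /=; [exact: n1|exact: n1|].
  by rewrite /ball/= addrACA opprD addrA subrr sub0r normrN gtr0_norm// addr_gt0.
move=> /(convex_hull_rhombus_bounds n8)[h1 h2 h3]; split; [lra|lra|].
apply: lt_le_trans h3; rewrite ltr_pM2r; lra.
Qed.

(** The condition n <= 10 q says exactly that (2n - 10)/(2n - 5) <= (4q - 2)/(4q - 1) = k, so that v
    < k. Any r strictly between max(v, 1/2) and k gives p = 1/r; the value 1/2 keeps p below 2. *)
Lemma exists_interpolation_exponent (n q : nat) v : (0 < q)%N -> (n <= 10 * q)%N -> (8 <= n)%N ->
  0 < v -> v * (2 * n%:R - 5) < 2 * n%:R - 10 ->
  exists p : R, [/\ 1 < p, p < 2, (4 * q)%:R - 1 < p * ((4 * q)%:R - 2) & p <= v^-1].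
Proof.
move=> q0 nq n8 v0 hv.
have n8R : 8 <= n%:R :> R by rewrite ler_nat.
have nqR : n%:R <= 10 * q%:R :> R by rewrite -natrM ler_nat.
have q1R : 1 <= q%:R :> R by rewrite ler1n.
have E4 : (4 * q)%:R = 4 * q%:R :> R by rewrite natrM.
rewrite E4; set Q := q%:R in nqR q1R *; set N := n%:R in n8R nqR hv.
pose k := (4 * Q - 2) / (4 * Q - 1).
have Q1 : 0 < 4 * Q - 1 by lra.
have kM : k * (4 * Q - 1) = 4 * Q - 2 by rewrite /k divfK// gt_eqF.
have hk : 2^-1 < k by rewrite /k ltr_pdivlMr//; lra.
have k1 : k < 1 by rewrite /k ltr_pdivrMr//; lra.
have vk : v < k.
  apply: (@lt_le_trans _ _ ((2 * N - 10) / (2 * N - 5))); first by rewrite ltr_pdivlMr//; lra.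
  rewrite ler_pdivrMr; last by lra.
  by rewrite /k mulrAC ler_pdivlMr//; nra.
pose m := Num.max v 2^-1; have mk : m < k by rewrite gt_max vk.
pose r := (m + k) / 2; have mr : m < r by rewrite midf_lt.
have rk : r < k by rewrite midf_lt.
have vm : v <= m by rewrite le_max lexx.
have hm : 2^-1 <= m by rewrite le_max lexx orbT.
have r0 : 0 < r by lra.
exists r^-1; split.
- by rewrite invf_gt1//; lra.
- by rewrite -[2]invrK ltf_pV2 ?posrE ?invr_gt0//; lra.
- by rewrite [ltRHS]mulrC ltr_pdivlMr// -kM [ltLHS]mulrC ltr_pM2r.
- by rewrite lef_pV2 ?posrE//; lra.
Qed.

End rhombus_exponents.

(** * The final estimate *)

Section main_estimate.
Context {R : realType} (n' : nat).
Notation n := n'.+1.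
Notation T := 'rV[R]_n.
Notation lam := (@lebesgue_rV R n).
Implicit Types (x y : T) (t : R) (a b : T -> R).

(** Hoelder's inequality is normalised by positive numbers; taking them slightly above the norms and
    passing to the limit covers functions of norm 0. *)
Lemma le_mul_limit (X : \bar R) (K u v : R) : 0 <= K -> 0 <= u -> 0 <= v ->
  (forall u' v', u < u' -> v < v' -> (X <= (K * (u' * v'))%:E)%E) ->
  (X <= (K * (u * v))%:E)%E.
Proof.
move=> K0 u0 v0 H; apply/lee_addgt0Pr => e e0.
pose S := K * (u + v + 1) + 1; have S0 : 0 < S by rewrite ltr_wpDl// mulr_ge0// !addr_ge0.
pose d := Num.min 1 (e / S); have d0 : 0 < d by rewrite lt_min ltr01 divr_gt0.
have d1 : d <= 1 by rewrite ge_min lexx.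
have dS : d * S <= e by rewrite -ler_pdivlMr// ge_min lexx orbT.
have := H (u + d) (v + d); rewrite !ltrDl d0 => /(_ isT isT) h.
apply: (le_trans h); rewrite -EFinD lee_fin.
have -> : K * ((u + d) * (v + d)) = K * (u * v) + d * (K * (u + v + d)) by ring.
rewrite lerD2l (le_trans _ dS)// ler_wpM2l ?(ltW d0)// /S.
apply: (@le_trans _ _ (K * (u + v + 1))); last by rewrite lerDl.
by rewrite ler_wpM2l// lerD2l.
Qed.

Lemma Lnorm_powR a (p : R) : 1 <= p -> bounded_integrable lam a -> continuous a ->
  (forall y, 0 <= a y) -> exists2 A : R, 0 <= A &
  (\int[lam]_x (a x `^ p)%:E = A%:E)%E /\ Lnorm lam p%:E (EFin \o a) = (A `^ p^-1)%:E.
Proof.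
move=> p1 ba ca a0; have [[_ _ iap] _] := powR_bounded_integrable ba ca a0 p1.
have E := integral_EFin iap.
exists (\int[lam]_x (a x `^ p)); first by apply: Rintegral_ge0 => x _; exact: powR_ge0.
split => //; rewrite unlock -poweR_EFin -E; congr (_ `^ _)%E.
by apply: eq_integral => x _; rewrite /= ger0_norm.
Qed.

(** The maximal function M, a supremum over uncountably many radii, is only compared pointwise with
    the measurable product of [HL a] and the majorant L. Stated for abstract a, b and M, the lemma
    serves both assignments of f and g. *)
Lemma Lnorm_le_of_domination (K0 p1 p2 p : R) : (8 <= n)%N -> 0 <= K0 -> 1 < p1 -> 0 < p2 ->
  0 < p -> p^-1 = p1^-1 + p2^-1 -> p2^-1 * (2 * n%:R - 5) < 2 * n%:R - 10 ->
  exists2 C : R, 0 <= C & forall a b (M : T -> \bar R),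
  bounded_integrable lam a -> continuous a -> (forall y, 0 <= a y) ->
  bounded_integrable lam b -> continuous b -> (forall y, 0 <= b y) ->
  (forall x, 0 <= M x)%E ->
  (forall x (L : \bar R), (forall t, 0 < t -> ((sphere_average b t x)%:E <= L)%E) ->
     (M x <= K0%:E * (HL a x * L))%E) ->
  (Lnorm lam p%:E M <= C%:E * Lnorm lam p1%:E (EFin \o a) * Lnorm lam p2%:E (EFin \o b))%E.
Proof.
move=> n8 K00 p1gt p20 p0 p12 hp2.
have p10 : 0 < p1 by exact: lt_trans p1gt.
pose q := ((n - 2) %/ 4)%N.
have q0 : (0 < q)%N by rewrite /q; lia.
have qn : (4 * q + 2 <= n)%N by rewrite /q; lia.
(* From q = floor((n - 2)/4) one gets n <= 4 q + 5, and q >= 1. *)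
have nq : (n <= 10 * q)%N by rewrite /q; lia.
have ip2 : 0 < p2^-1 by rewrite invr_gt0.
have [r [r1 r2 hr]] := exists_interpolation_exponent q0 nq n8 ip2 hp2; rewrite invrK => rp2.
have p2gt : 1 <= p2 by rewrite (le_trans _ rp2)// ltW.
have [C1 [C10 h1]] := @HL_strong_type R n p1 p1gt.
have [C2 C20 h2] := sphere_average_strong q0 qn r1 r2 hr rp2.
exists (K0 * (C1 `^ p1^-1 * C2 `^ p2^-1)); first by rewrite !mulr_ge0 ?powR_ge0.
move=> a b M ba ca a0 bb cb b0 M0 hM.
have [A A0 [EA ->]] := Lnorm_powR (ltW p1gt) ba ca a0.
have [B B0 [EB ->]] := Lnorm_powR p2gt bb cb b0.
have [L [mL L0 iL hL]] := h2 b bb cb b0.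
have [ma _ _] := ba; have mHL := measurable_HL ma a0.
have HL0 x : (0 <= HL a x)%E by exact: HL_ge0.
rewrite -!EFinM [leRHS](_ : _ = (K0 * ((C1 * A) `^ p1^-1 * (C2 * B) `^ p2^-1))%:E); last first.
  by rewrite !powRM//; congr EFin; ring.
apply: le_mul_limit => //; [exact: powR_ge0|exact: powR_ge0|].
move=> N1 N2 hN1 hN2.
have N10 : 0 < N1 by rewrite (le_lt_trans _ hN1)// powR_ge0.
have N20 : 0 < N2 by rewrite (le_lt_trans _ hN2)// powR_ge0.
have up (c N s : R) : 0 < s -> 0 <= c -> 0 < N -> c `^ s^-1 < N -> c <= N `^ s.
  move=> s0 c0 N0 cN; rewrite -[leLHS](powRr1 c0) -(mulVf (lt0r_neq0 s0)) powRrM.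
  by apply: ge0_ler_powR; rewrite ?nnegrE ?powR_ge0 ?(ltW s0) ?(ltW N0) ?(ltW cN).
have i1 : (\int[lam]_x (HL a x `^ p1) <= (N1 `^ p1)%:E)%E.
  by rewrite (le_trans (h1 a ma a0))// EA -EFinM lee_fin; apply: up => //; exact: mulr_ge0.
have i2 : (\int[lam]_x (L x `^ p2) <= (N2 `^ p2)%:E)%E.
  by rewrite (le_trans iL)// EB -EFinM lee_fin; apply: up => //; exact: mulr_ge0.
have H := hoelder_product p10 p20 p0 p12 mHL mL HL0 L0 N10 N20 i1 i2.
have NN0 : 0 <= K0 * (N1 * N2) by rewrite !mulr_ge0// ltW.
rewrite unlock; apply: (@le_poweR_inv _ _ _ p) => //; first exact: poweR_ge0.
have iM0 : (0 <= \int[lam]_x (`|M x| `^ p))%E by apply: integral_ge0 => x _; exact: poweR_ge0.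
rewrite -poweRrM mulVf ?gt_eqF// poweRe1// powRM// ?mulr_ge0 ?(ltW N10) ?(ltW N20)//.
have mUV : measurable_fun setT (fun x => (HL a x * L x) `^ p)%E.
  apply: (measurableT_comp (measurable_poweR _)); exact: emeasurable_funM.
apply: (@le_trans _ _ (\int[lam]_x ((K0 `^ p)%:E * ((HL a x * L x) `^ p)))%E).
  apply: ge0_le_integral_nomeas => x _; first exact: poweR_ge0.
  rewrite -poweR_EFin -poweRM ?lee_fin// ?mule_ge0//.
  have h : (`|M x| <= K0%:E * (HL a x * L x))%E by rewrite gee0_abs//; apply: hM => t t0; exact: hL.
  apply: gt0_ler_poweR; rewrite ?(ltW p0) ?in_itv/= ?leey ?andbT ?abse_ge0// mule_ge0 ?lee_fin// mule_ge0 ?HL0 ?L0//.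
rewrite ge0_integralZl ?lee_fin ?powR_ge0//; last by move=> x _; exact: poweR_ge0.
by rewrite EFinM; apply: lee_wpmul2l => //; rewrite lee_fin powR_ge0.
Qed.

End main_estimate.

Theorem theorem1 (R : realType) (n : nat) (hn : (8 <= n)%N) (p1 p2 p : R)
    (hp1 : 0 < p1) (hp2 : 0 < p2) (hp : 0 < p)
    (hp12 : p^-1 = p1^-1 + p2^-1)
    (hrhombus : open_rhombus n (vec3 p1^-1 p2^-1 p^-1)) :
  exists C : R, forall f g : 'rV[R]_n -> R[i], schwartz f -> schwartz g ->
    (Lp_norm p (spherical_maximal f g) <=
     C%:E * Lp_norm p1 (modulus f) * Lp_norm p2 (modulus g))%E.
Proof.
case: n hn hrhombus => [//|n'] hn; rewrite hp12 => /(open_rhombus_bounds hn)[u1 v1 uv].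
have n'0 : (0 < n')%N by case: n' hn {uv}.
have p1gt : 1 < p1 by rewrite -[p1]invrK invf_gt1// invr_gt0.
have p2gt : 1 < p2 by rewrite -[p2]invrK invf_gt1// invr_gt0.
have K0 : 0 <= 2 * (2 * n'.+1)%:R * 4 ^+ n'.+1 :> R by rewrite !mulr_ge0// exprn_ge0.
have n8R : 8 <= n'.+1%:R :> R by rewrite ler_nat.
have n5 : 0 < 2 * n'.+1%:R - 5 :> R by lra.
(* The smaller reciprocal is at most half of the sum, hence below (2n - 10)/(2n - 5); the
   corresponding function is the one given to the spherical maximal operator. *)
have [le21|lt12] := leP p2^-1 p1^-1.
  have h2 : p2^-1 * (2 * n'.+1%:R - 5) < 2 * n'.+1%:R - 10.
    have : p2^-1 * (2 * n'.+1%:R - 5) <= p1^-1 * (2 * n'.+1%:R - 5) by rewrite ler_wpM2r// ltW.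
    by move: uv; rewrite mulrDl; lra.
  have [C C0 hC] := Lnorm_le_of_domination hn K0 p1gt hp2 hp hp12 h2.
  exists C => f g sf sg; have [ba ca a0] := schwartz_norm sf; have [bb cb b0] := schwartz_norm sg.
  apply: hC => // [x|x L hL]; first exact: spherical_maximal_ge0.
  exact: spherical_maximal_le.
have h1 : p1^-1 * (2 * n'.+1%:R - 5) < 2 * n'.+1%:R - 10.
  have : p1^-1 * (2 * n'.+1%:R - 5) <= p2^-1 * (2 * n'.+1%:R - 5) by rewrite ler_wpM2r// ltW.
  by move: uv; rewrite mulrDl; lra.
have hp21 : p^-1 = p2^-1 + p1^-1 by rewrite addrC.
have [C C0 hC] := Lnorm_le_of_domination hn K0 p2gt hp1 hp hp21 h1.
exists C => f g sf sg; have [ba ca a0] := schwartz_norm sf; have [bb cb b0] := schwartz_norm sg.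
rewrite muleAC; apply: hC => // [x|x L hL]; first exact: spherical_maximal_ge0.
exact: spherical_maximal_le_swap.
Qed.
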